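(* Let $d\ge 1$, let $R\subset\mathbb{R}^d$ be a root system with positive subsystem $R_+$ and finite reflection group $G$, and let $k\colon R\to[0,\infty)$ be a $G$-invariant multiplicity function. Put $|k|=\sum_{a\in R_+}k(a)$ and $\lambda_k=\frac d2-1+|k|$. Then for every $f\in\mathcal{S}(\mathbb{R}^d)$, $$\int_{\mathbb{R}^d}\ln(|x|)\,|f(x)|^2\,d\mu_k(x)+\int_{\mathbb{R}^d}\ln(|y|)\,|F_k(f)(y)|^2\,d\mu_k(y)\ \ge\ \Bigl(\psi\Bigl(\frac{\lambda_k+1}{2}\Bigr)+\ln 2\Bigr)\int_{\mathbb{R}^d}|f(x)|^2\,d\mu_k(x),$$ where $F_k$ is the Dunkl transform and $\psi(t)=\frac{d}{dt}\ln\Gamma(t)$.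
   Context: $\mathbb{R}^d$ carries the standard scalar product $\langle x,y\rangle$ and norm $|x|$; $\mathcal{S}(\mathbb{R}^d)$ is the (complex-valued) Schwartz space; $\Gamma$ is the gamma function. For $a\ne 0$, $\sigma_a$ is the orthogonal reflection in the hyperplane $\langle a,x\rangle=0$. A root system $R$ is a finite set of nonzero vectors with $\sigma_a(R)=R$ and $R\cap\mathbb{R}a=\{\pm a\}$ for all $a\in R$; $R_+$ is a positive subsystem; $G=G(R)\subset O(d)$ is the finite group generated by $\{\sigma_a\colon a\in R\}$. A multiplicity function is a $G$-invariant function $k\colon R\to[0,\infty)$. The Dunkl weight is $v_k(x)=\prod_{a\in R_+}|\langle a,x\rangle|^{2k(a)}$, and $d\mu_k(x)=c_kv_k(x)\,dx$ with $c_k^{-1}=\int_{\mathbb{R}^d}e^{-|x|^2/2}v_k(x)\,dx$. The Dunkl operators are $$D_jf(x)=\frac{\partial f(x)}{\partial x_j}+\sum_{a\in R_+}k(a)\langle a,e_j\rangle\frac{f(x)-f(\sigma_ax)}{\langle a,x\rangle},\qquad j=1,\dots,d.$$ For $y\in\mathbb{R}^d$, the Dunkl kernel $x\mapsto e_k(x,y)=E_k(x,iy)$ is the unique (real-analytic) solution $f$ of $D_jf(x)=iy_jf(x)$, $j=1,\dots,d$, $f(0)=1$. The Dunkl transform is $F_k(f)(y)=\int_{\mathbb{R}^d}f(x)\overline{e_k(x,y)}\,d\mu_k(x)$. *)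

(* Defs.v *)
From HB Require Import structures.
From mathcomp Require Import all_boot all_order all_algebra finmap.
From mathcomp Require Import all_classical all_reals all_analysis.
From mathcomp Require Import complex.

Set Implicit Arguments.
Unset Strict Implicit.
Unset Printing Implicit Defensive.

Import Order.TTheory GRing.Theory Num.Theory.
Import numFieldNormedType.Exports.
Import ComplexField.Normc.

Local Open Scope classical_set_scope.
Local Open Scope ring_scope.

Definition measure_rV_display : measure_display.
Proof. exact: default_measure_display. Qed.

Section measurable_rV.
Context (R : realType) (n : nat).

Let coor : 'I_n -> 'rV[R]_n -> R := fun i x => x ord0 i.

Let rV_set0 : g_sigma_preimage coor set0.
Proof. exact: sigma_algebra0. Qed.

Let rV_setC A : g_sigma_preimage coor A -> g_sigma_preimage coor (~` A).
Proof. exact: sigma_algebraC. Qed.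

Let rV_bigcup (F : _^nat) : (forall i, g_sigma_preimage coor (F i)) ->
  g_sigma_preimage coor (\bigcup_i (F i)).
Proof. exact: sigma_algebra_bigcup. Qed.

(* sigma-algebra generated by the coordinates, i.e. the Borel one *)
HB.instance Definition _ := @isMeasurable.Build
  measure_rV_display 'rV[R]_n (g_sigma_preimage coor)
  rV_set0 rV_setC rV_bigcup.

Lemma measurable_coord (i : 'I_n) :
  measurable_fun [set: 'rV[R]_n] (fun x : 'rV[R]_n => x ord0 i).
Proof.
move=> _ Y mY; rewrite setTI; apply: sub_sigma_algebra => /=.
rewrite -bigcup_seq/=; exists i => /=; first by rewrite mem_index_enum.
by exists Y => //; rewrite setTI.
Qed.

Lemma measurable_fun_rV d (T : measurableType d) (f : T -> 'rV[R]_n) :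
  (forall i, measurable_fun [set: T] (fun x => f x ord0 i)) ->
  measurable_fun [set: T] f.
Proof.
move=> mf; suff : g_sigma_preimage (fun i => coor i \o f) `<=` measurable.
  rewrite g_sigma_preimage_comp => prefS _ A mA.
  by apply: prefS; exists A.
apply: smallest_sub; first exact: sigma_algebra_measurable.
move=> A; rewrite -bigcup_seq/= => -[i _ [B mB <-]].
exact: mf.
Qed.

End measurable_rV.

Section lebesgue_rV.
Context (R : realType).

Definition cons_rV n (p : R * 'rV[R]_n) : 'rV[R]_n.+1 :=
  row_mx (const_mx p.1 : 'rV[R]_1) p.2.

Definition uncons_rV n (x : 'rV[R]_n.+1) : R * 'rV[R]_n :=
  (x ord0 ord0, \row_i x ord0 (lift ord0 i)).

Lemma cons_rVE n p i : @cons_rV n p ord0 i =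
  if unlift ord0 i is Some j then p.2 ord0 j else p.1.
Proof.
rewrite /cons_rV mxE; case: unliftP => [j ->|->].
  case: splitP => [[[]]//|k /= jk].
  by congr (_ _ _); apply: val_inj; move: jk; rewrite /= /bump /=; case.
by case: splitP => [k _|//]; rewrite mxE.
Qed.

Lemma cons_rVK n : cancel (@cons_rV n) (@uncons_rV n).
Proof.
case=> a v; rewrite /uncons_rV cons_rVE unlift_none; congr pair.
by apply/rowP => i; rewrite mxE cons_rVE liftK.
Qed.

Lemma measurable_cons_rV n : measurable_fun [set: R * 'rV[R]_n] (@cons_rV n).
Proof.
apply: measurable_fun_rV => i.
under eq_fun do rewrite cons_rVE.
case: unliftP => [j _|_]; last exact: measurable_fst.
apply: (@measurableT_comp _ _ _ _ _ _ (fun x : 'rV[R]_n => x ord0 j)) => //.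
exact: measurable_coord.
Qed.

Lemma measurable_uncons_rV n : measurable_fun [set: 'rV[R]_n.+1] (@uncons_rV n).
Proof.
apply/measurable_fun_pair => /=; first exact: measurable_coord.
apply: measurable_fun_rV => i; under eq_fun do rewrite mxE.
exact: measurable_coord.
Qed.

Section step.
Local Open Scope ereal_scope.
Context (n : nat) (m : {sigma_finite_measure set 'rV[R]_n -> \bar R}).

Definition lebesgue_rV_step : set 'rV[R]_n.+1 -> \bar R :=
  pushforward (@lebesgue_measure R \x m) (@cons_rV n).

Let mcons (A : set 'rV[R]_n.+1) : measurable A ->
  measurable (@cons_rV n @^-1` A).
Proof. by move=> mA; rewrite -[X in measurable X]setTI; exact: measurable_cons_rV. Qed.

Let step0 : lebesgue_rV_step set0 = 0.
Proof. by rewrite /lebesgue_rV_step /pushforward preimage_set0 measure0. Qed.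

Let step_ge0 A : 0 <= lebesgue_rV_step A.
Proof. exact: (measure_ge0 (@lebesgue_measure R \x m)). Qed.

Let step_sigma_additive : semi_sigma_additive lebesgue_rV_step.
Proof.
move=> F mF tF mUF; rewrite /lebesgue_rV_step /pushforward preimage_bigcup.
apply: measure_semi_sigma_additive.
- by move=> i; exact: mcons.
- apply/trivIsetP => /= i j _ _ ij; rewrite -preimage_setI.
  by move/trivIsetP : tF => /(_ _ _ _ _ ij) ->//; rewrite preimage_set0.
- by rewrite -preimage_bigcup; exact: mcons.
Qed.

HB.instance Definition _ := isMeasure.Build _ _ _ lebesgue_rV_step
  step0 step_ge0 step_sigma_additive.

Let step_sigma_finite : sigma_finite setT lebesgue_rV_step.
Proof.
have /sigma_finiteP[F [TF ndF Foo]] := sigma_finiteT (@lebesgue_measure R).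
have /sigma_finiteP[G [TG ndG Goo]] := sigma_finiteT m.
exists (fun k => @uncons_rV n @^-1` (F k `*` G k)).
  apply/esym; rewrite -subTset => x _.
  have [i _ Fi] : (\bigcup_k F k) (uncons_rV x).1 by rewrite -TF.
  have [j _ Gj] : (\bigcup_k G k) (uncons_rV x).2 by rewrite -TG.
  exists (maxn i j) => //; split.
    by move: Fi; exact/subsetPset/ndF/leq_maxl.
  by move: Gj; exact/subsetPset/ndG/leq_maxr.
move=> k; have [mF Fk] := Foo k; have [mG Gk] := Goo k; split.
  rewrite -[X in measurable X]setTI; apply: measurable_uncons_rV => //.
  exact: measurableX.
rewrite /lebesgue_rV_step /pushforward -comp_preimage.
rewrite (_ : _ \o _ = id); last by apply/funext => p /=; rewrite cons_rVK.
by rewrite preimage_id product_measure1E// lte_mul_pinfty// ge0_fin_numE.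
Qed.

HB.instance Definition _ := Measure_isSigmaFinite.Build _ _ _ lebesgue_rV_step
  step_sigma_finite.

End step.

Fixpoint lebesgue_rV (n : nat) : {sigma_finite_measure set 'rV[R]_n -> \bar R} :=
  if n is m.+1 then lebesgue_rV_step (lebesgue_rV m) else \d_ (0 : 'rV[R]_0).

Lemma lebesgue_rV_box n (A : 'I_n -> set R) : (forall i, measurable (A i)) ->
  lebesgue_rV n [set x | forall i, A i (x ord0 i)] =
  (\prod_(i < n) lebesgue_measure (A i))%E.
Proof.
elim: n A => [|n ih] A mA.
  by rewrite big_ord0 /= diracE mem_set// => -[].
rewrite big_ord_recl -ih//=.
pose B : set 'rV[R]_n := [set x | forall i : 'I_n, A (lift ord0 i) (x ord0 i)].
have mB : measurable B.
  rewrite (_ : B = \bigcap_(i in [set: 'I_n])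
    ((fun x : 'rV[R]_n => x ord0 i) @^-1` A (lift ord0 i))).
    apply: fin_bigcap_measurable => // i _.
    by rewrite -[X in measurable X]setTI; exact: measurable_coord.
  by apply/seteqP; split => x /= h i => [_|]; apply: h.
apply: etrans (product_measure1E (@lebesgue_measure R) (lebesgue_rV n) (mA ord0) mB).
rewrite /lebesgue_rV_step /pushforward; congr (_ _).
apply/seteqP; split=> -[a v] /= => [h|[h0 h] i].
  split; first by have := h ord0; rewrite cons_rVE unlift_none.
  by move=> i; have := h (lift ord0 i); rewrite cons_rVE liftK.
by rewrite cons_rVE; case: unliftP => [j ->|->]//; exact: h.
Qed.

End lebesgue_rV.

Section euclidean.
Context (R : realType) (d : nat).
Implicit Types x y a : 'rV[R]_d.

Definition dot x y : R := \sum_(i < d) x ord0 i * y ord0 i.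

(* the norm `|x| provided by the library on matrices is the sup norm *)
Definition enorm x : R := Num.sqrt (dot x x).

Definition unit_vec (j : 'I_d) : 'rV[R]_d := delta_mx ord0 j.

Definition reflection a x : 'rV[R]_d := x - (2 * dot a x / dot a a) *: a.

End euclidean.

Section function_classes.
Context (R : realType) (d : nat).

(* for smooth g the order of differentiation is irrelevant, so that lists of
   directions play the role of multi-indices *)
Definition iter_partial (s : seq 'I_d) (g : 'rV[R]_d -> R) : 'rV[R]_d -> R :=
  foldr (fun j h x => 'D_(unit_vec R j) h x) g s.

Definition schwartz_real (g : 'rV[R]_d -> R) : Prop :=
  (forall s x, differentiable (iter_partial s g) x) /\
  (forall n s, exists M : R, forall x,
     enorm x ^+ n * `|iter_partial s g x| <= M).

Definition schwartz (f : 'rV[R]_d -> R[i]) : Prop :=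
  schwartz_real (fun x => complex.Re (f x)) /\
  schwartz_real (fun x => complex.Im (f x)).

Definition monomial (al : 'I_d -> nat) (h : 'rV[R]_d) : R :=
  \prod_(i < d) h ord0 i ^+ al i.

(* around every point g is the sum of an absolutely convergent power series;
   absolute convergence makes the choice of cubical partial sums immaterial *)
Definition real_analytic (g : 'rV[R]_d -> R) : Prop :=
  forall x0 : 'rV[R]_d, exists r : R, 0 < r /\
  exists c : ('I_d -> nat) -> R, forall h : 'rV[R]_d, enorm h < r ->
    let term (al : 'I_d -> nat) := c al * monomial al h in
    (exists M : R, forall n : nat,
       \sum_(al : {ffun 'I_d -> 'I_n}) `|term (fun i => al i)| <= M) /\
    (fun n : nat => \sum_(al : {ffun 'I_d -> 'I_n}) term (fun i => al i))
      @ \oo --> g (x0 + h).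

End function_classes.

Section root_systems.
Context (R : realType) (d : nat).
Implicit Types Phi Rp : {fset 'rV[R]_d}.

Definition root_system Phi : Prop :=
  [/\ forall a, a \in Phi -> a != 0,
      forall a, a \in Phi -> reflection a @` [set` Phi] = [set` Phi] &
      forall a, a \in Phi ->
        [set` Phi] `&` [set c *: a | c in [set: R]] = [set a; - a]].

Definition positive_subsystem Phi Rp : Prop :=
  exists b : 'rV[R]_d, (forall a, a \in Phi -> dot a b != 0) /\
    forall a, a \in Rp = (a \in Phi) && (0 < dot a b).

Inductive reflection_group Phi : ('rV[R]_d -> 'rV[R]_d) -> Prop :=
| RGid : reflection_group Phi id
| RGrefl a : a \in Phi -> reflection_group Phi (reflection a)
| RGcomp g h : reflection_group Phi g -> reflection_group Phi h ->
    reflection_group Phi (g \o h)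
| RGinv g h : reflection_group Phi g -> cancel g h -> cancel h g ->
    reflection_group Phi h.

(* only the values of k on Phi matter *)
Definition multiplicity_function Phi (k : 'rV[R]_d -> R) : Prop :=
  (forall a, a \in Phi -> 0 <= k a) /\
  (forall g a, reflection_group Phi g -> a \in Phi -> k (g a) = k a).

End root_systems.

Section dunkl.
Context (R : realType) (d : nat).
Variables (Rp : {fset 'rV[R]_d}) (k : 'rV[R]_d -> R).
Implicit Type f : 'rV[R]_d -> R[i].

Definition dunkl_weight (x : 'rV[R]_d) : R :=
  \prod_(a <- Rp) `|dot a x| `^ (2 * k a).

Definition dunkl_const : R :=
  (\int[@lebesgue_rV R d]_x (expR (- (enorm x ^+ 2 / 2)) * dunkl_weight x))^-1.

(* density of mu_k with respect to the Lebesgue measure *)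
Definition dunkl_density (x : 'rV[R]_d) : R := dunkl_const * dunkl_weight x.

Definition cderive (v : 'rV[R]_d) f (x : 'rV[R]_d) : R[i] :=
  Complex ('D_v (fun z => complex.Re (f z)) x)
          ('D_v (fun z => complex.Im (f z)) x).

(* (f x - f (reflection a x)) / <a, x>; on the hyperplane <a, x> = 0 it takes
   the value given by continuity, namely the limit as t -> 0 of
   (f (x + t a) - f (x - t a)) / (t |a|^2) *)
Definition dunkl_quotient (a : 'rV[R]_d) f (x : 'rV[R]_d) : R[i] :=
  if dot a x == 0 then (2 / dot a a)%:C%C * cderive a f x
  else (f x - f (reflection a x)) / (dot a x)%:C%C.

Definition dunkl_operator (j : 'I_d) f (x : 'rV[R]_d) : R[i] :=
  cderive (unit_vec R j) f x +
  \sum_(a <- Rp) (k a * dot a (unit_vec R j))%:C%C * dunkl_quotient a f x.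

Definition is_dunkl_kernel (y : 'rV[R]_d) f : Prop :=
  [/\ real_analytic (fun x => complex.Re (f x)),
      real_analytic (fun x => complex.Im (f x)),
      forall j x, dunkl_operator j f x = 'i%C * (y ord0 j)%:C%C * f x &
      f 0 = 1].

(* e_k(x, y), the constant 1 being a dummy value for xget *)
Definition dunkl_kernel (x y : 'rV[R]_d) : R[i] :=
  xget (fun=> 1) [set f | is_dunkl_kernel y f] x.

Definition cintegral (g : 'rV[R]_d -> R[i]) : R[i] :=
  Complex (\int[@lebesgue_rV R d]_x complex.Re (g x))
          (\int[@lebesgue_rV R d]_x complex.Im (g x)).

Definition dunkl_transform f (y : 'rV[R]_d) : R[i] :=
  cintegral (fun x => f x * conjc (dunkl_kernel x y) * (dunkl_density x)%:C%C).

Definition abs_mult : R := \sum_(a <- Rp) k a.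

Definition dunkl_lambda : R := d%:R / 2 - 1 + abs_mult.

End dunkl.

Section digamma.
Context (R : realType).

Definition Gamma (t : R) : R :=
  \int[@lebesgue_measure R]_(x in `]0, +oo[) (x `^ (t - 1) * expR (- x)).

Definition digamma (t : R) : R := derive1 (fun s => ln (Gamma s)) t.

End digamma.

(* Main.v *)
(* With m = (lambda_k + 1) / 2, Pitt's inequality states, for 0 < b < m,
     int |y|^(-2b) |F f|^2 dmu <= C(b) int |x|^(2b) |f|^2 dmu,
     C(b) = 4^(-b) Gamma(m - b) / Gamma(m + b).
   At b = 0 it is Plancherel's identity, and its derivative at b = 0 is the
   logarithmic inequality, because -C'(0) = 2 (psi(m) + ln 2).

   The kernel is built degree by degree: its part f_n of degree n solves
   (n + |k|) f_n - sum_a k(a) f_n o sigma_a = <x,y> f_(n-1), where the left-hand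
   side is coercive on tensors. Along rays these equations become a linear
   system to which a maximum principle applies; it yields uniqueness, the bound
   |e_k| <= 1, symmetry, and positivity of the heat kernel
     A_t(x,z) = int e^(-t|y|^2) e_k(x,y) conj(e_k(z,y)) dmu(y).
   For real f the smoothed energy int e^(-t|y|^2) |F f|^2 dmu is the quadratic
   form of A_t, which is dominated by Schur's test: with the weight 1 for
   Plancherel, and with the weight |z|^(-2m), written as a superposition of
   Gaussians, for Pitt. Both constants then reduce to Gamma and Beta integrals.
   For complex f the interference between real and imaginary part is odd in y,
   so it is invisible to radial weights. *)

From HB Require Import structures.
Require Import Defs.
From mathcomp Require Import all_boot all_order all_algebra finmap.
From mathcomp Require Import all_classical all_reals all_analysis.
From mathcomp Require Import measurable_realfun borel_hierarchy complex ring lra.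
Set Implicit Arguments.
Unset Strict Implicit.
Unset Printing Implicit Defensive.
Import Order.TTheory GRing.Theory Num.Theory.
Import numFieldNormedType.Exports.
Local Open Scope classical_set_scope.
Local Open Scope ring_scope.

(** * Real-valued integrals *)

Section real_integral.
Context {R : realType} {d} {T : measurableType d} (mu : {measure set T -> \bar R}).
Implicit Types f g : T -> R.

(** The constant is dictated by homogeneity. The homogeneous dimension is d + 2|k| = 4m, so the
    weight |z|^(-2m) sits at the borderline of L^2; averaging the heat kernels over t with the
    density t^(b-1) sends it to a multiple of |x|^(2b-2m). Schur's test with this weight therefore
    returns exactly C(b) |x|^(2b), and m is forced to be (lambda_k + 1) / 2. No inversion theorem
    enters. The heat kernel based at the origin is computed by the maximum principle; transforms of
    Gaussians are then explicit, and mass, mean and a variance bound of A_t(x,.) follow by letting a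
    Gaussian factor tend to 1. For a Lipschitz function this makes the heat operators an approximate
    identity, which gives the lower half of Plancherel; the upper half is Schur's test. Nothing is
    known about the decay of F_k f, so its logarithmic integral is never shown to be finite. It is
    bounded below in the extended reals through (1 - |y|^(-2b)) / (2b) <= ln |y|, whose integral is
    a difference of a Plancherel term and a Pitt term. These must agree to order zero in b before
    the division by b. *)

Definition integrableR f := mu.-integrable [set: T] (EFin \o f).

Lemma integrableR_measurable f : integrableR f -> measurable_fun setT f.
Proof. by move=> /integrableP[/measurable_EFinP]. Qed.

Lemma integrableR_dom g f : measurable_fun setT f -> integrableR g ->
  (forall x, `|f x| <= g x) -> integrableR f.
Proof.
move=> mf ig fg; apply: (le_integrable measurableT _ _ ig).
- exact/measurable_EFinP.
- by move=> x _ /=; rewrite lee_fin (le_trans (fg x))// ler_norm.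
Qed.

Lemma integrableRD f g : integrableR f -> integrableR g ->
  integrableR (fun x => f x + g x).
Proof. by move=> intf intg; have := integrableD measurableT intf intg. Qed.

Lemma integrableRZ c f : integrableR f -> integrableR (fun x => c * f x).
Proof. by move=> intf; have := integrableZl measurableT c intf. Qed.

Lemma integrableRN f : integrableR f -> integrableR (fun x => - f x).
Proof.
by move=> /(integrableRZ (-1)); congr integrableR; apply/funext => x; rewrite mulN1r.
Qed.

Lemma integrableRB f g : integrableR f -> integrableR g ->
  integrableR (fun x => f x - g x).
Proof. by move=> intf /integrableRN; exact: integrableRD. Qed.

Lemma integrableR_norm f : integrableR f -> integrableR (fun x => `|f x|).
Proof. by move=> intf; have := integrable_abse intf. Qed.

Lemma Rintegral_dominated_cvg (F : (T -> R)^nat) f g :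
  (forall n, measurable_fun setT (F n)) -> integrableR g ->
  (forall x, F n x @[n --> \oo] --> f x) ->
  (forall n x, `|F n x| <= g x) ->
  integrableR f /\ \int[mu]_x F n x @[n --> \oo] --> \int[mu]_x f x.
Proof.
move=> mF ig Ff Fg.
have mf : measurable_fun setT f.
  by apply: (measurable_fun_cvg mF) => x _; exact: Ff.
have mF' n : measurable_fun setT (EFin \o F n) by exact/measurable_EFinP.
have mf' : measurable_fun setT (EFin \o f) by exact/measurable_EFinP.
have [||intf _ H] := dominated_convergence measurableT mF' mf' _ ig.
- by apply: aeW => x _; apply/fine_cvgP; split; [exact: nearW|exact: Ff].
- by apply: aeW => x n _; rewrite /= lee_fin.
split=> //; apply: fine_cvg; rewrite fineK//.
exact: integrable_fin_num.
Qed.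

Lemma Rintegral_EFin f : integrableR f ->
  (\int[mu]_x (f x)%:E)%E = (\int[mu]_x f x)%:E.
Proof. by move=> intf; rewrite /Rintegral fineK//; exact: integrable_fin_num. Qed.

Lemma integrableR_ge0 f : measurable_fun setT f -> (forall x, 0 <= f x) ->
  (\int[mu]_x (f x)%:E < +oo)%E -> integrableR f.
Proof.
move=> mf f0 foo; apply/integrableP; split; first exact/measurable_EFinP.
by under eq_integral => x _ do rewrite /= ger0_norm//.
Qed.

End real_integral.

Section real_fubini.
Context {R : realType} {d1 d2} {T1 : measurableType d1} {T2 : measurableType d2}.
Context (m1 : {sigma_finite_measure set T1 -> \bar R})
  (m2 : {sigma_finite_measure set T2 -> \bar R}).
Variables (F : T1 -> T2 -> R) (g1 : T1 -> R) (g2 : T2 -> R).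
Hypothesis mF : measurable_fun setT (fun p : T1 * T2 => F p.1 p.2).
Hypotheses (ig1 : integrableR m1 g1) (ig2 : integrableR m2 g2).
Hypothesis FM : forall x y, `|F x y| <= g1 x * g2 y.

(** The majorant in product form bounds the iterated integral of |F| by the product of the integrals
    of |g1| and |g2|. Every exchange of integrals of signed functions below rests on such a
    majorant. *)
Lemma integrable_prod_dom :
  (m1 \x m2)%E.-integrable setT (fun p => (F p.1 p.2)%:E).
Proof.
have mF' : measurable_fun setT (EFin \o fun p : T1 * T2 => F p.1 p.2).
  exact/measurable_EFinP.
apply/integrable12ltyP => //=.
pose C := \int[m2]_y `|g2 y|.
have C0 : 0 <= C by apply: Rintegral_ge0.
have := integrableR_norm ig1; move=> /(integrableRZ C) /integrableP[_].
apply: le_lt_trans; apply: ge0_le_integral => //.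
- by move=> x _; apply: integral_ge0.
- apply: (@measurable_fun_fubini_tonelli_F _ _ _ _ _ m2 (fun p => `|(F p.1 p.2)%:E|)%E) => //.
  exact: measurableT_comp.
- apply/measurable_EFinP; apply: measurableT_comp => //.
  apply: measurable_funM => //; apply: measurableT_comp => //.
  exact: integrableR_measurable ig1.
move=> x _ /=; rewrite normrM normr_id (ger0_norm C0) EFinM -(Rintegral_EFin (integrableR_norm ig2)).
rewrite muleC -ge0_integralZl//=; last first.
  apply/measurable_EFinP; apply: measurableT_comp => //.
  exact: integrableR_measurable ig2.
apply: ge0_le_integral => //.
- apply/measurable_EFinP; apply: measurableT_comp => //.
  exact: (measurableT_comp mF (pair1_measurable x)).
- apply/measurable_EFinP; apply: measurable_funM => //; apply: measurableT_comp => //.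
  exact: integrableR_measurable ig2.
by move=> y _; rewrite -EFinM lee_fin (le_trans (FM x y))// -normrM ler_norm.
Qed.

Lemma integrableR_section1 x : integrableR m2 (F x).
Proof.
apply: (@integrableR_dom _ _ _ _ (fun y => g1 x * g2 y)) => //.
- exact: (measurableT_comp mF (pair1_measurable x)).
- exact: integrableRZ.
Qed.

Lemma integrableR_section2 y : integrableR m1 (F ^~ y).
Proof.
apply: (@integrableR_dom _ _ _ _ (fun x => g2 y * g1 x)) => //.
- exact: (measurableT_comp mF (pair2_measurable y)).
- exact: integrableRZ.
- by move=> x; rewrite mulrC.
Qed.

Lemma measurable_Rintegral_section1 : measurable_fun setT (fun x => \int[m2]_y F x y).
Proof.
have := measurable_fubini_F integrable_prod_dom; rewrite /fubini_F/= => /(measurableT_comp (@fine_measurable _ setT measurableT)).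
exact.
Qed.

Lemma measurable_Rintegral_section2 : measurable_fun setT (fun y => \int[m1]_x F x y).
Proof.
have := measurable_fubini_G integrable_prod_dom; rewrite /fubini_G/= => /(measurableT_comp (@fine_measurable _ setT measurableT)).
exact.
Qed.

Lemma Rintegral_Fubini : \int[m1]_x \int[m2]_y F x y = \int[m2]_y \int[m1]_x F x y.
Proof.
rewrite /Rintegral; congr fine.
under eq_integral => x _ do
  rewrite fineK ?(integrable_fin_num measurableT (integrableR_section1 x))//.
under [RHS]eq_integral => y _ do
  rewrite fineK ?(integrable_fin_num measurableT (integrableR_section2 y))//.
exact: (Fubini integrable_prod_dom).
Qed.

Lemma integrableR_Rintegral1 : integrableR m1 (fun x => \int[m2]_y F x y).
Proof.
have := integrable_fubini_F integrable_prod_dom; rewrite /fubini_F/=.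
rewrite /integrableR; congr (_.-integrable _ _); apply/funext => x/=.
by rewrite -Rintegral_EFin//; exact: integrableR_section1.
Qed.

End real_fubini.

(** * Lebesgue measure on R^d *)

Section lebesgue_affine.
Context {R : realType}.
Local Open Scope ereal_scope.

Let measurable_affine (c t : R) : measurable_fun setT (fun x : R => (c * x + t)%R).
Proof. by apply: measurable_funD => //; exact: measurable_funM. Qed.

Let affine_preimage (c t a b : R) : (0 < c)%R ->
  (fun x : R => (c * x + t)%R) @^-1` `]a, b]%classic =
  `](c^-1 * (a - t))%R, (c^-1 * (b - t))%R]%classic.
Proof.
move=> c0; apply/seteqP; split=> x /=; rewrite !in_itv/= ltr_pdivrMl// ler_pdivlMl//.
  by move=> /andP[]; rewrite ltrBlDr lerBrDr => -> ->.
by move=> /andP[]; rewrite ltrBlDr lerBrDr => -> ->.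
Qed.

(** The image of Lebesgue measure under x -> c x + t, multiplied by c, gives each interval ]a, b]
    its length, so uniqueness of Lebesgue measure identifies the two. *)
Lemma ge0_integral_pos_affine (c t : R) (f : R -> \bar R) : (0 < c)%R ->
  measurable_fun setT f -> (forall x, 0 <= f x) ->
  \int[lebesgue_measure]_x f x = c%:E * \int[lebesgue_measure]_x f (c * x + t)%R.
Proof.
move=> c0 mf f0.
have c0' : (0 <= c)%R by exact: ltW.
pose phi : R -> measurableTypeR R := fun x => (c * x + t)%R.
have mphi : measurable_fun [set: measurableTypeR R] phi by exact: measurable_affine.
have /= <- := @ge0_integral_pushforward _ _ (measurableTypeR R) (measurableTypeR R) R phi mphi (@lebesgue_measure R) setT f
  measurableT mf (fun x _ => f0 x).
have := @ge0_integral_mscale _ _ _ (pushforward (@lebesgue_measure R) phi) setT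
  measurableT (NngNum c0') f mf (fun x _ => f0 x).
move=> /= <-.
apply: eq_measure_integral => A mA _; apply: lebesgue_measure_unique => //.
move=> _ [[a b]] _ <-.
rewrite /= /mscale/= /pushforward affine_preimage// !lebesgue_measure_itv/= !lte_fin.
rewrite ltr_pM2l ?invr_gt0// ltrD2r; case: ifPn => ab; last by rewrite mule0.
rewrite -EFinB -EFinM; congr EFin; rewrite -mulrBr mulVKf ?gt_eqF//.
by rewrite opprB addrA subrK.
Qed.

Lemma ge0_integral_oppr (f : R -> \bar R) :
  measurable_fun setT f -> (forall x, 0 <= f x) ->
  \int[lebesgue_measure]_x f x = \int[lebesgue_measure]_x f (- x)%R.
Proof.
move=> mf f0.
have mN : measurable_fun [set: measurableTypeR R] (-%R : _ -> measurableTypeR R) by [].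
have /= <- := @ge0_integral_pushforward _ _ (measurableTypeR R) (measurableTypeR R) R _ mN (@lebesgue_measure R) setT f
  measurableT mf (fun x _ => f0 x).
by apply: eq_measure_integral => A mA _; exact/esym/lebesgue_measureN.
Qed.

Lemma ge0_integral_affine (c t : R) (f : R -> \bar R) : (c != 0)%R ->
  measurable_fun setT f -> (forall x, 0 <= f x) ->
  \int[lebesgue_measure]_x f x = `|c|%:E * \int[lebesgue_measure]_x f (c * x + t)%R.
Proof.
move=> c_neq0 mf f0; have [c0|] := ltP 0%R c.
  by rewrite gtr0_norm//; exact: ge0_integral_pos_affine.
rewrite le_eqVlt (negbTE c_neq0)/= => c0; rewrite ltr0_norm//.
rewrite (@ge0_integral_pos_affine (- c) t) ?oppr_gt0//; congr (_ * _).
rewrite ge0_integral_oppr//.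
  by apply: eq_integral => x _; rewrite mulrNN.
exact: measurableT_comp (measurable_affine _ _).
Qed.

End lebesgue_affine.

Section lebesgue_rV_theory.
Context {R : realType}.
Local Open Scope ereal_scope.

Lemma ge0_integral_rVS n (f : 'rV[R]_n.+1 -> \bar R) :
  measurable_fun setT f -> (forall x, 0 <= f x) ->
  \int[lebesgue_rV R n.+1]_x f x =
  \int[lebesgue_measure]_a \int[lebesgue_rV R n]_v f (cons_rV (a, v)).
Proof.
move=> mf f0.
have mcons := @measurable_cons_rV R n.
have mfc : measurable_fun setT (f \o @cons_rV R n) by exact: measurableT_comp.
have /= <- := @fubini_tonelli1 _ _ (measurableTypeR R) _ R (@lebesgue_measure R)
  (lebesgue_rV R n) (f \o @cons_rV R n) mfc (fun p => f0 _).
have /= <- := @ge0_integral_pushforward _ _ (measurableTypeR R * 'rV[R]_n)%type _ R _ mcons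
  (@lebesgue_measure R \x lebesgue_rV R n) setT f measurableT mf (fun x _ => f0 x).
exact: eq_measure_integral.
Qed.

Lemma measurable_rVD n (y : 'rV[R]_n) : measurable_fun setT (fun x : 'rV[R]_n => x + y)%R.
Proof.
apply: measurable_fun_rV => i; under eq_fun do rewrite mxE.
by apply: measurable_funD => //; exact: measurable_coord.
Qed.

Lemma measurable_rVZ n (c : R) : measurable_fun setT (fun x : 'rV[R]_n => c *: x)%R.
Proof.
apply: measurable_fun_rV => i; under eq_fun do rewrite mxE.
by apply: measurable_funM => //; exact: measurable_coord.
Qed.

Lemma measurable_rV_affine n (c : R) (y : 'rV[R]_n) :
  measurable_fun setT (fun x : 'rV[R]_n => c *: x + y)%R.
Proof. exact: (measurableT_comp (measurable_rVD y) (measurable_rVZ c)). Qed.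

(** Induction on the dimension: Tonelli splits off the first coordinate, and each coordinate
    contributes one factor |c|. In dimension 0 the space is a single point and nothing moves. *)
Lemma ge0_integral_rV_affine n (c : R) (y : 'rV[R]_n) (f : 'rV[R]_n -> \bar R) :
  (c != 0)%R -> measurable_fun setT f -> (forall x, 0 <= f x) ->
  \int[lebesgue_rV R n]_x f x =
  (`|c| ^+ n)%:E * \int[lebesgue_rV R n]_x f (c *: x + y)%R.
Proof.
move=> c0; elim: n y f => [|n ih] y f mf f0.
  rewrite expr0 mul1e; apply: eq_integral => x _; congr f.
  by apply/rowP => -[].
have mf' : measurable_fun setT (fun x : 'rV[R]_n.+1 => f (c *: x + y)%R).
  exact: measurableT_comp (measurable_rV_affine _ _).
rewrite !ge0_integral_rVS//.
pose F a := \int[lebesgue_rV R n]_v f (cons_rV (a, v)).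
have mcons := @measurable_cons_rV R n.
have mF : measurable_fun setT F.
  apply: (measurable_fun_fubini_tonelli_F (f \o @cons_rV R n)) => //=.
  exact: measurableT_comp.
have F0 a : 0 <= F a by exact: integral_ge0.
rewrite (ge0_integral_affine (y ord0 ord0) c0 mF F0).
have consE a v : (c *: cons_rV (a, v) + y)%R =
    cons_rV (c * a + y ord0 ord0, c *: v + (uncons_rV y).2)%R.
  apply/rowP => i; rewrite cons_rVE mxE [X in (X + _)%R]mxE cons_rVE.
  by case: unliftP => [j ->|->]; rewrite ?mxE.
rewrite exprS EFinM -muleA; congr (_ * _).
rewrite -ge0_integralZl//.
- apply: eq_integral => a _; rewrite /F (ih (uncons_rV y).2)//; last first.
    exact: (measurableT_comp mf (measurableT_comp mcons (pair1_measurable _))).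
  by congr (_ * _); apply: eq_integral => v _; rewrite consE.
- apply: (measurable_fun_fubini_tonelli_F (fun p => f (c *: cons_rV p + y)%R)) => //=.
  exact: (measurableT_comp mf' mcons).
- by move=> a _; exact: integral_ge0.
Qed.

End lebesgue_rV_theory.

(** * Continuous functions on R^d are measurable for the coordinate sigma-algebra *)

Section continuous_measurable_rV.
Context {R : realType} {n : nat}.

Let box (p : 'rV[rat]_n * rat) : set 'rV[R]_n :=
  [set x | forall i, `|x ord0 i - ratr (p.1 ord0 i)| < ratr p.2].

Let measurable_box p : measurable (box p).
Proof.
rewrite (_ : box p = \bigcap_(i in [set: 'I_n])
    ((fun x : 'rV[R]_n => `|x ord0 i - ratr (p.1 ord0 i)|) @^-1` `]-oo, ratr p.2[)).
  apply: fin_bigcap_measurable => // i _.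
  rewrite -[X in measurable X]setTI.
  have : measurable_fun setT (fun x : 'rV[R]_n => `|x ord0 i - ratr (p.1 ord0 i)|).
    apply: measurableT_comp => //; apply: measurable_funB => //; exact: measurable_coord.
  by apply => //; exact: measurable_itv.
apply/seteqP; split => x /= h i => [_|]; last by have := h i I; rewrite /= in_itv.
by rewrite /= in_itv/=; exact: h.
Qed.

(** Every point of an open set lies in a box with rational centre and rational half-width contained
    in the set, and there are only countably many such boxes. *)
Lemma open_measurable_rV (A : set 'rV[R]_n) : open A -> measurable A.
Proof.
move=> oA.
rewrite (_ : A = \bigcup_(p in [set: 'rV[rat]_n * rat])
    (if `[< box p `<=` A >] then box p else set0)).
  apply: countable_bigcupT_measurable => // p.
  by case: asboolP => _; [exact: measurable_box|exact: measurable0].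
apply/seteqP; split=> [x Ax|x [p _]]; last by case: asboolP => // pA /pA.
have /nbhs_ballP[e /= e0 eA] : nbhs x A by exact: open_nbhs_nbhs.
(* The centre of the box will be within q of x in each coordinate, so every point of the box is
   within 2q < e of x. *)
have [q /andP[q0 qe]] : exists q : rat, 0 < (ratr q : R) < e / 2.
  have [q] := @rat_in_itvoo R 0 (e / 2) ltac:(by rewrite divr_gt0).
  by rewrite in_itv/= => ?; exists q.
have /choice[r rP] : forall i : 'I_n, exists r : rat, `|x ord0 i - ratr r| < (ratr q : R).
  move=> i; have [r] := @rat_in_itvoo R (x ord0 i - ratr q) (x ord0 i + ratr q) ltac:(by rewrite ltrD2l gtrN).
  by rewrite in_itv/= => /andP[? ?]; exists r; rewrite ltr_norml; apply/andP; split; lra.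
exists (\row_i r i, q) => //; case: asboolP => [_|]; first by move=> i; rewrite mxE.
case=> y /= yq; apply: eA; split=> // i j; rewrite ord1.
have := yq j; have := rP j; rewrite mxE => h1 h2.
rewrite /ball/= (_ : _ - _ = (x ord0 j - ratr (r j)) - (y ord0 j - ratr (r j))); last by ring.
by rewrite (le_lt_trans (ler_normB _ _))//; lra.
Qed.

Lemma continuous_measurable_rV (f : 'rV[R]_n -> R) : continuous f -> measurable_fun setT f.
Proof.
move=> /continuousP cf; apply: (measurability _ (RGenOpens.measurableE R)).
move=> _ [_ [a [b ->] <-]]; rewrite setTI; apply: open_measurable_rV.
exact/cf/interval_open.
Qed.

End continuous_measurable_rV.

Section continuous_arith.
Context {R : realType} {T : topologicalType}.
Implicit Types u v : T -> R.

Lemma continuous_mulr u v : continuous u -> continuous v -> continuous (fun z => u z * v z).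
Proof. by move=> cu cv z; exact: (@cvgM _ _ (nbhs z) _ u v _ _ (cu z) (cv z)). Qed.

Lemma continuous_addr u v : continuous u -> continuous v -> continuous (fun z => u z + v z).
Proof. by move=> cu cv z; exact: (@cvgD _ _ _ (nbhs z) _ u v _ _ (cu z) (cv z)). Qed.

Lemma continuous_cstr (c : R) : continuous (fun _ : T => c).
Proof. by move=> z; exact: cvg_cst. Qed.

Lemma continuous_oppr u : continuous u -> continuous (fun z => - u z).
Proof. by move=> cu z; exact: (@cvgN _ _ _ (nbhs z) _ u _ (cu z)). Qed.

Lemma continuous_subr u v : continuous u -> continuous v -> continuous (fun z => u z - v z).
Proof. by move=> cu /continuous_oppr; exact: continuous_addr. Qed.

Lemma continuous_expr u : continuous u -> continuous (fun z => expR (u z)).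
Proof. by move=> cu z; exact: (continuous_comp (cu z) (@continuous_expR R (u z))). Qed.

End continuous_arith.

Lemma continuous_coord {R : realType} {d : nat} (i : 'I_d) :
  continuous (fun x : 'rV[R]_d => x ord0 i).
Proof. by move=> x; exact: (@coord_continuous R 1 d ord0 i). Qed.

Lemma continuous_sumr {R : realType} (T : topologicalType) I (r : seq I) (F : I -> T -> R) :
  (forall i, continuous (F i)) -> continuous (fun x => \sum_(i <- r) F i x).
Proof.
move=> cF x; elim: r => [|i r ih].
  under eq_fun do rewrite big_nil.
  exact: cvg_cst.
under eq_fun do rewrite big_cons.
by apply: cvgD => //; exact: cF.
Qed.

(** * Scalar product, Euclidean norm and reflections *)

Section euclidean_theory.
Context {R : realType} {d : nat}.
Implicit Types x y z a : 'rV[R]_d.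

Lemma dotC x y : dot x y = dot y x.
Proof. by apply: eq_bigr => i _; rewrite mulrC. Qed.

Lemma dotDl x y z : dot (x + y) z = dot x z + dot y z.
Proof. by rewrite -big_split; apply: eq_bigr => i _; rewrite mxE mulrDl. Qed.

Lemma dotZl c x y : dot (c *: x) y = c * dot x y.
Proof. by rewrite /dot big_distrr/=; apply: eq_bigr => i _; rewrite mxE mulrA. Qed.

Lemma dotNl x y : dot (- x) y = - dot x y.
Proof. by rewrite -scaleN1r dotZl mulN1r. Qed.

Lemma dotBl x y z : dot (x - y) z = dot x z - dot y z.
Proof. by rewrite dotDl dotNl. Qed.

Lemma dotDr x y z : dot x (y + z) = dot x y + dot x z.
Proof. by rewrite dotC dotDl !(dotC x). Qed.

Lemma dotZr c x y : dot x (c *: y) = c * dot x y.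
Proof. by rewrite dotC dotZl dotC. Qed.

Lemma dotNr x y : dot x (- y) = - dot x y.
Proof. by rewrite dotC dotNl dotC. Qed.

Lemma dotBr x y z : dot x (y - z) = dot x y - dot x z.
Proof. by rewrite dotDr dotNr. Qed.

Lemma dot0l x : dot 0 x = 0.
Proof. by rewrite -(scale0r 0) dotZl mul0r. Qed.

Lemma dot0r x : dot x 0 = 0.
Proof. by rewrite dotC dot0l. Qed.

Lemma dot_ge0 x : 0 <= dot x x.
Proof. by apply: sumr_ge0 => i _; rewrite -expr2 sqr_ge0. Qed.

Lemma dot_eq0 x : (dot x x == 0) = (x == 0).
Proof.
apply/eqP/eqP => [|->]; last exact: dot0l.
move/eqP; rewrite psumr_eq0; last by move=> i _; rewrite -expr2 sqr_ge0.
move=> /allP h; apply/rowP => i; rewrite mxE; apply/eqP.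
by have := h i (mem_index_enum i); rewrite /= -expr2 sqrf_eq0.
Qed.

Lemma enorm_ge0 x : 0 <= enorm x. Proof. exact: sqrtr_ge0. Qed.

Lemma sqr_enorm x : enorm x ^+ 2 = dot x x.
Proof. by rewrite sqr_sqrtr// dot_ge0. Qed.

Lemma enorm0 : enorm (0 : 'rV[R]_d) = 0.
Proof. by rewrite /enorm dot0l sqrtr0. Qed.

Lemma enorm_eq0 x : (enorm x == 0) = (x == 0).
Proof. by rewrite -sqrf_eq0 sqr_enorm dot_eq0. Qed.

Lemma enormZ c x : enorm (c *: x) = `|c| * enorm x.
Proof.
by rewrite /enorm dotZl dotZr mulrA -expr2 sqrtrM ?sqr_ge0// sqrtr_sqr.
Qed.

Lemma dot_le x y : `|dot x y| <= enorm x * enorm y.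
Proof.
have [->|y0] := eqVneq y 0; first by rewrite dot0r normr0 mulr_ge0 ?enorm_ge0.
have yy : 0 < dot y y by rewrite lt_neqAle eq_sym dot_eq0 y0 dot_ge0.
rewrite -ler_sqr ?nnegrE ?mulr_ge0 ?enorm_ge0// exprMn !sqr_enorm real_normK ?num_real//.
have := dot_ge0 (dot y y *: x - dot x y *: y).
rewrite dotBl !dotBr !dotZl !dotZr (dotC y x).
rewrite (_ : _ - _ = dot y y * (dot x x * dot y y - dot x y ^+ 2)); last by ring.
by rewrite pmulr_rge0// subr_ge0.
Qed.

Lemma coord_le_enorm x i : `|x ord0 i| <= enorm x.
Proof.
rewrite -ler_sqr ?nnegrE ?enorm_ge0// sqr_enorm real_normK ?num_real//.
rewrite /dot (bigD1 i)//= -expr2 lerDl.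
by apply: sumr_ge0 => j _; rewrite -expr2 sqr_ge0.
Qed.

Lemma dot_unit_vec x j : dot x (unit_vec R j) = x ord0 j.
Proof.
rewrite /dot (bigD1 j)//= big1 ?addr0 => [|i ij].
  by rewrite mxE !eqxx mulr1.
by rewrite mxE eqxx (negbTE ij) mulr0.
Qed.

Lemma reflectionD a x y : reflection a (x + y) = reflection a x + reflection a y.
Proof.
rewrite /reflection dotDr mulrDr mulrDl scalerDl opprD.
by rewrite addrACA.
Qed.

Lemma reflectionZ a c x : reflection a (c *: x) = c *: reflection a x.
Proof.
by rewrite /reflection dotZr scalerBr scalerA; congr (_ - _ *: _); ring.
Qed.

Lemma reflectionNx a x : reflection a (- x) = - reflection a x.
Proof. by rewrite -scaleN1r reflectionZ scaleN1r. Qed.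

Lemma reflectionB a x y : reflection a (x - y) = reflection a x - reflection a y.
Proof. by rewrite reflectionD reflectionNx. Qed.

Lemma reflection0 a : reflection a 0 = 0.
Proof. by rewrite /reflection dot0r mulr0 mul0r scale0r subrr. Qed.

Lemma reflectionN a x : reflection (- a) x = reflection a x.
Proof.
by rewrite /reflection !dotNl dotNr opprK scalerN mulrN mulNr scaleNr opprK.
Qed.

Lemma dot_reflection a x y : dot (reflection a x) y = dot x (reflection a y).
Proof. by rewrite /reflection dotBl dotBr dotZl dotZr (dotC x a); ring. Qed.

Lemma dot_reflection_root a x : a != 0 -> dot a (reflection a x) = - dot a x.
Proof.
rewrite -dot_eq0 => a0; rewrite /reflection dotBr dotZr.
by rewrite -mulrA mulVf// mulr1; ring.
Qed.

Lemma reflection_root a : a != 0 -> reflection a a = - a.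
Proof.
rewrite -dot_eq0 => a0; rewrite /reflection mulfK//.
by rewrite scaler_nat mulr2n opprD addrA subrr sub0r.
Qed.

Lemma reflectionK a : a != 0 -> involutive (reflection a).
Proof.
move=> a0 x; rewrite {2}/reflection reflectionB reflectionZ reflection_root// scalerN opprK.
by rewrite /reflection subrK.
Qed.

Lemma dot_reflection2 a x y : a != 0 -> dot (reflection a x) (reflection a y) = dot x y.
Proof. by move=> a0; rewrite dot_reflection reflectionK. Qed.

Lemma enorm_reflection a x : a != 0 -> enorm (reflection a x) = enorm x.
Proof. by move=> a0; rewrite /enorm dot_reflection2. Qed.

Lemma reflection_fixed a x : dot a x = 0 -> reflection a x = x.
Proof. by move=> ax; rewrite /reflection ax mulr0 mul0r scale0r subr0. Qed.

Lemma continuous_dot y : continuous (dot y).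
Proof.
rewrite (_ : dot y = fun x => \sum_(i < d) y ord0 i * x ord0 i)//.
apply: continuous_sumr => i x.
apply: (@cvgM _ _ (nbhs x) _ (fun=> y ord0 i) (fun z : 'rV[R]_d => z ord0 i)).
  exact: cvg_cst.
exact: (@coord_continuous R 1 d ord0 i).
Qed.

Lemma continuous_dotxx : continuous (fun x : 'rV[R]_d => dot x x).
Proof.
rewrite /dot; apply: continuous_sumr => i z.
by apply: (@cvgM _ _ (nbhs z) _ (fun z : 'rV[R]_d => z ord0 i) (fun z : 'rV[R]_d => z ord0 i));
  exact: (@coord_continuous R 1 d ord0 i).
Qed.

Lemma continuous_enorm : continuous (@enorm R d).
Proof.
move=> x; apply: (@continuous_comp _ _ _ (fun z : 'rV[R]_d => dot z z) Num.sqrt).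
  exact: continuous_dotxx.
exact: sqrt_continuous.
Qed.

Lemma measurable_dot y : measurable_fun setT (dot y).
Proof. by apply: continuous_measurable_rV; exact: continuous_dot. Qed.

Lemma measurable_dotxx : measurable_fun setT (fun x : 'rV[R]_d => dot x x).
Proof. by apply: continuous_measurable_rV; exact: continuous_dotxx. Qed.

Lemma measurable_enorm : measurable_fun setT (@enorm R d).
Proof. by apply: continuous_measurable_rV; exact: continuous_enorm. Qed.

Lemma measurable_fun_rVD dT (T : measurableType dT) (f g : T -> 'rV[R]_d) :
  measurable_fun setT f -> measurable_fun setT g ->
  measurable_fun setT (fun t : T => f t + g t).
Proof.
move=> mf mg; apply: measurable_fun_rV => i; under eq_fun do rewrite mxE.
by apply: measurable_funD; exact: (measurableT_comp (measurable_coord i)).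
Qed.

Lemma measurable_fun_rVN dT (T : measurableType dT) (f : T -> 'rV[R]_d) :
  measurable_fun setT f -> measurable_fun setT (fun t : T => - f t).
Proof.
move=> mf; apply: measurable_fun_rV => i; under eq_fun do rewrite mxE.
by apply: measurableT_comp => //; exact: (measurableT_comp (measurable_coord i)).
Qed.

Lemma measurable_reflection a : measurable_fun setT (reflection a).
Proof.
apply: measurable_fun_rV => i; under eq_fun do rewrite !mxE.
apply: measurable_funB; first exact: measurable_coord.
apply: measurable_funM => //; apply: measurable_funM => //.
by apply: measurable_funM => //; exact: measurable_dot.
Qed.

End euclidean_theory.

Section change_of_variables.
Context {R : realType} {dT} {T : measurableType dT} (mu : {measure set T -> \bar R}).
Variables (phi : T -> T) (c : R).
Hypotheses (mphi : measurable_fun setT phi) (c0 : 0 <= c).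
Hypothesis phiE : forall f : T -> \bar R, measurable_fun setT f ->
  (forall x, (0 <= f x)%E) -> (\int[mu]_x f (phi x) = c%:E * \int[mu]_x f x)%E.

Lemma integrableR_comp f : integrableR mu f -> integrableR mu (f \o phi).
Proof.
move=> /integrableP[mf foo]; apply/integrableP; split.
  by move: mf => /measurable_EFinP mf; apply/measurable_EFinP; exact: measurableT_comp.
rewrite (phiE (f := fun x => `|(f x)%:E|)%E)//; first by rewrite lte_mul_pinfty.
exact: measurableT_comp.
Qed.

(** The positive and the negative part each satisfy [phiE], and finiteness lets the factor
    distribute over their difference. Serves reflections, with c = 1, and affine maps. *)
Lemma Rintegral_comp f : integrableR mu f ->
  \int[mu]_x f (phi x) = c * \int[mu]_x f x.
Proof.
move=> intf; have mf : measurable_fun setT (EFin \o f) by case/integrableP : intf.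
rewrite /Rintegral -[X in X * _]/(fine c%:E) -fineM//; last exact: integrable_fin_num.
congr fine; rewrite integralE [in RHS]integralE.
rewrite muleBr//; last first.
  rewrite fin_num_adde_defr// integrable_fin_num//.
  exact: integrable_funepos.
rewrite -(phiE (measurable_funepos mf))// -(phiE (measurable_funeneg mf))//.
by congr (_ - _)%E; apply: eq_integral => x _; rewrite ?funeposE ?funenegE.
Qed.

End change_of_variables.

(** * Invariance of Lebesgue measure under reflections *)

Section lebesgue_rV_reflection.
Context {R : realType}.
Local Open Scope ereal_scope.

Let mgauss n : measurable_fun setT (fun x : 'rV[R]_n => (expR (- dot x x))%:E).
Proof.
apply/measurable_EFinP; apply: measurableT_comp => //; apply: measurableT_comp => //.
exact: measurable_dotxx.
Qed.

Lemma integral_gauss_rV n :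
  \int[lebesgue_rV R n]_x (expR (- dot x x))%:E = (Num.sqrt pi ^+ n)%:E.
Proof.
elim: n => [|n ih].
  rewrite integral_dirac//=; last exact: mgauss.
  rewrite /dot big_ord0 oppr0 expR0 expr0.
  by rewrite diracE mem_set// mul1e.
rewrite ge0_integral_rVS//.
under eq_integral => a _.
  under eq_integral => v _.
    rewrite (_ : dot _ _ = a ^+ 2 + dot v v)%R; last first.
      rewrite /dot big_ord_recl cons_rVE unlift_none -expr2; congr (_ + _)%R.
      by apply: eq_bigr => i _; rewrite cons_rVE liftK.
    rewrite opprD expRD EFinM.
    over.
  rewrite ge0_integralZl//; last exact: mgauss.
  rewrite ih muleC.
  over.
rewrite /= ge0_integralZl//; last first.
  by apply/measurable_EFinP; exact: measurable_gauss_fun.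
by rewrite integralT_gauss -EFinM -exprSr.
Qed.

Context {d : nat}.
Notation lam := (@lebesgue_rV R d).

Let transl (v : 'rV[R]_d) (h : 'rV[R]_d -> \bar R) : measurable_fun setT h ->
  (forall x, 0 <= h x) -> \int[lam]_x h (v + x)%R = \int[lam]_x h x.
Proof.
move=> mh h0; rewrite [RHS](@ge0_integral_rV_affine _ _ 1%R v)//.
rewrite normr1 expr1n mul1e; apply: eq_integral => x _.
by rewrite scale1r addrC.
Qed.

Let translN (v : 'rV[R]_d) (h : 'rV[R]_d -> \bar R) : measurable_fun setT h ->
  (forall x, 0 <= h x) -> \int[lam]_x h (v - x)%R = \int[lam]_x h x.
Proof.
move=> mh h0; rewrite [RHS](@ge0_integral_rV_affine _ _ (-1)%R v)//.
rewrite normrN1 expr1n mul1e; apply: eq_integral => x _.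
by rewrite scaleN1r addrC.
Qed.

(* A translation invariant and even measure is proportional to Lebesgue measure
   (Weil's Fubini argument), and the Gaussian shows the factor to be 1. *)
Lemma ge0_integral_reflection (a : 'rV[R]_d) (f : 'rV[R]_d -> \bar R) : a != 0%R ->
  measurable_fun setT f -> (forall x, 0 <= f x) ->
  \int[lam]_x f (reflection a x) = \int[lam]_x f x.
Proof.
move=> a0 mf f0.
pose s := reflection a; have ms : measurable_fun setT s := measurable_reflection a.
have sK : involutive s := reflectionK a0.
pose g (x : 'rV[R]_d) : \bar R := (expR (- dot x x))%:E.
have mg : measurable_fun setT g := @mgauss d.
have g0 x : 0 <= g x by rewrite lee_fin.
have mfs : measurable_fun setT (f \o s) by exact: measurableT_comp.
have mgs : measurable_fun setT (g \o s) by exact: measurableT_comp.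
have gs x : g (s x) = g x by rewrite /g dot_reflection2.
(* Integrating in y first, [g (x + s y)] equals [g (s x + y)], a translate of the Gaussian, because
   [g] is invariant under [s]. Integrating in x first, the shift of x by [s y] moves y into [f],
   where translation and evenness turn it into the integral of [f] composed with [s]. *)
pose F (p : 'rV[R]_d * 'rV[R]_d) := f p.1 * g (p.1 + s p.2)%R.
have mF : measurable_fun setT F.
  apply: emeasurable_funM; first exact: measurableT_comp.
  apply: measurableT_comp => //; apply: measurable_fun_rVD => //.
  exact: measurableT_comp.
have F0 p : 0 <= F p by rewrite mule_ge0.
have e1 : \int[lam]_x \int[lam]_y F (x, y) = \int[lam]_x f x * \int[lam]_x g x.
  have G0 : 0 <= \int[lam]_x g x by apply: integral_ge0 => x _; exact: g0.
  rewrite -(ge0_integralZr _ measurableT mf (fun x _ => f0 x) G0).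
  apply: eq_integral => x _.
  have mgx : measurable_fun setT (fun y => g (x + s y)%R).
    by apply: (measurableT_comp mg); exact: measurable_fun_rVD (measurable_cst x) ms.
  rewrite /F/= (ge0_integralZl _ measurableT mgx (fun y _ => g0 _) (f0 x)).
  congr (_ * _); rewrite -[RHS](transl (s x) mg g0).
  by apply: eq_integral => y _; rewrite -gs /s reflectionD -/s sK.
have e2 : \int[lam]_y \int[lam]_x F (x, y) = \int[lam]_x g x * \int[lam]_x f (s x).
  have L0 : 0 <= \int[lam]_x f (s x) by apply: integral_ge0 => x _; exact: f0.
  rewrite -(ge0_integralZr _ measurableT mg (fun x _ => g0 x) L0).
  transitivity (\int[lam]_y \int[lam]_x (g x * f (x - s y)%R)).
    apply: eq_integral => y _.
    have mFy : measurable_fun setT (fun x => F (x, y)).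
      by apply: (measurableT_comp mF); exact: pair2_measurable.
    rewrite -(transl (- s y)%R mFy (fun x => F0 _)).
    by apply: eq_integral => x _; rewrite /F/= addrAC addNr add0r muleC [(- _ + x)%R]addrC.
  have mH : measurable_fun setT
      (fun p : 'rV[R]_d * 'rV[R]_d => g p.1 * f (p.1 - s p.2)%R).
    apply: emeasurable_funM; first exact: (measurableT_comp mg measurable_fst).
    apply: (measurableT_comp mf); apply: measurable_fun_rVD; first exact: measurable_fst.
    by apply: measurable_fun_rVN; exact: (measurableT_comp ms measurable_snd).
  rewrite -(fubini_tonelli _ mH (fun p => mule_ge0 (g0 _) (f0 _))).
  apply: eq_integral => x _ /=.
  have mfx : measurable_fun setT (fun y => f (x - s y)%R).
    apply: (measurableT_comp mf); apply: (measurable_fun_rVD (measurable_cst x)).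
    exact: measurable_fun_rVN.
  rewrite (ge0_integralZl _ measurableT mfx (fun y _ => f0 _) (g0 x)).
  congr (_ * _); rewrite -[RHS](translN (s x) mfs (fun x => f0 _)).
  by apply: eq_integral => y _; rewrite /= /s reflectionB -/s sK.
move: e1; rewrite (fubini_tonelli F mF F0) e2 muleC integral_gauss_rV.
have pi0 : (0 < Num.sqrt (pi : R) ^+ d)%R by rewrite exprn_gt0// sqrtr_gt0 pi_gt0.
move=> /(congr1 (fun z => z * (Num.sqrt (pi : R) ^+ d)^-1%:E)).
by rewrite -!muleA -EFinM divff ?gt_eqF// !mule1.
Qed.

End lebesgue_rV_reflection.

Section Rintegral_rV.
Context {R : realType} {d : nat}.
Notation lam := (@lebesgue_rV R d).
Implicit Types f : 'rV[R]_d -> R.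

Lemma Rintegral_reflection a f : a != 0 -> integrableR lam f ->
  \int[lam]_x f (reflection a x) = \int[lam]_x f x.
Proof.
move=> a0 intf; rewrite -[RHS]mul1r; apply: Rintegral_comp => //.
by move=> g mg g0; rewrite mul1e ge0_integral_reflection.
Qed.

Let affineE c y : c != 0 -> forall f : 'rV[R]_d -> \bar R, measurable_fun setT f ->
  (forall x, (0 <= f x)%E) ->
  (\int[lam]_x f (c *: x + y)%R = ((`|c| ^+ d)^-1)%:E * \int[lam]_x f x)%E.
Proof.
move=> c0 f mf f0; rewrite (ge0_integral_rV_affine y c0 mf f0) muleA -EFinM.
by rewrite mulVf ?mul1e// expf_neq0// normr_eq0.
Qed.

Lemma integrable_rV_affine c y f : c != 0 -> integrableR lam f ->
  integrableR lam (fun x => f (c *: x + y)).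
Proof.
move=> c0 intf; apply: (integrableR_comp (measurable_rV_affine _ _) _ (affineE y c0)) => //.
Qed.

Lemma Rintegral_rV_affine c y f : c != 0 -> integrableR lam f ->
  \int[lam]_x f (c *: x + y) = (`|c| ^+ d)^-1 * \int[lam]_x f x.
Proof. by move=> c0 intf; exact: (Rintegral_comp (affineE y c0)). Qed.

Lemma integrable_gauss (t : R) : 0 < t ->
  integrableR lam (fun x => expR (- (t * dot x x))).
Proof.
move=> t0.
have I1 : integrableR lam (fun x => expR (- dot x x)).
  apply: integrableR_ge0 => //.
  - apply: measurableT_comp => //; apply: measurableT_comp => //.
    exact: measurable_dotxx.
  - by rewrite integral_gauss_rV ltry.
have st : Num.sqrt t != 0 by rewrite sqrtr_eq0 -ltNge.
have := integrable_rV_affine 0 st I1; congr integrableR; apply/funext => x.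
by rewrite addr0 dotZl dotZr mulrA -expr2 sqr_sqrtr// ltW.
Qed.

End Rintegral_rV.

(** * The Dunkl kernel as a series *)

Section positive_roots.
Context {R : realType} {d : nat}.
Implicit Types Phi Rp : {fset 'rV[R]_d}.

(** The form in which the root system is used. A reflection need not preserve the positive roots,
    but up to signs it permutes them by [tau], and the sums over [Rp] to be reindexed do not change
    when a root is replaced by its opposite. *)
Definition dunkl_data Rp (k : 'rV[R]_d -> R) : Prop :=
  [/\ forall a, a \in Rp -> a != 0,
      forall a, a \in Rp -> 0 <= k a &
      forall a, a \in Rp -> exists tau : 'rV[R]_d -> 'rV[R]_d,
        [/\ perm_eq [seq tau b | b <- Rp] Rp,
            forall b, b \in Rp -> k (tau b) = k b &
            forall b, tau b = reflection a b \/ tau b = - reflection a b]].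

Lemma positive_subsystem_dunkl_data Phi Rp k : root_system Phi ->
  positive_subsystem Phi Rp -> multiplicity_function Phi k -> dunkl_data Rp k.
Proof.
move=> [Phi0 Phis PhiN] [u [u0 RpE]] [k0 kG].
have RpPhi a : a \in Rp -> a \in Phi by rewrite RpE => /andP[].
have oppPhi a : a \in Phi -> - a \in Phi.
  move=> aPhi; have : [set a; - a] (- a) by right.
  by rewrite -PhiN// => -[].
have sPhi a b : a \in Phi -> b \in Phi -> reflection a b \in Phi.
  by move=> aPhi bPhi; have : (reflection a @` [set` Phi]) (reflection a b) by [exists b]; rewrite Phis.
have kN a : a \in Phi -> k (- a) = k a.
  by move=> aPhi; rewrite -(reflection_root (Phi0 _ aPhi)) kG//; exact: RGrefl.
split; first by move=> a /RpPhi /Phi0.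
  by move=> a /RpPhi /k0.
move=> a aRp; have aPhi := RpPhi _ aRp; have a0 := Phi0 _ aPhi.
(* The sign is chosen so that the image is again positive with respect to the vector [u] that
   defines the positive subsystem. *)
pose tau b := if 0 < dot (reflection a b) u then reflection a b else - reflection a b.
have tauE b : tau b = reflection a b \/ tau b = - reflection a b.
  by rewrite /tau; case: ifP; [left|right].
have tauRp b : b \in Rp -> tau b \in Rp.
  move=> /RpPhi bPhi; rewrite /tau; case: ifPn => [p|]; first by rewrite RpE sPhi.
  rewrite -leNgt le_eqVlt (negbTE (u0 _ (sPhi _ _ aPhi bPhi)))/= => n.
  by rewrite RpE oppPhi ?sPhi// dotNl oppr_gt0.
have tauI : {in Rp &, injective tau}.
  move=> b c bRp cRp bc.
  have /orP[/eqP|/eqP] : (reflection a b == reflection a c) || (reflection a b == - reflection a c).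
    move: (tauE b) (tauE c) bc => [->|->] [->|->] /eqP; rewrite ?eqr_oppLR ?opprK => -> //;
    by rewrite orbT.
  - by move=> /(congr1 (reflection a)); rewrite !reflectionK.
  (* In the remaining case b = - c, which is impossible since both roots have a positive scalar
     product with [u]. *)
  rewrite -reflectionNx => /(congr1 (reflection a)); rewrite !reflectionK// => bE.
  move: bRp; rewrite bE RpE dotNl oppr_gt0 => /andP[_].
  by move: cRp; rewrite RpE => /andP[_ /lt_trans] /[apply]; rewrite ltxx.
exists tau; split=> //.
  apply: uniq_perm; [by rewrite map_inj_in_uniq ?fset_uniq|exact: fset_uniq|].
  have sub : {subset [seq tau b | b <- Rp] <= Rp} by move=> _ /mapP[b bRp ->]; exact: tauRp.
  apply: (uniq_min_size _ sub _).2; first by rewrite map_inj_in_uniq ?fset_uniq.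
  by rewrite size_map.
move=> b /RpPhi bPhi; case: (tauE b) => ->; rewrite ?kN ?sPhi// kG//; exact: RGrefl.
Qed.

Context {Rp : {fset 'rV[R]_d}} {k : 'rV[R]_d -> R} (data : dunkl_data Rp k).

Lemma dunkl_data_neq0 a : a \in Rp -> a != 0. Proof. by case: data => + _ _; exact. Qed.

Lemma dunkl_data_ge0 a : a \in Rp -> 0 <= k a. Proof. by case: data => _ + _; exact. Qed.

(** Stands for the invariance of the root system under reflections: the sign by which [tau] differs
    from the reflection is absorbed by the evenness of [G] in the root. *)
Lemma dunkl_data_big (T : Type) (idx : T) (op : Monoid.com_law idx) (G : R -> 'rV[R]_d -> T) a :
  a \in Rp -> (forall c b, G c (- b) = G c b) ->
  \big[op/idx]_(b <- Rp) G (k b) (reflection a b) = \big[op/idx]_(b <- Rp) G (k b) b.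
Proof.
move=> aRp GN; case: data => _ _ /(_ _ aRp)[tau [pt kt tE]].
rewrite -[RHS](perm_big _ pt) big_map !big_seq; apply: eq_bigr => b bRp.
by rewrite kt//; case: (tE b) => ->; rewrite ?GN.
Qed.

Lemma abs_mult_ge0 : 0 <= abs_mult Rp k.
Proof. by rewrite /abs_mult big_seq; apply: sumr_ge0 => a; exact: dunkl_data_ge0. Qed.

End positive_roots.

(** * Homogeneous polynomials as tensors: monomials indexed by words of letters *)

Section words.
Context {R : realType} {d : nat}.
Implicit Types x h : 'rV[R]_d.

(** Indices of the n-th tensor power of R^d. Polynomials are represented by tensors that need not be
    symmetric, because the sum of squares of the coefficients is then invariant under reflections
    and every argument becomes an induction on the first letter. *)
Fixpoint word (n : nat) : finType :=
  if n is m.+1 then ('I_d * word m)%type else unit.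

Lemma big_word (T : Type) (idx : T) (op : Monoid.com_law idx) n (F : word n.+1 -> T) :
  \big[op/idx]_(w : word n.+1) F w = \big[op/idx]_(i < d) \big[op/idx]_(w : word n) F (i, w).
Proof. by rewrite (pair_bigA _ (fun i w => F (i, w)))/=; apply: eq_bigr => -[]. Qed.

Lemma big_word0 (T : Type) (idx : T) (op : Monoid.com_law idx) (F : word 0 -> T) :
  \big[op/idx]_(w : word 0) F w = F tt.
Proof. by rewrite (big_pred1 tt)// => -[]. Qed.

Fixpoint mon n : word n -> 'rV[R]_d -> R :=
  if n is m.+1 then fun w x => x ord0 w.1 * mon w.2 x else fun _ _ => 1.

(** The derivative of [mon w] at x in direction h, written out by the product rule. *)
Fixpoint dmon n : word n -> 'rV[R]_d -> 'rV[R]_d -> R :=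
  if n is m.+1 then fun w x h => h ord0 w.1 * mon w.2 x + x ord0 w.1 * dmon w.2 x h
  else fun _ _ _ => 0.

Definition l1norm x : R := \sum_(i < d) `|x ord0 i|.

Lemma l1norm_ge0 x : 0 <= l1norm x. Proof. exact: sumr_ge0. Qed.

Lemma l1normZ c x : l1norm (c *: x) = `|c| * l1norm x.
Proof. by rewrite /l1norm mulr_sumr; apply: eq_bigr => i _; rewrite mxE normrM. Qed.

Lemma sum_norm_mon n x : \sum_(w : word n) `|mon w x| = l1norm x ^+ n.
Proof.
elim: n => [|n ih]; first by rewrite big_word0/= normr1 expr0.
rewrite big_word exprS -ih mulr_suml; apply: eq_bigr => i _.
by rewrite mulr_sumr; apply: eq_bigr => w _ /=; rewrite normrM.
Qed.

Lemma sum_norm_dmon n x h :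
  \sum_(w : word n) `|dmon w x h| <= n%:R * l1norm x ^+ n.-1 * l1norm h.
Proof.
elim: n => [|n ih]; first by rewrite big_word0/= normr0 !mul0r.
rewrite big_word.
apply: (@le_trans _ _ (\sum_(i < d) \sum_(w : word n)
    (`|h ord0 i| * `|mon w x| + `|x ord0 i| * `|dmon w x h|))).
  apply: ler_sum => i _; apply: ler_sum => w _ /=.
  by rewrite (le_trans (ler_normD _ _))// !normrM.
under eq_bigr do rewrite big_split/= -!mulr_sumr sum_norm_mon.
rewrite big_split/= -!mulr_suml -!/(l1norm _).
have := ler_wpM2l (l1norm_ge0 x) ih; move/(lerD (lexx (l1norm h * l1norm x ^+ n))) => /le_trans; apply.
case: n {ih} => [|n] /=; first by rewrite !expr0 mul0r mul0r mulr0 addr0; lra.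
by rewrite (exprS _ n) -(natr1 n.+1); set p := l1norm x ^+ n; nra.
Qed.

Lemma sum_norm_monD n x h :
  \sum_(w : word n) `|mon w (x + h) - mon w x| <= (l1norm x + l1norm h) ^+ n - l1norm x ^+ n.
Proof.
elim: n => [|n ih]; first by rewrite big_word0/= !subrr normr0.
rewrite big_word.
apply: (@le_trans _ _ (\sum_(i < d) \sum_(w : word n)
   (`|x ord0 i| * `|mon w (x + h) - mon w x| + `|h ord0 i| * `|mon w (x + h)|))).
  apply: ler_sum => i _; apply: ler_sum => w _ /=; rewrite mxE -!normrM.
  by rewrite (le_trans _ (ler_normD _ _))// le_eqVlt; apply/orP; left; apply/eqP; congr `|_|; ring.
under eq_bigr do rewrite big_split/= -!mulr_sumr sum_norm_mon.
rewrite big_split/= -!mulr_suml -!/(l1norm _).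
have l1D : l1norm (x + h) <= l1norm x + l1norm h.
  by rewrite -big_split; apply: ler_sum => i _; rewrite mxE ler_normD.
have := ler_wpM2l (l1norm_ge0 x) ih.
have : l1norm h * l1norm (x + h) ^+ n <= l1norm h * (l1norm x + l1norm h) ^+ n.
  by rewrite ler_wpM2l ?l1norm_ge0// lerXn2r ?nnegrE ?addr_ge0 ?l1norm_ge0.
by rewrite !exprS; lra.
Qed.

(** Summed over all words, the first order Taylor remainders are majorised by the remainder of the
    one-variable power at [l1norm x] with increment [l1norm h]. Splitting off the first letter i
    writes a remainder as x_i times the shorter remainder plus h_i times the shorter difference. *)
Lemma sum_norm_mon2 n x h :
  \sum_(w : word n) `|mon w (x + h) - mon w x - dmon w x h| <=
  (l1norm x + l1norm h) ^+ n - l1norm x ^+ n - n%:R * l1norm x ^+ n.-1 * l1norm h.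
Proof.
elim: n => [|n ih].
  by rewrite big_word0/= !expr0 !mul0r !subrr ?subr0 ?subrr normr0.
rewrite big_word.
apply: (@le_trans _ _ (\sum_(i < d) \sum_(w : word n)
   (`|x ord0 i| * `|mon w (x + h) - mon w x - dmon w x h| +
    `|h ord0 i| * `|mon w (x + h) - mon w x|))).
  apply: ler_sum => i _; apply: ler_sum => w _ /=; rewrite mxE -!normrM.
  by rewrite (le_trans _ (ler_normD _ _))// le_eqVlt; apply/orP; left; apply/eqP; congr `|_|; ring.
under eq_bigr do rewrite big_split/= -!mulr_sumr.
rewrite big_split/= -!mulr_suml -!/(l1norm _).
have := ler_wpM2l (l1norm_ge0 x) ih.
have := ler_wpM2l (l1norm_ge0 h) (sum_norm_monD n x h).
case: n {ih} => [|n] /=; first by rewrite !expr0 !expr1; lra.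
by rewrite !exprS -(natr1 n.+1); lra.
Qed.

Lemma dmonZ n (w : word n) x c h : dmon w x (c *: h) = c * dmon w x h.
Proof. by elim: n w => [|n ih] w /=; rewrite ?mulr0// ih mxE; ring. Qed.

(* the elementary inequality behind all first order expansions below *)
Lemma exprD_second_order (X H t : R) n : 0 <= X -> 0 <= H -> 0 <= t <= 1 ->
  (X + t * H) ^+ n - X ^+ n - n%:R * X ^+ n.-1 * (t * H) <= t ^+ 2 * (X + H) ^+ n.
Proof.
move=> X0 H0 /andP[t0 t1].
have e1 m : (X + t * H) ^+ m - X ^+ m <= t * (X + H) ^+ m.
  elim: m => [|m ih]; first by rewrite !expr0; lra.
  have p0 : 0 <= (X + H) ^+ m by rewrite exprn_ge0// addr_ge0.
  have q : (X + t * H) ^+ m <= (X + H) ^+ m.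
    by rewrite lerXn2r ?nnegrE ?addr_ge0 ?mulr_ge0// lerD2l ler_piMl.
  have := ler_wpM2l X0 ih; have := ler_wpM2l (mulr_ge0 t0 H0) q.
  by rewrite !exprS; lra.
elim: n => [|n ih]; first by rewrite !expr0 mul0r; have := sqr_ge0 t; lra.
have := ler_wpM2l X0 ih; have := ler_wpM2l (mulr_ge0 t0 H0) (e1 n).
case: n {ih} => [|n] /=.
  have := sqr_ge0 t; rewrite !expr0 !expr1 expr2; nra.
by rewrite (exprS (X + t * H)) (exprS (X + H)) (exprS X n) -(natr1 n.+1); rewrite !exprS; lra.
Qed.

End words.

Arguments word : clear implicits.

(** * Orthogonal action of reflections on tensors *)

Section tensor_reflection.
Context {R : realType} {d : nat}.
Implicit Types (a x : 'rV[R]_d).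

Definition refl_coef a (i j : 'I_d) : R :=
  (i == j)%:R - 2 * a ord0 i * a ord0 j / dot a a.

Fixpoint refl_word a n : word d n -> word d n -> R :=
  if n is m.+1 then fun w v => refl_coef a w.1 v.1 * refl_word a w.2 v.2 else fun _ _ => 1.

Lemma refl_coefE a x i : reflection a x ord0 i = \sum_j refl_coef a i j * x ord0 j.
Proof.
rewrite /refl_coef; under eq_bigr do rewrite mulrBl.
rewrite big_split/= (bigD1 i)//= eqxx mul1r big1 ?addr0; last first.
  by move=> j ji; rewrite eq_sym (negbTE ji) mul0r.
rewrite sumrN !mxE; congr (_ - _).
rewrite /dot mulr_sumr !mulr_suml; apply: eq_bigr => j _; ring.
Qed.

Lemma mon_reflection a n (w : word d n) x :
  mon w (reflection a x) = \sum_v refl_word a w v * mon v x.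
Proof.
elim: n w => [|n ih] w; first by rewrite big_word0/= mulr1.
rewrite [LHS]/= refl_coefE ih big_word mulr_suml; apply: eq_bigr => i _.
by rewrite mulr_sumr; apply: eq_bigr => v _ /=; ring.
Qed.

(** Tensor powers of an orthogonal matrix are orthogonal. For a single letter the rows are
    orthonormal because the matrix sends [a] to [- a]. *)
Lemma refl_word_orth a n (w w' : word d n) : a != 0 ->
  \sum_v refl_word a w v * refl_word a w' v = (w == w')%:R.
Proof.
move=> a0; elim: n w w' => [|n ih] w w'.
  by rewrite big_word0/= mulr1; case: w w' => -[].
rewrite big_word.
transitivity (\sum_j refl_coef a w.1 j * refl_coef a w'.1 j * (w.2 == w'.2)%:R).
  apply: eq_bigr => j _; rewrite -ih mulr_sumr; apply: eq_bigr => v _ /=; ring.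
rewrite -mulr_suml.
suff -> : \sum_j refl_coef a w.1 j * refl_coef a w'.1 j = (w.1 == w'.1)%:R.
  by case: w w' => [i v] [i' v'] /=; rewrite xpair_eqE; do 2 case: eqP => //= _; rewrite ?mulr1 ?mulr0.
have e1 i : \sum_j refl_coef a i j * a ord0 j = - a ord0 i.
  by rewrite -refl_coefE reflection_root// mxE.
rewrite {1}/refl_coef; under eq_bigr do rewrite mulrBl.
rewrite big_split/= sumrN (bigD1 w.1)//= eqxx mul1r big1 ?addr0; last first.
  by move=> j ji; rewrite eq_sym (negbTE ji) mul0r.
transitivity (refl_coef a w'.1 w.1 - 2 * a ord0 w.1 / dot a a *
    \sum_j refl_coef a w'.1 j * a ord0 j).
  congr (_ - _); rewrite mulr_sumr; apply: eq_bigr => j _; ring.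
by rewrite e1 /refl_coef eq_sym; ring.
Qed.

(** Coefficients of the polynomial precomposed with the reflection, see [tensor_reflectionE]. *)
Definition refl_tensor a n (c : word d n -> R) : word d n -> R :=
  fun v => \sum_w c w * refl_word a w v.

Lemma refl_tensor_isometry a n (c : word d n -> R) : a != 0 ->
  \sum_v refl_tensor a c v ^+ 2 = \sum_v c v ^+ 2.
Proof.
move=> a0.
transitivity (\sum_w \sum_w' c w * c w' * \sum_v refl_word a w v * refl_word a w' v).
  under eq_bigr => v _.
    rewrite expr2 /refl_tensor big_distrlr/=.
    over.
  rewrite exchange_big; apply: eq_bigr => w _.
  rewrite exchange_big; apply: eq_bigr => w' _.
  rewrite mulr_sumr; apply: eq_bigr => v _; ring.
apply: eq_bigr => w _.
under eq_bigr do rewrite refl_word_orth//.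
rewrite (bigD1 w)//= eqxx mulr1 -expr2 big1 ?addr0// => w' ww'.
by rewrite eq_sym (negbTE ww') mulr0.
Qed.

End tensor_reflection.

(** * Solving the radial system degree by degree *)

Section tensor_system.
Context {R : realType} {d : nat} {Rp : {fset 'rV[R]_d}} {k : 'rV[R]_d -> R}.
Variable data : dunkl_data Rp k.
Notation K := (abs_mult Rp k).

(** On coefficients, this is the contraction of the Dunkl operators with x, that is the sum of x_j
    D_j: by Euler's identity it maps f of degree n to n f plus the sum of k(a) (f - f o sigma_a). *)
Definition radial_op n (c : word d n -> R) : word d n -> R :=
  fun v => (n%:R + K) * c v - \sum_(a <- Rp) k a * refl_tensor a c v.

(* [radial_op n] is symmetric with spectrum in [n, oo[ since each reflection
   acts isometrically on tensors *)
Lemma radial_op_coercive n (c : word d n -> R) :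
  n%:R ^+ 2 * \sum_v c v ^+ 2 <= \sum_v radial_op c v ^+ 2.
Proof.
set N := \sum_v c v ^+ 2.
have N0 : 0 <= N by apply: sumr_ge0 => v _; exact: sqr_ge0.
have h1 : n%:R * N <= \sum_v c v * radial_op c v.
  rewrite /radial_op; under eq_bigr do rewrite mulrBr.
  rewrite big_split/= sumrN.
  have -> : \sum_v c v * ((n%:R + K) * c v) = (n%:R + K) * N.
    by rewrite mulr_sumr; apply: eq_bigr => v _; ring.
  suff : \sum_v c v * (\sum_(a <- Rp) k a * refl_tensor a c v) <= K * N by lra.
  under eq_bigr do rewrite mulr_sumr.
  rewrite exchange_big/= /abs_mult mulr_suml big_seq [leRHS]big_seq; apply: ler_sum => a aRp.
  have -> : \sum_v c v * (k a * refl_tensor a c v) = k a * \sum_v c v * refl_tensor a c v.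
    by rewrite mulr_sumr; apply: eq_bigr => v _; ring.
  apply: ler_wpM2l; first exact: dunkl_data_ge0 data _ aRp.
  (* Since the reflected tensor has the same norm, N is the mean of the two sums of squares, and the
     scalar product is estimated by 2pq <= p^2 + q^2. *)
  have NE : N = 2^-1 * \sum_v (c v ^+ 2 + refl_tensor a c v ^+ 2).
    rewrite big_split/= (refl_tensor_isometry _ (dunkl_data_neq0 data aRp)) -/N; by field.
  rewrite NE mulr_sumr; apply: ler_sum => v _.
  by have := sqr_ge0 (c v - refl_tensor a c v); rewrite sqrrB; lra.
case: n c @N N0 h1 => [|n] c N N0 h1.
  by rewrite expr0n/= mul0r; apply: sumr_ge0 => v _; exact: sqr_ge0.
(* Expanding this square and inserting the lower bound [h1] for the scalar product gives the claimed
   lower bound for the norm of the image, in place of a spectral decomposition. *)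
have : 0 <= \sum_v (radial_op c v - n.+1%:R * c v) ^+ 2.
  by apply: sumr_ge0 => v _; exact: sqr_ge0.
suff -> : \sum_v (radial_op c v - n.+1%:R * c v) ^+ 2 =
    \sum_v radial_op c v ^+ 2 - 2 * n.+1%:R * \sum_v c v * radial_op c v + n.+1%:R ^+ 2 * N.
  move: h1 => /(ler_wpM2l (_ : 0 <= 2 * n.+1%:R)) => /(_ ltac:(by [])); lra.
rewrite !mulr_sumr -sumrN -!big_split/=; apply: eq_bigr => v _; ring.
Qed.

Definition radial_mx n : 'M[R]_#|word d n| :=
  \matrix_(i, j) ((n%:R + K) * (i == j)%:R -
    \sum_(a <- Rp) k a * refl_word a (enum_val i) (enum_val j)).

Lemma radial_mxE n (u : 'rV[R]_#|word d n|) j :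
  (u *m radial_mx n) ord0 j = radial_op (fun w => u ord0 (enum_rank w)) (enum_val j).
Proof.
rewrite mxE; under eq_bigr do rewrite mxE mulrBr.
rewrite big_split/= sumrN /radial_op; congr (_ - _).
  rewrite (bigD1 j)//= eqxx mulr1 big1 ?addr0; last first.
    by move=> i ij; rewrite (negbTE ij) !mulr0.
  by rewrite enum_valK mulrC.
under eq_bigr do rewrite mulr_sumr.
rewrite exchange_big; apply: eq_bigr => a _.
rewrite /refl_tensor mulr_sumr [RHS](reindex_onto enum_val enum_rank) /=; last first.
  by move=> w _; rewrite enum_rankK.
apply: eq_big => [i|i _]; first by rewrite enum_valK eqxx.
by rewrite enum_valK; ring.
Qed.

(** Coercivity kills the kernel in positive degree. In degree 0 the operator vanishes on constants,
    and the starting value 1 has to be prescribed. *)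
Lemma radial_mx_unit n : radial_mx n.+1 \in unitmx.
Proof.
rewrite -row_free_unit; apply: inj_row_free => u uM0.
pose c (w : word d n.+1) := u ord0 (enum_rank w).
have : n.+1%:R ^+ 2 * \sum_w c w ^+ 2 <= 0.
  rewrite (le_trans (radial_op_coercive _))// big1// => w _.
  by rewrite -[w]enum_rankK -radial_mxE uM0 mxE expr0n.
rewrite pmulr_rle0 ?exprn_gt0// => c0.
have {}c0 : \sum_w c w ^+ 2 == 0.
  by rewrite eq_le c0 sumr_ge0// => w _; exact: sqr_ge0.
move: c0; rewrite psumr_eq0; last by move=> w _; exact: sqr_ge0.
move=> /allP c0; apply/rowP => i; rewrite mxE.
rewrite -(enum_valK i).
by apply/eqP; have := c0 (enum_val i) (mem_index_enum _); rewrite /= sqrf_eq0.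
Qed.

(** The right-hand side <x,y> f_(n-1) is the tensor product of y with the preceding coefficients;
    the inverse matrix solves the radial equation for it. *)
Fixpoint dunkl_coef n (y : 'rV[R]_d) : word d n -> R :=
  if n is m.+1 then fun w => \sum_(u : word d m.+1)
    y ord0 u.1 * dunkl_coef y u.2 * invmx (radial_mx m.+1) (enum_rank u) (enum_rank w)
  else fun _ => 1.

Lemma dunkl_coef_eq n (y : 'rV[R]_d) (w : word d n.+1) :
  radial_op (dunkl_coef (n := n.+1) y) w = y ord0 w.1 * dunkl_coef y w.2.
Proof.
pose b : 'rV[R]_#|word d n.+1| :=
  \row_i (y ord0 (enum_val i).1 * dunkl_coef y (enum_val i).2).
have cE v : dunkl_coef (n := n.+1) y v = (b *m invmx (radial_mx n.+1)) ord0 (enum_rank v).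
  rewrite mxE [RHS](reindex_onto enum_rank enum_val) /=; last by move=> i _; rewrite enum_valK.
  by apply: eq_big => [u|u _]; rewrite ?enum_rankK ?eqxx// mxE enum_rankK.
have -> : dunkl_coef (n := n.+1) y = fun v => (b *m invmx (radial_mx n.+1)) ord0 (enum_rank v).
  exact/funext.
by rewrite -[w in LHS]enum_rankK -radial_mxE mulmxKV ?radial_mx_unit// mxE !enum_rankK.
Qed.

(** Coercivity divides by n^2 and the factor <x,y> multiplies by |y|^2 in each degree, whence the
    growth of the exponential series and convergence everywhere. *)
Lemma dunkl_coef_sqr_le n (y : 'rV[R]_d) :
  \sum_w dunkl_coef (n := n) y w ^+ 2 <= (dot y y) ^+ n / (n`!%:R) ^+ 2.
Proof.
elim: n => [|n ih]; first by rewrite big_word0/= !expr1n expr0 divr1.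
have := radial_op_coercive (dunkl_coef (n := n.+1) y).
under [leRHS]eq_bigr do rewrite dunkl_coef_eq.
rewrite [leRHS]big_word.
have -> : \sum_(i < d) \sum_(w : word d n) (y ord0 (i, w).1 * dunkl_coef y (i, w).2) ^+ 2 =
    dot y y * \sum_w dunkl_coef (n := n) y w ^+ 2.
  rewrite /dot mulr_suml; apply: eq_bigr => i _; rewrite mulr_sumr; apply: eq_bigr => w _ /=; ring.
rewrite -ler_pdivlMl ?exprn_gt0// => /le_trans; apply.
have n0 : n.+1%:R != 0 :> R by rewrite pnatr_eq0.
have f0 : n`!%:R != 0 :> R by rewrite pnatr_eq0 -lt0n fact_gt0.
have -> : dot y y ^+ n.+1 / n.+1`!%:R ^+ 2 =
    (n.+1%:R ^+ 2)^-1 * (dot y y * (dot y y ^+ n / n`!%:R ^+ 2)).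
  by rewrite factS natrM exprMn invfM exprS; ring.
by rewrite ler_wpM2l ?invr_ge0 ?exprn_ge0// ler_wpM2l ?dot_ge0.
Qed.

Lemma dunkl_coef_le n (y : 'rV[R]_d) (w : word d n) :
  `|dunkl_coef y w| <= enorm y ^+ n / n`!%:R.
Proof.
rewrite -ler_sqr ?nnegrE ?divr_ge0 ?exprn_ge0 ?enorm_ge0//.
rewrite real_normK ?num_real// expr_div_n -exprM mulnC exprM sqr_enorm.
apply: le_trans (dunkl_coef_sqr_le n y); rewrite (bigD1 w)//= lerDl.
by apply: sumr_ge0 => v _; exact: sqr_ge0.
Qed.

Lemma dunkl_coefZ n r (y : 'rV[R]_d) (w : word d n) :
  dunkl_coef (r *: y) w = r ^+ n * dunkl_coef y w.
Proof.
elim: n w => [|n ih] w /=; first by rewrite expr0 mul1r.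
by rewrite mulr_sumr; apply: eq_bigr => u _; rewrite ih mxE exprS; ring.
Qed.

Lemma measurable_dunkl_coef n (w : word d n) :
  measurable_fun setT (fun y => dunkl_coef y w).
Proof.
elim: n w => [|n ih] w /=; first exact: measurable_cst.
apply: measurable_sum => u; apply: measurable_funM => //.
by apply: measurable_funM => //; exact: measurable_coord.
Qed.

End tensor_system.

(** * First order expansions with quadratic remainder *)

Section second_order.
Context {R : realType} {d : nat}.
Implicit Types (x h : 'rV[R]_d) (g : 'rV[R]_d -> R).

(** Stable under sums, products and reflections, with a unique [L]. Polynomial identities can thus
    be differentiated by comparing expansions, and estimates with explicit remainders pass to the
    series. *)
Definition expands g x h (L : R) : Prop :=
  exists C, forall t : R, `|t| <= 1 -> `|g (x + t *: h) - g x - t * L| <= C * t ^+ 2.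

Lemma expands_cst c x h : expands (fun=> c) x h 0.
Proof. by exists 0 => t _; rewrite subrr mulr0 subr0 normr0 mul0r. Qed.

Lemma expandsD g1 g2 x h L1 L2 : expands g1 x h L1 -> expands g2 x h L2 ->
  expands (fun z => g1 z + g2 z) x h (L1 + L2).
Proof.
move=> [C1 H1] [C2 H2]; exists (C1 + C2) => t t1.
rewrite mulrDl (le_trans _ (lerD (H1 t t1) (H2 t t1)))// (le_trans _ (ler_normD _ _))//.
by rewrite le_eqVlt; apply/orP; left; apply/eqP; congr `|_|; ring.
Qed.

Lemma expandsZ c g x h L : expands g x h L -> expands (fun z => c * g z) x h (c * L).
Proof.
move=> [C H]; exists (`|c| * C) => t t1; rewrite -mulrA.
rewrite (le_trans _ (ler_wpM2l (normr_ge0 c) (H t t1)))// -normrM.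
by rewrite le_eqVlt; apply/orP; left; apply/eqP; congr `|_|; ring.
Qed.

Lemma expandsB g1 g2 x h L1 L2 : expands g1 x h L1 -> expands g2 x h L2 ->
  expands (fun z => g1 z - g2 z) x h (L1 - L2).
Proof.
move=> H1 /(expandsZ (-1)) /(expandsD H1).
by rewrite mulN1r; under eq_fun do rewrite mulN1r.
Qed.

Lemma expands_sum I (s : seq I) (G : I -> 'rV[R]_d -> R) x h (L : I -> R) :
  (forall i, expands (G i) x h (L i)) ->
  expands (fun z => \sum_(i <- s) G i z) x h (\sum_(i <- s) L i).
Proof.
move=> H; elim: s => [|i s ih].
  by under eq_fun do rewrite big_nil; rewrite big_nil; exact: expands_cst.
by under eq_fun do rewrite big_cons; rewrite big_cons; exact: expandsD.
Qed.

Lemma expandsM g1 g2 x h L1 L2 : expands g1 x h L1 -> expands g2 x h L2 ->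
  expands (fun z => g1 z * g2 z) x h (L1 * g2 x + g1 x * L2).
Proof.
move=> [C1 H1] [C2 H2].
exists (`|g2 x| * C1 + `|g1 x| * C2 + (C1 + `|L1|) * (C2 + `|L2|)) => t t1.
set u := g1 (x + t *: h); set v := g2 (x + t *: h).
have {}H1 := H1 t t1; have {}H2 := H2 t t1; rewrite -/u -/v in H1 H2.
have t2 : t ^+ 2 = `|t| ^+ 2 by rewrite real_normK ?num_real.
have C10 : 0 <= C1 * t ^+ 2 by exact: le_trans (normr_ge0 _) H1.
have C20 : 0 <= C2 * t ^+ 2 by exact: le_trans (normr_ge0 _) H2.
have tt : t ^+ 2 <= `|t| by rewrite t2 expr2 ler_piMl.
have lip (C L e : R) : 0 <= C * t ^+ 2 -> `|e - t * L| <= C * t ^+ 2 -> `|e| <= (C + `|L|) * `|t|.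
  move=> C0 He; have CC : C * t ^+ 2 <= C * `|t|.
    have [->|t0] := eqVneq t 0; first by rewrite expr0n normr0.
    by rewrite ler_wpM2l// -(pmulr_lge0 _ (_ : 0 < t ^+ 2))// exprn_even_gt0.
  rewrite -[e](subrK (t * L)) (le_trans (ler_normD _ _))// normrM.
  by rewrite mulrDl (mulrC `|L|) lerD// (le_trans He).
have h1 := lip _ _ _ C10 H1; have h2 := lip _ _ _ C20 H2.
rewrite (_ : _ - _ = g2 x * (u - g1 x - t * L1) + g1 x * (v - g2 x - t * L2) +
  (u - g1 x) * (v - g2 x)); last by ring.
apply: (le_trans (ler_normD _ _)); rewrite [leRHS]mulrDl; apply: lerD.
  apply: (le_trans (ler_normD _ _)); rewrite [leRHS]mulrDl !normrM -!mulrA.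
  by rewrite lerD// ler_wpM2l.
rewrite normrM t2 (_ : _ * _ = ((C1 + `|L1|) * `|t|) * ((C2 + `|L2|) * `|t|)); last by ring.
by rewrite ler_pM.
Qed.

Lemma expands_dot y x h : expands (fun z => dot z y) x h (dot h y).
Proof.
exists 0 => t _; rewrite dotDl dotZl [dot x y + _]addrC addrK subrr normr0.
by rewrite mul0r.
Qed.

Lemma expands_reflection a g x h L :
  expands g (reflection a x) (reflection a h) L -> expands (g \o reflection a) x h L.
Proof.
by move=> [C H]; exists C => t t1 /=; rewrite reflectionD reflectionZ; exact: H.
Qed.

Lemma expands_unique g x h L L' : expands g x h L -> expands g x h L' -> L = L'.
Proof.
move=> [C H] [C' H']; apply/eqP; rewrite -subr_eq0 -normr_le0; apply/ler_addgt0Pl => e e0.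
pose M := `|C| + `|C'| + 1.
have M0 : 0 < M by rewrite ltr_wpDl// addr_ge0.
pose t := Num.min 1 (e / M).
have t0 : 0 < t by rewrite lt_min ltr01 divr_gt0.
have t1 : `|t| <= 1 by rewrite gtr0_norm// ge_min lexx.
have tM : t * M <= e by rewrite -ler_pdivlMr// ge_min lexx orbT.
rewrite addr0 -(ler_pM2l t0) (le_trans _ (_ : (C + C') * t ^+ 2 <= _))//.
  rewrite mulrDl (le_trans _ (lerD (H t t1) (H' t t1)))//.
  rewrite -[g _ - g _ - t * L]opprK normrN opprB -{1}(gtr0_norm t0) -normrM.
  rewrite (le_trans _ (ler_normD _ _))//.
  by rewrite le_eqVlt; apply/orP; left; apply/eqP; congr `|_|; ring.
rewrite expr2 mulrA mulrC ler_wpM2l ?(ltW t0)// (le_trans _ tM)// mulrC ler_wpM2l ?(ltW t0)//.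
by rewrite /M; have := ler_norm C; have := ler_norm C'; lra.
Qed.

(** The remainder is needed only for small t, so that locally convergent power series qualify
    too. *)
Lemma quadratic_is_derive g x h L (C delta : R) : 0 < delta ->
  (forall t : R, `|t| <= delta -> `|g (x + t *: h) - g x - t * L| <= C * t ^+ 2) ->
  is_derive x h g L.
Proof.
move=> delta0 H.
suff cvgL : (fun t => t^-1 *: (g (t *: h + x) - g x)) @ 0^' --> L.
  apply: DeriveDef; first by apply/cvg_ex; exists L.
  exact: cvg_lim cvgL.
apply/cvgrPdist_le => /= e e0; near=> t.
have t0 : t != 0 by near: t; exact: nbhs_dnbhs_neq.
have t1 : `|t| <= delta.
  near: t; apply: nbhs_dnbhs; apply/nbhs_ballP; exists delta => //= t.
  by rewrite /ball/= sub0r normrN => /ltW.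
have te : `|t| <= e / (`|C| + 1).
  near: t; apply: nbhs_dnbhs; apply/nbhs_ballP; exists (e / (`|C| + 1)) => /=.
    by rewrite divr_gt0// ltr_wpDl.
  by move=> t; rewrite /ball/= sub0r normrN => /ltW.
have tn0 : 0 < `|t| by rewrite normr_gt0.
rewrite -(ler_pM2l tn0) -normrM addrC.
rewrite (_ : t * _ = - (g (t *: h + x) - g x - t * L)); last first.
  rewrite mulrDr mulrN -[t * (t^-1 *: _)]/(t *: _) scalerA mulfV// scale1r; ring.
rewrite normrN (addrC (t *: h)); apply: (le_trans (H t t1)).
rewrite (_ : t ^+ 2 = `|t| * `|t|); last by rewrite -expr2 real_normK ?num_real.
rewrite mulrCA ler_wpM2l//.
have : (`|C| + 1) * `|t| <= e by rewrite mulrC -ler_pdivlMr// ltr_wpDl.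
by apply: le_trans; rewrite ler_wpM2r// (le_trans (ler_norm _))// lerDl.
Unshelve. all: by end_near. Qed.

Lemma expands_is_derive g x h L : expands g x h L -> is_derive x h g L.
Proof. by move=> [C]; exact: quadratic_is_derive. Qed.

End second_order.

Lemma reflection_conj {R : realType} {d : nat} (a b x : 'rV[R]_d) : b != 0 ->
  reflection (reflection b a) (reflection b x) = reflection b (reflection a x).
Proof.
move=> b0; rewrite [RHS]reflectionB reflectionZ.
rewrite -[LHS]/(reflection b x - (2 * dot (reflection b a) (reflection b x) /
  dot (reflection b a) (reflection b a)) *: reflection b a).
by rewrite !dot_reflection2.
Qed.

Section dunkl_quotient_data.
Context {R : realType} {d : nat} {Rp : {fset 'rV[R]_d}} {k : 'rV[R]_d -> R}.
Implicit Types (x h a : 'rV[R]_d) (g : 'rV[R]_d -> R) (dg : 'rV[R]_d -> 'rV[R]_d -> R).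

(** Real counterpart of the Dunkl quotient. The derivative is an argument [dg], so that polynomials
    and series can use their explicit derivative formulas. *)
Definition quot a g dg x : R :=
  if dot a x == 0 then 2 / dot a a * dg x a else (g x - g (reflection a x)) / dot a x.

Definition dunkl_op g dg x v : R :=
  dg x v + \sum_(a <- Rp) k a * dot a v * quot a g dg x.

End dunkl_quotient_data.
Arguments dunkl_op {R d} Rp k g dg x v.

(** * The homogeneous components and the full Dunkl system *)

Section dunkl_poly.
Context {R : realType} {d : nat} {Rp : {fset 'rV[R]_d}} {k : 'rV[R]_d -> R}.
Variable data : dunkl_data Rp k.
Notation K := (abs_mult Rp k).
Implicit Types (x y h a v : 'rV[R]_d).

Definition dunkl_poly n y x : R := \sum_(w : word d n) @dunkl_coef _ _ Rp k n y w * mon w x.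

Definition ddunkl_poly n y x h : R := \sum_(w : word d n) @dunkl_coef _ _ Rp k n y w * dmon w x h.

Definition dunkl_poly_pred n y x : R := if n is m.+1 then dunkl_poly m y x else 0.

Lemma dunkl_poly0 y x : dunkl_poly 0 y x = 1.
Proof. by rewrite /dunkl_poly big_word0/= mulr1. Qed.

Lemma dunkl_polyZ n r y x : dunkl_poly n (r *: y) x = r ^+ n * dunkl_poly n y x.
Proof. by rewrite /dunkl_poly mulr_sumr; apply: eq_bigr => w _; rewrite dunkl_coefZ; ring. Qed.

Lemma monZ n (w : word d n) r x : mon w (r *: x) = r ^+ n * mon w x.
Proof. by elim: n w => [|n ih] w /=; rewrite ?mul1r// ih mxE exprS; ring. Qed.

Lemma dunkl_polyZr n r y x : dunkl_poly n y (r *: x) = r ^+ n * dunkl_poly n y x.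
Proof. by rewrite /dunkl_poly mulr_sumr; apply: eq_bigr => w _; rewrite monZ; ring. Qed.

Lemma ddunkl_polyZ n y x c h : ddunkl_poly n y x (c *: h) = c * ddunkl_poly n y x h.
Proof. by rewrite /ddunkl_poly mulr_sumr; apply: eq_bigr => w _; rewrite dmonZ mulrCA. Qed.

Let coef_sum_le n y (F : word d n -> R) M : \sum_w `|F w| <= M ->
  `|\sum_(w : word d n) @dunkl_coef _ _ Rp k n y w * F w| <= enorm y ^+ n / n`!%:R * M.
Proof.
move=> FM; rewrite (le_trans (ler_norm_sum _ _ _))//.
apply: le_trans (ler_wpM2l _ FM); last by rewrite divr_ge0 ?exprn_ge0 ?enorm_ge0.
rewrite mulr_sumr; apply: ler_sum => w _; rewrite normrM ler_wpM2r//.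
exact: dunkl_coef_le.
Qed.

Lemma dunkl_poly_le n y x : `|dunkl_poly n y x| <= enorm y ^+ n / n`!%:R * l1norm x ^+ n.
Proof. by apply: coef_sum_le; rewrite sum_norm_mon. Qed.

Lemma ddunkl_poly_le n y x h : `|ddunkl_poly n y x h| <=
  enorm y ^+ n / n`!%:R * (n%:R * l1norm x ^+ n.-1 * l1norm h).
Proof. by apply: coef_sum_le; exact: sum_norm_dmon. Qed.

Lemma dunkl_polyB_le n y x h : `|dunkl_poly n y (x + h) - dunkl_poly n y x| <=
  enorm y ^+ n / n`!%:R * ((l1norm x + l1norm h) ^+ n - l1norm x ^+ n).
Proof.
rewrite /dunkl_poly -sumrB; under eq_bigr do rewrite -mulrBr.
by apply: coef_sum_le; exact: sum_norm_monD.
Qed.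

Lemma dunkl_poly_second_order n y x h t : `|t| <= 1 ->
  `|dunkl_poly n y (x + t *: h) - dunkl_poly n y x - t * ddunkl_poly n y x h| <=
  enorm y ^+ n / n`!%:R * (t ^+ 2 * (l1norm x + l1norm h) ^+ n).
Proof.
move=> t1; rewrite -ddunkl_polyZ /dunkl_poly /ddunkl_poly -!sumrB.
under eq_bigr do rewrite -!mulrBr.
apply: coef_sum_le; rewrite (le_trans (sum_norm_mon2 _ _ _))// l1normZ.
rewrite -(real_normK (num_real t)); apply: exprD_second_order => //;
  by rewrite ?l1norm_ge0// normr_ge0.
Qed.

Lemma dunkl_poly_expands n y x h : expands (dunkl_poly n y) x h (ddunkl_poly n y x h).
Proof.
exists (enorm y ^+ n / n`!%:R * (l1norm x + l1norm h) ^+ n) => t t1.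
by rewrite (le_trans (dunkl_poly_second_order _ _ _ _ t1))// le_eqVlt; apply/orP; left; apply/eqP; ring.
Qed.

Lemma tensor_reflectionE n (c : word d n -> R) a x : \sum_w c w * mon w (reflection a x) =
  \sum_v refl_tensor a c v * mon v x.
Proof.
rewrite /refl_tensor; under eq_bigr do rewrite mon_reflection mulr_sumr.
rewrite exchange_big; apply: eq_bigr => v _; rewrite mulr_suml.
by apply: eq_bigr => w _; ring.
Qed.

Lemma radial_opE n (c : word d n -> R) x :
  (n%:R + K) * (\sum_w c w * mon w x) -
    \sum_(b <- Rp) k b * (\sum_w c w * mon w (reflection b x)) =
  \sum_v @radial_op _ _ Rp k _ c v * mon v x.
Proof.
rewrite /radial_op; under [RHS]eq_bigr do rewrite mulrBl.
rewrite [RHS]big_split/= sumrN; congr (_ - _).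
  by rewrite mulr_sumr; apply: eq_bigr => w _; ring.
under eq_bigr do rewrite tensor_reflectionE mulr_sumr.
by rewrite exchange_big; apply: eq_bigr => v _; rewrite mulr_suml; apply: eq_bigr => a _; ring.
Qed.

Lemma dunkl_poly_radial n y x :
  (n%:R + K) * dunkl_poly n y x - \sum_(b <- Rp) k b * dunkl_poly n y (reflection b x) =
  dot x y * dunkl_poly_pred n y x.
Proof.
case: n => [|n]; rewrite /dunkl_poly_pred.
  under eq_bigr do rewrite dunkl_poly0 mulr1.
  by rewrite dunkl_poly0 -/(abs_mult Rp k); ring.
rewrite [LHS]radial_opE; under eq_bigr do rewrite dunkl_coef_eq//.
rewrite big_word /dot mulr_suml; apply: eq_bigr => i _.
by rewrite mulr_sumr; apply: eq_bigr => w _ /=; ring.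
Qed.

(** The radial equation differentiated in direction h: both of its sides have an expansion, and the
    linear terms must agree. The chain rule for a reflection reflects the direction as well. *)
Lemma ddunkl_poly_radial n y x h :
  (n.+1%:R + K) * ddunkl_poly n.+1 y x h -
    \sum_(b <- Rp) k b * ddunkl_poly n.+1 y (reflection b x) (reflection b h) =
  dot h y * dunkl_poly n y x + dot x y * ddunkl_poly n y x h.
Proof.
apply: (@expands_unique _ _ (fun z => dot z y * dunkl_poly n y z) x h); last first.
  by apply: expandsM; [exact: expands_dot|exact: dunkl_poly_expands].
have -> : (fun z => dot z y * dunkl_poly n y z) = (fun z =>
    (n.+1%:R + K) * dunkl_poly n.+1 y z -
    \sum_(b <- Rp) k b * (dunkl_poly n.+1 y \o reflection b) z).
  by apply/funext => z; rewrite dunkl_poly_radial.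
apply: expandsB; first by apply: expandsZ; exact: dunkl_poly_expands.
apply: expands_sum => b; apply: expandsZ; apply: expands_reflection.
exact: dunkl_poly_expands.
Qed.

(** The quotient along [a] applied to the radial equation. Conjugation by sigma_b turns it into the
    quotient along sigma_b a, and the last term is the product rule for the factor <x,y>, whose own
    quotient is 2<a,y>/<a,a>. *)
Lemma quot_radial n y x a : a \in Rp ->
  (n.+1%:R + K) * quot a (dunkl_poly n.+1 y) (ddunkl_poly n.+1 y) x -
    \sum_(b <- Rp) k b *
      quot (reflection b a) (dunkl_poly n.+1 y) (ddunkl_poly n.+1 y) (reflection b x) =
  dot x y * quot a (dunkl_poly n y) (ddunkl_poly n y) x +
    2 * dot a y / dot a a * dunkl_poly n y (reflection a x).
Proof.
move=> aRp; have a0 := dunkl_data_neq0 data aRp.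
rewrite {1 3}/quot; case: ifPn => ax.
  rewrite [LHS](_ : _ = 2 / dot a a * ((n.+1%:R + K) * ddunkl_poly n.+1 y x a -
    \sum_(b <- Rp) k b * ddunkl_poly n.+1 y (reflection b x) (reflection b a))).
    rewrite ddunkl_poly_radial reflection_fixed; last exact/eqP.
    ring.
  rewrite [in RHS]mulrBr (@mulr_sumr _ _ Rp); congr (_ - _); first by ring.
  rewrite !big_seq; apply: eq_bigr => b bRp.
  have b0 := dunkl_data_neq0 data bRp.
  by rewrite /quot !dot_reflection2// ax; ring.
(* Off the hyperplane, the radial equation at sigma_a x is subtracted from the one at x; on it, the
   differentiated equation has been used. *)
rewrite [LHS](_ : _ = (((n.+1%:R + K) * dunkl_poly n.+1 y x -
      \sum_(b <- Rp) k b * dunkl_poly n.+1 y (reflection b x)) -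
    ((n.+1%:R + K) * dunkl_poly n.+1 y (reflection a x) -
      \sum_(b <- Rp) k b * dunkl_poly n.+1 y (reflection b (reflection a x)))) / dot a x).
  rewrite !dunkl_poly_radial/=; move: (dunkl_poly n y _) (dunkl_poly n y x) => p q.
  rewrite {1}/reflection dotBl dotZl; field.
  by rewrite dot_eq0 a0.
set P := dunkl_poly n.+1 y.
rewrite [X in _ = X / _](_ : _ = (n.+1%:R + K) * (P x - P (reflection a x)) -
  \sum_(b <- Rp) k b * (P (reflection b x) - P (reflection b (reflection a x)))); last first.
  under [X in _ = _ - X]eq_bigr do rewrite mulrBr.
  by rewrite [X in _ = _ - X]big_split/= sumrN; ring.
rewrite [RHS]mulrBl (@mulr_suml _ _ Rp); congr (_ - _); first by ring.
rewrite !big_seq; apply: eq_bigr => b bRp.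
have b0 := dunkl_data_neq0 data bRp.
rewrite /quot !dot_reflection2// (negbTE ax) mulrA; congr (_ * (_ - P _) / _).
exact: reflection_conj.
Qed.

Let P n y := dunkl_op Rp k (dunkl_poly n y) (ddunkl_poly n y).

Lemma quotNa a g dg x : (forall c h, dg x (c *: h) = c * dg x h) ->
  quot (- a) g dg x = - quot a g dg x.
Proof.
move=> dgZ; rewrite /quot !dotNl dotNr opprK oppr_eq0; case: ifP => _.
  by rewrite -scaleN1r dgZ; ring.
by rewrite reflectionN invrN mulrN.
Qed.

(** The Dunkl operator in direction v applied to the radial equation. The right-hand side is D_v of
    <x,y> f_n; its last sum measures the failure of the Leibniz rule for D_v. *)
Lemma dunkl_op_radial n y x v :
  (n.+1%:R + K) * P n.+1 y x v - \sum_(b <- Rp) k b * P n.+1 y (reflection b x) (reflection b v) =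
  dot v y * dunkl_poly n y x + dot x y * P n y x v +
    \sum_(a <- Rp) k a * dot a v * (2 * dot a y / dot a a * dunkl_poly n y (reflection a x)).
Proof.
set Q := quot ^~ (dunkl_poly n.+1 y) ^~ (ddunkl_poly n.+1 y).
(* Reindexing by sigma_b is allowed because the scalar product and the quotient both change sign
   with the root, so their product is even. *)
have inv b : b \in Rp ->
    \sum_(a <- Rp) k a * dot a (reflection b v) * Q a (reflection b x) =
    \sum_(a <- Rp) k a * dot a v * Q (reflection b a) (reflection b x).
  move=> bRp; have b0 := dunkl_data_neq0 data bRp.
  rewrite -(@dunkl_data_big _ _ _ _ data R 0 +%R
    (fun c a => c * dot a (reflection b v) * Q a (reflection b x)) b bRp); last first.
    move=> c a; rewrite dotNl /Q quotNa; first by ring.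
    by move=> c' h; rewrite ddunkl_polyZ.
  by apply: eq_bigr => a _; rewrite dot_reflection2.
rewrite /P /dunkl_op -/Q mulrDr.
transitivity (((n.+1%:R + K) * ddunkl_poly n.+1 y x v -
    \sum_(b <- Rp) k b * ddunkl_poly n.+1 y (reflection b x) (reflection b v)) +
  \sum_(a <- Rp) k a * dot a v * ((n.+1%:R + K) * Q a x -
     \sum_(b <- Rp) k b * Q (reflection b a) (reflection b x))).
  have -> : \sum_(b <- Rp) k b * (ddunkl_poly n.+1 y (reflection b x) (reflection b v) +
      \sum_(a <- Rp) k a * dot a (reflection b v) * Q a (reflection b x)) =
    \sum_(b <- Rp) k b * ddunkl_poly n.+1 y (reflection b x) (reflection b v) +
    \sum_(a <- Rp) k a * dot a v * \sum_(b <- Rp) k b * Q (reflection b a) (reflection b x).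
    under eq_bigr do rewrite mulrDr.
    rewrite big_split/=; congr (_ + _).
    rewrite big_seq; under eq_bigr => b bRp do rewrite inv// mulr_sumr.
    rewrite -big_seq exchange_big; apply: eq_bigr => a _.
    by rewrite (@mulr_sumr _ _ Rp); apply: eq_bigr => b _; ring.
  under [X in _ = _ + X]eq_bigr do rewrite mulrBr.
  rewrite [X in _ = _ + X]big_split/= sumrN.
  set S1 := \sum_(i <- Rp) _; set S2 := \sum_(i <- Rp) k i * _; set S3 := \sum_(i <- Rp) _.
  set S4 := \sum_(i <- Rp) _.
  have <- : (n.+1%:R + K) * S1 = S4.
    by rewrite (@mulr_sumr _ _ Rp); apply: eq_bigr => a _; rewrite /Q; ring.
  ring.
rewrite ddunkl_poly_radial big_seq.
under eq_bigr => a aRp do rewrite quot_radial// mulrDr.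
rewrite -big_seq big_split/= mulrDr !mulr_sumr -!addrA; congr (_ + (_ + (_ + _))).
by apply: eq_bigr => a _; ring.
Qed.

Lemma l1norm_le x : l1norm x <= d%:R * enorm x.
Proof.
rewrite /l1norm (le_trans (ler_sum _ (fun i _ => coord_le_enorm x i)))//.
by rewrite sumr_const card_ord mulr_natl.
Qed.

(** Chosen so that [l1norm x] plus the [l1norm] of the jump from x to sigma_a x is at most
    [refl_growth a * enorm x]. *)
Definition refl_growth a : R := d%:R + 2 * enorm a * l1norm a / dot a a.

Lemma refl_growth_ge0 a : 0 <= refl_growth a.
Proof. by rewrite addr_ge0// divr_ge0 ?dot_ge0// !mulr_ge0// ?enorm_ge0 ?l1norm_ge0. Qed.

Lemma exprD_sub_le (X H : R) n : 0 <= X -> 0 <= H ->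
  (X + H) ^+ n - X ^+ n <= n%:R * (X + H) ^+ n.-1 * H.
Proof.
move=> X0 H0; elim: n => [|n ih]; first by rewrite !expr0 subrr !mul0r.
have p0 : 0 <= (X + H) ^+ n by rewrite exprn_ge0// addr_ge0.
have q : X ^+ n <= (X + H) ^+ n by rewrite lerXn2r ?nnegrE ?addr_ge0// lerDl.
case: n ih p0 q => [|n] ih p0 q; first by rewrite !expr0 !expr1; lra.
have := ler_wpM2l (addr_ge0 X0 H0) ih; rewrite /= (exprS _ n.+1) (exprS X n.+1) -(natr1 n.+1).
have e : (X + H) * (n.+1%:R * (X + H) ^+ n * H) = n.+1%:R * (X + H) ^+ n.+1 * H.
  by rewrite (exprS _ n); ring.
rewrite /= e; have := ler_wpM2l H0 q; lra.
Qed.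

(** The jump from x to sigma_a x has length proportional to |<a,x>|, which cancels the denominator:
    the bound does not deteriorate near the hyperplane. *)
Lemma quot_poly_le n y x a : a != 0 ->
  `|quot a (dunkl_poly n y) (ddunkl_poly n y) x| <=
  2 * l1norm a / dot a a *
    (enorm y ^+ n / n`!%:R * (n%:R * (refl_growth a * enorm x) ^+ n.-1)).
Proof.
move=> a0; have aa : 0 < dot a a by rewrite lt_neqAle eq_sym dot_eq0 a0 dot_ge0.
have c0 : 0 <= enorm y ^+ n / n`!%:R by rewrite divr_ge0 ?exprn_ge0 ?enorm_ge0.
pose h := - (2 * dot a x / dot a a) *: a.
have hE : l1norm h = 2 * l1norm a / dot a a * `|dot a x|.
  rewrite l1normZ normrN normrM normrM ger0_norm// (ger0_norm (_ : 0 <= (dot a a)^-1)) ?invr_ge0 ?dot_ge0//.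
  by ring.
have XH : l1norm x + l1norm h <= refl_growth a * enorm x.
  rewrite /refl_growth mulrDl lerD ?l1norm_le// hE.
  rewrite [leRHS](_ : _ = 2 * l1norm a / dot a a * (enorm a * enorm x)); last by ring.
  by rewrite ler_wpM2l ?dot_le// divr_ge0 ?mulr_ge0 ?l1norm_ge0 ?dot_ge0.
have XHn m : (l1norm x + l1norm h) ^+ m <= (refl_growth a * enorm x) ^+ m.
  by rewrite lerXn2r ?nnegrE ?addr_ge0 ?mulr_ge0 ?l1norm_ge0 ?refl_growth_ge0 ?enorm_ge0.
have Xn m : l1norm x ^+ m <= (refl_growth a * enorm x) ^+ m.
  apply: le_trans (XHn m); rewrite lerXn2r ?nnegrE ?addr_ge0 ?l1norm_ge0//.
  by rewrite lerDl l1norm_ge0.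
rewrite /quot; case: ifPn => ax.
  rewrite normrM ger0_norm ?divr_ge0 ?dot_ge0//.
  apply: le_trans (ler_wpM2l _ (ddunkl_poly_le _ _ _ _)) _; first by rewrite divr_ge0 ?dot_ge0.
  rewrite [leLHS](_ : _ = 2 * l1norm a / dot a a * (enorm y ^+ n / n`!%:R * (n%:R * l1norm x ^+ n.-1))); last by ring.
  rewrite ler_wpM2l ?divr_ge0 ?mulr_ge0 ?l1norm_ge0 ?dot_ge0//.
  by rewrite ler_wpM2l// ler_wpM2l.
have nax : 0 < `|dot a x| by rewrite normr_gt0.
rewrite normrM normfV ler_pdivrMr//.
have -> : reflection a x = x + h by rewrite /reflection /h scaleNr.
rewrite distrC; apply: (le_trans (dunkl_polyB_le _ _ _ _)).
have := exprD_sub_le n (l1norm_ge0 x) (l1norm_ge0 h) => /(ler_wpM2l c0) /le_trans; apply.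
rewrite [leRHS](_ : _ = enorm y ^+ n / n`!%:R *
  (n%:R * (refl_growth a * enorm x) ^+ n.-1 * l1norm h)); last by rewrite hE; ring.
by rewrite ler_wpM2l// ler_wpM2r ?l1norm_ge0// ler_wpM2l.
Qed.

(** Error in the equation D_v f_n = <v,y> f_(n-1), of which the construction ensures only the
    contraction with v = x. *)
Let defect n y x v := P n y x v - dot v y * dunkl_poly_pred n y x.

Let defect_bounded n y (r s : R) : exists M, forall x v, enorm x <= r -> enorm v <= s ->
  `|defect n y x v| <= M.
Proof.
have [r0|r0] := ltP r 0.
  by exists 0 => x v xr; have := enorm_ge0 x; rewrite leNgt (le_lt_trans xr).
have [s0|s0] := ltP s 0.
  by exists 0 => x v _ vs; have := enorm_ge0 v; rewrite leNgt (le_lt_trans vs).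
pose cf m := enorm y ^+ m / m`!%:R : R.
have cf0 m : 0 <= cf m by rewrite divr_ge0 ?exprn_ge0 ?enorm_ge0.
exists (cf n * (n%:R * (d%:R * r) ^+ n.-1 * (d%:R * s)) +
  \sum_(a <- Rp) `|k a| * (enorm a * s) * (2 * l1norm a / dot a a *
    (cf n * (n%:R * (refl_growth a * r) ^+ n.-1))) + s * enorm y * (cf n.-1 * (d%:R * r) ^+ n.-1)).
move=> x v xr vs.
have Xn m : l1norm x ^+ m <= (d%:R * r) ^+ m.
  rewrite lerXn2r ?nnegrE ?mulr_ge0 ?l1norm_ge0// (le_trans (l1norm_le _))//.
  by rewrite ler_wpM2l.
have Vs : l1norm v <= d%:R * s by rewrite (le_trans (l1norm_le _))// ler_wpM2l.
rewrite /defect /P /dunkl_op (le_trans (ler_normB _ _))// lerD//.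
  rewrite (le_trans (ler_normD _ _))// lerD//.
    rewrite (le_trans (ddunkl_poly_le _ _ _ _))// -/(cf n) ler_wpM2l//.
    by rewrite ler_pM ?mulr_ge0 ?exprn_ge0 ?l1norm_ge0// ler_wpM2l.
  rewrite (le_trans (ler_norm_sum _ _ _))// !big_seq; apply: ler_sum => a aRp.
  have a0 := dunkl_data_neq0 data aRp.
  rewrite !normrM -!mulrA ler_wpM2l// mulrA.
  apply: ler_pM => //; first by rewrite (le_trans (dot_le _ _))// ler_wpM2l ?enorm_ge0.
  rewrite (le_trans (quot_poly_le _ _ _ a0))//.
  rewrite -!mulrA; do 3 (rewrite ler_wpM2l ?invr_ge0 ?l1norm_ge0 ?dot_ge0//).
  rewrite ler_wpM2l ?exprn_ge0 ?enorm_ge0// ler_wpM2l ?invr_ge0// ler_wpM2l// lerXn2r ?nnegrE ?mulr_ge0 ?refl_growth_ge0 ?enorm_ge0//.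
  by rewrite ler_wpM2l ?refl_growth_ge0.
rewrite normrM ler_pM//.
  by rewrite (le_trans (dot_le _ _))// ler_wpM2r ?enorm_ge0.
case: n => [|n] /=; first by rewrite normr0 mulr_ge0// exprn_ge0// mulr_ge0.
by rewrite (le_trans (dunkl_poly_le _ _ _))// -/(cf n) ler_wpM2l.
Qed.

(** The radial equation alone implies the full system. If it holds in degree n, then n + 1 + |k|
    times the defect in degree n + 1 is a sum of reflected defects with total weight |k|; taking
    suprema over reflection-invariant balls forces the defect to vanish. *)
Lemma dunkl_op_poly n y x v : P n y x v = dot v y * dunkl_poly_pred n y x.
Proof.
elim: n x v => [|n ih] x v.
  have d0 z u : ddunkl_poly 0 y z u = 0 by rewrite /ddunkl_poly big_word0/= mulr0.
  rewrite mulr0 /P /dunkl_op d0 add0r big1// => a _.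
  by rewrite /quot !dunkl_poly0 subrr mul0r d0 !mulr0 if_same mulr0.
(* The Leibniz failure in [dunkl_op_radial] is compensated by the change of <u,y> into <sigma_b u,y>
   in the reflected defects. *)
have eqn z u : (n.+1%:R + K) * defect n.+1 y z u =
    \sum_(b <- Rp) k b * defect n.+1 y (reflection b z) (reflection b u).
  have := dunkl_op_radial n y z u; rewrite ih => /eqP.
  rewrite subr_eq => /eqP e; rewrite /defect mulrBr e.
  under [RHS]eq_bigr do rewrite mulrBr.
  rewrite [RHS]big_split/= sumrN [RHS]addrC.
  have := dunkl_poly_radial n y z => /eqP; rewrite subr_eq => /eqP e2.
  have -> : (n.+1%:R + K) * (dot u y * dunkl_poly n y z) =
    dot u y * dunkl_poly n y z + dot u y * ((n%:R + K) * dunkl_poly n y z).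
    by rewrite -natr1; ring.
  rewrite e2 !mulrDr !mulr_sumr.
  set S1 := \sum_(a <- Rp) _; set S2 := \sum_(a <- Rp) _.
  set S3 := \sum_(a <- Rp) _; set S4 := \sum_(a <- Rp) _.
  suff : S1 = S3 - S4 by move=> ->; rewrite /dunkl_poly_pred; ring.
  rewrite /S1 /S3 /S4 -sumrB; apply: eq_bigr => a _.
  rewrite [reflection a u]/reflection dotBl dotZl; ring.
pose r := enorm x; pose s := enorm v.
(* Reflections preserve both balls, so each reflected defect is again at most the supremum of this
   set, which is finite by [defect_bounded]. *)
pose A := [set `|defect n.+1 y z u| | z in [set z | enorm z <= r] & u in [set u | enorm u <= s]].
have [M HM] := defect_bounded n.+1 y r s.
have supA : has_sup A.
  split; first by exists `|defect n.+1 y x v|; exists x; [exact: lexx|exists v => //; exact: lexx].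
  by exists M => _ [z zr [u us <-]]; exact: HM.
have Aub z u : enorm z <= r -> enorm u <= s -> `|defect n.+1 y z u| <= sup A.
  move=> zr us; apply: sup_upper_bound => //.
  by exists z => //; exists u.
have S0 : 0 <= sup A by rewrite (le_trans (normr_ge0 (defect n.+1 y x v)))// Aub.
have K0 := abs_mult_ge0 data.
have nK : 0 < n.+1%:R + K by rewrite ltr_pwDl.
have supAle : (n.+1%:R + K) * sup A <= K * sup A.
  rewrite -ler_pdivlMl//; apply: ge_sup; first by case: supA.
  move=> _ [z /= zr [u /= us <-]]; rewrite ler_pdivlMl// -{1}(gtr0_norm nK) -normrM eqn.
  rewrite (le_trans (ler_norm_sum _ _ _))// /abs_mult mulr_suml !big_seq.
  apply: ler_sum => b bRp; have b0 := dunkl_data_neq0 data bRp.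
  rewrite normrM (ger0_norm (dunkl_data_ge0 data bRp)) ler_wpM2l ?(dunkl_data_ge0 data)//.
  by rewrite Aub// enorm_reflection.
have supA0 : sup A <= 0.
  by move: supAle; rewrite mulrDl gerDr pmulr_rle0.
by apply/eqP; rewrite -subr_eq0 -normr_le0 (le_trans _ supA0)// Aub.
Qed.

End dunkl_poly.

(** * Convergent numerical series *)

Section is_sum.
Context {R : realType}.
Implicit Types (u v : nat -> R).

Variant is_sum u (s : R) : Prop := IsSum of series u @ \oo --> s.

Lemma is_sumP u s : is_sum u s -> series u @ \oo --> s. Proof. by case. Qed.

Lemma is_sumD u v s t : is_sum u s -> is_sum v t -> is_sum (fun n => u n + v n) (s + t).
Proof.
move=> [us] [vt]; apply: IsSum; rewrite (_ : series _ = series u + series v); first exact: cvgD.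
by rewrite -seriesD.
Qed.

Lemma is_sumZ c u s : is_sum u s -> is_sum (fun n => c * u n) (c * s).
Proof.
move=> [us]; apply: IsSum; rewrite (_ : series _ = c *: series u); last by rewrite -seriesZ.
by apply: cvgM => //; exact: cvg_cst.
Qed.

Lemma is_sumB u v s t : is_sum u s -> is_sum v t -> is_sum (fun n => u n - v n) (s - t).
Proof.
move=> us /(is_sumZ (-1)) /(is_sumD us); rewrite mulN1r.
by under eq_fun do rewrite mulN1r.
Qed.

Lemma is_sum0 : is_sum (fun=> 0) 0.
Proof.
apply: IsSum; rewrite (_ : series _ = fun=> 0); first exact: cvg_cst.
by apply/funext => n; rewrite /series/= big1.
Qed.

Lemma is_sum_big I (r : seq I) (U : I -> nat -> R) (S : I -> R) :
  (forall i, is_sum (U i) (S i)) -> is_sum (fun n => \sum_(i <- r) U i n) (\sum_(i <- r) S i).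
Proof.
move=> US; elim: r => [|i r ih].
  by under eq_fun do rewrite big_nil; rewrite big_nil; exact: is_sum0.
by under eq_fun do rewrite big_cons; rewrite big_cons; exact: is_sumD.
Qed.

Lemma is_sum_unique u s t : is_sum u s -> is_sum u t -> s = t.
Proof. by move=> [us] [ut]; exact: cvg_unique us ut. Qed.

Lemma is_sum_shift u s : is_sum (fun n => u n.+1) s -> is_sum u (u 0 + s).
Proof.
move=> [us]; apply: IsSum; rewrite -cvg_shiftS.
rewrite (_ : (fun _ => _) = fun n => u 0 + series (fun n => u n.+1) n); last first.
  by apply/funext => n; rewrite /series/= big_nat_recl.
by apply: cvgD => //; exact: cvg_cst.
Qed.

Lemma is_sum_dom u v t : (forall n, `|u n| <= v n) -> is_sum v t ->
  is_sum u (limn (series u)).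
Proof.
move=> uv [vt]; apply: IsSum; apply: (@normed_cvg R R^o).
apply: (@series_le_cvg _ (fun n => `|u n|) v) => // [n|].
- exact: le_trans (uv n).
- exact: cvgP vt.
Qed.

Lemma is_sum_le u v s t : (forall n, `|u n| <= v n) -> is_sum u s -> is_sum v t -> `|s| <= t.
Proof.
move=> uv [us] [vt].
have us' : (fun n => `|series u n|) @ \oo --> `|s| by exact: cvg_norm.
rewrite -(cvg_lim _ us')// -(cvg_lim _ vt)//.
apply: ler_lim; [exact: cvgP us'|exact: cvgP vt|].
near=> n; rewrite (le_trans (ler_norm_sum _ _ _))//.
by apply: ler_sum => i _.
Unshelve. all: by end_near. Qed.

Lemma is_sum_exp (z : R) : is_sum (fun n => z ^+ n / n`!%:R) (expR z).
Proof. by apply: IsSum; exact: is_cvg_series_exp_coeff. Qed.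

Lemma is_sum_tail u s N : is_sum u s ->
  is_sum (fun n => if (n < N)%N then 0 else u n) (s - series u N).
Proof.
move=> us; pose head n : R := if (n < N)%N then u n else 0.
have hs : is_sum head (series u N).
  apply: IsSum; apply/cvgrPdist_le => e e0; near=> m; rewrite (_ : _ - _ = 0) ?normr0 ?ltW//.
  have Nm : (N <= m)%N by near: m; exact: nbhs_infty_ge.
  rewrite /series/= [X in _ - X](@big_cat_nat _ _ _ N 0 m)//= [X in _ - (_ + X)]big1_seq ?addr0.
    apply/eqP; rewrite subr_eq0; apply/eqP.
    by apply: eq_big_nat => i /andP[_ iN]; rewrite /head iN.
  by move=> i; rewrite mem_index_iota => /andP[_ /andP[Ni _]]; rewrite /head ltnNge Ni.
have := is_sumB us hs; congr (is_sum _ _); apply/funext => n.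
by rewrite /head; case: ifP; rewrite ?subrr ?subr0.
Unshelve. all: by end_near. Qed.

(** Weierstrass test with a majorant valid only near [t]: the series is cut at an index where the
    tail of the majorant is below e / 3, and both tails of the sum are controlled by it. *)
Lemma is_sum_continuous_at (T : topologicalType) (u : nat -> T -> R) (S : T -> R) (v : nat -> R)
    V (t : T) : (forall n, {for t, continuous (u n)}) ->
  (\forall t' \near t, forall n, `|u n t'| <= v n) -> is_sum v V ->
  (forall t', is_sum (fun n => u n t') (S t')) -> {for t, continuous S}.
Proof.
move=> cu uv vV uS; apply/cvgrPdist_le => e e0.
have e3 : 0 < e / 3 by rewrite divr_gt0.
have [N NV] : exists N, V - series v N <= e / 3.
  have /cvgrPdist_le/(_ _ e3) [N _ /(_ N (leqnn N))] := is_sumP vV.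
  by move=> h; exists N; exact: le_trans (ler_norm _) h.
have cP : series (u^~ t') N @[t' --> t] --> series (u^~ t) N.
  rewrite /series/=; elim: (index_iota 0 N) => [|n s ih].
    by under eq_fun do rewrite big_nil; rewrite big_nil; exact: cvg_cst.
  under eq_fun do rewrite big_cons; rewrite big_cons.
  by apply: cvgD => //; exact: cu.
have tail t' : (forall n, `|u n t'| <= v n) -> `|S t' - series (u^~ t') N| <= e / 3.
  move=> h; apply: le_trans NV.
  apply: is_sum_le (is_sum_tail N (uS t')) (is_sum_tail N vV) => n.
  by case: ifP => _; rewrite ?normr0.
near=> t'.
have h1 : `|S t - series (u^~ t) N| <= e / 3 by apply: tail; exact: nbhs_singleton uv.
have h2 : `|S t' - series (u^~ t') N| <= e / 3 by apply: tail; near: t'.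
have h3 : `|series (u^~ t) N - series (u^~ t') N| <= e / 3.
  by near: t'; move/cvgrPdist_le : cP => /(_ _ e3).
rewrite (_ : S t - S t' = (S t - series (u^~ t) N) + (series (u^~ t) N - series (u^~ t') N) -
  (S t' - series (u^~ t') N)); last by ring.
rewrite (le_trans (ler_normB _ _))// (le_trans (lerD (ler_normD _ _) (lexx _)))//.
lra.
Unshelve. all: by end_near. Qed.

End is_sum.

(** * Summation of the components with bounded weights *)

Section dunkl_series.
Context {R : realType} {d : nat} {Rp : {fset 'rV[R]_d}} {k : 'rV[R]_d -> R}.
Variable data : dunkl_data Rp k.
Implicit Types (x y h a v : 'rV[R]_d).
Notation dpoly := (@dunkl_poly R d Rp k).
Notation ddpoly := (@ddunkl_poly R d Rp k).

(** The weights [eps] let one series serve for the real and for the imaginary part of the kernel,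
    where they are those of i^n. A Dunkl operator lowers the degree by one, hence acts by shifting
    [eps]. *)
Definition dunkl_series (eps : nat -> R) y x : R := limn (series (fun n => eps n * dpoly n y x)).

Definition ddunkl_series (eps : nat -> R) y x h : R :=
  limn (series (fun n => eps n * ddpoly n y x h)).

Variable eps : nat -> R.
Hypothesis eps1 : forall n, `|eps n| <= 1.

Let eps_le n (p M : R) : `|p| <= M -> `|eps n * p| <= M.
Proof. by move=> pM; rewrite normrM (le_trans _ pM)// ler_piMl. Qed.

Let fact_term (A B : R) n : A ^+ n / n`!%:R * B ^+ n = (A * B) ^+ n / n`!%:R.
Proof. by rewrite exprMn; ring. Qed.

Lemma dunkl_series_sum y x : is_sum (fun n => eps n * dpoly n y x) (dunkl_series eps y x).
Proof.
apply: is_sum_dom (is_sum_exp (enorm y * l1norm x)) => n; apply: eps_le.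
by rewrite -fact_term dunkl_poly_le.
Qed.

Let bernoulli (X H : R) n : 0 <= X -> 0 <= H -> n%:R * X ^+ n.-1 * H <= (X + H) ^+ n.
Proof.
move=> X0 H0; elim: n => [|n ih]; first by rewrite !mul0r expr0.
have p0 : 0 <= (X + H) ^+ n by rewrite exprn_ge0// addr_ge0.
have q : X ^+ n <= (X + H) ^+ n by rewrite lerXn2r ?nnegrE ?addr_ge0// lerDl.
have := ler_wpM2l X0 ih; have := ler_wpM2l H0 q.
case: n {ih q p0} => [|n] /=; first by rewrite !expr0 !expr1; lra.
by rewrite (exprS (X + H) n.+1) (exprS X n) -(natr1 n.+1); lra.
Qed.

Let ddpoly_bound n y x h : `|eps n * ddpoly n y x h| <= (enorm y * (l1norm x + l1norm h)) ^+ n / n`!%:R.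
Proof.
apply: eps_le; rewrite (le_trans (ddunkl_poly_le data _ _ _ _))// -fact_term ler_wpM2l//.
  by rewrite divr_ge0 ?exprn_ge0 ?enorm_ge0.
by rewrite bernoulli ?l1norm_ge0.
Qed.

Lemma ddunkl_series_sum y x h :
  is_sum (fun n => eps n * ddpoly n y x h) (ddunkl_series eps y x h).
Proof. by apply: is_sum_dom (is_sum_exp _) => n; exact: ddpoly_bound. Qed.

Lemma ddunkl_series_le y x h :
  `|ddunkl_series eps y x h| <= expR (enorm y * (l1norm x + l1norm h)).
Proof.
by apply: is_sum_le (ddunkl_series_sum y x h) (is_sum_exp _) => n; exact: ddpoly_bound.
Qed.

Lemma dunkl_series_second_order y x h t : `|t| <= 1 ->
  `|dunkl_series eps y (x + t *: h) - dunkl_series eps y x - t * ddunkl_series eps y x h| <=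
  expR (enorm y * (l1norm x + l1norm h)) * t ^+ 2.
Proof.
move=> t1; rewrite [leRHS]mulrC.
apply: is_sum_le (is_sumB (is_sumB (dunkl_series_sum _ _) (dunkl_series_sum _ _))
  (is_sumZ t (ddunkl_series_sum y x h))) (is_sumZ (t ^+ 2) (is_sum_exp _)) => n.
rewrite (_ : _ - _ = eps n * (dpoly n y (x + t *: h) - dpoly n y x - t * ddpoly n y x h)); last by ring.
by apply: eps_le; rewrite (le_trans (dunkl_poly_second_order data _ _ _ _ t1))// mulrCA fact_term.
Qed.

Lemma dunkl_series_expands y x h :
  expands (dunkl_series eps y) x h (ddunkl_series eps y x h).
Proof. by exists (expR (enorm y * (l1norm x + l1norm h))) => t; exact: dunkl_series_second_order. Qed.

Lemma dunkl_series0 y : dunkl_series eps y 0 = eps 0.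
Proof.
apply: is_sum_unique (dunkl_series_sum y 0) _.
rewrite -[X in is_sum _ X]addr0 -[X in X + _]mulr1 -(dunkl_poly0 (Rp := Rp) (k := k) y 0).
apply: is_sum_shift; rewrite (_ : (fun _ => _) = fun=> 0); first exact: is_sum0.
by apply/funext => n; rewrite -(scale0r 0) dunkl_polyZr exprS !mul0r mulr0.
Qed.

Lemma dunkl_series_scale r y x : dunkl_series eps (r *: y) x = dunkl_series eps y (r *: x).
Proof. by rewrite /dunkl_series; under eq_fun do rewrite dunkl_polyZ -dunkl_polyZr. Qed.

Lemma quot_series_sum y x a :
  is_sum (fun n => eps n * quot a (dpoly n y) (ddpoly n y) x)
    (quot a (dunkl_series eps y) (ddunkl_series eps y) x).
Proof.
rewrite /quot; case: ifPn => ax.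
  have := is_sumZ (2 / dot a a) (ddunkl_series_sum y x a).
  by congr (is_sum _ _); apply/funext => n; ring.
have := is_sumZ (dot a x)^-1 (is_sumB (dunkl_series_sum y x) (dunkl_series_sum y (reflection a x))).
by rewrite mulrC; congr (is_sum _ _); apply/funext => n; ring.
Qed.

Lemma quot_series_le y x a : a != 0 ->
  `|quot a (dunkl_series eps y) (ddunkl_series eps y) x| <=
  2 * l1norm a / dot a a * expR (enorm y * (refl_growth a * enorm x + 1)).
Proof.
move=> a0; apply: is_sum_le (quot_series_sum y x a) (is_sumZ _ (is_sum_exp _)) => n.
apply: eps_le; rewrite (le_trans (quot_poly_le data _ _ _ a0))// ler_wpM2l//.
  by rewrite divr_ge0 ?mulr_ge0 ?l1norm_ge0 ?dot_ge0.
rewrite -fact_term ler_wpM2l ?divr_ge0 ?exprn_ge0 ?enorm_ge0//.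
have := @bernoulli (refl_growth a * enorm x) 1 n; rewrite mulr1; apply => //.
by rewrite mulr_ge0 ?refl_growth_ge0 ?enorm_ge0.
Qed.

Lemma dunkl_op_series y x v :
  dunkl_op Rp k (dunkl_series eps y) (ddunkl_series eps y) x v =
  dot v y * dunkl_series (fun n => eps n.+1) y x.
Proof.
apply: (@is_sum_unique _ (fun n => eps n * dunkl_op Rp k (dpoly n y) (ddpoly n y) x v)).
  have := is_sumD (ddunkl_series_sum y x v)
    (is_sum_big Rp (fun a => is_sumZ (k a * dot a v) (quot_series_sum y x a))).
  congr (is_sum _ _); apply/funext => n; rewrite /dunkl_op mulrDr; congr (_ + _).
  by rewrite (@mulr_sumr _ _ Rp); apply: eq_bigr => a _; ring.
rewrite (_ : (fun _ => _) = fun n => dot v y * (eps n * dunkl_poly_pred (Rp := Rp) (k := k) n y x)); last first.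
  by apply/funext => n; rewrite dunkl_op_poly//; ring.
apply: is_sumZ; rewrite -[X in is_sum _ X]add0r -[X in X + _](mulr0 (eps 0)).
apply: (@is_sum_shift _ (fun n => eps n * dunkl_poly_pred (Rp := Rp) (k := k) n y x)).
apply: is_sum_dom (is_sum_exp (enorm y * l1norm x)) => n /=.
by rewrite normrM (le_trans (ler_piMl _ (eps1 _)))// -fact_term dunkl_poly_le.
Qed.

(** The Dunkl operator in direction v = x: the factor <a,x> cancels the denominator of each
    quotient, and only the derivative along the ray and plain differences remain. *)
Lemma dunkl_series_radial y x :
  ddunkl_series eps y x x +
    \sum_(b <- Rp) k b * (dunkl_series eps y x - dunkl_series eps y (reflection b x)) =
  dot x y * dunkl_series (fun n => eps n.+1) y x.
Proof.
rewrite -dunkl_op_series /dunkl_op; congr (_ + _); apply: eq_bigr => b _.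
rewrite -mulrA; congr (_ * _); rewrite /quot; case: ifPn => [/eqP bx|bx].
  by rewrite reflection_fixed// subrr bx mul0r.
by rewrite mulrCA mulfV// mulr1.
Qed.

Lemma measurable_dunkl_series :
  measurable_fun setT (fun p : 'rV[R]_d * 'rV[R]_d => dunkl_series eps p.2 p.1).
Proof.
apply: (@measurable_fun_cvg _ _ _ _ (fun n p => series (fun n => eps n * dpoly n p.2 p.1) n)).
  move=> m; apply: measurable_sum => n; apply: measurable_funM => //.
  apply: measurable_sum => w; apply: measurable_funM.
    by apply: (measurableT_comp (measurable_dunkl_coef _)).
  apply: (@measurableT_comp _ _ _ _ _ _ (mon w)) => //.
  elim: n w => [|n ih] w /=; first exact: measurable_cst.
  by apply: measurable_funM => //; exact: measurable_coord.
by move=> p _; exact: is_sumP (dunkl_series_sum _ _).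
Qed.

Lemma continuous_mon n (w : word d n) : continuous (@mon R d n w).
Proof.
elim: n w => [|n ih] w /=; first exact: continuous_cstr.
by apply: continuous_mulr => //; exact: continuous_coord.
Qed.

Lemma continuous_dunkl_coef n (w : word d n) :
  continuous (fun y => dunkl_coef (Rp := Rp) (k := k) y w).
Proof.
elim: n w => [|n ih] w /=; first exact: continuous_cstr.
apply: continuous_sumr => u; apply: continuous_mulr; last exact: continuous_cstr.
by apply: continuous_mulr => //; exact: continuous_coord.
Qed.

Lemma near_le_continuous (T : topologicalType) (g : T -> R) (t : T) :
  {for t, continuous g} -> \forall t' \near t, g t' <= g t + 1.
Proof.
move=> /cvgrPdist_le/(_ _ ltr01); apply: filterS => t' h.
by rewrite -lerBlDl (le_trans (ler_norm _))// distrC.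
Qed.

Lemma continuous_dunkl_series y : continuous (dunkl_series eps y).
Proof.
move=> x; pose Z := enorm y * (l1norm x + 1).
apply: (@is_sum_continuous_at _ _ _ _ (fun n => Z ^+ n / n`!%:R) (expR Z)).
- move=> n; have : continuous (fun x => eps n * dpoly n y x); last exact.
  apply: continuous_mulr; first exact: continuous_cstr.
  apply: continuous_sumr => w; apply: continuous_mulr; first exact: continuous_cstr.
  exact: continuous_mon.
- have cl : continuous (@l1norm R d).
    apply: continuous_sumr => i z.
    apply: (@continuous_comp _ R^o R^o (fun z : 'rV[R]_d => z ord0 i) Num.norm); first exact: continuous_coord.
    exact: norm_continuous.
  have := near_le_continuous (cl x); apply: filterS => x' xx' n.
  apply: eps_le; rewrite (le_trans (dunkl_poly_le data _ _ _))// fact_term.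
  rewrite ler_wpM2r ?invr_ge0// lerXn2r ?nnegrE ?mulr_ge0 ?enorm_ge0 ?l1norm_ge0//.
    by rewrite addr_ge0 ?l1norm_ge0.
  by rewrite ler_wpM2l ?enorm_ge0.
- exact: is_sum_exp.
- exact: dunkl_series_sum.
Qed.

Lemma continuous_dunkl_seriesr x : continuous (fun y => dunkl_series eps y x).
Proof.
move=> y; pose Z := (enorm y + 1) * l1norm x.
apply: (@is_sum_continuous_at _ _ _ _ (fun n => Z ^+ n / n`!%:R) (expR Z)).
- move=> n; have : continuous (fun y => eps n * dpoly n y x); last exact.
  apply: continuous_mulr; first exact: continuous_cstr.
  apply: continuous_sumr => w; apply: continuous_mulr; last exact: continuous_cstr.
  exact: continuous_dunkl_coef.
- have := near_le_continuous (@continuous_enorm R d y); apply: filterS => y' yy' n.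
  apply: eps_le; rewrite (le_trans (dunkl_poly_le data _ _ _))// fact_term.
  rewrite ler_wpM2r ?invr_ge0// lerXn2r ?nnegrE ?mulr_ge0 ?enorm_ge0 ?l1norm_ge0//.
    by rewrite addr_ge0 ?enorm_ge0.
  by rewrite ler_wpM2r ?l1norm_ge0.
- exact: is_sum_exp.
- by move=> y'; exact: dunkl_series_sum.
Qed.

(** * Real analyticity of the series *)

Section analyticity.
Variables (y x0 : 'rV[R]_d).

Fixpoint word_count n : word d n -> 'I_d -> nat :=
  if n is m.+1 then fun w i => ((i == w.1) + word_count w.2 i)%N else fun _ _ => 0%N.

Lemma word_count_le n (w : word d n) i : (word_count w i <= n)%N.
Proof.
elim: n w => [//|n ih] w /=; rewrite -add1n leq_add//.
by case: eqP.
Qed.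

Lemma mon_count n (w : word d n) x : mon w x = \prod_(i < d) x ord0 i ^+ word_count w i.
Proof.
elim: n w => [|n ih] w /=; first by rewrite big1.
rewrite ih; under [RHS]eq_bigr do rewrite exprD.
rewrite big_split/=; congr (_ * _); rewrite (bigD1 w.1)//= eqxx expr1 big1 ?mulr1// => i.
by move=> /negbTE ->.
Qed.

(** Coefficient of h^al in the expansion of [mon w (x0 + h)], a product of binomial expansions. *)
Let tc n (w : word d n) (al : 'I_d -> nat) : R :=
  \prod_(i < d) (x0 ord0 i ^+ (word_count w i - al i) *+ 'C(word_count w i, al i)).

Let tcE n (w : word d n) N h : (n < N)%N ->
  \sum_(al : {ffun 'I_d -> 'I_N}) tc w (fun i => al i) * monomial (fun i => al i) h =
  mon w (x0 + h).
Proof.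
move=> nN; rewrite mon_count.
transitivity (\prod_(i < d) \sum_(j < N)
    ((x0 ord0 i ^+ (word_count w i - j) *+ 'C(word_count w i, j)) * h ord0 i ^+ j)).
  rewrite bigA_distr_bigA; apply: eq_bigr => al _.
  by rewrite /tc /monomial -big_split.
apply: eq_bigr => i _; rewrite mxE exprDn.
have mN : (word_count w i < N)%N by rewrite (leq_ltn_trans (word_count_le _ _)).
rewrite (big_ord_widen N (fun j => x0 ord0 i ^+ (word_count w i - j) * h ord0 i ^+ j *+ 'C(word_count w i, j)))//.
rewrite [RHS]big_mkcond; apply: eq_bigr => j _; rewrite mulrnAl; case: ifP => // /negbT.
by rewrite -leqNgt => jm; rewrite bin_small.
Qed.

Let tc_le n (w : word d n) N h :
  \sum_(al : {ffun 'I_d -> 'I_N}) `|tc w (fun i => al i) * monomial (fun i => al i) h| <=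
  mon w (\row_i (`|x0 ord0 i| + `|h ord0 i|)).
Proof.
rewrite mon_count.
have -> : \sum_(al : {ffun 'I_d -> 'I_N}) `|tc w (fun i => al i) * monomial (fun i => al i) h| =
    \prod_(i < d) \sum_(j < N)
    ((`|x0 ord0 i| ^+ (word_count w i - j) *+ 'C(word_count w i, j)) * `|h ord0 i| ^+ j).
  rewrite bigA_distr_bigA; apply: eq_bigr => al _.
  rewrite /tc /monomial -big_split normr_prod; apply: eq_bigr => i _.
  by rewrite normrM normrMn !normrX.
have t0 i j : 0 <= (`|x0 ord0 i| ^+ (word_count w i - j) *+ 'C(word_count w i, j)) * `|h ord0 i| ^+ j.
  by rewrite mulr_ge0 ?mulrn_wge0.
apply: ler_prod => i _; rewrite sumr_ge0//= mxE exprDn.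
set m := word_count w i.
pose M := maxn N m.+1.
rewrite (big_ord_widen M (fun j => (`|x0 ord0 i| ^+ (m - j) *+ 'C(m, j)) * `|h ord0 i| ^+ j)) ?leq_maxl//.
rewrite (big_ord_widen M (fun j => `|x0 ord0 i| ^+ (m - j) * `|h ord0 i| ^+ j *+ 'C(m, j))) ?leq_maxr//.
rewrite [leRHS]big_mkcond [leLHS]big_mkcond; apply: ler_sum => j _; rewrite -mulrnAl.
case: ifPn => _; case: ifPn => [_|]; rewrite ?t0//.
by rewrite -leqNgt => jm; rewrite bin_small// mulr0n mul0r.
Qed.

(** Contribution of degree n to the Taylor coefficient with exponent [al] at [x0]. *)
Let bc n (al : 'I_d -> nat) : R := eps n * \sum_(w : word d n) dunkl_coef (Rp := Rp) (k := k) y w * tc w al.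

Let maj h n : R := (enorm y * \sum_i (`|x0 ord0 i| + `|h ord0 i|)) ^+ n / n`!%:R.

Let bc_le n N h :
  \sum_(al : {ffun 'I_d -> 'I_N}) `|bc n (fun i => al i) * monomial (fun i => al i) h| <= maj h n.
Proof.
apply: (@le_trans _ _ (\sum_(al : {ffun 'I_d -> 'I_N}) \sum_(w : word d n)
   enorm y ^+ n / n`!%:R * `|tc w (fun i => al i) * monomial (fun i => al i) h|)).
  apply: ler_sum => al _; rewrite /bc -mulrA normrM.
  rewrite (le_trans (ler_piMl _ (eps1 _)))// mulr_suml (le_trans (ler_norm_sum _ _ _))//.
  apply: ler_sum => w _; rewrite -mulrA normrM ler_wpM2r//.
  exact: dunkl_coef_le.
rewrite exchange_big/=; under eq_bigr do rewrite -mulr_sumr.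
rewrite -mulr_sumr /maj -fact_term ler_wpM2l ?divr_ge0 ?exprn_ge0 ?enorm_ge0//.
pose z : 'rV[R]_d := \row_i (`|x0 ord0 i| + `|h ord0 i|).
have -> : \sum_i (`|x0 ord0 i| + `|h ord0 i|) = l1norm z.
  by apply: eq_bigr => i _; rewrite mxE [RHS]ger0_norm// addr_ge0.
rewrite -sum_norm_mon; apply: ler_sum => w _.
exact: le_trans (tc_le _ _ _) (ler_norm _).
Qed.

Let bcE n N h : (n < N)%N ->
  \sum_(al : {ffun 'I_d -> 'I_N}) bc n (fun i => al i) * monomial (fun i => al i) h =
  eps n * dpoly n y (x0 + h).
Proof.
move=> nN; rewrite /bc /dunkl_poly.
under eq_bigr do rewrite -mulrA mulr_suml.
rewrite -mulr_sumr exchange_big; congr (_ * _); apply: eq_bigr => w _.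
by rewrite -(tcE _ _ nN) mulr_sumr; apply: eq_bigr => al _; ring.
Qed.

Let bc_sum al : is_sum (bc^~ al) (limn (series (bc^~ al))).
Proof.
pose N := (\max_(i < d) al i).+1.
have alN i : (al i < N)%N by rewrite ltnS (leq_bigmax i).
(* At h = (1,...,1) every monomial equals 1, so the bound on the sum over all exponents bounds each
   single coefficient. *)
apply: is_sum_dom (is_sum_exp (enorm y * \sum_i (`|x0 ord0 i| + `|(const_mx 1 : 'rV[R]_d) ord0 i|))) => n.
apply: le_trans (bc_le n N (const_mx 1)).
rewrite (bigD1 [ffun i => Ordinal (alN i)])//= -[leLHS]addr0 lerD ?sumr_ge0//.
rewrite (_ : (fun i => _) = al); last by apply/funext => i; rewrite ffunE.
by rewrite /monomial big1 ?mulr1// => i _; rewrite mxE expr1n.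
Qed.

(** Rearrangement of the sum over degrees into a sum over exponents. A cubical sum of size N
    reproduces the degrees below N exactly; in each higher degree both it and the true value are at
    most [maj], so the error is at most twice the tail of the majorant. *)
Lemma dunkl_series_analytic_at : exists c : ('I_d -> nat) -> R, forall h : 'rV[R]_d,
    let term (al : 'I_d -> nat) := c al * monomial al h in
    (exists M : R, forall n : nat,
       \sum_(al : {ffun 'I_d -> 'I_n}) `|term (fun i => al i)| <= M) /\
    (fun n : nat => \sum_(al : {ffun 'I_d -> 'I_n}) term (fun i => al i))
      @ \oo --> dunkl_series eps y (x0 + h).
Proof.
pose c al := limn (series (bc^~ al)); exists c => h term.
have tsum al : is_sum (fun n => bc n al * monomial al h) (term al).
  have := is_sumZ (monomial al h) (bc_sum al); rewrite mulrC.
  by congr (is_sum _ _); apply/funext => n; rewrite mulrC.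
have majsum : is_sum (maj h) (expR (enorm y * \sum_i (`|x0 ord0 i| + `|h ord0 i|))).
  exact: is_sum_exp.
set S := expR _ in majsum.
have maj0 n : 0 <= maj h n.
  rewrite divr_ge0// exprn_ge0// mulr_ge0 ?enorm_ge0//.
  by apply: sumr_ge0 => i _; exact: addr_ge0.
split.
  exists S => N.
  (* Multiplication by signs turns the sum of absolute values into a linear combination of
     convergent series, to which the termwise majorant applies. *)
  have := @is_sum_big _ _ (index_enum _) (fun (al : {ffun 'I_d -> 'I_N}) n =>
     Num.sg (term (fun i => al i)) * (bc n (fun i => al i) * monomial (fun i => al i) h)) _
     (fun al => is_sumZ _ (tsum _)).
  have -> : \sum_(al : {ffun 'I_d -> 'I_N}) Num.sg (term (fun i => al i)) * term (fun i => al i) =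
      \sum_(al : {ffun 'I_d -> 'I_N}) `|term (fun i => al i)|.
    by apply: eq_bigr => al _; rewrite -normrEsg.
  move=> Hs; rewrite -[leLHS]ger0_norm ?sumr_ge0//.
  apply: is_sum_le Hs majsum => n; apply: le_trans (bc_le n N h).
  rewrite (le_trans (ler_norm_sum _ _ _))//; apply: ler_sum => al _.
  by rewrite normrM ler_piMl// normr_sg; case: eqP.
pose tail N n : R := if (n < N)%N then 0 else maj h n.
have tailsum N : is_sum (tail N) (S - series (maj h) N) by exact: is_sum_tail.
have bound N : `|dunkl_series eps y (x0 + h) - \sum_(al : {ffun 'I_d -> 'I_N}) term (fun i => al i)| <=
    2 * (S - series (maj h) N).
  apply: is_sum_le (is_sumB (dunkl_series_sum y (x0 + h))
    (@is_sum_big _ _ (index_enum _) _ _ (fun al : {ffun 'I_d -> 'I_N} => tsum (fun i => al i))))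
    (is_sumZ 2 (tailsum N)) => n.
  rewrite /tail; case: ifPn => [nN|_].
    by rewrite bcE// subrr normr0 mulr0.
  rewrite mulr_natl mulr2n (le_trans (ler_normB _ _))// lerD//.
    rewrite -(bcE h (ltnSn n)) (le_trans (ler_norm_sum _ _ _))//; exact: bc_le.
  by rewrite (le_trans (ler_norm_sum _ _ _))//; exact: bc_le.
apply/cvgrPdist_le => e e0; near=> N; apply: (le_trans (bound N)).
have : `|S - series (maj h) N| <= e / 2.
  near: N; have /cvgrPdist_le := is_sumP majsum; apply; exact: divr_gt0.
by have := ler_norm (S - series (maj h) N); lra.
Unshelve. all: by end_near. Qed.

End analyticity.

Lemma dunkl_series_analytic y : real_analytic (dunkl_series eps y).
Proof.
(* The radius is arbitrary: the expansion converges for every h. *)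
move=> x0; exists 1; split=> //; have [c H] := dunkl_series_analytic_at y x0.
by exists c => h _; exact: H.
Qed.

End dunkl_series.

(** * Radial maximum principle *)

Section radial_derivative.
Context {R : realType} {d : nat}.
Implicit Types (x : 'rV[R]_d) (u v : 'rV[R]_d -> R).

(** Tends to 1 from below, so [shrink n *: x] stays in every centred ball containing x and the
    derivative along the ray has a sign at an extremum over the ball, even on its boundary. *)
Definition shrink n : R := 1 - n.+1%:R^-1.

(* the derivative at r = 1 of r |-> u (r x), along a sequence *)
Variant rad u x (l : R) : Prop :=
  Rad of (n.+1%:R * (u x - u (shrink n *: x))) @[n --> \oo] --> l.

Lemma shrink_ge0 n : 0 <= shrink n.
Proof. by rewrite subr_ge0 invf_le1// ler1n. Qed.

Lemma shrink_le1 n : shrink n <= 1.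
Proof. by rewrite gerBl invr_ge0. Qed.

Lemma cvg_shrink : shrink n @[n --> \oo] --> (1 : R).
Proof.
rewrite -[X in _ --> X]subr0; apply: cvgB; [exact: cvg_cst|exact: cvg_harmonic].
Qed.

Lemma rad_cvg u x l : rad u x l -> u (shrink n *: x) @[n --> \oo] --> u x.
Proof.
move=> [ul]; have : u x - n.+1%:R^-1 * (n.+1%:R * (u x - u (shrink n *: x))) @[n --> \oo] --> u x - 0 * l.
  by apply: cvgB; [exact: cvg_cst|apply: cvgM => //; exact: cvg_harmonic].
rewrite mul0r subr0; under eq_fun do rewrite mulKf ?pnatr_eq0// opprB addrC subrK.
exact.
Qed.

Lemma rad_cst c x : rad (fun=> c) x 0.
Proof. by constructor; under eq_fun do rewrite subrr mulr0; exact: cvg_cst. Qed.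

Lemma radD u v x l m : rad u x l -> rad v x m -> rad (fun z => u z + v z) x (l + m).
Proof.
move=> [ul] [vm]; constructor.
under eq_fun do rewrite opprD addrACA mulrDr.
exact: cvgD.
Qed.

Lemma radM u v x l m : rad u x l -> rad v x m ->
  rad (fun z => u z * v z) x (l * v x + u x * m).
Proof.
move=> ul [vm]; constructor.
rewrite (_ : (fun _ => _) = fun n => n.+1%:R * (u x - u (shrink n *: x)) * v x +
  u (shrink n *: x) * (n.+1%:R * (v x - v (shrink n *: x)))); last first.
  by apply/funext => n; ring.
apply: cvgD; last by apply: cvgM => //; exact: rad_cvg ul.
by case: ul => ul; apply: cvgM => //; exact: cvg_cst.
Qed.

Lemma radZ c u x l : rad u x l -> rad (fun z => c * u z) x (c * l).
Proof. by move=> /(radM (rad_cst c x)); rewrite mul0r add0r. Qed.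

Lemma radB u v x l m : rad u x l -> rad v x m -> rad (fun z => u z - v z) x (l - m).
Proof.
move=> ul /(radZ (-1)) /(radD ul); rewrite mulN1r.
by under eq_fun do rewrite mulN1r.
Qed.

Lemma rad_ge0 u x l : (forall n, u (shrink n *: x) <= u x) -> rad u x l -> 0 <= l.
Proof.
move=> ux [ul]; rewrite -(cvg_lim _ ul)//.
apply: limr_ge; first exact: cvgP ul.
by apply: nearW => n; rewrite mulr_ge0// subr_ge0.
Qed.

Lemma rad_is_derive u x l : is_derive x x u l -> rad u x l.
Proof.
move=> [ud <-]; constructor.
have /cvgr_dnbhsP/(_ (fun n => - n.+1%:R^-1)) H :
  t^-1 * (u (t *: x + x) - u x) @[t --> (0 : R)^'] --> 'D_x u x by exact: ud.
rewrite (_ : (fun _ => _) = fun n => (- n.+1%:R^-1)^-1 * (u (- n.+1%:R^-1 *: x + x) - u x)).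
  apply: H; split=> [n|]; first by rewrite oppr_eq0 invr_eq0 pnatr_eq0.
  by rewrite -oppr0; apply: cvgN; exact: cvg_harmonic.
apply/funext => n; rewrite invrN invrK mulNr -mulrN opprB.
congr (_ * (_ - u _)).
by rewrite /shrink scalerBl scale1r addrC scaleNr.
Qed.

Lemma rad_dotxx x : rad (fun z => dot z z) x (2 * dot x x).
Proof.
constructor.
have : (1 + shrink n) * dot x x @[n --> \oo] --> (1 + 1) * dot x x.
  apply: cvgM; last exact: cvg_cst.
  by apply: cvgD; [exact: cvg_cst|exact: cvg_shrink].
rewrite (_ : 1 + 1 = 2 :> R)// (_ : (fun _ => _) =
  fun n => n.+1%:R * (dot x x - dot (shrink n *: x) (shrink n *: x)))//.
apply/funext => n; rewrite dotZl dotZr /shrink.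
have n0 : n.+1%:R != 0 :> R by rewrite pnatr_eq0.
by move: (n.+1%:R : R) n0 => N N0; field.
Qed.

(** The Euclidean norm is not differentiable at 0, but on rays it is linear, so the derivative along
    the ray exists at every point. *)
Lemma rad_exp_enorm (M : R) x : rad (fun z => expR (- (M * enorm z))) x
  (- (M * enorm x) * expR (- (M * enorm x))).
Proof.
pose c := - (M * enorm x).
have ce z : 0 <= z -> - (M * enorm (z *: x)) = c * z.
  by move=> z0; rewrite enormZ ger0_norm// /c; ring.
constructor.
have d1 : is_derive (1 : R) 1 (fun s : R => expR (c * s)) (c * expR c).
  apply: is_derive_eq; by rewrite /GRing.scale/= !mulr1 mulrC.
case: d1 => ud dE.
have /cvgr_dnbhsP/(_ (fun n => - n.+1%:R^-1)) H :
  t^-1 * (expR (c * (t *: 1 + 1)) - expR (c * 1)) @[t --> (0 : R)^'] --> c * expR c.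
  by rewrite -dE; exact: ud.
rewrite (_ : (fun _ => _) = fun n => (- n.+1%:R^-1)^-1 *
  (expR (c * (- n.+1%:R^-1 *: 1 + 1)) - expR (c * 1))).
  apply: H; split=> [n|]; first by rewrite oppr_eq0 invr_eq0 pnatr_eq0.
  by rewrite -oppr0; apply: cvgN; exact: cvg_harmonic.
apply/funext => n; rewrite invrN invrK mulNr -mulrN opprB mulr1 ce ?shrink_ge0//.
congr (_ * (_ - expR (_ * _))); rewrite /shrink.
have -> : (- n.+1%:R^-1 : R)%:A = - n.+1%:R^-1 :> R by exact: mulr1.
exact: addrC.
Qed.

Lemma compact_ball_enorm (r : R) : compact [set x : 'rV[R]_d | enorm x <= r].
Proof.
apply: bounded_closed_compact.
  exists r; split; first exact: num_real.
  move=> M rM x /= xr; rewrite (le_trans _ (ltW rM))//.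
  have r0 : 0 <= r by exact: le_trans (enorm_ge0 x) xr.
  rewrite (_ : `|x| = mx_norm x)// mx_normrE; apply: bigmax_le => // -[i j] _ /=.
  by rewrite ord1 (le_trans (coord_le_enorm x j)).
rewrite (_ : [set x | _] = @enorm R d @^-1` [set z | z <= r])//.
apply: closed_comp; last exact: closed_le.
by move=> x _; exact: continuous_enorm.
Qed.

End radial_derivative.

Section maximum_principle.
Context {R : realType} {d : nat} {Rp : {fset 'rV[R]_d}} {k : 'rV[R]_d -> R}.
Variable data : dunkl_data Rp k.
Implicit Types (x : 'rV[R]_d) (u v c : 'rV[R]_d -> R).

Definition refl_part u x : R := \sum_(a <- Rp) k a * (u x - u (reflection a x)).

(** The function u^2 + v^2 - e'|z|^2 attains its maximum over a centred ball. At a maximum other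
    than the origin its derivative along the ray would be negative, since the reflection terms have
    a favourable sign and the last term contributes - 2e'|z|^2; hence the maximum is at 0. *)
Lemma maximum_principle u v c : continuous u -> continuous v ->
  (forall x, rad u x (- (c x * v x) - refl_part u x)) ->
  (forall x, rad v x (c x * u x - refl_part v x)) ->
  forall x, u x ^+ 2 + v x ^+ 2 <= u 0 ^+ 2 + v 0 ^+ 2.
Proof.
move=> cu cv ru rv x; apply/ler_addgt0Pr => e e0.
(* Keeps the penalty e'|x|^2 at the given point below e. *)
pose e' := e / (dot x x + 1).
have e'0 : 0 < e' by rewrite divr_gt0// ltr_wpDl ?dot_ge0.
pose phi z := u z * u z + v z * v z - e' * dot z z.
have cphi : continuous phi.
  apply: continuous_subr; first by apply: continuous_addr; exact: continuous_mulr.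
  by apply: continuous_mulr; [exact: continuous_cstr|exact: continuous_dotxx].
have cB : compact [set z : 'rV[R]_d | enorm z <= enorm x] by exact: compact_ball_enorm.
have [z0] := compact_EVT_max (ex_intro _ x (lexx _)) cB (continuous_subspaceT cphi).
rewrite inE/= => z0x zmax.
have {}zmax t : enorm t <= enorm x -> phi t <= phi z0 by move=> tx; apply: zmax; rewrite inE.
have [z00|z00] := eqVneq z0 0.
  have := zmax x (lexx _); rewrite /phi z00 dot0l mulr0 subr0 -!expr2 lerBlDr => /le_trans; apply.
  by rewrite lerD2l /e' mulrAC ler_pdivrMr ?ltr_wpDl ?dot_ge0// ler_pM2l// lerDl.
exfalso.
(* The terms with [c] describe a rotation of (u, v) and cancel in the derivative of u^2 + v^2. *)
have rphi := radB (radD (radM (ru z0) (ru z0)) (radM (rv z0) (rv z0))) (radZ e' (rad_dotxx z0)).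
have /rad_ge0/(_ rphi) : forall n, phi (shrink n *: z0) <= phi z0.
  move=> n; apply: zmax; rewrite enormZ ger0_norm ?shrink_ge0//.
  by rewrite (le_trans _ z0x)// ler_piMl ?enorm_ge0// shrink_le1.
rewrite leNgt => /negP; apply; rewrite subr_lt0.
have zz : 0 < dot z0 z0 by rewrite lt_neqAle eq_sym dot_eq0 z00 dot_ge0.
apply: (@le_lt_trans _ _ 0); last by rewrite mulr_gt0// mulr_gt0.
suff : 0 <= u z0 * refl_part u z0 + v z0 * refl_part v z0 by lra.
rewrite /refl_part (@mulr_sumr _ _ Rp) (@mulr_sumr _ _ Rp) -big_split/= big_seq.
apply: sumr_ge0 => a aRp; have a0 := dunkl_data_neq0 data aRp.
have -> : u z0 * (k a * (u z0 - u (reflection a z0))) + v z0 * (k a * (v z0 - v (reflection a z0))) =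
   k a * (u z0 * (u z0 - u (reflection a z0)) + v z0 * (v z0 - v (reflection a z0))) by ring.
rewrite mulr_ge0 ?(dunkl_data_ge0 data)//.
(* The reflected point lies in the same ball and has the same penalty, so u^2 + v^2 is no larger
   there; it remains to write 2u(u - u') = u^2 - u'^2 + (u - u')^2. *)
have := zmax (reflection a z0); rewrite enorm_reflection// => /(_ z0x).
rewrite /phi dot_reflection2//.
have := sqr_ge0 (u z0 - u (reflection a z0)); have := sqr_ge0 (v z0 - v (reflection a z0)).
by rewrite !expr2; lra.
Qed.

Lemma maximum_principle0 u : continuous u -> (forall x, rad u x (- refl_part u x)) ->
  u 0 = 0 -> forall x, u x = 0.
Proof.
move=> cu ru u0 x.
have := @maximum_principle u (fun=> 0) (fun=> 0) cu (@continuous_cstr _ _ 0).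
have r1 z : rad u z (- (0 * 0) - refl_part u z) by rewrite mul0r oppr0 add0r.
have r2 z : rad (fun=> 0) z (0 * u z - refl_part (fun=> 0) z).
  rewrite mul0r /refl_part big1 => [|a _]; last by rewrite subrr mulr0.
  by rewrite subr0; exact: rad_cst.
move=> /(_ r1 r2 x); rewrite u0 !expr0n/= !addr0 => h.
by apply/eqP; rewrite -sqrf_eq0 eq_le h sqr_ge0.
Qed.

(** After multiplication by exp(-(M + 1)|z|) the coefficient of u in the radial equation is negative
    away from 0. At a negative minimum over a ball this makes the derivative along the ray positive,
    the reflection terms helping, while minimality makes it nonpositive. *)
Lemma positivity_principle u c (M : R) : continuous u ->
  (forall x, rad u x (c x * u x - refl_part u x)) ->
  (forall x, c x <= M * enorm x) -> 0 < u 0 -> forall x, 0 <= u x.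
Proof.
move=> cu ru cM u0 x.
pose M' := M + 1; pose E (z : 'rV[R]_d) := expR (- (M' * enorm z)).
pose phi z := u z * E z.
have cphi : continuous phi.
  apply: continuous_mulr => //; apply: continuous_expr; apply: continuous_oppr.
  by apply: continuous_mulr; [exact: continuous_cstr|exact: continuous_enorm].
have cB : compact [set z : 'rV[R]_d | enorm z <= enorm x] by exact: compact_ball_enorm.
have [z0] := compact_EVT_min (ex_intro _ x (lexx _)) cB (continuous_subspaceT cphi).
rewrite inE/= => z0x zmin.
have {}zmin t : enorm t <= enorm x -> phi z0 <= phi t by move=> tx; apply: zmin; rewrite inE.
have [p0|] := leP 0 (phi z0).
  by have := le_trans p0 (zmin x (lexx _)); rewrite /phi pmulr_lge0// expR_gt0.
rewrite /phi pmulr_llt0 ?expR_gt0// => uz0; exfalso.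
have z00 : z0 != 0 by apply: contraTneq uz0 => ->; rewrite -leNgt ltW.
have rphi := radZ (-1) (radM (ru z0) (rad_exp_enorm M' z0)).
have /rad_ge0/(_ rphi) : forall n, -1 * phi (shrink n *: z0) <= -1 * phi z0.
  move=> n; rewrite !mulN1r lerN2; apply: zmin; rewrite enormZ ger0_norm ?shrink_ge0//.
  by rewrite (le_trans _ z0x)// ler_piMl ?enorm_ge0// shrink_le1.
rewrite mulN1r oppr_ge0 mulrA -mulrDl pmulr_lle0 ?expR_gt0// leNgt => /negP; apply.
have e0 : 0 < enorm z0 by rewrite lt_neqAle eq_sym enorm_eq0 z00 enorm_ge0.
have h1 : 0 < (c z0 - M' * enorm z0) * u z0.
  rewrite nmulr_rgt0// subr_lt0 (le_lt_trans (cM z0))// /M' mulrDl mul1r.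
  by rewrite ltrDl.
suff : refl_part u z0 <= 0 by lra.
rewrite /refl_part big_seq; apply: sumr_le0 => a aRp; have a0 := dunkl_data_neq0 data aRp.
rewrite mulr_ge0_le0 ?(dunkl_data_ge0 data)// subr_le0.
have := zmin (reflection a z0); rewrite enorm_reflection// => /(_ z0x).
by rewrite /phi /E enorm_reflection// ler_pM2r ?expR_gt0.
Qed.

End maximum_principle.

(** * Real and imaginary part of the Dunkl kernel *)

Section kernel.
Context {R : realType} {d : nat} {Rp : {fset 'rV[R]_d}} {k : 'rV[R]_d -> R}.
Variable data : dunkl_data Rp k.
Implicit Types (x y z h a v : 'rV[R]_d).

(* real and imaginary part of i ^ n *)
Definition re_ipow n : R := if odd n then 0 else (-1) ^+ n./2.
Definition im_ipow n : R := if odd n then (-1) ^+ n./2 else 0.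

Lemma re_ipow_le1 n : `|re_ipow n| <= 1.
Proof. by rewrite /re_ipow; case: odd; rewrite ?normr0// normrX normrN1 expr1n. Qed.

Lemma im_ipow_le1 n : `|im_ipow n| <= 1.
Proof. by rewrite /im_ipow; case: odd; rewrite ?normr0// normrX normrN1 expr1n. Qed.

Lemma re_ipowS n : re_ipow n.+1 = - im_ipow n.
Proof.
rewrite /re_ipow /im_ipow/= uphalf_half; case: (odd n) => /=; last by rewrite oppr0.
by rewrite add1n exprS mulN1r.
Qed.

Lemma im_ipowS n : im_ipow n.+1 = re_ipow n.
Proof. by rewrite /re_ipow /im_ipow/= uphalf_half; case: (odd n). Qed.

(** Together with [ksin], the analogues of cos<x,y> and sin<x,y>: the real and imaginary part of
    e_k(x,y). *)
Definition kcos x y : R := @dunkl_series R d Rp k re_ipow y x.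
Definition ksin x y : R := @dunkl_series R d Rp k im_ipow y x.

Lemma dunkl_series_reS y x : @dunkl_series R d Rp k (fun n => re_ipow n.+1) y x = - ksin x y.
Proof.
apply: is_sum_unique (dunkl_series_sum data _ y x) _ => [n|]; first exact: re_ipow_le1.
have := is_sumZ (-1) (dunkl_series_sum data im_ipow_le1 y x).
by rewrite mulN1r; congr (is_sum _ _); apply/funext => n; rewrite re_ipowS mulN1r mulNr.
Qed.

Lemma dunkl_series_imS y x : @dunkl_series R d Rp k (fun n => im_ipow n.+1) y x = kcos x y.
Proof. by congr (dunkl_series _ _ _); apply/funext => n; rewrite im_ipowS. Qed.

Definition dkcos x y h : R := @ddunkl_series R d Rp k re_ipow y x h.
Definition dksin x y h : R := @ddunkl_series R d Rp k im_ipow y x h.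

Lemma kcos_derive x y h : is_derive x h (kcos ^~ y) (dkcos x y h).
Proof. exact/expands_is_derive/(dunkl_series_expands data re_ipow_le1). Qed.

Lemma ksin_derive x y h : is_derive x h (ksin ^~ y) (dksin x y h).
Proof. exact/expands_is_derive/(dunkl_series_expands data im_ipow_le1). Qed.

Lemma dunkl_op_kcos x y v :
  dunkl_op Rp k (kcos ^~ y) (fun z => dkcos z y) x v = - (dot v y * ksin x y).
Proof. by rewrite [LHS](dunkl_op_series data re_ipow_le1) dunkl_series_reS mulrN. Qed.

Lemma dunkl_op_ksin x y v :
  dunkl_op Rp k (ksin ^~ y) (fun z => dksin z y) x v = dot v y * kcos x y.
Proof. by rewrite [LHS](dunkl_op_series data im_ipow_le1) dunkl_series_imS. Qed.

Lemma rad_kcos x y : rad (kcos ^~ y) x (- (dot x y * ksin x y) - refl_part (Rp := Rp) (k := k) (kcos ^~ y) x).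
Proof.
rewrite -mulrN -dunkl_series_reS -(dunkl_series_radial data re_ipow_le1) -/(refl_part _ _) addrK.
exact/rad_is_derive/kcos_derive.
Qed.

Lemma rad_ksin x y : rad (ksin ^~ y) x (dot x y * kcos x y - refl_part (Rp := Rp) (k := k) (ksin ^~ y) x).
Proof.
rewrite -dunkl_series_imS -(dunkl_series_radial data im_ipow_le1) -/(refl_part _ _) addrK.
exact/rad_is_derive/ksin_derive.
Qed.

Lemma kcos0l y : kcos 0 y = 1. Proof. by rewrite [LHS](dunkl_series0 data re_ipow_le1). Qed.
Lemma ksin0l y : ksin 0 y = 0. Proof. by rewrite [LHS](dunkl_series0 data im_ipow_le1). Qed.

Lemma kcosZ r x y : kcos (r *: x) y = kcos x (r *: y).
Proof. by rewrite /kcos dunkl_series_scale. Qed.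
Lemma ksinZ r x y : ksin (r *: x) y = ksin x (r *: y).
Proof. by rewrite /ksin dunkl_series_scale. Qed.

Lemma kcosNr x y : kcos x (- y) = kcos x y.
Proof.
rewrite /kcos /dunkl_series; congr (limn (series _)); apply/funext => n.
rewrite -scaleN1r dunkl_polyZ /re_ipow; case: ifPn => [|]; first by rewrite !mul0r.
by move=> /negbTE on; rewrite -[(-1) ^+ n]signr_odd on expr0 mul1r.
Qed.

Lemma ksinNr x y : ksin x (- y) = - ksin x y.
Proof.
apply: is_sum_unique (dunkl_series_sum data im_ipow_le1 (- y) x) _.
have := is_sumZ (-1) (dunkl_series_sum data im_ipow_le1 y x).
rewrite mulN1r; congr (is_sum _ _); apply/funext => n.
rewrite -(scaleN1r y) dunkl_polyZ /im_ipow; case: ifPn => [on|]; last by rewrite !mul0r mulr0.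
by rewrite -[(-1) ^+ n]signr_odd on expr1; ring.
Qed.

End kernel.

Lemma continuous_reflection {R : realType} {d : nat} (a : 'rV[R]_d) : continuous (reflection a).
Proof.
move=> x; apply: (@cvgB R 'rV[R]_d _ (nbhs x)); first exact: cvg_id.
apply: (@cvgZ R 'rV[R]_d _ (nbhs x)); last exact: cvg_cst.
have : continuous (fun z => 2 * dot a z / dot a a); last exact.
apply: continuous_mulr; last exact: continuous_cstr.
by apply: continuous_mulr; [exact: continuous_cstr|exact: continuous_dot].
Qed.

(** * Bound, uniqueness and symmetry of the kernel *)

Section kernel_properties.
Context {R : realType} {d : nat} {Rp : {fset 'rV[R]_d}} {k : 'rV[R]_d -> R}.
Variable data : dunkl_data Rp k.
Implicit Types (x y z h a : 'rV[R]_d) (u v : 'rV[R]_d -> R).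
Notation refl_part := (@refl_part R d Rp k).
Notation kcos := (@kcos R d Rp k).
Notation ksin := (@ksin R d Rp k).

Lemma continuous_kcos y : continuous (kcos ^~ y).
Proof. exact: continuous_dunkl_series data _ re_ipow_le1 y. Qed.
Lemma continuous_ksin y : continuous (ksin ^~ y).
Proof. exact: continuous_dunkl_series data _ im_ipow_le1 y. Qed.
Lemma continuous_kcosr x : continuous (kcos x).
Proof. exact: continuous_dunkl_seriesr data _ re_ipow_le1 x. Qed.
Lemma continuous_ksinr x : continuous (ksin x).
Proof. exact: continuous_dunkl_seriesr data _ im_ipow_le1 x. Qed.

Lemma measurable_kcos2 : measurable_fun setT (fun p : 'rV[R]_d * 'rV[R]_d => kcos p.1 p.2).
Proof. exact: measurable_dunkl_series data _ re_ipow_le1. Qed.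
Lemma measurable_ksin2 : measurable_fun setT (fun p : 'rV[R]_d * 'rV[R]_d => ksin p.1 p.2).
Proof. exact: measurable_dunkl_series data _ im_ipow_le1. Qed.

Lemma kernel_le1 x y : kcos x y ^+ 2 + ksin x y ^+ 2 <= 1.
Proof.
have := maximum_principle data (continuous_kcos (y := y)) (continuous_ksin (y := y))
  (fun z => rad_kcos data z y) (fun z => rad_ksin data z y) x.
by rewrite kcos0l// ksin0l// expr1n expr0n/= addr0.
Qed.

Lemma kcos_le1 x y : `|kcos x y| <= 1.
Proof.
rewrite -[leLHS]ger0_norm// -ler_sqr ?nnegrE// expr1n ger0_norm// real_normK ?num_real//.
by rewrite (le_trans _ (kernel_le1 x y))// lerDl sqr_ge0.
Qed.

Lemma ksin_le1 x y : `|ksin x y| <= 1.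
Proof.
rewrite -ler_sqr ?nnegrE// expr1n real_normK ?num_real//.
by rewrite (le_trans _ (kernel_le1 x y))// lerDr sqr_ge0.
Qed.

Lemma refl_partB u v x : refl_part (fun z => u z - v z) x = refl_part u x - refl_part v x.
Proof. by rewrite /refl_part -sumrB; apply: eq_bigr => a _; ring. Qed.

(** The difference of two solutions solves the same linear system with zero initial values, and the
    maximum principle makes it vanish. Only the radial equations are required, which is what makes
    symmetry accessible. *)
Lemma kernel_unique y (u v : 'rV[R]_d -> R) : continuous u -> continuous v ->
  (forall x, rad u x (- (dot x y * v x) - refl_part u x)) ->
  (forall x, rad v x (dot x y * u x - refl_part v x)) ->
  u 0 = 1 -> v 0 = 0 -> u = kcos ^~ y /\ v = ksin ^~ y.
Proof.
move=> cu cv ru rv u0 v0.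
have cuk := continuous_subr cu (continuous_kcos (y := y)).
have cvk := continuous_subr cv (continuous_ksin (y := y)).
have H x : (u x - kcos x y) ^+ 2 + (v x - ksin x y) ^+ 2 <= 0.
  have := @maximum_principle _ _ _ _ data _ _ (fun z => dot z y) cuk cvk.
  rewrite u0 v0 kcos0l// ksin0l// !subrr expr0n/= addr0; apply => z.
  - rewrite refl_partB mulrBr.
    rewrite (_ : _ - _ = - (dot z y * v z) - refl_part u z - (- (dot z y * ksin z y) - refl_part (kcos ^~ y) z)); last by ring.
    by apply: radB => //; exact: rad_kcos.
  - rewrite refl_partB mulrBr.
    rewrite (_ : _ - _ = dot z y * u z - refl_part v z - (dot z y * kcos z y - refl_part (ksin ^~ y) z)); last by ring.
    by apply: radB => //; exact: rad_ksin.
by split; apply/funext => x; apply/eqP; rewrite -subr_eq0 -sqrf_eq0 eq_le sqr_ge0 andbT;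
  apply: le_trans (H x); rewrite ?lerDl ?lerDr sqr_ge0.
Qed.

Lemma rad_reflection (a : 'rV[R]_d) u x l : rad u (reflection a x) l -> rad (fun z => u (reflection a z)) x l.
Proof. by move=> [ul]; constructor; under eq_fun do rewrite reflectionZ. Qed.

Lemma reflectionNa a x : reflection (- a) x = reflection a x.
Proof.
by rewrite /reflection !dotNl dotNr opprK mulrN mulNr scaleNr scalerN opprK.
Qed.

Lemma refl_part_reflection a u x : a \in Rp ->
  refl_part u (reflection a x) = refl_part (fun z => u (reflection a z)) x.
Proof.
move=> aRp; have a0 := dunkl_data_neq0 data aRp; rewrite /refl_part.
rewrite -[LHS](@dunkl_data_big _ _ _ _ data _ _ +%R (fun c b => c * (u (reflection a x) - u (reflection b (reflection a x)))) a aRp); last first.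
  by move=> c b; rewrite reflectionNa.
by apply: eq_bigr => b _; rewrite reflection_conj.
Qed.

Lemma kernel_reflection a x y : a \in Rp ->
  kcos (reflection a x) (reflection a y) = kcos x y /\
  ksin (reflection a x) (reflection a y) = ksin x y.
Proof.
move=> aRp; have a0 := dunkl_data_neq0 data aRp.
have [|||||| E1 E2] := @kernel_unique y (fun z => kcos (reflection a z) (reflection a y))
  (fun z => ksin (reflection a z) (reflection a y)).
- move=> z; apply: (@continuous_comp _ _ _ (reflection a)); last exact: continuous_kcos.
  exact: continuous_reflection.
- move=> z; apply: (@continuous_comp _ _ _ (reflection a)); last exact: continuous_ksin.
  exact: continuous_reflection.
- move=> z; apply: rad_reflection; rewrite -(dot_reflection2 _ _ a0) -refl_part_reflection//.
  exact: rad_kcos.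
- move=> z; apply: rad_reflection; rewrite -(dot_reflection2 _ _ a0) -refl_part_reflection//.
  exact: rad_ksin.
- by rewrite reflection0 kcos0l.
- by rewrite reflection0 ksin0l.
by split; [exact: (congr1 (@^~ x) E1)|exact: (congr1 (@^~ x) E2)].
Qed.

(** As a function of its second argument the kernel solves the radial system as well: scaling one
    argument equals scaling the other, and a reflection can be moved across by [kernel_reflection].
    Uniqueness then exchanges the arguments. *)
Lemma kernel_sym x y : kcos x y = kcos y x /\ ksin x y = ksin y x.
Proof.
have refll a z : a \in Rp -> kcos (reflection a y) z = kcos y (reflection a z) /\
    ksin (reflection a y) z = ksin y (reflection a z).
  move=> aRp; have [<- <-] := kernel_reflection y (reflection a z) aRp.
  by rewrite reflectionK// (dunkl_data_neq0 data aRp).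
have [|||||| E1 E2] := @kernel_unique y (kcos y) (ksin y).
- exact: continuous_kcosr.
- exact: continuous_ksinr.
- move=> z; have [H] := rad_kcos data y z; constructor; rewrite dotC.
  rewrite (_ : refl_part _ _ = refl_part (kcos ^~ z) y); last first.
    by rewrite /refl_part; apply: eq_big_seq => a aRp; rewrite (refll _ _ aRp).1.
  by move: H; under eq_fun do rewrite kcosZ.
- move=> z; have [H] := rad_ksin data y z; constructor; rewrite dotC.
  rewrite (_ : refl_part _ _ = refl_part (ksin ^~ z) y); last first.
    by rewrite /refl_part; apply: eq_big_seq => a aRp; rewrite (refll _ _ aRp).2.
  by move: H; under eq_fun do rewrite ksinZ.
- by rewrite -(scale0r y) -kcosZ scale0r kcos0l.
- by rewrite -(scale0r y) -ksinZ scale0r ksin0l.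
by split; [rewrite E1|rewrite E2].
Qed.

Lemma kcosC x y : kcos x y = kcos y x. Proof. by have [] := kernel_sym x y. Qed.
Lemma ksinC x y : ksin x y = ksin y x. Proof. by have [] := kernel_sym x y. Qed.

End kernel_properties.

(** * First order Taylor expansion of real analytic functions *)

Section analytic_derivative.
Context {R : realType} {d : nat}.
Implicit Types (x h : 'rV[R]_d).

(** Cubical sums of size at least 2 are used, so that the exponent 1 is available in every
    coordinate. *)
Let unit_idx n (j i : 'I_d) : 'I_n.+2 := if i == j then inord 1 else ord0.

(** If every coordinate of h is at most t s, a term of total degree at least 2 is at most t^2 times
    the absolute value of the same term at s (1,...,1), where the power series converges
    absolutely. *)
Lemma real_analytic_quadratic (g : 'rV[R]_d -> R) x : real_analytic g ->
  exists L : 'I_d -> R, exists M s : R, [/\ 0 < s, 0 <= M & forall h t, 0 <= t <= 1 ->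
    (forall i, `|h ord0 i| <= t * s) ->
    `|g (x + h) - g x - \sum_j h ord0 j * L j| <= M * t ^+ 2].
Proof.
move=> /(_ x)[r [r0 [c H]]].
pose one : 'rV[R]_d := const_mx 1.
(* Small enough for s (1,...,1) to lie in the ball where the expansion holds. *)
pose s := r / (enorm one + 1).
have e1 : 0 < enorm one + 1 by rewrite ltr_wpDl ?enorm_ge0.
have s0 : 0 < s by rewrite divr_gt0.
have so : enorm (s *: one) < r.
  by rewrite enormZ gtr0_norm// /s mulrAC ltr_pdivrMr// mulrDr mulr1 ltrDl.
have [[M HM] _] := H _ so.
have M0 : 0 <= M by apply: le_trans (HM 0%N); apply: sumr_ge0.
pose L j := c (fun i => (i == j) : nat).
exists L, M, s; split=> // h t /andP[t0 t1] hts.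
have hr : enorm h < r.
  apply: le_lt_trans so; rewrite /enorm ler_sqrt ?dot_ge0// /dot; apply: ler_sum => i _.
  rewrite !mxE mulr1 -!expr2 -[leLHS]real_normK ?num_real// lerXn2r ?nnegrE ?(ltW s0)//.
  by rewrite (le_trans (hts i))// ler_piMl// ltW.
have [_ Hh] := H _ hr.
have c0 : c (fun=> 0%N) = g x.
  have n0 : enorm (0 : 'rV[R]_d) < r by rewrite enorm0.
  have [_ ] := H _ n0; rewrite addr0 => H0.
  rewrite -(cvg_lim _ H0)//; apply/esym/cvg_lim => //; rewrite -cvg_shiftS.
  rewrite (_ : (fun _ => _) = fun=> c (fun=> 0%N)); first exact: cvg_cst.
  apply/funext => n /=; rewrite (bigD1 [ffun=> ord0])//= big1 ?addr0 => [|al].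
    rewrite /monomial big1 ?mulr1 => [|i _]; last by rewrite ffunE.
    by congr c; apply/funext => i; rewrite ffunE.
  move=> al0; rewrite /monomial; have [i ai] : exists i, al i != ord0.
    apply/existsP; apply: contraNT al0 => /existsPn a0; apply/eqP/ffunP => i.
    by rewrite ffunE; apply/eqP; move/negPn: (a0 i).
  rewrite (bigD1 i)//= mxE expr0n -[(al i : nat) == 0%N]/(al i == ord0) (negbTE ai).
  by rewrite mul0r mulr0.
(* Each term of the power series minus the part it contributes to the value and to the linear form,
   so that only total degrees at least 2 survive. *)
pose T n (al : {ffun 'I_d -> 'I_n.+2}) : R :=
  c (fun i => al i) * monomial (fun i => al i) h -
  (if al == [ffun=> ord0] then g x else 0) -
  \sum_j (if al == [ffun i => unit_idx n j i] then h ord0 j * L j else 0).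
have sT n : \sum_al T n al = \sum_(al : {ffun 'I_d -> 'I_n.+2})
     c (fun i => al i) * monomial (fun i => al i) h - g x - \sum_j h ord0 j * L j.
  rewrite /T !sumrB -!big_mkcond/= big_pred1_eq; congr (_ - _).
  by rewrite exchange_big/=; apply: eq_bigr => j _; rewrite -big_mkcond/= big_pred1_eq.
have idxE n (j i : 'I_d) : (unit_idx n j i : nat) = (i == j).
  by rewrite /unit_idx; case: eqP => _ //=; rewrite inordK.
have bT n al : `|T n al| <= t ^+ 2 * `|c (fun i => al i) * monomial (fun i => al i) (s *: one)|.
  have rhs0 : 0 <= t ^+ 2 * `|c (fun i => al i) * monomial (fun i => al i) (s *: one)|.
    by rewrite mulr_ge0 ?sqr_ge0.
  have unit_neq0 (j : 'I_d) : ([ffun=> ord0] : {ffun 'I_d -> 'I_n.+2}) != [ffun i => unit_idx n j i].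
    apply/eqP => /ffunP /(_ j); rewrite !ffunE => /(congr1 val) /=.
    by rewrite idxE eqxx.
  have [al0|al0] := eqVneq al [ffun=> ord0].
    rewrite (_ : T n al = 0) ?normr0// /T al0 eqxx big1 ?subr0.
      rewrite /monomial big1 ?mulr1 => [|i _]; last by rewrite ffunE.
      rewrite (_ : (fun i => _) = (fun=> 0%N)) ?c0 ?subrr//.
      by apply/funext => i; rewrite ffunE.
    by move=> j _; rewrite (negbTE (unit_neq0 j)).
  have [i ai] : exists i, al i != ord0.
    apply/existsP; apply: contraNT al0 => /existsPn a0; apply/eqP/ffunP => i.
    by rewrite ffunE; apply/eqP; move/negPn: (a0 i).
  have [j aj|nj] := pickP (fun j => al == [ffun i => unit_idx n j i]).
    have alE i' : (al i' : nat) = (i' == j) by rewrite (eqP aj) ffunE idxE.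
    rewrite (_ : T n al = 0) ?normr0// /T (negbTE al0) subr0 (bigD1 j)//= aj big1 ?addr0.
      rewrite /monomial (bigD1 j)//= alE eqxx expr1 big1 ?mulr1.
        by rewrite /L mulrC (_ : (fun i => _) = (fun i => (i == j) : nat)) ?subrr//; apply/funext => i'.
      by move=> i' /negbTE ij; rewrite alE ij.
    move=> j' jj'; rewrite (eqP aj); case: eqP => // /ffunP/(_ j); rewrite !ffunE => /(congr1 val)/=.
    by rewrite !idxE eqxx eq_sym (negbTE jj').
  (* An exponent that is neither zero nor a unit vector: either one entry is at least 2, or it is 1
     and a second entry is nonzero. *)
  have deg2 : (2 <= \sum_i al i)%N.
    rewrite (bigD1 i)//=.
    have i1 : (0 < al i)%N by rewrite lt0n.
    have := nj i => /negbT /eqP nji.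
    have [ai2|ai2] := leqP 2 (al i); first by rewrite (leq_trans ai2) ?leq_addr.
    have {}ai2 : (al i : nat) = 1%N by apply/eqP; rewrite eqn_leq -ltnS ai2 i1.
    rewrite ai2 add1n ltnS lt0n; apply/eqP => s00; apply: nji; apply/ffunP => i'.
    rewrite ffunE; apply: val_inj; rewrite /= idxE; case: eqP => [->|/eqP ii'] //.
    by move/eqP: s00; rewrite sum_nat_eq0 => /forallP/(_ i')/implyP/(_ ii')/eqP.
  rewrite /T (negbTE al0) subr0 big1 ?subr0 => [|j _]; last by rewrite nj.
  rewrite !normrM mulrCA ler_wpM2l// /monomial !normr_prod.
  apply: (@le_trans _ _ (\prod_i (t ^+ al i * s ^+ al i))).
    apply: ler_prod => i' _; rewrite normr_ge0 normrX -exprMn/=.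
    have ts0 : 0 <= t * s by rewrite mulr_ge0// ltW.
    exact: lerXn2r.
  rewrite big_split/= prodrXr ler_pM//.
  - by rewrite exprn_ge0.
  - by apply: prodr_ge0 => i' _; rewrite exprn_ge0// ltW.
  - by rewrite ler_wiXn2l.
  apply: ler_prod => i' _; rewrite !mxE mulr1 ger0_norm ?exprn_ge0 ?(ltW s0)//=.
have Hh' : (fun n => \sum_al T n al) @ \oo --> g (x + h) - g x - \sum_j h ord0 j * L j.
  under eq_fun do rewrite sT.
  apply: cvgB; last exact: cvg_cst.
  apply: cvgB; last exact: cvg_cst.
  by move: Hh; rewrite -(cvg_shiftn 2); under eq_fun do rewrite addn2.
have {}Hh' : (fun n => `|\sum_al T n al|) @ \oo --> `|g (x + h) - g x - \sum_j h ord0 j * L j| by exact: cvg_norm.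
rewrite -(cvg_lim _ Hh')//; apply: limr_le; first exact: cvgP Hh'.
apply: nearW => n; rewrite (le_trans (ler_norm_sum _ _ _))// (le_trans (ler_sum _ (fun al _ => bT n al)))//.
rewrite -mulr_sumr mulrC ler_wpM2r ?sqr_ge0//; exact: (HM n.+2).
Qed.

Lemma real_analytic_derive (g : 'rV[R]_d -> R) x : real_analytic g ->
  exists L : 'I_d -> R, forall h, is_derive x h g (\sum_j h ord0 j * L j).
Proof.
move=> ga; have [L [M [s [s0 M0 H]]]] := real_analytic_quadratic x ga; exists L => h.
(* With this C, t h satisfies the coordinate bound of the quadratic estimate for the parameter |t|
   C, which is at most 1 when |t| <= 1 / C. *)
pose C := enorm h / s + 1.
have C0 : 0 < C by rewrite ltr_wpDl// divr_ge0 ?enorm_ge0 ?ltW.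
apply: (@quadratic_is_derive _ _ _ _ _ _ (M * C ^+ 2) (C^-1)); first by rewrite invr_gt0.
move=> t tC.
have := H (t *: h) (`|t| * C).
have tC1 : `|t| * C <= 1 by rewrite -ler_pdivlMr// div1r.
rewrite mulr_ge0 ?tC1 ?(ltW C0)// => /(_ isT).
rewrite exprMn real_normK ?num_real// (_ : \sum_j _ = t * \sum_j h ord0 j * L j); last first.
  by rewrite mulr_sumr; apply: eq_bigr => j _; rewrite mxE mulrA.
move=> /(_ _)/le_trans; apply; last by rewrite le_eqVlt; apply/orP; left; apply/eqP; ring.
move=> i; rewrite mxE normrM -mulrA ler_wpM2l// (le_trans (coord_le_enorm h i))//.
by rewrite /C mulrDl divfK ?gt_eqF// mul1r lerDl ltW.
Qed.

Lemma real_analytic_continuous (g : 'rV[R]_d -> R) : real_analytic g -> continuous g.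
Proof.
move=> ga x; have [L [M [s [s0 M0 H]]]] := real_analytic_quadratic x ga.
apply/(@cvgrPdist_le R R^o _ (nbhs x)) => e e0.
pose B := \sum_j s * `|L j| + M + 1.
have B0 : 0 < B by rewrite ltr_wpDl// addr_ge0// sumr_ge0// => j _; rewrite mulr_ge0// ltW.
pose t := Num.min 1 (e / B).
have t0 : 0 < t by rewrite lt_min ltr01 divr_gt0.
have t1 : t <= 1 by rewrite ge_min lexx.
have tB : t * B <= e by rewrite -ler_pdivlMr// ge_min lexx orbT.
have : \forall x' \near x, `|x - x'| < t * s.
  apply: (@cvgr_dist_lt R 'rV[R]_d _ (nbhs x) _ id x); first exact: cvg_id.
  by rewrite mulr_gt0.
apply: filterS => x' xx'.
have hb i : `|(x' - x) ord0 i| <= t * s.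
  rewrite distrC in xx'; apply: le_trans (ltW xx').
  by rewrite (_ : `|x' - x| = mx_norm (x' - x))// mx_normrE; exact: (@le_bigmax _ _ _ _ (fun i : 'I_1 * 'I_d => `|(x' - x) i.1 i.2|) (ord0, i)).
have := H (x' - x) t; rewrite t1 ltW// => /(_ isT hb).
rewrite (_ : x + (x' - x) = x') => [h1|]; last by rewrite addrC subrK.
have h2 : `|\sum_j (x' - x) ord0 j * L j| <= t * \sum_j s * `|L j|.
  rewrite (le_trans (ler_norm_sum _ _ _))// mulr_sumr; apply: ler_sum => j _.
  by rewrite normrM mulrA ler_wpM2r.
rewrite distrC (_ : g x' - g x = (g x' - g x - \sum_j (x' - x) ord0 j * L j) + \sum_j (x' - x) ord0 j * L j); last by ring.
rewrite (le_trans (ler_normD _ _))// (le_trans (lerD h1 h2))//.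
apply: le_trans tB; rewrite /B.
have : M * t ^+ 2 <= M * t by rewrite ler_wpM2l// expr2 ler_piMl// ltW.
by lra.
Qed.

End analytic_derivative.

(** * Identification with the kernel of the definitions *)

Section dunkl_kernel.
Context {R : realType} {d : nat} {Rp : {fset 'rV[R]_d}} {k : 'rV[R]_d -> R}.
Variable data : dunkl_data Rp k.
Implicit Types (x y z h a : 'rV[R]_d).
Notation refl_part := (@refl_part R d Rp k).
Notation kcos := (@kcos R d Rp k).
Notation ksin := (@ksin R d Rp k).

Definition kexp y x : R[i] := Complex (kcos x y) (ksin x y).

Lemma Re_sum I (s : seq I) (F : I -> R[i]) :
  complex.Re (\sum_(i <- s) F i) = \sum_(i <- s) complex.Re (F i).
Proof. by elim/big_rec2: _ => // i x y _ <-; case: (F i) y => [? ?] []. Qed.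

Lemma Im_sum I (s : seq I) (F : I -> R[i]) :
  complex.Im (\sum_(i <- s) F i) = \sum_(i <- s) complex.Im (F i).
Proof. by elim/big_rec2: _ => // i x y _ <-; case: (F i) y => [? ?] []. Qed.

Lemma Re_scale (c : R) (z : R[i]) : complex.Re (c%:C%C * z) = c * complex.Re z.
Proof. by case: z => u v /=; rewrite mul0r subr0. Qed.

Lemma Im_scale (c : R) (z : R[i]) : complex.Im (c%:C%C * z) = c * complex.Im z.
Proof. by case: z => u v /=; rewrite mul0r addr0. Qed.

Lemma divrC_complex (c : R) (z : R[i]) : z / c%:C%C = (c^-1)%:C%C * z.
Proof. by rewrite mulrC (fmorphV (real_complex R)). Qed.

Lemma dunkl_operator_ReIm (u v : 'rV[R]_d -> R) (du dv : 'rV[R]_d -> 'rV[R]_d -> R) j x :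
  (forall h, is_derive x h u (du x h)) -> (forall h, is_derive x h v (dv x h)) ->
  dunkl_operator Rp k j (fun z => Complex (u z) (v z)) x =
  Complex (dunkl_op Rp k u du x (unit_vec R j)) (dunkl_op Rp k v dv x (unit_vec R j)).
Proof.
move=> ud vd.
have cd h : cderive h (fun z => Complex (u z) (v z)) x = Complex (du x h) (dv x h).
  by rewrite /cderive/= (@derive_val _ _ _ _ _ _ _ (ud h)) (@derive_val _ _ _ _ _ _ _ (vd h)).
have qE a : dunkl_quotient a (fun z => Complex (u z) (v z)) x = Complex (quot a u du x) (quot a v dv x).
  rewrite /dunkl_quotient /quot; case: ifP => _.
    rewrite cd; apply/eqP; rewrite eq_complex Re_scale Im_scale/= !eqxx//.
  by rewrite divrC_complex; apply/eqP; rewrite eq_complex Re_scale Im_scale/=; apply/andP; split;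
    apply/eqP; rewrite mulrC.
rewrite /dunkl_operator cd; apply/eqP; rewrite eq_complex; apply/andP; split; apply/eqP.
  rewrite [LHS]/= -/(complex.Re _).
  transitivity (du x (unit_vec R j) + complex.Re (\sum_(a <- Rp) (k a * dot a (unit_vec R j))%:C%C * dunkl_quotient a (fun z => Complex (u z) (v z)) x)).
    by case: (\sum_(_ <- _) _).
  by rewrite Re_sum /=; congr (_ + _); apply: eq_bigr => a _; rewrite Re_scale qE.
transitivity (dv x (unit_vec R j) + complex.Im (\sum_(a <- Rp) (k a * dot a (unit_vec R j))%:C%C * dunkl_quotient a (fun z => Complex (u z) (v z)) x)).
  by case: (\sum_(_ <- _) _).
by rewrite Im_sum /=; congr (_ + _); apply: eq_bigr => a _; rewrite Im_scale qE.
Qed.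

Lemma is_dunkl_kernel_kexp y : is_dunkl_kernel Rp k y (kexp y).
Proof.
split.
- exact: (dunkl_series_analytic data re_ipow_le1 y).
- exact: (dunkl_series_analytic data im_ipow_le1 y).
- move=> j x.
  have -> := @dunkl_operator_ReIm (kcos ^~ y) (ksin ^~ y) (fun z => dkcos (Rp := Rp) (k := k) z y)
    (fun z => dksin (Rp := Rp) (k := k) z y) j x (kcos_derive data x y) (ksin_derive data x y).
  rewrite dunkl_op_kcos// dunkl_op_ksin// dotC dot_unit_vec.
  by apply/eqP; rewrite eq_complex/=; apply/andP; split; apply/eqP; ring.
- by rewrite /kexp kcos0l// ksin0l.
Qed.

(** Contraction of the Dunkl equations with the coordinates of x, which requires the derivative to
    be linear in the direction. *)
Lemma radial_of_dunkl_op (u : 'rV[R]_d -> R) (du : 'rV[R]_d -> 'rV[R]_d -> R) (w : R) x y :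
  (forall h, du x h = \sum_j h ord0 j * du x (unit_vec R j)) ->
  (forall j, dunkl_op Rp k u du x (unit_vec R j) = y ord0 j * w) ->
  du x x = dot x y * w - refl_part u x.
Proof.
move=> dux D.
have : \sum_j x ord0 j * dunkl_op Rp k u du x (unit_vec R j) = dot x y * w.
  by rewrite /dot mulr_suml; apply: eq_bigr => j _; rewrite D mulrA.
move=> <-; rewrite /dunkl_op; under eq_bigr do rewrite mulrDr.
rewrite big_split/= -dux -addrA; apply/eqP; rewrite -subr_eq0 opprD addNKr oppr_eq0 subr_eq0; apply/eqP.
under eq_bigr do rewrite (@mulr_sumr _ _ Rp).
rewrite exchange_big/=; apply: eq_bigr => a _.
rewrite (eq_bigr (fun j => (x ord0 j * dot a (unit_vec R j)) * (k a * quot a u du x))); last by move=> j _; ring.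
rewrite -mulr_suml (_ : \sum_j _ = dot a x); last first.
  by rewrite /dot; apply: eq_bigr => j _; rewrite -/(dot a _) dot_unit_vec mulrC.
rewrite /quot; case: ifPn => [/eqP ax|ax].
  by rewrite ax mul0r reflection_fixed// subrr mulr0.
by field.
Qed.

(** Analyticity supplies continuity and a linear differential; the contracted equations are those of
    [kernel_unique]. *)
Lemma is_dunkl_kernel_unique y f : is_dunkl_kernel Rp k y f -> f = kexp y.
Proof.
move=> [fr fi fD f0].
pose u x := complex.Re (f x); pose v x := complex.Im (f x).
have fE : f = fun z => Complex (u z) (v z) by apply/funext => z; rewrite /u /v; case: (f z).
have [U HU] := choice (fun x => real_analytic_derive x fr).
have [V HV] := choice (fun x => real_analytic_derive x fi).
pose du x h := \sum_j (h : 'rV[R]_d) ord0 j * U x j.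
pose dv x h := \sum_j (h : 'rV[R]_d) ord0 j * V x j.
have dvec (W : 'I_d -> R) (h : 'rV[R]_d) :
    \sum_j h ord0 j * W j = \sum_j h ord0 j * \sum_i (unit_vec R j) ord0 i * W i.
  apply: eq_bigr => j _; congr (_ * _); rewrite (bigD1 j)//= mxE !eqxx mul1r big1 ?addr0//.
  by move=> i /negbTE ij; rewrite mxE ij andbF mul0r.
have Du x j : dunkl_op Rp k u du x (unit_vec R j) = y ord0 j * - v x /\
    dunkl_op Rp k v dv x (unit_vec R j) = y ord0 j * u x.
  have := fD j x; rewrite {1}fE.
  have -> := @dunkl_operator_ReIm u v du dv j x (HU x) (HV x) => /eqP.
  rewrite eq_complex /u /v; case: (f x) => p q /= /andP[/eqP -> /eqP ->].
  by split; ring.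
have [||||||uE vE] := @kernel_unique _ _ _ _ data y u v.
- exact: real_analytic_continuous.
- exact: real_analytic_continuous.
- move=> x; have h := radial_of_dunkl_op (dvec (U x)) (fun j => (Du x j).1).
  by rewrite -mulrN -h; apply: rad_is_derive; exact: HU.
- move=> x; have h := radial_of_dunkl_op (dvec (V x)) (fun j => (Du x j).2).
  by rewrite -h; apply: rad_is_derive; exact: HV.
- by rewrite /u f0.
- by rewrite /v f0.
by rewrite fE uE vE.
Qed.

Lemma dunkl_kernelE x y : dunkl_kernel Rp k x y = Complex (kcos x y) (ksin x y).
Proof.
rewrite /dunkl_kernel (@xget_unique _ _ _ (kexp y))//; first exact: is_dunkl_kernel_kexp.
by move=> f; exact: is_dunkl_kernel_unique.
Qed.

End dunkl_kernel.

(** * Integration by parts *)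

Section slow_growth.
Context {R : realType} {d : nat}.
Implicit Types (x y a : 'rV[R]_d) (f g : 'rV[R]_d -> R) (t : R).
Notation lam := (@lebesgue_rV R d).

(** Growth below every Gaussian. The class is closed under products and contains the weight, the
    kernels, their Dunkl quotients and scalar products, so integrability against a Gaussian needs no
    further estimate. *)
Definition slow g := forall t, 0 < t ->
  exists M, forall y, `|g y| <= M * expR (t * dot y y).

Lemma slow_le f g : slow g -> (forall y, `|f y| <= g y) -> slow f.
Proof.
move=> sg fg t t0; have [M HM] := sg t t0; exists M => y.
by rewrite (le_trans (fg y))// (le_trans _ (HM y))// ler_norm.
Qed.

Lemma slow_cst c : slow (fun=> c).
Proof.
move=> t t0; exists `|c| => y; rewrite ler_peMr// -expR0 ler_expR.
by rewrite mulr_ge0 ?dot_ge0// ltW.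
Qed.

Lemma slowD f g : slow f -> slow g -> slow (fun y => f y + g y).
Proof.
move=> sf sg t t0; have [M HM] := sf t t0; have [M' HM'] := sg t t0.
exists (M + M') => y; rewrite mulrDl (le_trans (ler_normD _ _))//.
exact: lerD.
Qed.

Lemma slowM f g : slow f -> slow g -> slow (fun y => f y * g y).
Proof.
move=> sf sg t t0; have t20 : 0 < t / 2 by rewrite divr_gt0.
have [M HM] := sf _ t20; have [M' HM'] := sg _ t20.
exists (M * M') => y; rewrite normrM [t](splitr t) mulrDl expRD mulrACA.
exact: ler_pM.
Qed.

Lemma slowN f : slow f -> slow (fun y => - f y).
Proof. by move=> sf t t0; have [M HM] := sf t t0; exists M => y; rewrite normrN. Qed.

Lemma slow_sum (I : eqType) (r : seq I) (F : I -> 'rV[R]_d -> R) :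
  (forall i, i \in r -> slow (F i)) -> slow (fun y => \sum_(i <- r) F i y).
Proof.
elim: r => [_|i r ih sF]; first by under eq_fun do rewrite big_nil; exact: slow_cst.
under eq_fun do rewrite big_cons; apply: slowD; first by apply: sF; exact: mem_head.
by apply: ih => j jr; apply: sF; rewrite in_cons jr orbT.
Qed.

Lemma slow_reflection a f : a != 0 -> slow f -> slow (f \o reflection a).
Proof.
by move=> a0 sf t t0; have [M HM] := sf t t0; exists M => y /=; rewrite -(dot_reflection2 y y a0).
Qed.

Lemma slow_norm f : slow f -> slow (fun y => `|f y|).
Proof. by move=> sf t t0; have [M HM] := sf t t0; exists M => y; rewrite normr_id. Qed.

Lemma slow_exp_enorm c : slow (fun y => expR (c * enorm y)).
Proof.
(* The constant from completing the square in c r <= t r^2 + c^2 / (4t). *)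
move=> t t0; exists (expR (c ^+ 2 / (4 * t))) => y.
rewrite ger0_norm ?expR_ge0// -expRD ler_expR -sqr_enorm -subr_ge0.
rewrite (_ : _ - _ = t * (enorm y - c / (2 * t)) ^+ 2).
  by rewrite mulr_ge0 ?sqr_ge0 ?ltW.
by field; rewrite gt_eqF.
Qed.

Lemma slow_enorm : slow (@enorm R d).
Proof.
apply: slow_le (slow_exp_enorm 1) _ => y; rewrite ger0_norm ?enorm_ge0// mul1r.
by rewrite (le_trans _ (expR_ge1Dx _))// lerDr.
Qed.

Lemma slow_dot a : slow (dot a).
Proof.
apply: slow_le (slowM (slow_cst (enorm a)) slow_enorm) _ => y; exact: dot_le.
Qed.

Lemma slow_exp_l1norm (c b : R) : slow (fun y => expR (c * (l1norm y + b))).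
Proof.
apply: (slow_le (g := fun y => expR (`|c| * `|b|) * expR ((`|c| * d%:R) * enorm y))).
  by apply: slowM; [exact: slow_cst|exact: slow_exp_enorm].
move=> y; rewrite ger0_norm ?expR_ge0// -expRD ler_expR.
have h : c * (l1norm y + b) <= `|c| * (l1norm y + `|b|).
  rewrite (le_trans (ler_norm _))// normrM ler_wpM2l// (le_trans (ler_normD _ _))// ger0_norm ?l1norm_ge0//.
rewrite (le_trans h)// mulrDr addrC lerD2l -mulrA ler_wpM2l//.
exact: l1norm_le.
Qed.

Lemma slow_gauss_le g t : 0 < t -> slow g ->
  exists M, forall y, `|expR (- (t * dot y y)) * g y| <= M * expR (- (t / 2 * dot y y)).
Proof.
move=> t0 /(_ _ (divr_gt0 t0 (ltr0Sn R 1)))[M HM]; exists M => y.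
rewrite normrM ger0_norm ?expR_ge0// (le_trans (ler_wpM2l (expR_ge0 _) (HM y)))//.
rewrite mulrCA -expRD le_eqVlt; apply/orP; left; apply/eqP; congr (_ * expR _).
by field.
Qed.

Lemma integrable_slow g t : 0 < t -> measurable_fun setT g -> slow g ->
  integrableR lam (fun y => expR (- (t * dot y y)) * g y).
Proof.
move=> t0 mg sg; have [M HM] := slow_gauss_le t0 sg.
apply: integrableR_dom HM.
  apply: measurable_funM => //; apply: measurableT_comp => //; apply: measurableT_comp => //.
  by apply: measurable_funM => //; exact: measurable_dotxx.
by apply: integrableRZ; apply: integrable_gauss; rewrite divr_gt0.
Qed.

End slow_growth.

(** * The Dunkl weight and a smooth regularisation *)

Section weight.
Context {R : realType} {d : nat} {Rp : {fset 'rV[R]_d}} {k : 'rV[R]_d -> R}.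
Variable data : dunkl_data Rp k.
Implicit Types (x y a : 'rV[R]_d).
Notation w := (dunkl_weight Rp k).

(** The product of (<a,y>^2 + eps)^k(a), written as an exponential to make its logarithmic
    derivative explicit. The weight itself may fail to be differentiable on the hyperplanes; this
    one is smooth and still invariant under reflections. *)
Definition reg_weight (eps : R) y : R := expR (\sum_(a <- Rp) k a * ln (dot a y ^+ 2 + eps)).

Lemma continuous_reg_weight eps : 0 < eps -> continuous (reg_weight eps).
Proof.
move=> eps0; apply: continuous_expr; apply: continuous_sumr => a.
apply: continuous_mulr; first exact: continuous_cstr.
move=> x; apply: (@continuous_comp _ _ _ (fun y => dot a y ^+ 2 + eps) (@ln R)).
  have : continuous (fun y => dot a y ^+ 2 + eps); last exact.
  apply: continuous_addr; last exact: continuous_cstr.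
  by apply: continuous_mulr; exact: continuous_dot.
by apply: continuous_ln; rewrite ltr_wpDl// sqr_ge0.
Qed.

Lemma reg_weight_reflection eps a y : a \in Rp -> reg_weight eps (reflection a y) = reg_weight eps y.
Proof.
move=> aRp; have a0 := dunkl_data_neq0 data aRp; rewrite /reg_weight; congr expR.
rewrite -[RHS](@dunkl_data_big _ _ _ _ data _ _ +%R (fun c b => c * ln (dot b y ^+ 2 + eps)) a aRp).
  by apply: eq_bigr => b _; rewrite dot_reflection.
by move=> c b; rewrite dotNl sqrrN.
Qed.

Lemma weightN y : w (- y) = w y.
Proof. by apply: eq_bigr => a _; rewrite dotNr normrN. Qed.

Lemma weight_ge0 y : 0 <= w y.
Proof. by apply: prodr_ge0 => a _; exact: powR_ge0. Qed.

Lemma powR_sum (I : Type) (s : seq I) (F : I -> R) r : 0 < r ->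
  r `^ (\sum_(i <- s) F i) = \prod_(i <- s) r `^ F i.
Proof.
move=> r0; apply: (big_morph (fun p => r `^ p)) => [p q|]; last exact: powRr0.
by rewrite powRD// (gt_eqF r0) implybT.
Qed.

Lemma weightZ r y : 0 < r -> w (r *: y) = r `^ (2 * abs_mult Rp k) * w y.
Proof.
move=> r0; rewrite /dunkl_weight /abs_mult (@mulr_sumr _ _ Rp) powR_sum// -big_split/=.
by apply: eq_bigr => a _; rewrite dotZr normrM gtr0_norm// powRM// ltW.
Qed.

Lemma reg_weightE eps y : 0 < eps -> reg_weight eps y = \prod_(a <- Rp) (dot a y ^+ 2 + eps) `^ k a.
Proof.
move=> e0; rewrite /reg_weight expR_sum; apply: eq_bigr => a _.
by rewrite /powR gt_eqF// ltr_wpDl// sqr_ge0.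
Qed.

Lemma powR_normr_sqr (c p : R) : `|c| `^ (2 * p) = (c ^+ 2) `^ p.
Proof. by rewrite powRrM -[2]/(2%:R) powR_mulrn// real_normK ?num_real. Qed.

Lemma reg_weight_le eps y : 0 < eps <= 1 -> reg_weight eps y <= reg_weight 1 y.
Proof.
move=> /andP[e0 e1]; rewrite ler_expR big_seq [leRHS]big_seq; apply: ler_sum => a aRp.
rewrite ler_wpM2l ?(dunkl_data_ge0 data)// ler_ln ?posrE ?lerD2l// ltr_wpDl ?sqr_ge0//.
Qed.

Lemma weight_le_reg y : w y <= reg_weight 1 y.
Proof.
rewrite reg_weightE// /dunkl_weight big_seq [leRHS]big_seq; apply: ler_prod => a aRp.
rewrite powR_ge0/= powR_normr_sqr ge0_ler_powR ?(dunkl_data_ge0 data)// ?nnegrE ?addr_ge0 ?sqr_ge0//.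
by rewrite lerDl.
Qed.

Lemma slow_reg_weight : slow (reg_weight 1).
Proof.
move=> t t0; pose B := \sum_(a <- Rp) k a * (dot a a + 1).
have B0 : 0 <= B.
  rewrite /B big_seq; apply: sumr_ge0 => a aRp.
  by rewrite mulr_ge0 ?(dunkl_data_ge0 data)// addr_ge0 ?dot_ge0.
(* With ln X <= s X - ln s for X = <a,y>^2 + 1, this s makes the total coefficient of |y|^2 at most
   t. *)
pose s := t / (B + 1).
have s0 : 0 < s by rewrite divr_gt0// ltr_wpDl.
have sB : s * B <= t.
  by rewrite /s mulrAC ler_pdivrMr ?ltr_wpDl// ler_pM2l// lerDl.
exists (expR (\sum_(a <- Rp) k a * (s - ln s))) => y.
rewrite ger0_norm ?expR_ge0// -expRD ler_expR.
have -> : \sum_(a <- Rp) k a * (s - ln s) + t * dot y y =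
   \sum_(a <- Rp) k a * (s - ln s + s * (dot a a * dot y y)) + (t - \sum_(a <- Rp) k a * s * dot a a) * dot y y.
  rewrite [X in _ = X + _](eq_bigr (fun a => k a * (s - ln s) + k a * s * dot a a * dot y y)); last by move=> a _; ring.
  rewrite big_split/= -[X in _ + X + _](@mulr_suml _ _ Rp).
  by move: (\sum_(a <- Rp) _) (\sum_(a <- Rp) _) => p q; ring.
rewrite -[leLHS]addr0; apply: lerD; last first.
  rewrite mulr_ge0 ?dot_ge0// subr_ge0 (le_trans _ sB)// /B (@mulr_sumr _ _ Rp) big_seq [leRHS]big_seq.
  apply: ler_sum => a aRp; have := dunkl_data_ge0 data aRp.
  move=> ka; rewrite (_ : s * _ = k a * s * (dot a a + 1)); last by ring.
  by rewrite ler_wpM2l ?lerDl// mulr_ge0// ltW.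
rewrite big_seq [leRHS]big_seq; apply: ler_sum => a aRp.
rewrite ler_wpM2l ?(dunkl_data_ge0 data)//.
have p0 : 0 < dot a y ^+ 2 + 1 by rewrite ltr_wpDl ?sqr_ge0.
have : ln (s * (dot a y ^+ 2 + 1)) <= s * (dot a y ^+ 2 + 1).
  by rewrite ltW// ln_sublinear// mulr_gt0.
rewrite lnM ?posrE// => h.
have : s * dot a y ^+ 2 <= s * (dot a a * dot y y).
  rewrite ler_wpM2l ?(ltW s0)// -!sqr_enorm -exprMn -[leLHS]real_normK ?num_real//.
  by rewrite lerXn2r ?nnegrE ?mulr_ge0 ?enorm_ge0 ?dot_le.
by lra.
Qed.

Lemma slow_weight : slow w.
Proof.
by apply: slow_le slow_reg_weight _ => y; rewrite ger0_norm ?weight_ge0// weight_le_reg.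
Qed.

Lemma cvg_reg_weight y : reg_weight n.+1%:R^-1 y @[n --> \oo] --> w y.
Proof.
rewrite (_ : (fun _ => _) = fun n => \prod_(a <- Rp) (dot a y ^+ 2 + n.+1%:R^-1) `^ k a); last first.
  by apply/funext => n; rewrite reg_weightE.
rewrite /dunkl_weight.
have : {subset enum_fset Rp <= Rp} by [].
elim: (enum_fset Rp) => [_|a s ih sRp].
  by under eq_fun do rewrite big_nil; rewrite big_nil; exact: cvg_cst.
have aRp : a \in Rp by apply: sRp; exact: mem_head.
under eq_fun do rewrite big_cons; rewrite big_cons; apply: cvgM; last first.
  by apply: ih => b bs; apply: sRp; rewrite in_cons bs orbT.
rewrite powR_normr_sqr.
have cu : dot a y ^+ 2 + n.+1%:R^-1 @[n --> \oo] --> dot a y ^+ 2.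
  rewrite -[X in _ --> X]addr0; apply: cvgD; [exact: cvg_cst|exact: cvg_harmonic].
(* For k(a) = 0 the factor is constantly 1, on the hyperplane too, since 0 to the power 0 is 1; for
   k(a) > 0 it tends to 0 there. *)
have [ka|ka] := eqVneq (k a) 0.
  by rewrite ka powRr0; under eq_fun do rewrite powRr0; exact: cvg_cst.
have [ay|ay] := eqVneq (dot a y) 0; last first.
  have p0 : 0 < dot a y ^+ 2 by rewrite lt_neqAle eq_sym sqrf_eq0 ay sqr_ge0.
  rewrite /powR (gt_eqF p0); under eq_fun do rewrite gt_eqF ?ltr_wpDl ?sqr_ge0//.
  apply: (@continuous_cvg _ _ _ _ _ _ expR); first exact: continuous_expR.
  apply: cvgM; first exact: cvg_cst.
  apply: (@continuous_cvg _ _ _ _ _ _ (@ln R)); [exact: continuous_ln|exact: cu].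
have ka0 : 0 < k a by rewrite lt_neqAle eq_sym ka (dunkl_data_ge0 data).
rewrite ay expr0n/= powR0 ?gt_eqF//.
have /cvg_at_rightP := powR_cvg0 ka0; apply; split=> [n|]; first by rewrite add0r invr_gt0.
by under eq_fun do rewrite add0r; exact: cvg_harmonic.
Qed.

Lemma measurable_weight : measurable_fun setT w.
Proof.
rewrite /dunkl_weight; elim: (enum_fset Rp) => [|a s ih].
  by under eq_fun do rewrite big_nil; exact: measurable_cst.
under eq_fun do rewrite big_cons; apply: measurable_funM => //.
apply: (@measurableT_comp _ _ _ _ _ _ (fun z : R => z `^ (2 * k a))); first exact: measurable_powR.
by apply: measurableT_comp => //; exact: measurable_dot.
Qed.

End weight.

Arguments reg_weight {R d} Rp k eps y.

Section integral_derivative.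
Context {R : realType} {d : nat}.
Implicit Types (y v : 'rV[R]_d) (psi : 'rV[R]_d -> R).
Notation lam := (@lebesgue_rV R d).

Lemma is_derive_harmonic (V : normedModType R) (f : V -> R) (x v : V) l : is_derive x v f l ->
  n.+1%:R * (f (x + n.+1%:R^-1 *: v) - f x) @[n --> \oo] --> l.
Proof.
move=> [fd <-]; have /cvgr_dnbhsP/(_ (fun n => n.+1%:R^-1)) H :
  h^-1 * (f (h *: v + x) - f x) @[h --> (0 : R)^'] --> 'D_v f x by exact: fd.
rewrite (_ : (fun _ => _) = fun n => (n.+1%:R^-1)^-1 * (f (n.+1%:R^-1 *: v + x) - f x)).
  by apply: H; split=> [n|]; [rewrite invr_eq0 pnatr_eq0|exact: cvg_harmonic].
by apply/funext => n; rewrite invrK (addrC x).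
Qed.

Lemma is_derive_along psi y v (s l : R) :
  is_derive (y + s *: v) v psi l -> is_derive s 1 (fun s => psi (y + s *: v)) l.
Proof.
move=> [dp <-].
have E : (fun h : R => h^-1 *: (psi (h *: v + (y + s *: v)) - psi (y + s *: v))) =
   (fun h : R => h^-1 *: (psi (y + (h *: (1 : R) + s) *: v) - psi (y + s *: v))).
  apply/funext => h; congr (_ *: (psi _ - _)).
  by rewrite scalerDl addrCA; congr (_ + (_ *: v + _)); rewrite /GRing.scale/= mulr1.
apply: DeriveDef; first by rewrite /derivable -E; exact: dp.
by rewrite /derive -E.
Qed.

Lemma gauss_shift_le (t s : R) y (v : 'rV[R]_d) : 0 <= t -> `|s| <= 1 ->
  expR (- (t * dot (y + s *: v) (y + s *: v))) <=
  expR (t * dot v v) * expR (- (t / 2 * dot y y)).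
Proof.
move=> t0 s1; rewrite -expRD ler_expR.
have : dot y y <= 2 * dot (y + s *: v) (y + s *: v) + 2 * (s ^+ 2 * dot v v).
  have := dot_ge0 (y + (2 * s) *: v).
  by rewrite !dotDl !dotDr !dotZl !dotZr (dotC v y); lra.
have : s ^+ 2 * dot v v <= dot v v.
  by rewrite ler_piMl ?dot_ge0// -[s ^+ 2]real_normK ?num_real// exprn_ile1.
move=> h1 h2; have := ler_wpM2l t0 (le_trans h2 (lerD (lexx _) (ler_wpM2l (ler0n _ 2) h1))).
by lra.
Qed.

(** Difference quotients of [psi] along v integrate to 0 by translation invariance. By the mean
    value theorem they are values of [dpsi] at nearby points, and the Gaussian bound there, spread
    by [gauss_shift_le], dominates them. *)
Lemma Rintegral_derive0 psi dpsi v (t M : R) : 0 < t -> integrableR lam psi ->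
  (forall y (s : R), is_derive s 1 (fun s => psi (y + s *: v)) (dpsi (y + s *: v))) ->
  (forall y, `|dpsi y| <= M * expR (- (t * dot y y))) ->
  integrableR lam dpsi /\ \int[lam]_y dpsi y = 0.
Proof.
move=> t0 ipsi D B.
have M0 : 0 <= M by have := le_trans (normr_ge0 _) (B 0); rewrite dot0l mulr0 oppr0 expR0 mulr1.
pose F n y := n.+1%:R * (psi (y + n.+1%:R^-1 *: v) - psi y).
have mpsi := integrableR_measurable ipsi.
have ishift (c : R) : integrableR lam (fun y => psi (y + c *: v)).
  have := integrable_rV_affine (c *: v) (oner_neq0 R) ipsi.
  by under eq_fun do rewrite scale1r.
have shiftE (c : R) : \int[lam]_y psi (y + c *: v) = \int[lam]_y psi y.
  have := Rintegral_rV_affine (c *: v) (oner_neq0 R) ipsi.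
  rewrite normr1 expr1n invr1 mul1r => <-.
  by congr (Rintegral _ _ _); apply/funext => y; rewrite scale1r.
have [||||idpsi cF] := @Rintegral_dominated_cvg _ _ _ lam F dpsi
  (fun y => M * (expR (t * dot v v) * expR (- (t / 2 * dot y y)))).
- move=> n; apply: measurable_funM => //; apply: measurable_funB => //.
  exact: integrableR_measurable (ishift _).
- by apply: integrableRZ; apply: integrableRZ; apply: integrable_gauss; rewrite divr_gt0.
- move=> y; have := is_derive_harmonic (D y 0); rewrite scale0r addr0.
  by under eq_fun do rewrite add0r [_%:A]mulr1.
- move=> n y; pose s : R := n.+1%:R^-1.
  have s0 : 0 < s by rewrite invr_gt0.
  have s1 : s <= 1 by rewrite invf_le1// ler1n.
  have [|c] := @MVT_segment R (fun s => psi (y + s *: v)) (fun s => dpsi (y + s *: v)) 0 s (ltW s0) (fun x _ => D y x).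
    apply: continuous_subspaceT => x; apply: differentiable_continuous.
    by apply/derivable1_diffP; have [] := D y x.
  rewrite in_itv/= subr0 scale0r addr0 => /andP[c0 cs] E.
  rewrite /F -/s E mulrCA mulfV ?pnatr_eq0// mulr1.
  rewrite (le_trans (B _))// ler_wpM2l// gauss_shift_le ?(ltW t0)// ger0_norm//.
  exact: le_trans cs s1.
split=> //; rewrite -(cvg_lim _ cF)//.
apply/cvg_lim => //; rewrite (_ : (fun _ => _) = fun=> 0); first exact: cvg_cst.
apply/funext => n; rewrite /F RintegralZl//; last by apply: integrableRB.
rewrite (@RintegralB _ _ _ lam setT (fun y => psi (y + n.+1%:R^-1 *: v)) psi)//; last exact: (ishift n.+1%:R^-1).
by rewrite (shiftE n.+1%:R^-1) subrr mulr0.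
Qed.

End integral_derivative.

(** * Antisymmetry of Dunkl operators for the weight with a Gaussian *)

Section weighted_ibp.
Context {R : realType} {d : nat} {Rp : {fset 'rV[R]_d}} {k : 'rV[R]_d -> R}.
Variable data : dunkl_data Rp k.
Implicit Types (x y a : 'rV[R]_d).
Notation lam := (@lebesgue_rV R d).
Notation w := (dunkl_weight Rp k).

Variables (u v : 'rV[R]_d -> R) (du dv : 'rV[R]_d -> 'rV[R]_d -> R) (e : 'rV[R]_d).
Hypotheses (ud : forall x h, is_derive x h u (du x h)) (vd : forall x h, is_derive x h v (dv x h)).
Hypotheses (mu : measurable_fun setT u) (mv : measurable_fun setT v).
Hypotheses (su : slow u) (sv : slow v) (sdu : slow (du ^~ e)) (sdv : slow (dv ^~ e)).
Hypotheses (squ : forall a, a \in Rp -> slow (quot a u du)) (sqv : forall a, a \in Rp -> slow (quot a v dv)).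
Variables (t : R) (t0 : 0 < t).

Let G y : R := expR (- (t * dot y y)).

(** Bounded substitute for 1/<a,y>, odd under sigma_a; the logarithmic derivative of the regularised
    weight is a combination of these. *)
Let reg_quot eps a y : R := dot a y / (dot a y ^+ 2 + eps).

Let is_derive_exp y eps s : 0 < eps -> is_derive s (1 : R)
  (fun s : R => G (y + s *: e) * reg_weight Rp k eps (y + s *: e))
  (G (y + s *: e) * reg_weight Rp k eps (y + s *: e) *
    (- (2 * t * dot e (y + s *: e)) + \sum_(a <- Rp) 2 * k a * dot a e * reg_quot eps a (y + s *: e))).
Proof.
move=> e0.
pose E (s : R) : R := - (t * dot (y + s *: e) (y + s *: e)) +
  \sum_(a <- Rp) k a * ln (dot a (y + s *: e) ^+ 2 + eps).
have -> : (fun s : R => G (y + s *: e) * reg_weight Rp k eps (y + s *: e)) = expR \o E.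
  by apply/funext => r; rewrite /G /reg_weight -expRD.
rewrite -[G _ * _]expRD -/(E s).
have dd b : is_derive s (1 : R) (fun s : R => dot b (y + s *: e)) (dot b e).
  have -> : (fun s : R => dot b (y + s *: e)) = (fun=> dot b y) + (fun s : R => s * dot b e).
    by apply/funext => r; rewrite dotDr dotZr.
  by apply: is_derive_eq; rewrite add0r /GRing.scale/= mulr1 mulr0 add0r.
have dq : is_derive s (1 : R) (fun s : R => - (t * dot (y + s *: e) (y + s *: e))) (- (2 * t * dot e (y + s *: e))).
  have -> : (fun s : R => - (t * dot (y + s *: e) (y + s *: e))) =
    (fun=> - (t * dot y y)) - (fun s : R => s * (2 * t * dot e y)) - (fun s : R => s ^+ 2 * (t * dot e e)).
    by apply/funext => r; rewrite !fctE !(dotDl, dotDr, dotZl, dotZr) (dotC y e); ring.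
  by apply: is_derive_eq; rewrite /GRing.scale/= dotDr dotZr; ring.
have dl a : is_derive s (1 : R) (fun s : R => ln (dot a (y + s *: e) ^+ 2 + eps))
    (2 * dot a e * reg_quot eps a (y + s *: e)).
  have p0 : 0 < dot a (y + s *: e) ^+ 2 + eps by rewrite ltr_wpDl ?sqr_ge0.
  have dg : is_derive s (1 : R) (fun s : R => dot a (y + s *: e) ^+ 2 + eps)
     (2 * dot a (y + s *: e) * dot a e).
    have -> : (fun s : R => dot a (y + s *: e) ^+ 2 + eps) = (fun s : R => dot a (y + s *: e)) ^+ 2 + (fun=> eps).
      by apply/funext => r.
    by apply: is_derive_eq; rewrite /GRing.scale/= expr1 addr0.
  have := @is_derive1_comp R (@ln R) _ s _ _ (is_derive1_ln p0) dg.
  by congr (is_derive _ _ _ _); rewrite /reg_quot; field; rewrite gt_eqF.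
have dsum : is_derive s (1 : R) (fun s : R => \sum_(a <- Rp) k a * ln (dot a (y + s *: e) ^+ 2 + eps))
    (\sum_(a <- Rp) 2 * k a * dot a e * reg_quot eps a (y + s *: e)).
  elim: (enum_fset Rp) => [|a r ih].
    by under eq_fun do rewrite big_nil; rewrite big_nil; exact: is_derive_cst.
  under eq_fun do rewrite big_cons; rewrite big_cons.
  apply: is_deriveD => //.
  have := @is_deriveZ _ _ _ _ (k a) _ _ _ (dl a).
  by congr (is_derive _ _ _ _); rewrite /GRing.scale/=; ring.
have := @is_derive1_comp R expR E s _ _ (is_derive_expR _) (is_deriveD dq dsum).
by [].
Qed.

Let dpsi eps y := (du y e * v y + u y * dv y e) * (G y * reg_weight Rp k eps y) +
  u y * v y * (G y * reg_weight Rp k eps y *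
    (- (2 * t * dot e y) + \sum_(a <- Rp) 2 * k a * dot a e * reg_quot eps a y)).

Let reg_quot_odd eps a y : a != 0 -> reg_quot eps a (reflection a y) = - reg_quot eps a y.
Proof. by move=> a0; rewrite /reg_quot dot_reflection_root// sqrrN mulNr. Qed.

Let reg_quot_le eps a y : 0 < eps -> `|reg_quot eps a y| <= eps^-1 * `|dot a y|.
Proof.
move=> e0; rewrite /reg_quot normrM mulrC ler_wpM2r// ger0_norm ?invr_ge0 ?addr_ge0 ?sqr_ge0 ?(ltW e0)//.
by rewrite lef_pV2 ?posrE ?ltr_wpDl ?sqr_ge0// lerDr sqr_ge0.
Qed.

(** The bound is independent of [eps]: this majorant permits the removal of the regularisation. *)
Let reg_quot_diff eps a y (g : 'rV[R]_d -> R) dg : 0 < eps ->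
  `|(g y - g (reflection a y)) * reg_quot eps a y| <= `|quot a g dg y|.
Proof.
move=> e0; rewrite /quot /reg_quot; case: ifPn => [/eqP ay|ay].
  by rewrite ay mul0r mulr0 normr0.
rewrite (_ : _ * _ = (g y - g (reflection a y)) / dot a y * (dot a y ^+ 2 / (dot a y ^+ 2 + eps))).
  rewrite normrM ler_piMr// ger0_norm ?divr_ge0 ?addr_ge0 ?sqr_ge0 ?(ltW e0)//.
  by rewrite ler_pdivrMr ?ltr_wpDl ?sqr_ge0// mul1r lerDl ltW.
by field; rewrite ay gt_eqF// ltr_wpDl ?sqr_ge0.
Qed.

(** Differentiating the regularised weight produces 2 u v times [reg_quot], which has no uniform
    bound. Subtracting terms that are odd under sigma_a, hence of integral zero, replaces it by
    differences of u and v times [reg_quot], which are dominated by the Dunkl quotients and converge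
    to them. *)
Lemma weighted_ibp :
  integrableR lam (fun y => (dunkl_op Rp k u du y e * v y + u y * dunkl_op Rp k v dv y e -
    2 * t * dot e y * (u y * v y)) * (G y * w y)) /\
  \int[lam]_y ((dunkl_op Rp k u du y e * v y + u y * dunkl_op Rp k v dv y e -
    2 * t * dot e y * (u y * v y)) * (G y * w y)) = 0.
Proof.
pose q n a y := reg_quot n.+1%:R^-1 a y.
pose r n y := reg_weight Rp k n.+1%:R^-1 y.
have en n : 0 < n.+1%:R^-1 :> R by rewrite invr_gt0.
have en1 n : n.+1%:R^-1 <= 1 :> R by rewrite invf_le1// ler1n.
have mr n : measurable_fun setT (r n).
  by apply: continuous_measurable_rV; exact: continuous_reg_weight.
have sr n : slow (r n).
  apply: slow_le (slow_reg_weight data) _ => y; rewrite ger0_norm ?expR_ge0//.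
  by rewrite reg_weight_le// en en1.
have mq n a : measurable_fun setT (q n a).
  apply: continuous_measurable_rV; apply: continuous_mulr; first exact: continuous_dot.
  move=> x; apply: (@cvgV _ _ (nbhs x)); first by rewrite gt_eqF// ltr_wpDl ?sqr_ge0.
  have : continuous (fun z => dot a z ^+ 2 + n.+1%:R^-1); last exact.
  apply: continuous_addr; last exact: continuous_cstr.
  by apply: continuous_mulr; exact: continuous_dot.
have sq n a : slow (q n a).
  apply: slow_le (slowM (slow_cst _) (slow_norm (slow_dot a))) _ => y; exact: reg_quot_le.
have mG : measurable_fun setT G.
  by apply: continuous_measurable_rV; apply: continuous_expr; apply: continuous_oppr;
    apply: continuous_mulr; [exact: continuous_cstr|exact: continuous_dotxx].
(* The bracket is even and [q n a] is odd under sigma_a, while the Gaussian and the regularised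
   weight are invariant, so the integral vanishes. *)
pose T n a y := G y * ((u (reflection a y) * v y + u y * v (reflection a y)) * q n a y * r n y).
have iT n a : a \in Rp -> integrableR lam (T n a).
  move=> aRp; have a0 := dunkl_data_neq0 data aRp; apply: integrable_slow => //.
    apply: measurable_funM => //; apply: measurable_funM => //; apply: measurable_funD;
    apply: measurable_funM => //; (apply: measurableT_comp => //; exact: measurable_reflection).
  apply: slowM => //; apply: slowM => //; apply: slowD; apply: slowM => //; exact: slow_reflection.
have T0 n a : a \in Rp -> \int[lam]_y T n a y = 0.
  move=> aRp; have a0 := dunkl_data_neq0 data aRp.
  have := Rintegral_reflection a0 (iT n a aRp).
  have -> : (fun y => T n a (reflection a y)) = (fun y => -1 * T n a y).
    apply/funext => y; rewrite /T /G dot_reflection2// reflectionK// /q reg_quot_odd// /r.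
    by rewrite reg_weight_reflection//; ring.
  rewrite RintegralZl//; last exact: iT.
  by move: (\int[lam]_y _) => z; lra.
have dpsiP n : integrableR lam (dpsi n.+1%:R^-1) /\ \int[lam]_y dpsi n.+1%:R^-1 y = 0.
  have dpsiE y : dpsi n.+1%:R^-1 y = G y * ((du y e * v y + u y * dv y e + u y * v y *
      (- (2 * t * dot e y) + \sum_(a <- Rp) 2 * k a * dot a e * q n a y)) * r n y).
    by rewrite /dpsi /q /r; ring.
  have [M HM] : exists M, forall y, `|dpsi n.+1%:R^-1 y| <= M * expR (- (t / 2 * dot y y)).
    under eq_exists do under eq_forall do rewrite dpsiE.
    apply: slow_gauss_le => //; apply: slowM => //; apply: slowD.
      by apply: slowD; apply: slowM.
    apply: slowM; first exact: slowM.
    apply: slowD; first by apply: slowN; apply: slowM; [exact: slow_cst|exact: slow_dot].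
    by apply: slow_sum => a _; apply: slowM => //; exact: slow_cst.
  apply: (@Rintegral_derive0 _ _ (fun y => G y * (u y * v y * r n y)) _ e (t / 2) M) => //.
  - by rewrite divr_gt0.
  - apply: integrable_slow => //; last by apply: slowM => //; exact: slowM.
    by apply: measurable_funM => //; exact: measurable_funM.
  move=> y s.
  have -> : (fun s : R => G (y + s *: e) * (u (y + s *: e) * v (y + s *: e) * r n (y + s *: e))) =
    (fun s : R => u (y + s *: e)) * (fun s : R => v (y + s *: e)) *
    (fun s : R => G (y + s *: e) * reg_weight Rp k n.+1%:R^-1 (y + s *: e)).
    by apply/funext => z; rewrite !fctE /r; ring.
  have := is_deriveM (is_deriveM (is_derive_along (ud (y + s *: e) e)) (is_derive_along (vd (y + s *: e) e)))
    (is_derive_exp y s (en n)).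
  by congr (is_derive _ _ _ _); rewrite !fctE /dpsi /GRing.scale/=; ring.
pose F n y := dpsi n.+1%:R^-1 y - \sum_(a <- Rp) (k a * dot a e) * T n a y.
have iS n : integrableR lam (fun y => \sum_(a <- Rp) (k a * dot a e) * T n a y) /\
    \int[lam]_y \sum_(a <- Rp) (k a * dot a e) * T n a y = 0.
  have : {subset enum_fset Rp <= Rp} by [].
  elim: (enum_fset Rp) => [_|a s ih sRp].
    under eq_fun do rewrite big_nil; split; first exact: integrable0.
    by rewrite /Rintegral integral0.
  have aRp : a \in Rp by apply: sRp; exact: mem_head.
  have [|ih1 ih2] := ih; first by move=> b bs; apply: sRp; rewrite in_cons bs orbT.
  have iTa : integrableR lam (fun y => (k a * dot a e) * T n a y) by exact: integrableRZ (iT _ _ aRp).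
  under eq_fun do rewrite big_cons; split; first exact: integrableRD.
  rewrite (@RintegralD _ _ _ lam setT (fun y => (k a * dot a e) * T n a y))//= ih2 addr0.
  by rewrite RintegralZl ?T0 ?mulr0//; exact: iT.
have iF n : integrableR lam (F n) by apply: integrableRB; [have [] := dpsiP n|have [] := iS n].
have F0 n : \int[lam]_y F n y = 0.
  have [i1 e1] := dpsiP n; have [i2 e2] := iS n.
  by rewrite (@RintegralB _ _ _ lam setT (dpsi n.+1%:R^-1))// e1 e2 subrr.
(* Majorant of all F n without the Gaussian, obtained with [reg_weight_le] and [reg_quot_diff]. *)
pose S y := (`|du y e| * `|v y| + `|u y| * `|dv y e| + `|2 * t * dot e y| * (`|u y| * `|v y|) +
  \sum_(a <- Rp) `|k a * dot a e| * (`|quot a u du y| * `|v y| + `|u y| * `|quot a v dv y|)) * reg_weight Rp k 1 y.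
have sS : slow S.
  apply: slowM; last exact: slow_reg_weight data.
  have nu := slow_norm su; have nv := slow_norm sv.
  apply: slowD; first apply: slowD; first apply: slowD; first by apply: slowM => //; exact: slow_norm.
  - by apply: slowM => //; exact: slow_norm.
  - apply: slowM; last exact: slowM.
    by apply: slow_norm; apply: slowM; [exact: slow_cst|exact: slow_dot].
  apply: slow_sum => a aRp; apply: slowM; first exact: slow_cst.
  by apply: slowD; apply: slowM => //; apply: slow_norm; [exact: squ|exact: sqv].
have FE n y : F n y = (du y e * v y + u y * dv y e - 2 * t * dot e y * (u y * v y) +
    \sum_(a <- Rp) (k a * dot a e) * ((u y - u (reflection a y)) * q n a y * v y +
      u y * ((v y - v (reflection a y)) * q n a y))) * (G y * r n y).
  pose U := \sum_(a <- Rp) (k a * dot a e) * ((u (reflection a y) * v y + u y * v (reflection a y)) * q n a y).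
  have -> : F n y = dpsi n.+1%:R^-1 y - U * (G y * r n y).
    by rewrite /F /U (@mulr_suml _ _ Rp); congr (_ - _); apply: eq_bigr => a _; rewrite /T; ring.
  have -> : \sum_(a <- Rp) (k a * dot a e) * ((u y - u (reflection a y)) * q n a y * v y +
      u y * ((v y - v (reflection a y)) * q n a y)) =
      u y * v y * (\sum_(a <- Rp) 2 * k a * dot a e * q n a y) - U.
    by rewrite (@mulr_sumr _ _ Rp) -sumrB; apply: eq_bigr => a _; ring.
  by rewrite /dpsi -/(r n y) /q; ring.
have [M HM] := slow_gauss_le t0 sS.
have [||||H1 H2] := @Rintegral_dominated_cvg _ _ _ lam F (fun y => (dunkl_op Rp k u du y e * v y + u y * dunkl_op Rp k v dv y e -
    2 * t * dot e y * (u y * v y)) * (G y * w y)) (fun y => M * expR (- (t / 2 * dot y y))).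
- by move=> n; exact: integrableR_measurable (iF n).
- by apply: integrableRZ; apply: integrable_gauss; rewrite divr_gt0.
- move=> y.
  have cW : G y * r n y @[n --> \oo] --> G y * w y.
    by apply: cvgM; [exact: cvg_cst|exact: cvg_reg_weight].
  pose B := du y e * v y + u y * dv y e - 2 * t * dot e y * (u y * v y).
  have -> : (dunkl_op Rp k u du y e * v y + u y * dunkl_op Rp k v dv y e - 2 * t * dot e y * (u y * v y)) * (G y * w y) =
      B * (G y * w y) + \sum_(a <- Rp) (k a * dot a e) * (quot a u du y * v y + u y * quot a v dv y) * (G y * w y).
    pose U1 := \sum_(a <- Rp) k a * dot a e * quot a u du y.
    pose U2 := \sum_(a <- Rp) k a * dot a e * quot a v dv y.
    have -> : \sum_(a <- Rp) (k a * dot a e) * (quot a u du y * v y + u y * quot a v dv y) * (G y * w y) =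
       (U1 * v y + u y * U2) * (G y * w y).
      rewrite [U1 * _](@mulr_suml _ _ Rp) [_ * U2](@mulr_sumr _ _ Rp) -big_split/= (@mulr_suml _ _ Rp).
      by apply: eq_bigr => a _; ring.
    by rewrite /dunkl_op -/U1 -/U2 /B; ring.
  rewrite (_ : (fun n => F n y) = fun n => B * (G y * r n y) + \sum_(a <- Rp) (k a * dot a e) *
      ((u y - u (reflection a y)) * q n a y * v y + u y * ((v y - v (reflection a y)) * q n a y)) * (G y * r n y)); last first.
    by apply/funext => n; rewrite FE -/B mulrDl [X in _ + X](@mulr_suml _ _ Rp).
  apply: cvgD; first by apply: cvgM; [exact: cvg_cst|exact: cW].
  have : {subset enum_fset Rp <= Rp} by [].
  elim: (enum_fset Rp) => [_|a s ih sRp].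
    by under eq_fun do rewrite big_nil; rewrite big_nil; exact: cvg_cst.
  have aRp : a \in Rp by apply: sRp; exact: mem_head.
  under eq_fun do rewrite big_cons; rewrite big_cons; apply: cvgD; last first.
    by apply: ih => b bs; apply: sRp; rewrite in_cons bs orbT.
  (* On the hyperplane all [q n a y] are 0 although the Dunkl quotient need not be; there the limit
     vanishes because of the factor k(a) w(y). *)
  have [ay|ay] := eqVneq (dot a y) 0.
    have q0 n : q n a y = 0 by rewrite /q /reg_quot ay mul0r.
    under eq_fun do rewrite q0 !mulr0 mul0r addr0 mulr0 mul0r.
    rewrite (_ : _ * (G y * w y) = 0); first exact: cvg_cst.
    have [->|ka] := eqVneq (k a) 0; first by rewrite !mul0r.
    rewrite (_ : w y = 0) ?mulr0// /dunkl_weight (big_fsetD1 a)//= ay normr0 powR0 ?mul0r//.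
    by rewrite mulf_neq0// pnatr_eq0.
  have cq : q n a y @[n --> \oo] --> (dot a y)^-1.
    have -> : (dot a y)^-1 = dot a y / (dot a y ^+ 2 + 0) by field.
    apply: cvgM; first exact: cvg_cst.
    apply: cvgV; first by rewrite addr0 sqrf_eq0.
    by apply: cvgD; [exact: cvg_cst|exact: cvg_harmonic].
  apply: cvgM => //; apply: cvgM; first exact: cvg_cst.
  rewrite /quot (negbTE ay); apply: cvgD.
    apply: cvgM; last exact: cvg_cst.
    by apply: cvgM => //; exact: cvg_cst.
  apply: cvgM; first exact: cvg_cst.
  by apply: cvgM => //; exact: cvg_cst.
- move=> n y; apply: le_trans (HM y).
  have S0 : 0 <= S y.
    rewrite mulr_ge0 ?expR_ge0// !addr_ge0// ?mulr_ge0//.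
    by apply: sumr_ge0 => a _; rewrite mulr_ge0// addr_ge0// mulr_ge0.
  have G0 : 0 <= G y by exact: expR_ge0.
  have r0 : 0 <= r n y by exact: expR_ge0.
  have Gr : `|G y * r n y| = G y * r n y by rewrite ger0_norm// mulr_ge0.
  have -> : `|expR (- (t * dot y y)) * S y| = G y * S y by rewrite ger0_norm// mulr_ge0.
  rewrite (FE n y) normrM Gr.
  rewrite mulrCA ler_wpM2l//.
  have r1 : r n y <= reg_weight Rp k 1 y by apply: reg_weight_le => //; rewrite en en1.
  apply: ler_pM => //.
  rewrite (le_trans (ler_normD _ _))// lerD//.
    rewrite (le_trans (ler_normB _ _))// lerD//.
      by rewrite (le_trans (ler_normD _ _))// !normrM.
    by rewrite !normrM.
  rewrite (le_trans (ler_norm_sum _ _ _))//; apply: ler_sum => a _.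
  rewrite normrM ler_wpM2l// (le_trans (ler_normD _ _))// lerD// normrM.
    by rewrite ler_wpM2r// reg_quot_diff.
  by rewrite ler_wpM2l// reg_quot_diff.
split=> //; rewrite -(cvg_lim _ H2)//; apply/cvg_lim => //.
by under eq_fun do rewrite F0; exact: cvg_cst.
Qed.

End weighted_ibp.

Section gauss_decay.
Context {R : realType} {d : nat}.
Implicit Types (y : 'rV[R]_d) (p g : 'rV[R]_d -> R).
Notation lam := (@lebesgue_rV R d).

Definition gauss_decay p := measurable_fun setT p /\
  exists t M, 0 < t /\ forall y, `|p y| <= M * expR (- (t * dot y y)).

Lemma gauss_decay_integrable p : gauss_decay p -> integrableR lam p.
Proof.
move=> [mp [t [M [t0 HM]]]]; apply: integrableR_dom HM => //.
by apply: integrableRZ; exact: integrable_gauss.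
Qed.

Lemma gauss_decayM p g : gauss_decay p -> measurable_fun setT g -> slow g ->
  gauss_decay (fun y => p y * g y).
Proof.
move=> [mp [t [M [t0 HM]]]] mg sg; split; first exact: measurable_funM.
have [M' HM'] := slow_gauss_le t0 sg; exists (t / 2), (`|M| * M'); split; first by rewrite divr_gt0.
move=> y; rewrite -(mulrA `|M|); apply: (le_trans _ (ler_wpM2l (normr_ge0 M) (HM' y))).
rewrite !normrM mulrA ler_wpM2r// (le_trans (HM y))// ger0_norm ?expR_ge0// ler_wpM2r ?expR_ge0//.
exact: ler_norm.
Qed.

Lemma measurable_gauss (t : R) : measurable_fun setT (fun y : 'rV[R]_d => expR (- (t * dot y y))).
Proof.
by apply: continuous_measurable_rV; apply: continuous_expr; apply: continuous_oppr;
  apply: continuous_mulr; [exact: continuous_cstr|exact: continuous_dotxx].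
Qed.

Lemma gauss_decay_gauss (t : R) : 0 < t -> gauss_decay (fun y => expR (- (t * dot y y))).
Proof.
move=> t0; split; first exact: measurable_gauss.
by exists t, 1; split=> // y; rewrite ger0_norm ?expR_ge0// mul1r.
Qed.

End gauss_decay.

Lemma integrableR_sum {dT} {T : measurableType dT} {R : realType} {mu : {measure set T -> \bar R}}
    (I : eqType) (r : seq I) (F : I -> T -> R) : (forall i, i \in r -> integrableR mu (F i)) ->
  integrableR mu (fun x => \sum_(i <- r) F i x) /\
  \int[mu]_x (\sum_(i <- r) F i x) = \sum_(i <- r) \int[mu]_x F i x.
Proof.
elim: r => [_|i r ih iF].
  under eq_fun do rewrite big_nil; rewrite big_nil; split; first exact: integrable0.
  by rewrite /Rintegral integral0.
under eq_fun do rewrite big_cons; rewrite big_cons.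
have iFi : integrableR mu (F i) by apply: iF; exact: mem_head.
have [|i1 e1] := ih; first by move=> j jr; apply: iF; rewrite in_cons jr orbT.
by split; [exact: integrableRD|rewrite (@RintegralD _ _ _ mu setT (F i))// e1].
Qed.

(** * Differentiation of transforms along rays *)

Section dunkl_integral.
Context {R : realType} {d : nat} {Rp : {fset 'rV[R]_d}} {k : 'rV[R]_d -> R}.
Variable data : dunkl_data Rp k.
Implicit Types (x y z h a : 'rV[R]_d).
Notation lam := (@lebesgue_rV R d).
Notation K := (@dunkl_series R d Rp k).
Notation dK := (@ddunkl_series R d Rp k).

Section series_integral.
Variables (p : 'rV[R]_d -> R) (eps : nat -> R).
Hypotheses (gp : gauss_decay p) (eps1 : forall n, `|eps n| <= 1).

Lemma measurable_dunkl_seriesr x : measurable_fun setT (fun y => K eps y x).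
Proof. by apply: continuous_measurable_rV; exact: (continuous_dunkl_seriesr data eps1). Qed.

Lemma slow_series x : slow (fun y => K eps y x).
Proof.
apply: (slow_le (g := fun y => expR (l1norm x * enorm y))); first exact: slow_exp_enorm.
by move=> y; rewrite mulrC; apply: is_sum_le (dunkl_series_sum data eps1 y x) (is_sum_exp _) => n;
  rewrite normrM (le_trans (ler_piMl _ (eps1 _)))// exprMn mulrAC; exact: dunkl_poly_le.
Qed.

Definition series_integral x := \int[lam]_y (p y * K eps y x).

Let integrable_p g : measurable_fun setT g -> slow g -> integrableR lam (fun y => p y * g y).
Proof. by move=> mg sg; apply: gauss_decay_integrable; exact: gauss_decayM. Qed.

Lemma dunkl_series_lipschitz y x h t : `|t| <= 1 ->
  `|K eps y (x + t *: h) - K eps y x| <= 2 * `|t| * expR ((l1norm x + l1norm h) * enorm y).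
Proof.
move=> t1; have := dunkl_series_second_order data eps1 y x h t1.
have := ddunkl_series_le data eps1 y x h; rewrite mulrC; set E := expR _ => h1 h2.
have t2 : `|t| ^+ 2 <= `|t| by rewrite expr2 ler_piMl.
rewrite -[K eps y (x + _) - _](subrK (t * dK eps y x h)) (le_trans (ler_normD _ _))//.
rewrite [leRHS](_ : _ = E * `|t| + `|t| * E); last by ring.
rewrite lerD//.
  by rewrite (le_trans h2)// ler_wpM2l ?expR_ge0// -[t ^+ 2]real_normK ?num_real.
by rewrite normrM ler_wpM2l.
Qed.

Lemma continuous_series_integral : continuous series_integral.
Proof.
move=> x; pose E y := expR ((l1norm x + d%:R) * enorm y).
have iE : integrableR lam (fun y => `|p y * E y|).
  apply: integrableR_norm; apply: integrable_p; last exact: slow_exp_enorm.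
  apply: continuous_measurable_rV; apply: continuous_expr.
  by apply: continuous_mulr; [exact: continuous_cstr|exact: continuous_enorm].
pose I := \int[lam]_y `|p y * E y|.
have I0 : 0 <= I by apply: Rintegral_ge0.
have L h : enorm h <= 1 -> `|series_integral (x + h) - series_integral x| <= 2 * enorm h * I.
  move=> h1; have [->|h0] := eqVneq h 0.
    by rewrite addr0 subrr normr0 enorm0 mulr0 mul0r.
  pose u := (enorm h)^-1 *: h.
  have hu : h = enorm h *: u by rewrite scalerA mulfV ?enorm_eq0// scale1r.
  have u1 : enorm u = 1.
    by rewrite enormZ ger0_norm ?invr_ge0 ?enorm_ge0// mulVf// enorm_eq0.
  have isr x' : integrableR lam (fun y => p y * K eps y x').
    by apply: integrable_p; [exact: measurable_dunkl_seriesr|exact: slow_series].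
  rewrite /series_integral -(@RintegralB _ _ _ lam setT (fun y => p y * K eps y (x + h)))//; [|exact: isr..].
  apply: (le_trans (le_normr_Rintegral _ _)) => //; first by apply: integrableRB.
  rewrite -RintegralZl//; apply: le_Rintegral => //.
  - by apply: integrableR_norm; exact: integrableRB.
  - exact: integrableRZ.
  move=> y _; rewrite -mulrBr !normrM mulrCA ler_wpM2l// hu (le_trans (dunkl_series_lipschitz _ _ _ _))//.
    by rewrite ger0_norm ?enorm_ge0// -hu.
  rewrite (@ger0_norm _ (enorm h)) ?enorm_ge0// -hu ler_wpM2l ?mulr_ge0 ?enorm_ge0//.
  rewrite [leRHS]ger0_norm ?expR_ge0// ler_expR ler_wpM2r ?enorm_ge0// lerD2l.
  by rewrite (le_trans (l1norm_le _))// u1 mulr1.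
apply/(@cvgrPdist_le R R^o _ (nbhs x)) => e e0.
pose r := Num.min 1 (e / (2 * I + 1)).
have D0 : 0 < 2 * I + 1 by rewrite ltr_wpDl// mulr_ge0.
have r0 : 0 < r by rewrite lt_min ltr01 divr_gt0.
have : \forall x' \near x, enorm (x' - x) < r.
  have ce : continuous (fun z : 'rV[R]_d => enorm (z - x)).
    move=> z; apply: (@continuous_comp _ _ _ (fun z => z - x) (@enorm R d)); last exact: continuous_enorm.
    by apply: (@cvgB R 'rV[R]_d _ (nbhs z)); [exact: cvg_id|exact: cvg_cst].
  have := ce x; rewrite /continuous_at subrr enorm0 => /(@cvgrPdist_lt R R^o _ (nbhs x))/(_ _ r0).
  by apply: filterS => z; rewrite sub0r normrN ger0_norm ?enorm_ge0.
apply: filterS => x' xx'; have := L (x' - x).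
rewrite (_ : x + (x' - x) = x'); last by rewrite addrC subrK.
rewrite distrC (le_trans (ltW xx')) ?ge_min ?lexx// => /(_ isT)/le_trans; apply.
have : enorm (x' - x) <= e / (2 * I + 1) by rewrite (le_trans (ltW xx'))// ge_min lexx orbT.
rewrite ler_pdivlMr// => h; apply: le_trans h.
by have := enorm_ge0 (x' - x); lra.
Qed.

(** Passage of the derivative along the ray under the integral sign. The Lipschitz bound of the
    series, applied to the increment from x to [shrink n *: x], gives a majorant independent of n,
    and the radial equation of the series replaces [eps] by its shift. *)
Lemma rad_series_integral x : rad series_integral x
  (\int[lam]_y (dot x y * p y * K (fun n => eps n.+1) y x) - refl_part (Rp := Rp) (k := k) series_integral x).
Proof.
have isr x' : integrableR lam (fun y => p y * K eps y x').
  by apply: integrable_p; [exact: measurable_dunkl_seriesr|exact: slow_series].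
pose E y := expR ((l1norm x + l1norm (- x)) * enorm y).
have mE : measurable_fun setT E.
  apply: continuous_measurable_rV; apply: continuous_expr.
  by apply: continuous_mulr; [exact: continuous_cstr|exact: continuous_enorm].
have shrinkE n : shrink n *: x = x + n.+1%:R^-1 *: (- x).
  by rewrite /shrink scalerBl scale1r scalerN.
have [||||i1 c1] := @Rintegral_dominated_cvg _ _ _ lam
    (fun n y => n.+1%:R * (p y * K eps y x - p y * K eps y (shrink n *: x)))
    (fun y => p y * dK eps y x x) (fun y => 2 * `|p y * E y|).
- by move=> n; apply: integrableR_measurable; apply: integrableRZ; exact: integrableRB.
- by apply: integrableRZ; apply: integrableR_norm; apply: integrable_p => //; exact: slow_exp_enorm.
- move=> y; have [H] := rad_is_derive (expands_is_derive (dunkl_series_expands data eps1 y x x)).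
  under eq_fun do rewrite -mulrBr mulrCA; apply: cvgM => //; exact: cvg_cst.
- move=> n y; rewrite -mulrBr !normrM mulrCA [leRHS]mulrCA ler_wpM2l// shrinkE distrC.
  have n0 : 0 < n.+1%:R^-1 :> R by rewrite invr_gt0.
  rewrite (le_trans (ler_wpM2l (normr_ge0 _) (dunkl_series_lipschitz y x (- x) _)))//.
    by rewrite gtr0_norm// invf_le1// ler1n.
  rewrite (@gtr0_norm _ n.+1%:R^-1)// normr_nat (@ger0_norm _ (E y)) ?expR_ge0//.
  by rewrite mulrA mulrCA mulfV ?pnatr_eq0// mulr1.
constructor.
rewrite (_ : (fun _ => _) = fun n => \int[lam]_y (n.+1%:R * (p y * K eps y x - p y * K eps y (shrink n *: x)))).
  rewrite (_ : _ - _ = \int[lam]_y (p y * dK eps y x x))//.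
  have eps1' n : `|eps n.+1| <= 1 by [].
  have mK' : measurable_fun setT (fun y => K (fun n => eps n.+1) y x).
    by apply: continuous_measurable_rV; exact: (continuous_dunkl_seriesr data eps1').
  have sK' : slow (fun y => K (fun n => eps n.+1) y x).
    apply: (slow_le (g := fun y => expR (l1norm x * enorm y))); first exact: slow_exp_enorm.
    by move=> y; rewrite mulrC; apply: is_sum_le (dunkl_series_sum data eps1' y x) (is_sum_exp _) => n;
    rewrite normrM (le_trans (ler_piMl _ (eps1' _)))// exprMn mulrAC; exact: dunkl_poly_le.
  have iD b : b \in Rp -> integrableR lam (fun y => k b * (p y * K eps y x - p y * K eps y (reflection b x))).
    by move=> _; apply: integrableRZ; exact: integrableRB.
  have [iS eS] := integrableR_sum iD.
  have i2 : integrableR lam (fun y => dot x y * p y * K (fun n => eps n.+1) y x).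
    under eq_fun do rewrite [dot x _ * _]mulrC -mulrA; apply: integrable_p.
      by apply: measurable_funM => //; exact: measurable_dot.
    by apply: slowM => //; exact: slow_dot.
  have -> : refl_part (Rp := Rp) (k := k) series_integral x = \int[lam]_y
      (\sum_(b <- Rp) k b * (p y * K eps y x - p y * K eps y (reflection b x))).
    rewrite eS; apply: eq_bigr => b _; rewrite RintegralZl//; last exact: integrableRB.
    by rewrite (@RintegralB _ _ _ lam setT (fun y => p y * K eps y x))//; exact: isr.
  rewrite -(@RintegralB _ _ _ lam setT (fun y => dot x y * p y * K (fun n => eps n.+1) y x))//.
  congr (Rintegral _ _ _); apply/funext => y.
  rewrite -[dK eps y x x](addrK (\sum_(b <- Rp) k b * (K eps y x - K eps y (reflection b x)))).
  rewrite dunkl_series_radial// mulrBr; congr (_ - _); first by ring.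
  by rewrite (@mulr_sumr _ _ Rp); apply: eq_bigr => b _; ring.
apply/funext => n; rewrite RintegralZl//; last exact: integrableRB.
by rewrite (@RintegralB _ _ _ lam setT (fun y => p y * K eps y x))//; exact: isr.
Qed.

End series_integral.
End dunkl_integral.
Arguments series_integral {R d} Rp k p eps x.

(** * The heat kernel *)

Section heat_kernel.
Context {R : realType} {d : nat} {Rp : {fset 'rV[R]_d}} {k : 'rV[R]_d -> R}.
Variable data : dunkl_data Rp k.
Implicit Types (x y z h a e : 'rV[R]_d) (t s : R).
Notation lam := (@lebesgue_rV R d).
Notation C := (@kcos R d Rp k).
Notation S := (@ksin R d Rp k).
Notation rho := (dunkl_density Rp k).
Notation c := (dunkl_const Rp k).

Lemma dunkl_const_ge0 : 0 <= c.
Proof.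
by rewrite invr_ge0; apply: Rintegral_ge0 => y _; rewrite mulr_ge0 ?expR_ge0 ?weight_ge0.
Qed.

Lemma density_ge0 y : 0 <= rho y.
Proof. by rewrite mulr_ge0 ?dunkl_const_ge0 ?weight_ge0. Qed.

Lemma densityN y : rho (- y) = rho y. Proof. by rewrite /dunkl_density weightN. Qed.

Lemma measurable_density : measurable_fun setT rho.
Proof. by apply: measurable_funM => //; exact: measurable_weight. Qed.

Lemma slow_density : slow rho.
Proof. by apply: slowM; [exact: slow_cst|exact: slow_weight]. Qed.

Definition gauss_density t y : R := expR (- (t * dot y y)) * rho y.

Lemma gauss_density_ge0 t y : 0 <= gauss_density t y.
Proof. by rewrite mulr_ge0 ?expR_ge0 ?density_ge0. Qed.

Lemma gauss_decay_density t : 0 < t -> gauss_decay (gauss_density t).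
Proof.
move=> t0; apply: gauss_decayM; [exact: gauss_decay_gauss|exact: measurable_density|exact: slow_density].
Qed.

Lemma measurable_kcosr x : measurable_fun setT (C x).
Proof. exact: (measurable_dunkl_seriesr data re_ipow_le1). Qed.
Lemma measurable_ksinr x : measurable_fun setT (S x).
Proof. exact: (measurable_dunkl_seriesr data im_ipow_le1). Qed.

Lemma slow_bounded (g : 'rV[R]_d -> R) : (forall y, `|g y| <= 1) -> slow g.
Proof. by move=> g1; apply: slow_le (slow_cst 1) _. Qed.

Lemma slow_kcosr x : slow (C x). Proof. by apply: slow_bounded => y; exact: kcos_le1. Qed.
Lemma slow_ksinr x : slow (S x). Proof. by apply: slow_bounded => y; exact: ksin_le1. Qed.

Lemma integrable_gauss_density t (g : 'rV[R]_d -> R) : 0 < t -> measurable_fun setT g -> slow g ->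
  integrableR lam (fun y => gauss_density t y * g y).
Proof.
by move=> t0 mg sg; apply: gauss_decay_integrable; apply: gauss_decayM => //; exact: gauss_decay_density.
Qed.

Lemma slow_ddunkl_series eps x e : (forall n, `|eps n| <= 1) ->
  slow (fun y => @ddunkl_series R d Rp k eps x y e).
Proof.
move=> eps1; apply: (slow_le (slow_exp_l1norm (enorm x) (l1norm e))) => y.
exact: ddunkl_series_le.
Qed.

Lemma slow_quot_series eps x a : (forall n, `|eps n| <= 1) -> a != 0 ->
  slow (quot a (@dunkl_series R d Rp k eps x) (@ddunkl_series R d Rp k eps x)).
Proof.
move=> eps1 a0; apply: (slow_le (slowM (slow_cst (2 * l1norm a / dot a a * expR (enorm x)))
  (slow_exp_enorm (enorm x * refl_growth a)))) => y.
rewrite (le_trans (quot_series_le data eps1 _ _ a0))// -[leRHS]mulrA -expRD.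
by rewrite le_eqVlt; apply/orP; left; apply/eqP; congr (_ * expR _); ring.
Qed.

(** Integration by parts in y for the functions [kcos] and [ksin] of y; by symmetry of the kernel
    they are eigenfunctions in y with spectral parameters x and z. *)
Lemma kernel_ibp t x z e : 0 < t ->
  2 * t * \int[lam]_y (gauss_density t y * (dot e y * (C x y * S z y))) =
  dot e z * \int[lam]_y (gauss_density t y * (C x y * C z y)) -
  dot e x * \int[lam]_y (gauss_density t y * (S x y * S z y)).
Proof.
move=> t0.
have mC u : measurable_fun setT (C ^~ u).
  by apply: continuous_measurable_rV; exact: (continuous_kcos data).
have mS u : measurable_fun setT (S ^~ u).
  by apply: continuous_measurable_rV; exact: (continuous_ksin data).
have sC u : slow (C ^~ u) by apply: slow_bounded => y; exact: kcos_le1.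
have sS u : slow (S ^~ u) by apply: slow_bounded => y; exact: ksin_le1.
have [iw] := @weighted_ibp _ _ _ _ data (C ^~ x) (S ^~ z) (fun y => dkcos (Rp := Rp) (k := k) y x)
  (fun y => dksin (Rp := Rp) (k := k) y z) e (fun y h => kcos_derive data y x h) (fun y h => ksin_derive data y z h)
  (mC x) (mS z) (sC x) (sS z)
  (slow_ddunkl_series x e re_ipow_le1) (slow_ddunkl_series z e im_ipow_le1)
  (fun a aRp => slow_quot_series x re_ipow_le1 (dunkl_data_neq0 data aRp))
  (fun a aRp => slow_quot_series z im_ipow_le1 (dunkl_data_neq0 data aRp)) t t0.
pose I1 y := gauss_density t y * (C x y * C z y).
pose I2 y := gauss_density t y * (S x y * S z y).
pose I3 y := gauss_density t y * (dot e y * (C x y * S z y)).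
have mCr := measurable_kcosr; have mSr := measurable_ksinr.
have sCr := slow_kcosr; have sSr := slow_ksinr.
have i1 : integrableR lam I1.
  by apply: integrable_gauss_density => //; [exact: measurable_funM|exact: slowM].
have i2 : integrableR lam I2.
  by apply: integrable_gauss_density => //; [exact: measurable_funM|exact: slowM].
have i3 : integrableR lam I3.
  apply: integrable_gauss_density => //.
    by apply: measurable_funM; [exact: measurable_dot|exact: measurable_funM].
  by apply: slowM; [exact: slow_dot|exact: slowM].
move=> /(congr1 ( *%R c)); rewrite mulr0 -RintegralZl// => H.
apply/esym/eqP; rewrite -subr_eq0; apply/eqP; rewrite -[RHS]H.
rewrite -!(RintegralZl _ _ _)//.
rewrite -(@RintegralB _ _ _ lam setT (fun y => dot e z * I1 y) (fun y => dot e x * I2 y))//; [|exact: integrableRZ..].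
rewrite -(@RintegralB _ _ _ lam setT (fun y => dot e z * I1 y - dot e x * I2 y) (fun y => 2 * t * I3 y))//; last 2 first.
- by apply: integrableRB; exact: integrableRZ.
- exact: integrableRZ.
congr (Rintegral _ _ _); apply/funext => y.
rewrite dunkl_op_kcos// dunkl_op_ksin// /I1 /I2 /I3 /gauss_density /dunkl_density.
by rewrite !(kcosC data y) !(ksinC data y); ring.
Qed.

(** Only the real part of e_k(x,y) conj(e_k(z,y)) appears; the imaginary part is odd in y and
    integrates to 0. *)
Definition heat t x z : R := \int[lam]_y (gauss_density t y * (C x y * C z y + S x y * S z y)).

Lemma heatC t x z : heat t x z = heat t z x.
Proof. by congr (Rintegral _ _ _); apply/funext => y; ring. Qed.

Let iCC t x z : 0 < t -> integrableR lam (fun y => gauss_density t y * (C x y * C z y)).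
Proof.
move=> t0; apply: integrable_gauss_density => //; first by apply: measurable_funM; exact: measurable_kcosr.
by apply: slowM; exact: slow_kcosr.
Qed.

Let iSS t x z : 0 < t -> integrableR lam (fun y => gauss_density t y * (S x y * S z y)).
Proof.
move=> t0; apply: integrable_gauss_density => //; first by apply: measurable_funM; exact: measurable_ksinr.
by apply: slowM; exact: slow_ksinr.
Qed.

Let gpC t z : 0 < t -> gauss_decay (fun y => gauss_density t y * C z y).
Proof.
move=> t0; apply: gauss_decayM; [exact: gauss_decay_density|exact: measurable_kcosr|exact: slow_kcosr].
Qed.

Let gpS t z : 0 < t -> gauss_decay (fun y => gauss_density t y * S z y).
Proof.
move=> t0; apply: gauss_decayM; [exact: gauss_decay_density|exact: measurable_ksinr|exact: slow_ksinr].
Qed.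

Lemma heat_series t z : 0 < t -> heat t ^~ z = (fun x =>
  series_integral Rp k (fun y => gauss_density t y * C z y) (@re_ipow R) x +
  series_integral Rp k (fun y => gauss_density t y * S z y) (@im_ipow R) x).
Proof.
move=> t0; apply/funext => x; rewrite /series_integral.
transitivity (\int[lam]_y (gauss_density t y * (C x y * C z y) + gauss_density t y * (S x y * S z y))).
  by congr (Rintegral _ _ _); apply/funext => y; ring.
rewrite (@RintegralD _ _ _ lam setT (fun y => gauss_density t y * (C x y * C z y)))//; [|exact: iCC|exact: iSS].
by congr (_ + _); congr (Rintegral _ _ _); apply/funext => y; rewrite -/(C _ _) -/(S _ _); ring.
Qed.

Lemma continuous_heat t z : 0 < t -> continuous (heat t ^~ z).
Proof.
move=> t0; rewrite heat_series//; apply: continuous_addr.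
  by apply: continuous_series_integral => //; [exact: gpC|exact: re_ipow_le1].
by apply: continuous_series_integral => //; [exact: gpS|exact: im_ipow_le1].
Qed.

Lemma refl_partD u v x : refl_part (Rp := Rp) (k := k) (fun y => u y + v y) x =
  refl_part (Rp := Rp) (k := k) u x + refl_part (Rp := Rp) (k := k) v x.
Proof. by rewrite /refl_part -big_split/=; apply: eq_bigr => a _; ring. Qed.

(** Radial equation of exp(-(|x|^2 + |z|^2)/(4t)) E_k(x, z/(2t)), the closed form of the heat kernel
    up to a factor, obtained here without that formula. *)
Lemma rad_heat t x z : 0 < t -> rad (heat t ^~ z) x
  ((dot x z - dot x x) / (2 * t) * heat t x z - refl_part (Rp := Rp) (k := k) (heat t ^~ z) x).
Proof.
move=> t0.
have := radD (rad_series_integral data (gpC z t0) (@re_ipow_le1 R) x)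
  (rad_series_integral data (gpS z t0) (@im_ipow_le1 R) x).
rewrite -heat_series// addrACA -opprD -refl_partD -heat_series//.
congr (rad _ _ (_ - _)).
pose J1 y := gauss_density t y * (dot x y * (C z y * S x y)).
pose J2 y := gauss_density t y * (dot x y * (C x y * S z y)).
have iJ u v : integrableR lam (fun y => gauss_density t y * (dot x y * (C u y * S v y))).
  apply: integrable_gauss_density => //.
    by apply: measurable_funM; [exact: measurable_dot|apply: measurable_funM; [exact: measurable_kcosr|exact: measurable_ksinr]].
  by apply: slowM; [exact: slow_dot|apply: slowM; [exact: slow_kcosr|exact: slow_ksinr]].
have -> : \int[lam]_y (dot x y * (gauss_density t y * C z y) * dunkl_series (Rp := Rp) (k := k) (fun n => re_ipow n.+1) y x) =
   - \int[lam]_y J1 y.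
  rewrite -mulN1r -RintegralZl//; last exact: iJ.
  by congr (Rintegral _ _ _); apply/funext => y; rewrite dunkl_series_reS// /J1; ring.
have -> : \int[lam]_y (dot x y * (gauss_density t y * S z y) * dunkl_series (Rp := Rp) (k := k) (fun n => im_ipow n.+1) y x) =
   \int[lam]_y J2 y.
  by congr (Rintegral _ _ _); apply/funext => y; rewrite dunkl_series_imS /J2; ring.
have h1 := kernel_ibp z x x t0; have h2 := kernel_ibp x z x t0.
have -> : heat t x z = \int[lam]_y (gauss_density t y * (C x y * C z y)) + \int[lam]_y (gauss_density t y * (S x y * S z y)).
  rewrite -(@RintegralD _ _ _ lam setT (fun y => gauss_density t y * (C x y * C z y)))//; [|exact: iCC|exact: iSS].
  by congr (Rintegral _ _ _); apply/funext => y; ring.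
have e1 : \int[lam]_y (gauss_density t y * (C z y * C x y)) = \int[lam]_y (gauss_density t y * (C x y * C z y)).
  by congr (Rintegral _ _ _); apply/funext => y; ring.
have e2 : \int[lam]_y (gauss_density t y * (S z y * S x y)) = \int[lam]_y (gauss_density t y * (S x y * S z y)).
  by congr (Rintegral _ _ _); apply/funext => y; ring.
move: h1 h2; rewrite e1 e2 -/(Rintegral _ _ J1) -/(Rintegral _ _ J2).
move: (\int[lam]_y _) (\int[lam]_y J1 y) (\int[lam]_y J2 y) (\int[lam]_y _) => p q q' p' h1 h2.
have t2 : 2 * t != 0 by rewrite mulf_neq0 ?pnatr_eq0// gt_eqF.
by apply: (mulfI t2); rewrite mulrDr mulrN h1 h2; field; rewrite gt_eqF.
Qed.

End heat_kernel.

Section limits.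
Context {dT} {T : measurableType dT} {R : realType} {mu : {measure set T -> \bar R}}.

Lemma Rintegral_fatou (F : nat -> T -> R) (f : T -> R) (B : R) :
  (forall n, integrableR mu (F n)) -> (forall n x, 0 <= F n x) ->
  (forall x, F n x @[n --> \oo] --> f x) -> (forall n, \int[mu]_x F n x <= B) ->
  integrableR mu f /\ \int[mu]_x f x <= B.
Proof.
move=> iF F0 cF FB.
have f0 x : 0 <= f x by rewrite -(cvg_lim _ (cF x))//; apply: limr_ge; [exact: cvgP (cF x)|exact: nearW].
have mf : measurable_fun setT f.
  by apply: (measurable_fun_cvg (h := F)) => [n|x _]; [exact: integrableR_measurable (iF n)|exact: cF].
have H : (\int[mu]_x (f x)%:E <= B%:E)%E.
  have mF n : measurable_fun setT (fun x => (F n x)%:E).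
    by apply/measurable_EFinP; exact: integrableR_measurable (iF n).
  have := @fatou _ _ _ mu setT measurableT (fun n x => (F n x)%:E) mF (fun n x _ => F0 n x).
  rewrite (_ : (fun x => _) = (fun x => (f x)%:E)); last first.
    apply/funext => x; apply: (cvg_limn_einf_sup _).1.
    by apply: cvg_EFin; [exact: nearW|exact: cF].
  move=> /le_trans; apply; rewrite limn_einf_lim; apply: lime_le; first exact: is_cvg_einfs.
  apply: nearW => n; apply: (@le_trans _ _ (\int[mu]_x (F n x)%:E)%E).
    by apply: ereal_inf_lbound; exists n => /=.
  by rewrite Rintegral_EFin// lee_fin.
have i : integrableR mu f by apply: integrableR_ge0 => //; rewrite (le_lt_trans H)// ltry.
by split=> //; rewrite -lee_fin -Rintegral_EFin.
Qed.

End limits.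

(** * Positivity, Gaussian integrals and moments of the heat kernel *)

Section heat_formulas.
Context {R : realType} {d : nat} {Rp : {fset 'rV[R]_d}} {k : 'rV[R]_d -> R}.
Variable data : dunkl_data Rp k.
Hypothesis c0 : dunkl_const Rp k != 0.
Implicit Types (x y z h a e : 'rV[R]_d) (t s : R).
Notation lam := (@lebesgue_rV R d).
Notation C := (@kcos R d Rp k).
Notation S := (@ksin R d Rp k).
Notation w := (dunkl_weight Rp k).
Notation rho := (dunkl_density Rp k).
Notation p := (@gauss_density R d Rp k).
Notation heat := (@heat R d Rp k).

(** Half of the homogeneous dimension d + 2|k| of the measure; equal to lambda_k + 1. *)
Definition hdim : R := d%:R / 2 + abs_mult Rp k.

Lemma hdim_ge0 : 0 <= hdim.
Proof. by rewrite addr_ge0 ?divr_ge0 ?(abs_mult_ge0 data). Qed.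

(** Homogeneity of the weight reduces to t = 1/2, where the normalising constant makes the integral
    1. *)
Lemma Rintegral_gauss_density t : 0 < t -> \int[lam]_y p t y = (2 * t) `^ (- hdim).
Proof.
move=> t0; have t20 : 0 < 2 * t by rewrite mulr_gt0.
pose s := (2 * t) `^ (- 2^-1).
have s0 : 0 < s by rewrite powR_gt0.
have s2 : s ^+ 2 = (2 * t)^-1 by rewrite -powR_mulrn ?ltW// -powRrM mulNr mulVf ?pnatr_eq0// powR_inv1// ltW.
pose f y := expR (- (t * dot y y)) * w y.
have if_ : integrableR lam f.
  apply: integrable_slow => //; [exact: measurable_weight|exact: slow_weight].
have := Rintegral_rV_affine 0 (lt0r_neq0 s0) if_.
have -> : (fun x => f (s *: x + 0)) = (fun x => s `^ (2 * abs_mult Rp k) * (expR (- (enorm x ^+ 2 / 2)) * w x)).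
  apply/funext => x; rewrite addr0 /f weightZ// dotZl dotZr sqr_enorm mulrCA; congr (_ * (expR _ * _)).
  rewrite (_ : s * (s * dot x x) = s ^+ 2 * dot x x); last by ring.
  by rewrite s2; field; rewrite gt_eqF.
have ie : integrableR lam (fun x => expR (- (enorm x ^+ 2 / 2)) * w x).
  have := integrable_slow (t := 2^-1) _ (measurable_weight (Rp := Rp) (k := k)) (slow_weight data).
  rewrite invr_gt0 => /(_ (ltr0Sn R 1)); congr (integrableR _ _); apply/funext => y.
  by rewrite sqr_enorm [2^-1 * _]mulrC.
rewrite RintegralZl// gtr0_norm// => H.
rewrite /gauss_density /dunkl_density.
under eq_Rintegral do rewrite mulrCA.
rewrite RintegralZl// -/f (_ : \int[lam]_y f y = s ^+ d * (s `^ (2 * abs_mult Rp k) * \int[lam]_x (expR (- (enorm x ^+ 2 / 2)) * w x))); last first.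
  by rewrite H mulrA mulfV ?mul1r// expf_neq0// gt_eqF.
pose I := \int[lam]_x (expR (- (enorm x ^+ 2 / 2)) * w x).
have cI : dunkl_const Rp k * I = 1.
  by rewrite /dunkl_const -/I mulVf// -invr_eq0.
rewrite -/I mulrCA [dunkl_const _ _ * _]mulrCA cI mulr1 -(powR_mulrn _ (ltW s0)) -powRD; last first.
  by rewrite (gt_eqF s0) implybT.
by rewrite /s -powRrM; congr (_ `^ _); rewrite /hdim; field.
Qed.

Lemma Rintegral_opp (f : 'rV[R]_d -> R) : integrableR lam f -> \int[lam]_y f (- y) = \int[lam]_y f y.
Proof.
move=> fi; have N1 : -1 != 0 :> R by rewrite oppr_eq0 oner_eq0.
have := Rintegral_rV_affine 0 N1 fi.
rewrite normrN1 expr1n invr1 mul1r => <-.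
by congr (Rintegral _ _ _); apply/funext => y; rewrite scaleN1r addr0.
Qed.

Lemma Rintegral_odd (f : 'rV[R]_d -> R) : integrableR lam f -> (forall y, f (- y) = - f y) ->
  \int[lam]_y f y = 0.
Proof.
move=> fi fN; have := Rintegral_opp fi.
have -> : (fun y => f (- y)) = (fun y => -1 * f y) by apply/funext => y; rewrite fN mulN1r.
by rewrite RintegralZl//; move: (\int[lam]_y _) => z; lra.
Qed.

Lemma gauss_densityN t y : p t (- y) = p t y.
Proof. by rewrite /gauss_density densityN dotNl dotNr opprK. Qed.

Lemma heat_at0 t x : heat t x 0 = \int[lam]_y (p t y * C x y).
Proof. by congr (Rintegral _ _ _); apply/funext => y; rewrite kcos0l// ksin0l// mulr1 mulr0 addr0. Qed.

Lemma rad_exp_dotxx s x : rad (fun z : 'rV[R]_d => expR (s * dot z z)) x (2 * s * dot x x * expR (s * dot x x)).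
Proof.
constructor; have d1 : is_derive (1 : R) (1 : R) (fun r : R => expR (s * dot x x * r ^+ 2)) (2 * s * dot x x * expR (s * dot x x)).
  have dg : is_derive (1 : R) (1 : R) (fun r : R => s * dot x x * r ^+ 2) (2 * s * dot x x).
    have -> : (fun r : R => s * dot x x * r ^+ 2) = (fun=> s * dot x x) * ((fun r : R => r) ^+ 2) by apply/funext.
    by apply: is_derive_eq; rewrite !fctE /GRing.scale/= !expr1n; ring.
  have := @is_derive1_comp R expR _ 1 _ _ (is_derive_expR _) dg.
  by congr (is_derive _ _ _ _); rewrite expr1n mulr1 mulrC.
case: d1 => ud dE.
have /cvgr_dnbhsP/(_ (fun n => - n.+1%:R^-1)) H :
  r^-1 * (expR (s * dot x x * (r *: (1 : R) + 1) ^+ 2) - expR (s * dot x x * 1 ^+ 2)) @[r --> (0 : R)^'] -->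
  2 * s * dot x x * expR (s * dot x x).
  by rewrite -dE; exact: ud.
rewrite (_ : (fun _ => _) = fun n => (- n.+1%:R^-1)^-1 *
  (expR (s * dot x x * (- n.+1%:R^-1 *: (1 : R) + 1) ^+ 2) - expR (s * dot x x * 1 ^+ 2))).
  apply: H; split=> [n|]; first by rewrite oppr_eq0 invr_eq0 pnatr_eq0.
  by rewrite -oppr0; apply: cvgN; exact: cvg_harmonic.
apply/funext => n; rewrite invrN invrK mulNr -mulrN opprB expr1n mulr1.
congr (_ * (_ - expR _)); rewrite dotZl dotZr /shrink.
have -> : (- n.+1%:R^-1 : R)%:A = - n.+1%:R^-1 :> R by exact: mulr1.
by ring.
Qed.

(** For z = 0 the Gaussian factor removes the coefficient in the radial equation. The quotient by
    it, minus its value at 0, solves the equation with reflection terms only and vanishes at the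
    origin, hence everywhere. *)
Lemma heat_gauss t x : 0 < t -> heat t x 0 = (2 * t) `^ (- hdim) * expR (- (dot x x / (4 * t))).
Proof.
move=> t0; set Z := _ `^ _.
have H00 : heat t 0 0 = Z.
  rewrite heat_at0 /Z -Rintegral_gauss_density//; congr (Rintegral _ _ _); apply/funext => y.
  by rewrite kcos0l// mulr1.
pose s := (4 * t)^-1.
have cu : continuous (fun y => heat t y 0 * expR (s * dot y y) - Z).
  apply: continuous_subr; last exact: continuous_cstr.
  apply: continuous_mulr; first exact: continuous_heat.
  apply: continuous_expr; apply: continuous_mulr; [exact: continuous_cstr|exact: continuous_dotxx].
have ru y : rad (fun y => heat t y 0 * expR (s * dot y y) - Z) y
   (- refl_part (Rp := Rp) (k := k) (fun y => heat t y 0 * expR (s * dot y y) - Z) y).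
  have := radB (radM (rad_heat data y 0 t0) (rad_exp_dotxx s y)) (rad_cst Z y).
  congr (rad _ _ _).
  have -> : refl_part (Rp := Rp) (k := k) (fun y => heat t y 0 * expR (s * dot y y) - Z) y =
     refl_part (Rp := Rp) (k := k) (heat t ^~ 0) y * expR (s * dot y y).
    rewrite /refl_part (@mulr_suml _ _ Rp); apply: eq_big_seq => a aRp.
    by rewrite dot_reflection2 ?(dunkl_data_neq0 data aRp)//; ring.
  by rewrite dot0r /s; field; rewrite gt_eqF.
have := maximum_principle0 data cu ru; rewrite dot0l mulr0 expR0 mulr1 H00 subrr => /(_ erefl x)/eqP.
rewrite subr_eq0 => /eqP <-; rewrite -mulrA -expRD /s.
by rewrite (_ : _ + _ = 0) ?expR0 ?mulr1//; field; rewrite gt_eqF.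
Qed.

(** The coefficient (<x,z> - |x|^2)/(2t) grows at most like |x| |z|/(2t), as the positivity
    principle demands; the value at x = 0 is positive by symmetry and [heat_gauss]. *)
Lemma heat_ge0 t x z : 0 < t -> 0 <= heat t x z.
Proof.
move=> t0; apply: (@positivity_principle _ _ _ _ data (heat t ^~ z)
  (fun x => (dot x z - dot x x) / (2 * t)) (enorm z / (2 * t))).
- exact: continuous_heat.
- by move=> y; exact: rad_heat.
- move=> y; rewrite mulrAC ler_pM2r ?invr_gt0 ?mulr_gt0// lerBlDr ler_wpDr ?dot_ge0//.
  by rewrite mulrC (le_trans (ler_norm _))// dot_le.
by rewrite heatC heat_gauss// mulr_gt0 ?expR_gt0 ?powR_gt0 ?mulr_gt0.
Qed.

Lemma gauss_ksin_moment t z e : 0 < t ->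
  \int[lam]_y (p t y * (dot e y * S z y)) = dot e z / (2 * t) * heat t z 0.
Proof.
move=> t0; have := kernel_ibp data 0 z e t0; rewrite dot0r mul0r subr0.
have -> : (fun y => p t y * (dot e y * (C 0 y * S z y))) = (fun y => p t y * (dot e y * S z y)).
  by apply/funext => y; rewrite kcos0l// mul1r.
have -> : (fun y => p t y * (C 0 y * C z y)) = (fun y => p t y * C z y).
  by apply/funext => y; rewrite kcos0l// mul1r.
rewrite -heat_at0 => H; apply: (mulfI (x := 2 * t)); first by rewrite mulf_neq0 ?pnatr_eq0// gt_eqF.
by rewrite H; field; rewrite gt_eqF.
Qed.

Lemma measurable_heat t x : 0 < t -> measurable_fun setT (heat t x).
Proof.
move=> t0; apply: continuous_measurable_rV; rewrite (_ : heat t x = heat t ^~ x); first exact: continuous_heat.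
by apply/funext => z; rewrite heatC.
Qed.

(** For real g the Dunkl transform is [cos_transform g] minus i times [sin_transform g]. *)
Definition cos_transform (g : 'rV[R]_d -> R) y := \int[lam]_z (g z * rho z * C z y).
Definition sin_transform (g : 'rV[R]_d -> R) y := \int[lam]_z (g z * rho z * S z y).

Section swap.
Variable g : 'rV[R]_d -> R.
Hypothesis ig : integrableR lam (fun z => g z * rho z).
Variables (t : R) (x : 'rV[R]_d).
Hypothesis t0 : 0 < t.

Let F z y := g z * rho z * (p t y * (C x y * C z y + S x y * S z y)).

Let mF : measurable_fun setT (fun q : 'rV[R]_d * 'rV[R]_d => F q.1 q.2).
Proof.
have m2 (f : 'rV[R]_d -> R) : measurable_fun setT f -> measurable_fun setT (fun q : 'rV[R]_d * 'rV[R]_d => f q.2).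
  by move=> mf; exact: (measurableT_comp mf measurable_snd).
have m1 (f : 'rV[R]_d -> R) : measurable_fun setT f -> measurable_fun setT (fun q : 'rV[R]_d * 'rV[R]_d => f q.1).
  by move=> mf; exact: (measurableT_comp mf measurable_fst).
apply: measurable_funM; first exact: m1 (integrableR_measurable ig).
apply: measurable_funM; first by apply: m2; have [] := gauss_decay_density data t0.
apply: measurable_funD; apply: measurable_funM.
- by apply: m2; exact: measurable_kcosr.
- exact: measurable_kcos2.
- by apply: m2; exact: measurable_ksinr.
- exact: measurable_ksin2.
Qed.

Let FE z y : `|F z y| <= `|g z * rho z| * (2 * p t y).
Proof.
rewrite /F normrM ler_wpM2l// normrM ger0_norm ?gauss_density_ge0// mulrC ler_wpM2r ?gauss_density_ge0//.
rewrite (le_trans (ler_normD _ _))// !normrM -[2]/(1 + 1) lerD//.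
  by rewrite -[1]mulr1 ler_pM ?kcos_le1.
by rewrite -[1]mulr1 ler_pM ?ksin_le1.
Qed.

(** By Fubini, applying the heat kernel to g amounts to multiplying the transform of g by a Gaussian
    and integrating back against the kernel. *)
Lemma heat_swap :
  integrableR lam (fun z => g z * rho z * heat t x z) /\
  integrableR lam (fun y => p t y * (C x y * cos_transform g y + S x y * sin_transform g y)) /\
  \int[lam]_z (g z * rho z * heat t x z) =
  \int[lam]_y (p t y * (C x y * cos_transform g y + S x y * sin_transform g y)).
Proof.
have iag : integrableR lam (fun z => `|g z * rho z|) by exact: integrableR_norm.
have i2p : integrableR lam (fun y => 2 * p t y).
  by apply: integrableRZ; apply: gauss_decay_integrable; exact: gauss_decay_density.
have icos y : integrableR lam (fun z => g z * rho z * C z y).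
  apply: integrableR_dom iag _.
    apply: measurable_funM; first exact: integrableR_measurable ig.
    by apply: continuous_measurable_rV; exact: (continuous_kcos data).
  by move=> z; rewrite normrM ler_piMr// kcos_le1.
have isin y : integrableR lam (fun z => g z * rho z * S z y).
  apply: integrableR_dom iag _.
    apply: measurable_funM; first exact: integrableR_measurable ig.
    by apply: continuous_measurable_rV; exact: (continuous_ksin data).
  by move=> z; rewrite normrM ler_piMr// ksin_le1.
have E1 z : \int[lam]_y F z y = g z * rho z * heat t x z.
  rewrite RintegralZl//; apply: integrable_gauss_density => //.
    exact: (measurable_funD (measurable_funM (measurable_kcosr data x) (measurable_kcosr data z))
      (measurable_funM (measurable_ksinr data x) (measurable_ksinr data z))).
  exact: (slowD (slowM (slow_kcosr data x) (slow_kcosr data z)) (slowM (slow_ksinr data x) (slow_ksinr data z))).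
have E2 y : \int[lam]_z F z y = p t y * (C x y * cos_transform g y + S x y * sin_transform g y).
  have -> : F ^~ y = (fun z => (p t y * C x y) * (g z * rho z * C z y) + (p t y * S x y) * (g z * rho z * S z y)).
    by apply/funext => z; rewrite /F; ring.
  rewrite (@RintegralD _ _ _ lam setT (fun z => (p t y * C x y) * (g z * rho z * C z y)))//; [|exact: integrableRZ..].
  have -> : \int[lam]_z ((p t y * C x y) * (g z * rho z * C z y)) = (p t y * C x y) * cos_transform g y.
    by rewrite RintegralZl//; exact: icos.
  have -> : \int[lam]_z ((p t y * S x y) * (g z * rho z * S z y)) = (p t y * S x y) * sin_transform g y.
    by rewrite RintegralZl//; exact: isin.
  by ring.
split; [|split].
- by have := integrableR_Rintegral1 mF iag i2p FE; congr (integrableR _ _); apply/funext.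
- apply: (integrableR_dom (g := fun y => (\int[lam]_z `|g z * rho z|) * (2 * p t y))).
  + have := measurable_Rintegral_section2 mF iag i2p FE.
    by congr (measurable_fun _ _); apply/funext => y; rewrite -E2.
  + exact: integrableRZ.
  move=> y; rewrite -E2; have iFy := integrableR_section2 mF iag FE y.
  rewrite (le_trans (le_normr_Rintegral _ iFy))// mulrC -RintegralZl//; apply: le_Rintegral => //.
  - exact: integrableR_norm.
  - exact: integrableRZ.
  by move=> z _; rewrite mulrC FE.
have := Rintegral_Fubini mF iag i2p FE.
under eq_Rintegral do rewrite E1.
by under [in X in _ = X -> _]eq_Rintegral do rewrite E2.
Qed.

End swap.

Lemma gauss_density_heat s t y : 0 < s ->
  p t y * heat s y 0 = (2 * s) `^ (- hdim) * p (t + (4 * s)^-1) y.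
Proof.
move=> s0; rewrite heat_gauss// /gauss_density.
have -> : expR (- ((t + (4 * s)^-1) * dot y y)) = expR (- (t * dot y y)) * expR (- (dot y y / (4 * s))).
  by rewrite -expRD; congr expR; ring.
by ring.
Qed.

Let integrable_gauss_ksin s y e : 0 < s -> integrableR lam (fun z => p s z * (dot e z * S z y)).
Proof.
move=> s0; apply: integrable_gauss_density => //.
  apply: measurable_funM; first exact: measurable_dot.
  by apply: continuous_measurable_rV; exact: (continuous_ksin data).
by apply: slowM; [exact: slow_dot|apply: slow_bounded => z; exact: ksin_le1].
Qed.

Let integrable_gauss_kcos s y e : 0 < s -> integrableR lam (fun z => p s z * (dot e z * C z y)).
Proof.
move=> s0; apply: integrable_gauss_density => //.
  apply: measurable_funM; first exact: measurable_dot.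
  by apply: continuous_measurable_rV; exact: (continuous_kcos data).
by apply: slowM; [exact: slow_dot|apply: slow_bounded => z; exact: kcos_le1].
Qed.

Section moments.
Variables (s t : R) (x : 'rV[R]_d).
Hypotheses (s0 : 0 < s) (t0 : 0 < t).

(** The transform of exp(-s|z|^2) is a multiple of exp(-|y|^2/(4s)), so multiplication by
    exp(-t|y|^2) leads to this parameter. *)
Let t' := t + (4 * s)^-1.
Let t'0 : 0 < t'. Proof. by rewrite addr_gt0// invr_gt0 mulr_gt0. Qed.

Let mass : integrableR lam (fun z => p s z * heat t x z) /\
  \int[lam]_z (p s z * heat t x z) = (2 * s) `^ (- hdim) * heat t' x 0.
Proof.
have ips : integrableR lam (p s) by apply: gauss_decay_integrable; exact: gauss_decay_density.
have [i1 [_ b0]] := heat_swap ips x t0; split=> //; apply: (etrans b0).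
have -> : cos_transform (fun z => expR (- (s * dot z z))) = (fun y => heat s y 0).
  by apply/funext => y; rewrite heat_at0; congr (Rintegral _ _ _); apply/funext => z; rewrite kcosC.
have -> : sin_transform (fun z => expR (- (s * dot z z))) = (fun=> 0).
  apply/funext => y; apply: Rintegral_odd; last first.
    by move=> z; rewrite -/(p s z) -/(p s (- z)) gauss_densityN ksinC// ksinNr// mulrN ksinC.
  apply: integrable_gauss_density => //.
    by apply: continuous_measurable_rV; exact: (continuous_ksin data).
  by apply: slow_bounded => z; exact: ksin_le1.
rewrite heat_at0 -RintegralZl//; last first.
  by apply: integrable_gauss_density => //; [exact: measurable_kcosr|exact: slow_kcosr].
congr (Rintegral _ _ _); apply/funext => y.
have := gauss_density_heat t y s0; rewrite -/t' => H.
by rewrite [RHS]mulrA -H; ring.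
Qed.

Lemma Rintegral_heat_gauss :
  integrableR lam (fun z => p s z * heat t x z) /\
  \int[lam]_z (p s z * heat t x z) =
    (1 + 4 * s * t) `^ (- hdim) * expR (- (s * dot x x / (1 + 4 * s * t))).
Proof.
have [i1 ->] := mass; split=> //.
have st0 : 0 < 1 + 4 * s * t by rewrite addr_gt0// !mulr_gt0.
rewrite heat_gauss// mulrA -powRM ?mulr_ge0 ?(ltW s0) ?(ltW t'0)//.
have st : s != 0 by rewrite gt_eqF.
have e1 : 2 * s * (2 * t') = 1 + 4 * s * t by rewrite /t'; field.
have e2 : 4 * t' = (1 + 4 * s * t) / s by rewrite /t'; field.
rewrite e1 e2; congr (_ * expR (- _)); field; rewrite st/=.
by rewrite (gt_eqF st0).
Qed.

Lemma Rintegral_heat_gauss_dot e :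
  integrableR lam (fun z => dot e z * p s z * heat t x z) /\
  \int[lam]_z (dot e z * p s z * heat t x z) = dot e x / (1 + 4 * s * t) *
    \int[lam]_z (p s z * heat t x z).
Proof.
have ips : integrableR lam (fun z => dot e z * expR (- (s * dot z z)) * rho z).
  have := integrable_gauss_density data s0 (measurable_dot e) (slow_dot e).
  by congr (integrableR _ _); apply/funext => z; rewrite /gauss_density; ring.
have [i1 [_ b0]] := heat_swap ips x t0.
have E : (fun z => dot e z * p s z * heat t x z) = (fun z => dot e z * expR (- (s * dot z z)) * rho z * heat t x z).
  by apply/funext => z; rewrite /gauss_density; ring.
rewrite E; split=> //; rewrite b0 mass.2.
have -> : cos_transform (fun z => dot e z * expR (- (s * dot z z))) = (fun=> 0).
  apply/funext => y; have -> : cos_transform (fun z => dot e z * expR (- (s * dot z z))) y =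
      \int[lam]_z (p s z * (dot e z * C z y)).
    by congr (Rintegral _ _ _); apply/funext => z; rewrite /gauss_density; ring.
  apply: Rintegral_odd; first exact: integrable_gauss_kcos.
  by move=> z; rewrite gauss_densityN dotNr kcosC// kcosNr// kcosC//; ring.
have -> : sin_transform (fun z => dot e z * expR (- (s * dot z z))) = (fun y => dot e y / (2 * s) * heat s y 0).
  apply/funext => y; rewrite -gauss_ksin_moment//.
  by congr (Rintegral _ _ _); apply/funext => z; rewrite /gauss_density (ksinC data z); ring.
have it' : integrableR lam (fun y => p t' y * (dot e y * S x y)).
  have := integrable_gauss_ksin x e t'0; congr (integrableR _ _).
  by apply/funext => y; rewrite ksinC.
transitivity ((2 * s) `^ (- hdim) / (2 * s) * \int[lam]_y (p t' y * (dot e y * S x y))).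
  rewrite -RintegralZl//; congr (Rintegral _ _ _); apply/funext => y.
  rewrite mulr0 add0r; have := gauss_density_heat t y s0; rewrite -/t' => H.
  transitivity (p t y * heat s y 0 * (S x y * dot e y / (2 * s))); first by ring.
  by rewrite H; ring.
rewrite gauss_ksin_moment//.
have st : s != 0 by rewrite gt_eqF.
have st0 : 0 < 1 + 4 * s * t by rewrite addr_gt0// !mulr_gt0.
have e1 : 2 * t' = (1 + 4 * s * t) / (2 * s) by rewrite /t'; field.
rewrite e1; field; rewrite st (gt_eqF st0)//.
Qed.

Let q := 1 + 4 * s * t.

(** Correct to first order at s = 0: the value at s = 0 will be the total mass, and the slope bounds
    the second moment. *)
Lemma heat_gauss_bound :
  expR (- (s * (4 * t * hdim + dot x x))) <= \int[lam]_z (p s z * heat t x z) <= 1.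
Proof.
have q1 : 1 < q by rewrite /q ltrDl !mulr_gt0.
have q0 : 0 < q by rewrite (lt_trans ltr01).
rewrite Rintegral_heat_gauss.2 -/q /powR (gt_eqF q0) -expRD ler_expR -[X in _ && (_ <= X)](@expR0 R) ler_expR.
have lnq : 0 <= ln q <= 4 * s * t.
  rewrite ln_ge0 ?(ltW q1)//= /q le_ln1Dx//.
  by rewrite (lt_trans (ltrN10 R))// !mulr_gt0.
have h1 : 0 <= s * dot x x / q <= s * dot x x.
  rewrite divr_ge0 ?mulr_ge0 ?dot_ge0 ?(ltW s0) ?(ltW q0)//= ler_pdivrMr// ler_peMr ?(ltW q1)//.
  by rewrite mulr_ge0 ?dot_ge0// ltW.
case/andP: lnq => l1 l2; case/andP: h1 => h1 h2.
have m1 := mulr_ge0 hdim_ge0 l1; have m2 := ler_wpM2l hdim_ge0 l2.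
by rewrite mulNr; apply/andP; split; [rewrite -lerN2|]; lra.
Qed.

End moments.

Section moments_limit.
Variables (t : R) (x : 'rV[R]_d).
Hypothesis t0 : 0 < t.

Let s n : R := n.+1%:R^-1.
Let s0 n : 0 < s n. Proof. by rewrite invr_gt0. Qed.

Let cvg_exp_harmonic (u : R) : expR (- (s n * u)) @[n --> \oo] --> (1 : R).
Proof.
have : expR (- (s n * u)) @[n --> \oo] --> expR (- (0 * u)).
  apply: (@continuous_cvg _ _ _ _ _ _ expR); first exact: continuous_expR.
  by apply: cvgN; apply: cvgM; [exact: cvg_harmonic|exact: cvg_cst].
by rewrite mul0r oppr0 expR0.
Qed.

Let cvg_gauss z : expR (- (s n * dot z z)) @[n --> \oo] --> (1 : R).
Proof. exact: cvg_exp_harmonic. Qed.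

Let gauss_le1 n z : expR (- (s n * dot z z)) <= 1.
Proof. by rewrite -expR0 ler_expR oppr_le0 mulr_ge0 ?dot_ge0// ltW. Qed.

(** Fatou's lemma with the factors exp(-s|z|^2), s -> 0, gives integrability; the heat kernel is
    then its own majorant, and the limit is squeezed by [heat_gauss_bound]. *)
Lemma heat_mass : integrableR lam (fun z => heat t x z * rho z) /\
  \int[lam]_z (heat t x z * rho z) = 1.
Proof.
have [||||im _] := @Rintegral_fatou _ _ _ lam (fun n z => p (s n) z * heat t x z) (fun z => heat t x z * rho z) 1.
- by move=> n; have [] := Rintegral_heat_gauss x (s0 n) t0.
- by move=> n z; rewrite mulr_ge0 ?gauss_density_ge0 ?heat_ge0.
- move=> z; rewrite -[X in _ --> X]mul1r; under eq_fun do rewrite /gauss_density -mulrA [rho z * _]mulrC.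
  by apply: cvgM; [exact: cvg_gauss|exact: cvg_cst].
- by move=> n; have /andP[] := heat_gauss_bound x (s0 n) t0.
split=> //.
have [||||_ c1] := @Rintegral_dominated_cvg _ _ _ lam (fun n z => p (s n) z * heat t x z)
   (fun z => heat t x z * rho z) (fun z => heat t x z * rho z).
- by move=> n; have [/integrableR_measurable] := Rintegral_heat_gauss x (s0 n) t0.
- exact: im.
- move=> z; rewrite -[X in _ --> X]mul1r; under eq_fun do rewrite /gauss_density -mulrA [rho z * _]mulrC.
  by apply: cvgM; [exact: cvg_gauss|exact: cvg_cst].
- move=> n z; rewrite ger0_norm; last exact: mulr_ge0 (gauss_density_ge0 _ _) (heat_ge0 _ _ t0).
  rewrite /gauss_density -mulrA [rho z * _]mulrC ler_piMl//.
  exact: mulr_ge0 (heat_ge0 _ _ t0) (density_ge0 _).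
rewrite -(cvg_lim _ c1)//; apply/cvg_lim => //.
apply: (@squeeze_cvgr _ _ _ _ (fun n => expR (- (s n * (4 * t * hdim + dot x x)))) (fun=> 1)).
- by apply: nearW => n; exact: heat_gauss_bound.
- exact: cvg_exp_harmonic.
- exact: cvg_cst.
Qed.

(** Increases |z|^2 out of a difference quotient: a nonnegative bounded substitute for |z|^2 whose
    integral is known from the Gaussian formula. *)
Let D n z : R := n.+1%:R * (1 - expR (- (s n * dot z z))).

Let cvg_D z : D n z @[n --> \oo] --> dot z z.
Proof.
have dE : is_derive (0 : R) (1 : R) (fun r : R => - expR (- (r * dot z z))) (dot z z).
  have dg : is_derive (0 : R) (1 : R) (fun r : R => - (r * dot z z)) (- dot z z).
    have -> : (fun r : R => - (r * dot z z)) = - ((fun r : R => r) * (fun=> dot z z)) by apply/funext.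
    apply: (is_derive_eq (is_deriveN (is_deriveM (is_derive_id (0 : R) (1 : R)) (is_derive_cst (dot z z) (0 : R) (1 : R))))).
    by rewrite /GRing.scale/=; ring.
  have := is_deriveN (@is_derive1_comp R expR _ 0 _ _ (is_derive_expR _) dg).
  by congr (is_derive _ _ _ _); rewrite mul0r oppr0 expR0 mul1r opprK.
have := is_derive_harmonic dE; rewrite (_ : (fun n => _) = D ^~ z)//; apply/funext => n.
by rewrite /D add0r [_%:A]mulr1 mul0r oppr0 expR0 opprK addrC.
Qed.

Let D_ge0 n z : 0 <= D n z.
Proof. by rewrite mulr_ge0// subr_ge0. Qed.

Lemma heat_second_moment : integrableR lam (fun z => heat t x z * rho z * dot z z) /\
  \int[lam]_z (heat t x z * rho z * dot z z) <= 4 * t * hdim + dot x x.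
Proof.
have [im m1] := heat_mass.
have i2 n : integrableR lam (fun z => p (s n) z * heat t x z) by have [] := Rintegral_heat_gauss x (s0 n) t0.
have E n : (fun z => heat t x z * rho z * D n z) =
    (fun z => n.+1%:R * (heat t x z * rho z - p (s n) z * heat t x z)).
  by apply/funext => z; rewrite /D /gauss_density; ring.
apply: (Rintegral_fatou (F := fun n z => heat t x z * rho z * D n z)).
- by move=> n; rewrite E; apply: integrableRZ; exact: integrableRB.
- move=> n z; apply: mulr_ge0 (D_ge0 _ _); exact: mulr_ge0 (heat_ge0 _ _ t0) (density_ge0 _).
- by move=> z; apply: cvgM; [exact: cvg_cst|exact: cvg_D].
move=> n; rewrite E RintegralZl//; last exact: integrableRB.
rewrite (@RintegralB _ _ _ lam setT (fun z => heat t x z * rho z))//; last exact: (i2 n).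
rewrite m1 -ler_pdivlMl// mulrC.
have /andP[h _] := heat_gauss_bound x (s0 n) t0.
have := expR_ge1Dx (- (s n * (4 * t * hdim + dot x x))).
by rewrite -/(s n); lra.
Qed.

Let dot_le_sqr e z : `|dot e z| <= enorm e * (1 + dot z z).
Proof.
rewrite (le_trans (dot_le e z))// ler_wpM2l ?enorm_ge0// -sqr_enorm.
by have := sqr_ge0 (enorm z - 1); have := sqr_ge0 (enorm z); rewrite !expr2; lra.
Qed.

(** The Gaussian factor is removed by dominated convergence, the second moment supplying the
    majorant through |z| <= 1 + |z|^2. *)
Lemma heat_first_moment e : integrableR lam (fun z => heat t x z * rho z * dot e z) /\
  \int[lam]_z (heat t x z * rho z * dot e z) = dot e x.
Proof.
have [im m1] := heat_mass; have [i2 _] := heat_second_moment.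
have hr z : 0 <= heat t x z * rho z by exact: mulr_ge0 (heat_ge0 _ _ t0) (density_ge0 _).
have [||||i1 c1] := @Rintegral_dominated_cvg _ _ _ lam (fun n z => dot e z * p (s n) z * heat t x z)
   (fun z => heat t x z * rho z * dot e z)
   (fun z => enorm e * (heat t x z * rho z + heat t x z * rho z * dot z z)).
- by move=> n; have [/integrableR_measurable] := Rintegral_heat_gauss_dot x (s0 n) t0 e.
- by apply: integrableRZ; exact: integrableRD.
- move=> z; rewrite (_ : (fun n => _) = fun n => expR (- (s n * dot z z)) * (heat t x z * rho z * dot e z)); last first.
    by apply/funext => n; rewrite /gauss_density; ring.
  rewrite -[X in _ --> X]mul1r; apply: cvgM; [exact: cvg_gauss|exact: cvg_cst].
- move=> n z; rewrite (_ : _ * _ = expR (- (s n * dot z z)) * (heat t x z * rho z) * dot e z); last first.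
    by rewrite /gauss_density; ring.
  have e0 : 0 <= expR (- (s n * dot z z)) by exact: expR_ge0.
  rewrite normrM (ger0_norm (mulr_ge0 e0 (hr z))).
  rewrite (_ : enorm e * _ = (heat t x z * rho z) * (enorm e * (1 + dot z z))); last by ring.
  apply: ler_pM (dot_le_sqr e z) => //; first exact: mulr_ge0 e0 (hr z).
  by have := ler_wpM2r (hr z) (gauss_le1 n z); rewrite mul1r.
split=> //; rewrite -(cvg_lim _ c1)//; apply/cvg_lim => //.
have E n : \int[lam]_z (dot e z * p (s n) z * heat t x z) =
    dot e x / (1 + 4 * s n * t) * \int[lam]_z (p (s n) z * heat t x z).
  by have [] := Rintegral_heat_gauss_dot x (s0 n) t0 e.
rewrite (_ : (fun n => _) = fun n => dot e x / (1 + 4 * s n * t) * \int[lam]_z (p (s n) z * heat t x z)); last first.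
  by apply/funext => n; rewrite E.
suff : dot e x / (1 + 4 * s n * t) * \int[lam]_z (p (s n) z * heat t x z) @[n --> \oo] --> dot e x / (1 + 4 * 0 * t) * 1.
  by rewrite mulr0 mul0r addr0 divr1 mulr1.
apply: cvgM.
  apply: cvgM; first exact: cvg_cst.
  apply: cvgV; first by rewrite mulr0 mul0r addr0 oner_neq0.
  apply: cvgD; first exact: cvg_cst.
  apply: cvgM; last exact: cvg_cst.
  by apply: cvgM; [exact: cvg_cst|exact: cvg_harmonic].
apply: (@squeeze_cvgr _ _ _ _ (fun n => expR (- (s n * (4 * t * hdim + dot x x)))) (fun=> 1)).
- by apply: nearW => n; exact: heat_gauss_bound.
- exact: cvg_exp_harmonic.
- exact: cvg_cst.
Qed.

(** Expanding |x - z|^2, the |x|^2 from mass, mean and second moment cancels. The remaining bound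
    tends to 0 with t, uniformly in x. *)
Lemma heat_variance : integrableR lam (fun z => heat t x z * rho z * dot (x - z) (x - z)) /\
  \int[lam]_z (heat t x z * rho z * dot (x - z) (x - z)) <= 4 * t * hdim.
Proof.
have [im m1] := heat_mass; have [i2 m2] := heat_second_moment; have [i1 e1] := heat_first_moment x.
pose A z := heat t x z * rho z.
have -> : (fun z => heat t x z * rho z * dot (x - z) (x - z)) =
    (fun z => dot x x * A z - 2 * (A z * dot x z) + A z * dot z z).
  by apply/funext => z; rewrite !(dotDl, dotDr, dotNl, dotNr) (dotC z x) /A; ring.
have j1 : integrableR lam (fun z => dot x x * A z) by exact: integrableRZ.
have j2 : integrableR lam (fun z => 2 * (A z * dot x z)) by exact: integrableRZ.
have j3 := integrableRB j1 j2; split; first exact: integrableRD.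
rewrite (@RintegralD _ _ _ lam setT (fun z => dot x x * A z - 2 * (A z * dot x z)))//.
rewrite (@RintegralB _ _ _ lam setT (fun z => dot x x * A z))// !RintegralZl// e1 m1.
by move: m2; rewrite /A; lra.
Qed.

End moments_limit.

End heat_formulas.

Lemma measurable_fun_powRl {dT} {T : measurableType dT} {R : realType} (f : T -> R) (p : R) :
  measurable_fun setT f -> measurable_fun setT (fun x => f x `^ p).
Proof.
by move=> mf; apply: (@measurableT_comp _ _ _ _ _ _ (fun z : R => z `^ p)).
Qed.

Lemma measurable_fun_invr {dT} {T : measurableType dT} {R : realType} (f : T -> R) :
  measurable_fun setT f -> measurable_fun setT (fun x => (f x)^-1).
Proof.
move=> mf; rewrite (_ : (fun x => _) = (fun x => f x * (f x * f x) `^ (-1))).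
  by apply: measurable_funM => //; apply: measurable_fun_powRl; exact: measurable_funM.
apply/funext => x; rewrite powR_inv1; last by rewrite -expr2 sqr_ge0.
have [->|f0] := eqVneq (f x) 0; first by rewrite mul0r invr0.
by field.
Qed.

Lemma ge0_integralZl_real {dT} {T : measurableType dT} {R : realType} (mu : {measure set T -> \bar R})
    (c : R) (f : T -> R) : 0 <= c -> measurable_fun setT f -> (forall x, 0 <= f x) ->
  (\int[mu]_x (c * f x)%:E = c%:E * \int[mu]_x (f x)%:E)%E.
Proof.
move=> c0 mf f0; under eq_integral do rewrite EFinM.
by rewrite ge0_integralZl//; [exact/measurable_EFinP|move=> x _; rewrite lee_fin].
Qed.

(** * Gamma and Beta integrals *)

Section gamma_kernel.
Context {R : realType}.
Implicit Types (a b c s t : R).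
Notation leb := (@lebesgue_measure R).

(** Extended by 0 to the whole line, so that Tonelli applies without restricted domains. The value c
    = 0 leaves the pure power s^(a-1), the density of the superpositions of Gaussians. *)
Definition gamma_kernel a c s : R := if 0 < s then s `^ (a - 1) * expR (- (c * s)) else 0.

Lemma gamma_kernel_ge0 a c s : 0 <= gamma_kernel a c s.
Proof. by rewrite /gamma_kernel; case: ifP => // _; rewrite mulr_ge0 ?powR_ge0 ?expR_ge0. Qed.

Lemma gamma_kernel_le0 a c s : s <= 0 -> gamma_kernel a c s = 0.
Proof. by move=> s0; rewrite /gamma_kernel ltNge s0. Qed.

Lemma measurable_if_pos (f : R -> R) : measurable_fun setT f ->
  measurable_fun setT (fun s : R => if 0 < s then f s else 0).
Proof.
move=> mf; apply: measurable_fun_ifT => //.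
by apply: (measurable_fun_ltr (f := fun=> 0) (g := fun s : R => s)).
Qed.

Lemma measurable_gamma_kernel a c : measurable_fun setT (gamma_kernel a c).
Proof.
apply: measurable_if_pos; apply: measurable_funM; first exact: measurable_powR.
by apply: measurableT_comp => //; apply: measurableT_comp => //; exact: measurable_funM.
Qed.

(** The inequality u <= exp u at u = e s / a, raised to the power a. *)
Lemma powR_le_exp a e s : 0 < s -> 0 < a -> 0 < e -> s `^ a <= (a / e) `^ a * expR (e * s).
Proof.
move=> s0 a0 e0.
have h : s <= a / e * expR (e * s / a).
  have := expR_ge1Dx (e * s / a); move: (expR _) => E h.
  have h2 : e * s / a <= E by lra.
  rewrite -ler_pdivrMl ?divr_gt0// invf_div.
  by rewrite (_ : e / a * s = e * s / a)//; ring.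
have -> : expR (e * s) = expR (e * s / a) `^ a.
  by rewrite /powR gt_eqF ?expR_gt0// expRK; congr expR; field; rewrite gt_eqF.
rewrite -powRM ?expR_ge0 ?divr_ge0 ?(ltW a0) ?(ltW e0)//.
by rewrite ge0_ler_powR ?nnegrE ?(ltW a0) ?(ltW s0)// mulr_ge0 ?divr_ge0 ?expR_ge0 ?(ltW a0) ?(ltW e0).
Qed.

(** The derivative of the bounded function [F a], and of order s^(a-1) at 0: an integrable majorant
    whose integral needs no improper calculus of its own. *)
Let f a s : R := a * s `^ (a - 1) / (1 + s `^ a) ^+ 2.
Let F a s : R := - (1 + s `^ a)^-1.

Let dF a s : 0 < s -> is_derive s 1 (F a) (f a s).
Proof.
move=> s0; have d1 := is_derive1_powR a s0.
have p0 : 1 + s `^ a != 0 by rewrite gt_eqF// ltr_wpDr ?powR_ge0.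
have d2 : is_derive s (1 : R) (fun r : R => 1 + r `^ a) (a * s `^ (a - 1)).
  have := is_deriveD (is_derive_cst (1 : R) s (1 : R)) d1.
  by rewrite add0r.
have := is_deriveN (@is_deriveV R (fun r => 1 + r `^ a) s _ _ p0 d2).
by congr (is_derive _ _ _ _); rewrite /f /GRing.scale/=; field.
Qed.

Lemma continuous_powR_pos p s : 0 < s -> {for s, continuous (fun s : R => s `^ p)}.
Proof.
by move=> s0; apply: differentiable_continuous; apply/derivable1_diffP; have [] := is_derive1_powR p s0.
Qed.

Let cF a s : 0 < s -> {for s, continuous (F a)}.
Proof.
by move=> s0; apply: differentiable_continuous; apply/derivable1_diffP; have [] := dF a s0.
Qed.

Let cf a s : 0 < s -> {for s, continuous (f a)}.
Proof.
move=> s0; have p0 : 1 + s `^ a != 0 by rewrite gt_eqF// ltr_wpDr ?powR_ge0.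
apply: (@cvgM _ _ (nbhs s)); first by apply: cvgM; [exact: cvg_cst|exact: continuous_powR_pos].
apply: cvgV; first by rewrite expf_neq0.
have c1 : 1 + x `^ a @[x --> s] --> 1 + s `^ a.
  by apply: cvgD; [exact: cvg_cst|exact: continuous_powR_pos].
exact: (@cvgM _ _ (nbhs s) _ _ _ _ _ c1 c1).
Qed.

Let f_ge0 a s : 0 < a -> 0 <= f a s.
Proof.
by move=> a0; rewrite /f divr_ge0 ?sqr_ge0// mulr_ge0 ?powR_ge0// ltW.
Qed.

Lemma integrable_gamma_majorant a : 0 < a ->
  integrableR leb (fun s => if 0 < s then f a s else 0).
Proof.
(* The intervals [1/(n+2), n+2] exhaust the positive half-line; starting at 2 keeps them
   nondegenerate. *)
move=> a0; pose l n : R := n.+2%:R^-1; pose r n : R := n.+2%:R.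
have l0 n : 0 < l n by rewrite invr_gt0.
have lr n : l n < r n by rewrite (lt_le_trans (y := 1))// /l /r ?ler1n// invf_lt1// ltr1n.
have cfn n : {within `[l n, r n], continuous (f a)}.
  apply: continuous_in_subspaceT => s; rewrite inE/= in_itv/= => /andP[ls _].
  by apply: cf; exact: lt_le_trans (l0 n) ls.
have ifn n : leb.-integrable `[l n, r n] (EFin \o f a).
  by apply: continuous_compact_integrable => //; exact: segment_compact.
have Fn n : \int[leb]_(s in `[l n, r n]) f a s <= 1.
  rewrite -lee_fin /Rintegral fineK; last exact: integrable_fin_num.
  rewrite (@continuous_FTC2 _ _ (F a)) => [| |//| |].
  - rewrite -EFinB lee_fin /F opprK addrC lerBlDr.
    apply: (@le_trans _ _ 1); last by rewrite lerDl invr_ge0 addr_ge0 ?powR_ge0.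
    by rewrite invf_le1 ?ltr_wpDr ?powR_ge0// lerDl powR_ge0.
  - exact: lr.
  - split.
    + by move=> s; rewrite in_itv/= => /andP[ls _]; have [] := dF a (lt_trans (l0 n) ls).
    + by apply: cvg_at_right_filter; apply: cF; exact: l0.
    + by apply: cvg_at_left_filter; apply: cF; exact: lt_trans (l0 n) (lr n).
  - move=> s; rewrite in_itv/= => /andP[ls _].
    by rewrite derive1E (@derive_val _ _ _ _ _ _ _ (dF a (lt_trans (l0 n) ls))).
have [||||//] := @Rintegral_fatou _ _ _ leb (fun n => f a \_ `[l n, r n]) (fun s => if 0 < s then f a s else 0) 1.
- by move=> n; have := (@integrable_mkcond _ (measurableTypeR R) R leb `[l n, r n]%classic (EFin \o f a) (measurable_itv _)).1 (ifn n); rewrite restrict_EFin.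
- by move=> n s; rewrite patchE; case: ifP => // _; exact: f_ge0.
- move=> s; case: ifPn => s0; last first.
    rewrite (_ : (fun n => _) = fun=> 0); first exact: cvg_cst.
    apply/funext => n; rewrite patchE memNset//= in_itv/= => /andP[ls _].
    by move: s0; rewrite (lt_le_trans (l0 n) ls).
  apply: cvg_near_cst; near=> n; rewrite patchE mem_set//= in_itv/=; apply/andP; split.
    near: n; exists (Num.trunc s^-1) => // m /= Nm.
    rewrite /l -[s]invrK lef_pV2 ?posrE ?invr_gt0// (le_trans (ltW (truncnS_gt _)))//.
    by rewrite ler_nat ltnS (leq_trans Nm).
  near: n; exists (Num.trunc s) => // m /= Nm.
  by rewrite (le_trans (ltW (truncnS_gt _)))// /r ler_nat ltnS (leq_trans Nm).
- by move=> n; rewrite -Rintegral_mkcond; exact: Fn.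
Unshelve. all: by end_near.
Qed.

Lemma integrable_gamma_kernel a c : 0 < a -> 0 < c -> integrableR leb (gamma_kernel a c).
Proof.
move=> a0 c0; have c20 : 0 < c / 2 by rewrite divr_gt0.
pose A := (a / (c / 2)) `^ a.
have A0 : 0 <= A by exact: powR_ge0.
pose M := (1 + A) ^+ 2 / a.
apply: (@integrableR_dom R _ (measurableTypeR R) leb (fun s => M * (if 0 < s then f a s else 0))).
- exact: measurable_gamma_kernel.
- by apply: integrableRZ; exact: integrable_gamma_majorant.
move=> s; rewrite ger0_norm ?gamma_kernel_ge0// /gamma_kernel; case: ifPn => s0; last by rewrite mulr0.
have h1 := powR_le_exp s0 a0 c20; rewrite -/A in h1.
have E1 : 1 <= expR (c / 2 * s) by rewrite -[X in X <= _](@expR0 R) ler_expR mulr_ge0 ?(ltW c20) ?(ltW s0).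
have h2 : 1 + s `^ a <= (1 + A) * expR (c / 2 * s) by rewrite mulrDl mul1r lerD.
have p0 : 0 < 1 + s `^ a by rewrite ltr_wpDr ?powR_ge0.
have h3 : (1 + s `^ a) ^+ 2 <= (1 + A) ^+ 2 * expR (c * s).
  have -> : expR (c * s) = expR (c / 2 * s) ^+ 2 by rewrite expr2 -expRD; congr expR; field.
  by rewrite -exprMn lerXn2r ?nnegrE ?(ltW p0)// mulr_ge0 ?expR_ge0 ?addr_ge0.
have -> : M * f a s = s `^ (a - 1) * ((1 + A) ^+ 2 / (1 + s `^ a) ^+ 2).
  by rewrite /M /f; field; rewrite (gt_eqF a0) (gt_eqF p0).
rewrite ler_wpM2l ?powR_ge0// ler_pdivlMr ?exprn_gt0// expRN mulrC ler_pdivrMr ?expR_gt0//.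
Qed.

Lemma GammaE a : Gamma a = \int[leb]_s gamma_kernel a 1 s.
Proof.
rewrite /Gamma /Rintegral integral_mkcond; congr fine; apply: eq_integral => s _.
rewrite patchE /gamma_kernel mul1r; case: ifPn.
  by rewrite inE/= in_itv/= andbT => ->.
by rewrite notin_setE/= in_itv/= andbT => /negP/negbTE ->.
Qed.

Lemma integral_gamma_kernel a c : 0 < a -> 0 < c ->
  (\int[leb]_s (gamma_kernel a c s)%:E = (Gamma a * c `^ (- a))%:E)%E.
Proof.
move=> a0 c0; have ci : 0 < c^-1 by rewrite invr_gt0.
rewrite (ge0_integral_pos_affine 0 ci) => [|//|s]; last 2 first.
- by apply/measurable_EFinP; exact: measurable_gamma_kernel.
- by rewrite lee_fin gamma_kernel_ge0.
rewrite GammaE mulrC EFinM -(Rintegral_EFin (integrable_gamma_kernel a0 ltr01)).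
rewrite (_ : (c `^ (- a))%:E = (c^-1)%:E * (c `^ (1 - a))%:E)%E; last first.
  rewrite -EFinM; congr EFin; rewrite -powR_inv1 ?(ltW c0)// -powRD; last by rewrite (gt_eqF c0) implybT.
  by congr (_ `^ _); ring.
rewrite -muleA; congr (_ * _)%E; rewrite -ge0_integralZl//; last 3 first.
- by apply/measurable_EFinP; exact: measurable_gamma_kernel.
- by move=> s _; rewrite lee_fin gamma_kernel_ge0.
- by rewrite lee_fin powR_ge0.
apply: eq_integral => s _; rewrite -EFinM addr0; congr EFin; rewrite /gamma_kernel pmulr_rgt0//.
case: ifPn => s0; last by rewrite mulr0.
rewrite mulVKf ?gt_eqF// mul1r powRM ?(ltW ci) ?(ltW s0)// mulrA; congr (_ * _ * _).
by rewrite -powR_inv1 ?(ltW c0)// -powRrM; congr (_ `^ _); ring.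
Qed.

Lemma Gamma_gt0 a : 0 < a -> 0 < Gamma a.
Proof.
move=> a0; have ik := integrable_gamma_kernel a0 ltr01.
(* Lower bound of the integrand on [1, 2], where s^(a-1) >= 1/s >= 1/2 and exp(-s) >= exp(-2). *)
pose m : R := expR (- 2) / 2.
have m0 : 0 < m by rewrite divr_gt0 ?expR_gt0.
rewrite GammaE -lte_fin -Rintegral_EFin// (@lt_le_trans _ _ (\int[leb]_(s in `[1%R, 2%R]) (gamma_kernel a 1 s)%:E)%E)//; last first.
  apply: ge0_subset_integral => //.
  - by apply/measurable_EFinP; exact: measurable_gamma_kernel.
  - by move=> s _; rewrite lee_fin gamma_kernel_ge0.
apply: (@lt_le_trans _ _ (\int[leb]_(s in `[1%R, 2%R]) m%:E)%E).
  by rewrite integral_cst//= lebesgue_measure_itv/= lte_fin ltr1n -EFinB -EFinM lte_fin mulr_gt0// subr_gt0 ltr1n.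
apply: ge0_le_integral => //.
- by move=> s _; rewrite lee_fin ltW.
- by apply/measurable_EFinP; apply: measurable_funTS; exact: measurable_gamma_kernel.
move=> s; rewrite /= in_itv/= => /andP[s1 s2]; rewrite lee_fin.
have s0 : 0 < s by exact: lt_le_trans s1.
rewrite /gamma_kernel s0 /m mulrC mul1r; apply: ler_pM => //; rewrite ?expR_ge0//; last by rewrite ler_expR lerN2.
rewrite powRB ?(gt_eqF s0) ?implybT// powRr1 ?(ltW s0)// ler_pdivlMr// mulrC ler_pdivrMr// mulrC.
rewrite (le_trans s2)// ler_peMr//.
have : 1 `^ a <= s `^ a by rewrite ge0_ler_powR ?nnegrE ?(ltW a0) ?(ltW s0).
by rewrite powR1.
Qed.

Lemma norm_expR_sub1 (x : R) : `|expR x - 1| <= `|x| * expR `|x|.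
Proof.
have [x0|x0] := leP 0 x.
  rewrite (ger0_norm x0) ger0_norm ?subr_ge0; last by rewrite -[X in X <= _](@expR0 R) ler_expR.
  have := expR_ge1Dx (- x); rewrite expRN => h.
  have := ler_wpM2r (expR_ge0 x) h; rewrite mulVf ?gt_eqF ?expR_gt0//; lra.
rewrite (ltr0_norm x0) ltr0_norm ?subr_lt0; last by rewrite -[X in _ < X](@expR0 R) ltr_expR.
have h := expR_ge1Dx x; have h2 : 1 <= expR (- x) by rewrite -[X in X <= _](@expR0 R) ler_expR oppr_ge0 ltW.
have h3 : 0 <= - x by rewrite oppr_ge0 ltW.
by have := ler_wpM2l h3 h2; lra.
Qed.

(** Differentiation under the integral sign. The difference quotients of s^h are at most |ln s|
    exp(|h| |ln s|), and the logarithm is absorbed into a power of s or of 1/s. *)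
Lemma derivable_Gamma a : 0 < a -> derivable (@Gamma R) a 1.
Proof.
(* The majorant has the exponents a + 2 de and a - 2 de, so a - 2 de has to stay positive. *)
move=> a0; pose de := a / 4; have de0 : 0 < de by rewrite divr_gt0.
pose L := \int[leb]_s (gamma_kernel a 1 s * ln s).
suff H : h^-1 *: (Gamma (h *: (1 : R) + a) - Gamma a) @[h --> 0^'] --> L by apply: cvgP H.
apply/cvgr_dnbhsP => u [u0 cu].
have [N uN] : exists N, forall n, (N <= n)%N -> `|u n| <= de.
  have /cvgrPdist_le/(_ _ de0)[N _ H] := cu; exists N => n Nn.
  by have := H n Nn; rewrite sub0r normrN.
rewrite -(cvg_shiftn N).
have ik h : `|h| <= de -> integrableR leb (gamma_kernel (h + a) 1).
  move=> hd; apply: integrable_gamma_kernel => //.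
  by have := ler_norm (- h); rewrite normrN /de in hd *; lra.
have [||||_ c1] := @Rintegral_dominated_cvg _ _ _ leb
  (fun n s => (u (n + N)%N)^-1 * (gamma_kernel (u (n + N)%N + a) 1 s - gamma_kernel a 1 s))
  (fun s => gamma_kernel a 1 s * ln s)
  (fun s => de^-1 * (gamma_kernel (a + 2 * de) 1 s + gamma_kernel (a - 2 * de) 1 s)).
- move=> n; apply: measurable_funM => //; apply: measurable_funB; exact: measurable_gamma_kernel.
- apply: integrableRZ; apply: integrableRD; apply: integrable_gamma_kernel => //.
    by rewrite addr_gt0// mulr_gt0.
  by rewrite /de; lra.
- move=> s; rewrite /gamma_kernel; case: ifPn => s0; last first.
    under eq_fun do rewrite subrr mulr0; rewrite mul0r; exact: cvg_cst.
  have dE : is_derive (0 : R) (1 : R) (fun h : R => expR (h * ln s)) (ln s).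
    have dg : is_derive (0 : R) (1 : R) (fun h : R => h * ln s) (ln s).
      have := is_deriveM (is_derive_id (0 : R) (1 : R)) (is_derive_cst (ln s) (0 : R) (1 : R)).
      by congr (is_derive _ _ _ _); rewrite /GRing.scale/=; ring.
    have := @is_derive1_comp R expR _ 0 _ _ (is_derive_expR _) dg.
    by congr (is_derive _ _ _ _); rewrite mul0r expR0 mul1r.
  have [dd dv] := dE.
  have /cvgr_dnbhsP/(_ (fun n => u (n + N)%N)) H :
    h^-1 * (expR ((h *: (1 : R) + 0) * ln s) - expR (0 * ln s)) @[h --> (0 : R)^'] --> ln s.
    by rewrite -[X in _ --> X]dv; exact: dd.
  rewrite (_ : (fun n => _) = fun n => s `^ (a - 1) * expR (- (1 * s)) *
    ((u (n + N)%N)^-1 * (expR ((u (n + N)%N *: (1 : R) + 0) * ln s) - expR (0 * ln s)))); last first.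
    apply/funext => n; rewrite addr0 [_%:A]mulr1 mul0r expR0.
    have -> : u (n + N)%N + a - 1 = (a - 1) + u (n + N)%N by ring.
    by rewrite powRD ?(gt_eqF s0) ?implybT// [s `^ u _]/powR (gt_eqF s0); ring.
  apply: cvgM; first exact: cvg_cst.
  apply: H; split=> [n|]; first exact: u0.
  by rewrite cvg_shiftn.
- move=> n s; set h := u (n + N)%N; have hd : `|h| <= de by apply: uN; rewrite leq_addl.
  have h0 : h != 0 by exact: u0.
  rewrite /gamma_kernel; case: ifPn => s0; last by rewrite subrr mulr0 addr0 mulr0 normr0.
  have -> : h + a - 1 = (a - 1) + h by ring.
  have -> : a + 2 * de - 1 = (a - 1) + 2 * de by ring.
  have -> : a - 2 * de - 1 = (a - 1) - 2 * de by ring.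
  have PD q : s `^ ((a - 1) + q) = s `^ (a - 1) * s `^ q by rewrite powRD// (gt_eqF s0) implybT.
  rewrite !PD.
  set A := s `^ (a - 1) * expR (- (1 * s)).
  have A0 : 0 <= A by rewrite mulr_ge0 ?powR_ge0 ?expR_ge0.
  have -> : h^-1 * (s `^ (a - 1) * s `^ h * expR (- (1 * s)) - A) = A * (h^-1 * (s `^ h - 1)).
    by rewrite /A; ring.
  rewrite [leRHS](_ : _ = A * (de^-1 * (s `^ (2 * de) + s `^ (- (2 * de))))); last by rewrite /A; ring.
  rewrite normrM (ger0_norm A0) ler_wpM2l// normrM normfV.
  rewrite /powR (gt_eqF s0) ler_pdivrMl ?normr_gt0//.
  rewrite (le_trans (norm_expR_sub1 _))// normrM -(mulrA `|h|) ler_wpM2l//.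
  have h1 : `|ln s| <= de^-1 * expR (de * `|ln s|).
    rewrite -ler_pdivrMl ?invr_gt0// invrK.
    by have := expR_ge1Dx (de * `|ln s|); move: (expR _) => E; lra.
  have h2 : expR (`|h| * `|ln s|) <= expR (de * `|ln s|) by rewrite ler_expR ler_wpM2r.
  rewrite (le_trans (ler_pM _ _ h1 h2)) ?expR_ge0// -(mulrA de^-1) ler_wpM2l ?invr_ge0 ?(ltW de0)// -expRD.
  have [l0|l0] := leP 0 (ln s).
    rewrite (ger0_norm l0) -mulrDl -[leLHS]addr0 lerD ?expR_ge0// ler_expR.
    by rewrite le_eqVlt; apply/orP; left; apply/eqP; ring.
  rewrite (ltr0_norm l0) -mulrDl -[leLHS]add0r lerD ?expR_ge0// ler_expR.
  by rewrite le_eqVlt; apply/orP; left; apply/eqP; ring.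
rewrite (_ : (fun n => _) = fun n => \int[leb]_s ((u (n + N)%N)^-1 *
  (gamma_kernel (u (n + N)%N + a) 1 s - gamma_kernel a 1 s)))//.
apply/funext => n; have hd : `|u (n + N)%N| <= de by apply: uN; rewrite leq_addl.
have ia : integrableR leb (gamma_kernel a 1) by exact: integrable_gamma_kernel.
rewrite RintegralZl//; last by apply: integrableRB => //; exact: ik.
rewrite (@RintegralB _ _ _ leb setT (gamma_kernel (u (n + N)%N + a) 1))//; last exact: ik.
by rewrite -!GammaE [_%:A]mulr1.
Qed.

Lemma is_derive_ln_Gamma a : 0 < a -> is_derive a 1 (fun s => ln (Gamma s)) (digamma a).
Proof.
move=> a0; have g0 := Gamma_gt0 a0; have dG := derivable_Gamma a0.
have D : is_derive a (1 : R) (@Gamma R) ('D_1 (@Gamma R) a) by exact: DeriveDef.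
have H := @is_derive1_comp R (@ln R) (@Gamma R) a _ _ (is_derive1_ln g0) D.
have d2 := @derive_val _ _ _ _ _ _ _ H; have d1 := @ex_derive _ _ _ _ _ _ _ H.
by constructor; [exact: d1|rewrite /digamma derive1E].
Qed.

End gamma_kernel.

(** * Beta integrals and the origin of Pitt's constant *)

Section beta_prime.
Context {R : realType}.
Implicit Types (a b c s t : R).
Notation leb := (@lebesgue_measure R).

Lemma gamma_kernel0 a s : gamma_kernel a 0 s = if 0 < s then s `^ (a - 1) else 0.
Proof. by rewrite /gamma_kernel mul0r oppr0 expR0 mulr1. Qed.

Lemma measurable_if_snd (f : R * R -> R) : measurable_fun setT f ->
  measurable_fun setT (fun q : R * R => if 0 < q.2 then f q else 0).
Proof.
move=> mf; apply: measurable_fun_ifT => //.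
apply: (measurable_fun_ltr (f := fun=> 0) (g := fun q : R * R => q.2)) => //.
exact: measurable_snd.
Qed.

Lemma measurable_gamma_kernel2 a (phi : R -> R) : measurable_fun setT phi ->
  measurable_fun setT (fun q : R * R => gamma_kernel a (phi q.1) q.2).
Proof.
move=> mphi; apply: measurable_if_snd; apply: measurable_funM.
  by apply: measurable_fun_powRl; exact: measurable_snd.
apply: measurableT_comp => //; apply: measurableT_comp => //; apply: measurable_funM.
  exact: (measurableT_comp mphi measurable_fst).
exact: measurable_snd.
Qed.

Let m1 (f : R -> R) : measurable_fun setT f -> measurable_fun setT (fun q : R * R => f q.1).
Proof. by move=> mf; exact: (measurableT_comp mf measurable_fst). Qed.

Let m2 (f : R -> R) : measurable_fun setT f -> measurable_fun setT (fun q : R * R => f q.2).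
Proof. by move=> mf; exact: (measurableT_comp mf measurable_snd). Qed.

Local Open Scope ereal_scope.

Lemma tonelli_R (f : R -> R -> R) : measurable_fun setT (fun q : R * R => f q.1 q.2) ->
  (forall x y, 0 <= f x y)%R ->
  \int[leb]_x \int[leb]_y (f x y)%:E = \int[leb]_y \int[leb]_x (f x y)%:E.
Proof.
move=> mf f0; apply: (@fubini_tonelli _ _ (measurableTypeR R) (measurableTypeR R) R leb leb (fun q => (f q.1 q.2)%:E)).
  exact/measurable_EFinP.
by move=> q; rewrite lee_fin.
Qed.

(** Gamma(a+b) (1+t)^(-(a+b)) is written as a Gamma integral in v. Exchanging the order, the
    t-integral gives Gamma(b) v^(-b), and Gamma(a) is left over. *)
Lemma beta_prime a b : (0 < a)%R -> (0 < b)%R ->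
  \int[leb]_t (gamma_kernel b 0 t * (1 + t) `^ (- (a + b)))%:E = (Gamma b * Gamma a / Gamma (a + b))%:E.
Proof.
move=> a0 b0; have ab0 : (0 < a + b)%R by exact: addr_gt0.
have G0 := Gamma_gt0 ab0.
have mb := measurable_gamma_kernel b 0.
have mH : measurable_fun setT (fun q : R * R => gamma_kernel b 0 q.1 * gamma_kernel (a + b) (1 + q.1) q.2)%R.
  apply: measurable_funM; first exact: m1.
  apply: (@measurable_gamma_kernel2 _ (fun z => 1 + z)%R).
  by apply: measurable_funD; [exact: measurable_cst|exact: measurable_id].
have H := @tonelli_R (fun t v => gamma_kernel b 0 t * gamma_kernel (a + b) (1 + t) v)%R mH
  (fun t v => mulr_ge0 (gamma_kernel_ge0 _ _ _) (gamma_kernel_ge0 _ _ _)).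
have mfin : measurable_fun setT (fun t => gamma_kernel b 0 t * (1 + t) `^ (- (a + b)))%R.
  apply: measurable_funM; first exact: mb.
  by apply: measurable_fun_powRl; apply: measurable_funD; [exact: measurable_cst|exact: measurable_id].
suff E : (Gamma (a + b))%:E * \int[leb]_t (gamma_kernel b 0 t * (1 + t) `^ (- (a + b)))%:E = (Gamma b * Gamma a)%:E.
  rewrite [RHS](_ : _ = ((Gamma (a + b))^-1)%:E * (Gamma b * Gamma a)%:E); last by rewrite -EFinM mulrC.
  have GV : ((Gamma (a + b))^-1 * Gamma (a + b) = 1)%R by exact: mulVf (lt0r_neq0 G0).
  by rewrite -E muleA -EFinM GV mul1e.
have f0 t : (0 <= gamma_kernel b 0 t * (1 + t) `^ (- (a + b)))%R.
  exact: mulr_ge0 (gamma_kernel_ge0 _ _ _) (powR_ge0 _ _).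
rewrite -(ge0_integralZl_real leb (ltW G0) mfin f0).
transitivity (\int[leb]_t \int[leb]_v (gamma_kernel b 0 t * gamma_kernel (a + b) (1 + t) v)%:E).
  apply: eq_integral => t _.
  rewrite (ge0_integralZl_real leb (gamma_kernel_ge0 b 0 t) (measurable_gamma_kernel _ _) (gamma_kernel_ge0 _ _)).
  have [t0|t0] := ltP 0%R t; last by rewrite gamma_kernel0 ltNge t0/= mul0r mulr0 mul0e.
  have t1 : (0 < 1 + t)%R by rewrite addr_gt0.
  by rewrite (integral_gamma_kernel ab0 t1) -EFinM; congr EFin; ring.
rewrite {}H; transitivity (\int[leb]_v (Gamma b * gamma_kernel a 1 v)%:E).
  apply: eq_integral => v _; have [v0|v0] := ltP 0%R v; last first.
    rewrite (gamma_kernel_le0 a 1 v0) mulr0 integral0_eq// => t _.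
    by rewrite (gamma_kernel_le0 _ _ v0) mulr0.
  have p0 : (0 <= v `^ (a + b - 1) * expR (- v))%R by exact: mulr_ge0 (powR_ge0 _ _) (expR_ge0 _).
  transitivity (\int[leb]_t (v `^ (a + b - 1) * expR (- v) * gamma_kernel b v t)%:E).
    apply: eq_integral => t _; congr EFin; rewrite /gamma_kernel v0; case: ifPn => _; last by rewrite mul0r mulr0.
    have -> : expR (- ((1 + t) * v)) = (expR (- v) * expR (- (v * t)))%R by rewrite -expRD; congr expR; ring.
    by rewrite mul0r oppr0 expR0; ring.
  rewrite (ge0_integralZl_real leb p0 (measurable_gamma_kernel _ _) (gamma_kernel_ge0 _ _)).
  rewrite (integral_gamma_kernel b0 v0) -EFinM; congr EFin; rewrite /gamma_kernel v0 mul1r.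
  have -> : (v `^ (a - 1) = v `^ (a + b - 1) * v `^ (- b))%R.
    rewrite -powRD; last by rewrite (gt_eqF v0) implybT.
    by congr (_ `^ _)%R; ring.
  by ring.
rewrite (ge0_integralZl_real leb (ltW (Gamma_gt0 b0)) (measurable_gamma_kernel _ _) (gamma_kernel_ge0 _ _)).
by rewrite (integral_gamma_kernel a0 ltr01) powR1 mulr1.
Qed.

(** The substitution tau = 4 s t separates the variables and leaves the factor 4^(-b). The
    s-integral is then a Gamma integral with value Gamma(m-b) u^(b-m) up to a power of 1 + tau, and
    the tau-integral is the Beta integral with parameters m and b. *)
Lemma pitt_integral m b u : (0 < b)%R -> (b < m)%R -> (0 < u)%R ->
  \int[leb]_t \int[leb]_s (gamma_kernel b 0 t * (gamma_kernel m 0 s *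
    ((1 + 4 * s * t) `^ (- (2 * m)) * expR (- (s * u / (1 + 4 * s * t))))))%:E =
  (4 `^ (- b) * (Gamma (m - b) / Gamma (m + b)) * (Gamma b * Gamma m) * u `^ (b - m))%:E.
Proof.
move=> b0 bm u0; have m0 : (0 < m)%R by exact: lt_trans bm.
have mb0 : (0 < m - b)%R by rewrite subr_gt0.
pose K t s : R := (gamma_kernel b 0 t * (gamma_kernel m 0 s *
    ((1 + 4 * s * t) `^ (- (2 * m)) * expR (- (s * u / (1 + 4 * s * t))))))%R.
have K0 t s : (0 <= K t s)%R.
  apply: mulr_ge0; first exact: gamma_kernel_ge0.
  apply: mulr_ge0; first exact: gamma_kernel_ge0.
  exact: mulr_ge0 (powR_ge0 _ _) (expR_ge0 _).
have mK : measurable_fun setT (fun q : R * R => K q.1 q.2).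
  apply: measurable_funM; first by apply: m1; exact: measurable_gamma_kernel.
  apply: measurable_funM; first by apply: m2; exact: measurable_gamma_kernel.
  have mq : measurable_fun setT (fun q : R * R => 1 + 4 * q.2 * q.1)%R.
    apply: measurable_funD; first exact: measurable_cst.
    apply: measurable_funM; last exact: measurable_fst.
    by apply: measurable_funM; [exact: measurable_cst|exact: measurable_snd].
  apply: measurable_funM; first exact: measurable_fun_powRl.
  apply: measurableT_comp => //; apply: measurableT_comp => //; apply: measurable_funM.
    by apply: measurable_funM; [exact: measurable_snd|exact: measurable_cst].
  exact: measurable_fun_invr.
rewrite (tonelli_R mK K0).
(* Integrand after the substitution; the power s^(-b) from the Jacobian has been merged into the
   exponent m - b. *)
pose c tau : R := (gamma_kernel b 0 tau * (1 + tau) `^ (- (2 * m)) * 4 `^ (- b))%R.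
pose H s tau : R := (c tau * gamma_kernel (m - b) (u / (1 + tau)) s)%R.
have c0 tau : (0 <= c tau)%R.
  exact: mulr_ge0 (mulr_ge0 (gamma_kernel_ge0 _ _ _) (powR_ge0 _ _)) (powR_ge0 _ _).
have H0 s tau : (0 <= H s tau)%R by exact: mulr_ge0 (c0 _) (gamma_kernel_ge0 _ _ _).
have m1t : measurable_fun setT (fun tau : R => 1 + tau)%R.
  by apply: measurable_funD; [exact: measurable_cst|exact: measurable_id].
have mc : measurable_fun setT c.
  apply: measurable_funM; last exact: measurable_cst.
  by apply: measurable_funM; [exact: measurable_gamma_kernel|exact: measurable_fun_powRl].
have mH : measurable_fun setT (fun q : R * R => H q.1 q.2).
  apply: measurable_funM; first exact: m2.
  have := @measurable_gamma_kernel2 (m - b) (fun tau => u / (1 + tau))%R.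
  have mu : measurable_fun setT (fun tau : R => u / (1 + tau))%R.
    by apply: measurable_funM; [exact: measurable_cst|exact: measurable_fun_invr].
  move=> /(_ mu) mg; exact: (measurableT_comp mg (measurable_swap (T2 := R) (T1 := R))).
transitivity (\int[leb]_s \int[leb]_tau (H s tau)%:E).
  apply: eq_integral => s _; have [s0|s0] := ltP 0%R s; last first.
    rewrite integral0_eq; last by move=> t _; rewrite /K (gamma_kernel_le0 m 0 s0) mul0r mulr0.
    by rewrite integral0_eq// => t _; rewrite /H (gamma_kernel_le0 _ _ s0) mulr0.
  have s4 : (0 < 4 * s)%R by rewrite mulr_gt0.
  have s40 : (0 < (4 * s)^-1)%R by rewrite invr_gt0.
  have mKs : measurable_fun setT (K^~ s) by exact: (measurableT_comp mK (pair2_measurable s)).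
  rewrite (ge0_integral_pos_affine 0 s40); last 2 first.
  - exact/measurable_EFinP.
  - by move=> t; rewrite lee_fin.
  have mA : measurable_fun setT (fun t : R => K ((4 * s)^-1 * t + 0) s)%R.
    apply: (measurableT_comp mKs).
    apply: measurable_funD; last exact: measurable_cst.
    by apply: measurable_funM; [exact: measurable_cst|exact: measurable_id].
  rewrite -(ge0_integralZl_real leb (ltW s40) mA (fun t => K0 _ _)).
  apply: eq_integral => tau _; congr EFin; rewrite /K /H /c addr0 !gamma_kernel0 pmulr_rgt0// s0.
  case: ifPn => tau0; last by rewrite !mul0r mulr0.
  rewrite /gamma_kernel s0.
  have -> : (4 * s * ((4 * s)^-1 * tau) = tau)%R by rewrite mulVKf// gt_eqF.
  have E1 : ((4 * s)^-1 * ((4 * s)^-1 * tau) `^ (b - 1) = 4 `^ (- b) * s `^ (- b) * tau `^ (b - 1))%R.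
    rewrite powRM ?(ltW s40) ?(ltW tau0)// mulrA; congr (_ * _)%R.
    rewrite -powRM ?(ltW s0)// -(powR_inv1 (ltW s4)) -powRrM -powRD; last by rewrite (gt_eqF s4) implybT.
    by congr (_ `^ _)%R; ring.
  have E2 : (s `^ (m - b - 1) = s `^ (m - 1) * s `^ (- b))%R.
    rewrite -powRD; last by rewrite (gt_eqF s0) implybT.
    by congr (_ `^ _)%R; ring.
  have E3 : (s * u / (1 + tau) = u / (1 + tau) * s)%R by ring.
  by rewrite mulrA E1 E2 E3; ring.
rewrite (tonelli_R mH H0).
pose C := (4 `^ (- b) * Gamma (m - b) * u `^ (b - m))%R.
have C0 : (0 <= C)%R by exact: mulr_ge0 (mulr_ge0 (powR_ge0 _ _) (ltW (Gamma_gt0 mb0))) (powR_ge0 _ _).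
transitivity (\int[leb]_tau (C * (gamma_kernel b 0 tau * (1 + tau) `^ (- (m + b))))%:E).
  apply: eq_integral => tau _.
  rewrite (ge0_integralZl_real leb (c0 tau) (measurable_gamma_kernel _ _) (gamma_kernel_ge0 _ _)).
  have [t0|t0] := ltP 0%R tau; last first.
    by rewrite /c (gamma_kernel_le0 b 0 t0) !mul0r mulr0 mul0e.
  have t1 : (0 < 1 + tau)%R by rewrite addr_gt0.
  have ut : (0 < u / (1 + tau))%R by rewrite divr_gt0.
  rewrite (integral_gamma_kernel mb0 ut) -EFinM; congr EFin; rewrite /c /C.
  have -> : ((u / (1 + tau)) `^ (- (m - b)) = u `^ (b - m) * (1 + tau) `^ (m - b))%R.
    rewrite powRM ?(ltW u0) ?invr_ge0 ?(ltW t1)// -(powR_inv1 (ltW t1)) -powRrM.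
    by congr (_ `^ _ * _ `^ _)%R; ring.
  have -> : ((1 + tau) `^ (- (m + b)) = (1 + tau) `^ (- (2 * m)) * (1 + tau) `^ (m - b))%R.
    rewrite -powRD; last by rewrite (gt_eqF t1) implybT.
    by congr (_ `^ _)%R; ring.
  by ring.
have mf : measurable_fun setT (fun tau => gamma_kernel b 0 tau * (1 + tau) `^ (- (m + b)))%R.
  by apply: measurable_funM; [exact: measurable_gamma_kernel|exact: measurable_fun_powRl].
rewrite (ge0_integralZl_real leb C0 mf (fun tau => mulr_ge0 (gamma_kernel_ge0 _ _ _) (powR_ge0 _ _))).
by rewrite (beta_prime m0 b0) -EFinM; congr EFin; rewrite /C; ring.
Qed.

End beta_prime.

Section tonelli.
Context {R : realType} {d1 d2} {T1 : measurableType d1} {T2 : measurableType d2}.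
Context (m1 : {sigma_finite_measure set T1 -> \bar R}) (m2 : {sigma_finite_measure set T2 -> \bar R}).
Local Open Scope ereal_scope.

Lemma tonelli_real (f : T1 -> T2 -> R) : measurable_fun setT (fun q : T1 * T2 => f q.1 q.2) ->
  (forall x y, 0 <= f x y)%R ->
  \int[m1]_x \int[m2]_y (f x y)%:E = \int[m2]_y \int[m1]_x (f x y)%:E.
Proof.
move=> mf f0; apply: (@fubini_tonelli _ _ _ _ _ m1 m2 (fun q => (f q.1 q.2)%:E)).
  exact/measurable_EFinP.
by move=> q; rewrite lee_fin.
Qed.

Lemma measurable_ge0_integral (f : T1 -> T2 -> R) : measurable_fun setT (fun q : T1 * T2 => f q.1 q.2) ->
  (forall x y, 0 <= f x y)%R -> measurable_fun setT (fun x => \int[m2]_y (f x y)%:E).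
Proof.
move=> mf f0; apply: (@measurable_fun_fubini_tonelli_F _ _ _ _ _ m2 (fun q => (f q.1 q.2)%:E)).
  exact/measurable_EFinP.
by move=> q; rewrite lee_fin.
Qed.

Lemma measurable_fun_fst (f : T1 -> R) : measurable_fun setT f -> measurable_fun setT (fun q : T1 * T2 => f q.1).
Proof. by move=> mf; exact: (measurableT_comp mf measurable_fst). Qed.

Lemma measurable_fun_snd (f : T2 -> R) : measurable_fun setT f -> measurable_fun setT (fun q : T1 * T2 => f q.2).
Proof. by move=> mf; exact: (measurableT_comp mf measurable_snd). Qed.

End tonelli.

Lemma ge0_le_integral_real {dT} {T : measurableType dT} {R : realType} (mu : {measure set T -> \bar R})
    (f g : T -> \bar R) : measurable_fun setT f -> measurable_fun setT g ->
  (forall x, 0 <= f x)%E -> (forall x, f x <= g x)%E -> (\int[mu]_x f x <= \int[mu]_x g x)%E.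
Proof.
move=> mf mg f0 fg; apply: ge0_le_integral => // x _; exact: fg.
Qed.

Lemma ge0_integralD_real {dT} {T : measurableType dT} {R : realType} (mu : {measure set T -> \bar R})
    (f g : T -> \bar R) : measurable_fun setT f -> measurable_fun setT g ->
  (forall x, 0 <= f x)%E -> (forall x, 0 <= g x)%E ->
  (\int[mu]_x (f x + g x) = \int[mu]_x f x + \int[mu]_x g x)%E.
Proof. by move=> mf mg f0 g0; rewrite ge0_integralD. Qed.

(** A Dirac mass on the parameter space makes the constant 1 integrable, which reduces the claim to
    the version with a product majorant. *)
Lemma measurable_Rintegral_param {R : realType} {d1 d2} {T1 : measurableType d1} {T2 : measurableType d2}
    (m2 : {sigma_finite_measure set T2 -> \bar R}) (F : T1 -> T2 -> R) (g : T2 -> R) (x0 : T1) :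
  measurable_fun setT (fun q : T1 * T2 => F q.1 q.2) -> integrableR m2 g ->
  (forall x y, `|F x y| <= g y) -> measurable_fun setT (fun x => \int[m2]_y F x y).
Proof.
move=> mF ig FG.
apply: (@measurable_Rintegral_section1 R _ _ T1 T2 (\d_ x0) m2 F (fun=> 1) g) => //.
  by apply: finite_measure_integrable_cst.
by move=> x y; rewrite mul1r.
Qed.

Lemma lee_double {R : realType} (j : R) (A : \bar R) :
  (0 <= A)%E -> ((2 * j)%:E <= A + A)%E -> (j%:E <= A)%E.
Proof.
case: A => [r| |]// _; first by rewrite -EFinD !lee_fin; lra.
by move=> _; rewrite leey.
Qed.

Lemma weighted_am_gm {R : realType} (a b r r' v h h' : R) : 0 < h -> 0 < h' ->
    0 <= r -> 0 <= r' -> 0 <= v ->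
  2 * (`|a| * r * (`|b| * r' * v)) <= a ^+ 2 * r / h * (h' * r' * v) + b ^+ 2 * r' / h' * (h * r * v).
Proof.
move=> h0 h'0 r0 r'0 v0.
rewrite -(real_normK (num_real a)) -(real_normK (num_real b)) -subr_ge0.
move: `|a| `|b| => {a} {b} a b.
have -> : a ^+ 2 * r / h * (h' * r' * v) + b ^+ 2 * r' / h' * (h * r * v) - 2 * (a * r * (b * r' * v)) =
   (r * r' * v / (h * h')) * (a * h' - b * h) ^+ 2.
  by field; rewrite (gt_eqF h0) (gt_eqF h'0).
rewrite mulr_ge0 ?sqr_ge0// divr_ge0//; first by rewrite !mulr_ge0.
by rewrite mulr_ge0 ?(ltW h0) ?(ltW h'0).
Qed.

(** * Plancherel and Pitt *)

Section null_origin.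
Context {R : realType} {d : nat}.
Hypothesis d_ge1 : (1 <= d)%N.
Notation lam := (@lebesgue_rV R d).

(** A coordinate is needed: in dimension 0 the measure is a unit mass at the origin. *)
Lemma lebesgue_rV_origin : lam [set 0] = 0%E.
Proof.
have := @lebesgue_rV_box R d (fun=> [set 0]) (fun=> measurable_set1 0).
rewrite (_ : (fun x => _) = [set 0]); last first.
  apply/seteqP; split => [x x0|x xE i] /=; last by rewrite xE mxE.
  by apply/rowP => i; rewrite mxE; exact: x0.
move=> ->; rewrite (bigD1 (Ordinal d_ge1))//= lebesgue_measure_set1 mul0e.
by [].
Qed.

Lemma ge0_integral_off_origin (f g : 'rV[R]_d -> \bar R) :
  measurable_fun setT f -> measurable_fun setT g -> (forall x, 0 <= f x)%E -> (forall x, 0 <= g x)%E ->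
  (forall x, x != 0 -> f x = g x) -> (\int[lam]_x f x = \int[lam]_x g x)%E.
Proof.
move=> mf mg f0 g0 fg; apply: ae_eq_integral => //.
exists [set 0]; split.
- rewrite (_ : [set 0] = (fun x : 'rV[R]_d => dot x x) @^-1` [set 0]).
    by rewrite -[X in measurable X]setTI; apply: measurable_dotxx.
  by apply/seteqP; split => x /= => [->|/eqP]; [rewrite dot0l|rewrite dot_eq0 => /eqP].
- exact: lebesgue_rV_origin.
- move=> x /= /not_implyP[_ fgx]; apply: contrapT => /eqP x0; exact/fgx/fg.
Qed.

End null_origin.

(** * Schur's test and Plancherel's identity for real functions *)

Section plancherel.
Context {R : realType} {d : nat} {Rp : {fset 'rV[R]_d}} {k : 'rV[R]_d -> R}.
Variable data : dunkl_data Rp k.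
Hypothesis c0 : dunkl_const Rp k != 0.
Implicit Types (x y z : 'rV[R]_d) (t s : R).
Notation lam := (@lebesgue_rV R d).
Notation C := (@kcos R d Rp k).
Notation S := (@ksin R d Rp k).
Notation rho := (dunkl_density Rp k).
Notation p := (@gauss_density R d Rp k).
Notation heat := (@heat R d Rp k).
Notation hdim := (@hdim R d Rp k).

Let mrho : measurable_fun setT rho := measurable_density (Rp := Rp) (k := k).
Let rho0 x : 0 <= rho x := density_ge0 (Rp := Rp) (k := k) x.

Lemma measurable_heat2 t : 0 < t -> measurable_fun setT (fun q : 'rV[R]_d * 'rV[R]_d => heat t q.1 q.2).
Proof.
move=> t0; have [mp _] := gauss_decay_density data t0.
apply: (@measurable_Rintegral_param R _ _ ('rV[R]_d * 'rV[R]_d)%type 'rV[R]_d lam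
  (fun q y => p t y * (C q.1 y * C q.2 y + S q.1 y * S q.2 y)) (fun y => 2 * p t y) (0, 0)).
- apply: measurable_funM; first exact: measurable_fun_snd.
  have mfst (f : 'rV[R]_d * 'rV[R]_d -> R) : measurable_fun setT f ->
      measurable_fun setT (fun r : ('rV[R]_d * 'rV[R]_d) * 'rV[R]_d => f (r.1.1, r.2)).
    move=> mf; apply: (measurableT_comp mf); apply/measurable_fun_pair => /=; last exact: measurable_snd.
    exact: (measurableT_comp measurable_fst measurable_fst).
  have msnd (f : 'rV[R]_d * 'rV[R]_d -> R) : measurable_fun setT f ->
      measurable_fun setT (fun r : ('rV[R]_d * 'rV[R]_d) * 'rV[R]_d => f (r.1.2, r.2)).
    move=> mf; apply: (measurableT_comp mf); apply/measurable_fun_pair => /=; last exact: measurable_snd.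
    exact: (measurableT_comp measurable_snd measurable_fst).
  apply: measurable_funD; apply: measurable_funM.
  + exact: (mfst _ (measurable_kcos2 data)).
  + exact: (msnd _ (measurable_kcos2 data)).
  + exact: (mfst _ (measurable_ksin2 data)).
  + exact: (msnd _ (measurable_ksin2 data)).
- by apply: integrableRZ; apply: gauss_decay_integrable; exact: gauss_decay_density.
move=> q y; rewrite normrM ger0_norm ?gauss_density_ge0// mulrC ler_wpM2r ?gauss_density_ge0//.
rewrite (le_trans (ler_normD _ _))// !normrM -[2]/(1 + 1) lerD//.
  by rewrite -[X in _ <= X]mulr1 ler_pM ?kcos_le1.
by rewrite -[X in _ <= X]mulr1 ler_pM ?ksin_le1.
Qed.

Variable g : 'rV[R]_d -> R.
Hypothesis mg : measurable_fun setT g.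
Hypothesis ig : integrableR lam (fun z => g z * rho z).
Variable B : R.
Hypothesis gB : forall x, `|g x| <= B.

Notation cg := (@cos_transform R d Rp k g).
Notation sg := (@sin_transform R d Rp k g).

Let I := \int[lam]_z `|g z * rho z|.

Lemma measurable_cos_transform : measurable_fun setT cg.
Proof.
apply: (@measurable_Rintegral_param R _ _ 'rV[R]_d 'rV[R]_d lam
  (fun y z => g z * rho z * C z y) (fun z => `|g z * rho z|) 0).
- apply: measurable_funM; first exact: measurable_fun_snd (integrableR_measurable ig).
  exact: (measurableT_comp (measurable_kcos2 data) (measurable_swap (T1 := 'rV[R]_d) (T2 := 'rV[R]_d))).
- exact: integrableR_norm.
- by move=> y z; rewrite normrM ler_piMr// kcos_le1.
Qed.

Lemma measurable_sin_transform : measurable_fun setT sg.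
Proof.
apply: (@measurable_Rintegral_param R _ _ 'rV[R]_d 'rV[R]_d lam
  (fun y z => g z * rho z * S z y) (fun z => `|g z * rho z|) 0).
- apply: measurable_funM; first exact: measurable_fun_snd (integrableR_measurable ig).
  exact: (measurableT_comp (measurable_ksin2 data) (measurable_swap (T1 := 'rV[R]_d) (T2 := 'rV[R]_d))).
- exact: integrableR_norm.
- by move=> y z; rewrite normrM ler_piMr// ksin_le1.
Qed.

Lemma integrable_cos_kernel y : integrableR lam (fun z => g z * rho z * C z y).
Proof.
apply: (integrableR_dom _ (integrableR_norm ig)).
  apply: measurable_funM; first exact: integrableR_measurable ig.
  by apply: continuous_measurable_rV; exact: (continuous_kcos data).
by move=> z; rewrite normrM ler_piMr// kcos_le1.
Qed.

Lemma integrable_sin_kernel y : integrableR lam (fun z => g z * rho z * S z y).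
Proof.
apply: (integrableR_dom _ (integrableR_norm ig)).
  apply: measurable_funM; first exact: integrableR_measurable ig.
  by apply: continuous_measurable_rV; exact: (continuous_ksin data).
by move=> z; rewrite normrM ler_piMr// ksin_le1.
Qed.

Lemma cos_transform_le y : `|cg y| <= I.
Proof.
apply: (le_trans (le_normr_Rintegral measurableT (integrable_cos_kernel y))).
apply: le_Rintegral => //; [exact: integrableR_norm (integrable_cos_kernel y)|exact: integrableR_norm|].
by move=> z _; rewrite normrM ler_piMr// kcos_le1.
Qed.

Lemma sin_transform_le y : `|sg y| <= I.
Proof.
apply: (le_trans (le_normr_Rintegral measurableT (integrable_sin_kernel y))).
apply: le_Rintegral => //; [exact: integrableR_norm (integrable_sin_kernel y)|exact: integrableR_norm|].
by move=> z _; rewrite normrM ler_piMr// ksin_le1.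
Qed.

Definition power_spectrum y : R := cg y ^+ 2 + sg y ^+ 2.

Lemma power_spectrum_ge0 y : 0 <= power_spectrum y.
Proof. by rewrite addr_ge0 ?sqr_ge0. Qed.

Lemma measurable_power_spectrum : measurable_fun setT power_spectrum.
Proof.
have mc := measurable_cos_transform; have ms := measurable_sin_transform.
exact: (measurable_funD (measurable_funM mc mc) (measurable_funM ms ms)).
Qed.

Lemma power_spectrum_le y : power_spectrum y <= 2 * I ^+ 2.
Proof.
have sq u : `|u| <= I -> u ^+ 2 <= I ^+ 2.
  by move=> h; rewrite -[u ^+ 2]real_normK ?num_real// lerXn2r ?nnegrE// (le_trans _ h).
rewrite mulr_natl mulr2n; exact: (lerD (sq _ (cos_transform_le y)) (sq _ (sin_transform_le y))).
Qed.

Lemma integrable_gauss_spectrum t : 0 < t -> integrableR lam (fun y => p t y * power_spectrum y).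
Proof.
move=> t0; apply: integrable_gauss_density => //; first exact: measurable_power_spectrum.
by apply: slow_le (slow_cst (2 * I ^+ 2)) _ => y; rewrite ger0_norm ?power_spectrum_ge0 ?power_spectrum_le.
Qed.

Definition heat_op t x := \int[lam]_z (g z * rho z * heat t x z).

(** One square of the transform is opened by Fubini; the other was already absorbed by
    [heat_swap]. *)
Lemma gauss_spectrum_heat t : 0 < t ->
  integrableR lam (fun x => g x * rho x * heat_op t x) /\
  \int[lam]_y (p t y * power_spectrum y) = \int[lam]_x (g x * rho x * heat_op t x).
Proof.
move=> t0; have [mp _] := gauss_decay_density data t0.
have mc := measurable_cos_transform; have ms := measurable_sin_transform.
have I0 : 0 <= I by apply: Rintegral_ge0.
pose F x y := g x * rho x * (p t y * (C x y * cg y + S x y * sg y)).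
have mF : measurable_fun setT (fun q : 'rV[R]_d * 'rV[R]_d => F q.1 q.2).
  apply: measurable_funM; first exact: measurable_fun_fst (integrableR_measurable ig).
  apply: measurable_funM; first exact: measurable_fun_snd mp.
  apply: measurable_funD; apply: measurable_funM.
  - exact: (measurable_kcos2 data).
  - exact: measurable_fun_snd mc.
  - exact: (measurable_ksin2 data).
  - exact: measurable_fun_snd ms.
have i1 : integrableR lam (fun x => `|g x * rho x|) by exact: integrableR_norm.
have i2 : integrableR lam (fun y => 2 * I * p t y).
  by apply: integrableRZ; apply: gauss_decay_integrable; exact: gauss_decay_density.
have FM x y : `|F x y| <= `|g x * rho x| * (2 * I * p t y).
  rewrite /F normrM ler_wpM2l// normrM ger0_norm ?gauss_density_ge0// mulrC ler_wpM2r ?gauss_density_ge0//.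
  rewrite (le_trans (ler_normD _ _))// !normrM mulr_natl mulr2n lerD//.
    by rewrite -[X in _ <= X]mul1r ler_pM ?kcos_le1 ?cos_transform_le.
  by rewrite -[X in _ <= X]mul1r ler_pM ?ksin_le1 ?sin_transform_le.
have E1 x : \int[lam]_y F x y = g x * rho x * heat_op t x.
  have [_ [i3 e3]] := heat_swap data ig x t0.
  by rewrite RintegralZl// -e3.
have E2 y : \int[lam]_x F x y = p t y * power_spectrum y.
  have -> : (fun x => F x y) = (fun x => (p t y * cg y) * (g x * rho x * C x y) + (p t y * sg y) * (g x * rho x * S x y)).
    by apply/funext => x; rewrite /F; ring.
  have ic := integrable_cos_kernel y; have is_ := integrable_sin_kernel y.
  rewrite (@RintegralD _ _ _ lam setT (fun x => (p t y * cg y) * (g x * rho x * C x y)))//; [|exact: integrableRZ..].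
  rewrite (RintegralZl _ measurableT ic) (RintegralZl _ measurableT is_) -/(cg y) -/(sg y).
  by rewrite /power_spectrum; ring.
split.
  have := integrableR_Rintegral1 mF i1 i2 FM; congr (integrableR _ _); apply/funext => x; exact: E1.
transitivity (\int[lam]_y \int[lam]_x F x y).
  by apply: eq_Rintegral => y _; rewrite (E2 y).
rewrite -(Rintegral_Fubini mF i1 i2 FM).
by apply: eq_Rintegral => x _; exact: (E1 x).
Qed.

Let heat0 t x z : 0 < t -> 0 <= heat t x z. Proof. exact: heat_ge0. Qed.

Lemma integrable_sqr : integrableR lam (fun x => g x ^+ 2 * rho x).
Proof.
apply: (integrableR_dom (g := fun x => B * `|g x * rho x|)).
- by apply: measurable_funM => //; exact: (measurable_funM mg mg).
- by apply: integrableRZ; exact: integrableR_norm.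
move=> x; rewrite expr2 -mulrA normrM ler_wpM2r//; exact: gB.
Qed.

(** Schur's test. The weighted arithmetic-geometric inequality splits g(x) g(z) A_t(x,z) into two
    halves that are exchanged by swapping x and z, hence have equal integrals by symmetry of the
    heat kernel. Since that common value may be infinite, everything stays in the extended reals. *)
Lemma gauss_spectrum_schur t (h : 'rV[R]_d -> R) : 0 < t -> measurable_fun setT h -> (forall z, 0 < h z) ->
  ((\int[lam]_y (p t y * power_spectrum y))%:E <=
   \int[lam]_x ((g x ^+ 2 * rho x / h x)%:E * \int[lam]_z (h z * rho z * heat t x z)%:E))%E.
Proof.
move=> t0 mh h0; have [i1 ->] := gauss_spectrum_heat t0.
pose a x : R := g x ^+ 2 * rho x / h x.
have a0 x : 0 <= a x by rewrite divr_ge0 ?(ltW (h0 x))// mulr_ge0 ?sqr_ge0.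
have ma : measurable_fun setT a.
  apply: measurable_funM; last exact: measurable_fun_invr.
  by apply: measurable_funM; [exact: (measurable_funM mg mg)|exact: mrho].
pose T x z : R := a x * (h z * rho z * heat t x z).
have w0 x z : 0 <= h z * rho z * heat t x z.
  exact: mulr_ge0 (mulr_ge0 (ltW (h0 z)) (rho0 z)) (heat0 x z t0).
have T0 x z : 0 <= T x z by exact: mulr_ge0 (a0 x) (w0 x z).
have mhr : measurable_fun setT (fun z => h z * rho z) by apply: measurable_funM.
have mT : measurable_fun setT (fun q : 'rV[R]_d * 'rV[R]_d => T q.1 q.2).
  apply: measurable_funM; first exact: measurable_fun_fst ma.
  apply: measurable_funM; last exact: measurable_heat2.
  exact: measurable_fun_snd mhr.
have mT' : measurable_fun setT (fun q : 'rV[R]_d * 'rV[R]_d => T q.2 q.1).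
  exact: (measurableT_comp mT (measurable_swap (T1 := 'rV[R]_d) (T2 := 'rV[R]_d))).
pose A := (\int[lam]_x \int[lam]_z (T x z)%:E)%E.
have -> : (\int[lam]_x ((a x)%:E * \int[lam]_z (h z * rho z * heat t x z)%:E))%E = A.
  apply: eq_integral => x _; rewrite (ge0_integralZl_real lam (a0 x) _ (w0 x))//.
  by apply: measurable_funM => //; exact: measurable_heat.
have A' : (\int[lam]_x \int[lam]_z (T z x)%:E)%E = A.
  exact: (tonelli_real lam lam mT' (fun x z => T0 z x)).
have sumA : (\int[lam]_x \int[lam]_z (T x z + T z x)%:E)%E = (A + A)%E.
  have pos (f : 'rV[R]_d -> 'rV[R]_d -> R) x : (forall x z, 0 <= f x z) -> (0 <= \int[lam]_z (f x z)%:E)%E.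
    by move=> f0; apply: integral_ge0 => z _; rewrite lee_fin.
  rewrite -{2}A' /A -(ge0_integralD_real lam (measurable_ge0_integral lam mT T0)
    (measurable_ge0_integral lam mT' (fun x z => T0 z x)) (fun x => pos _ x T0) (fun x => pos _ x (fun x z => T0 z x))).
  apply: eq_integral => x _; under eq_integral do rewrite EFinD.
  apply: ge0_integralD_real.
  - by apply/measurable_EFinP; exact: (measurableT_comp mT (pair1_measurable x)).
  - by apply/measurable_EFinP; exact: (measurableT_comp mT' (pair1_measurable x)).
  - by move=> z; rewrite lee_fin.
  - by move=> z; rewrite lee_fin.
have AM x z : 2 * (`|g x * rho x| * (`|g z * rho z| * heat t x z)) <= T x z + T z x.
  rewrite /T /a (heatC t z x) (normrM (g x)) (normrM (g z)) (ger0_norm (rho0 x)) (ger0_norm (rho0 z)).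
  exact: (weighted_am_gm (g x) (g z) (h0 x) (h0 z) (rho0 x) (rho0 z) (heat0 x z t0)).
pose J := \int[lam]_x (g x * rho x * heat_op t x).
have mgr := integrableR_measurable ig.
have low : ((2 * J)%:E <= A + A)%E.
  have i1n := integrableRZ 2 (integrableR_norm i1).
  apply: (@le_trans _ _ (\int[lam]_x (2 * `|g x * rho x * heat_op t x|))%:E).
    rewrite lee_fin (RintegralZl _ measurableT (integrableR_norm i1)); apply: (ler_wpM2l (ler0n R 2)).
    exact: le_trans (ler_norm _) (le_normr_Rintegral measurableT i1).
  rewrite -(Rintegral_EFin i1n) -sumA; apply: ge0_le_integral_real.
  - by apply/measurable_EFinP; exact: integrableR_measurable i1n.
  - apply: (measurable_ge0_integral lam (f := fun x z => T x z + T z x)); first exact: measurable_funD mT mT'.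
    by move=> x z; exact: addr_ge0.
  - by move=> x; rewrite lee_fin; exact: (mulr_ge0 (ler0n R 2) (normr_ge0 _)).
  move=> x; have [i2 _] := heat_swap data ig x t0.
  have i2' : integrableR lam (fun z => `|g z * rho z| * heat t x z).
    have := integrableR_norm i2; congr (integrableR _ _); apply/funext => z.
    by rewrite (normrM (g z * rho z)) (ger0_norm (heat0 x z t0)).
  have i3 := integrableRZ 2 (integrableRZ `|g x * rho x| i2').
  apply: (@le_trans _ _ (\int[lam]_z (2 * (`|g x * rho x| * (`|g z * rho z| * heat t x z))))%:E).
    rewrite lee_fin (RintegralZl _ measurableT (integrableRZ `|g x * rho x| i2')); apply: (ler_wpM2l (ler0n R 2)).
    rewrite (RintegralZl _ measurableT i2') (normrM (g x * rho x)); apply: (ler_wpM2l (normr_ge0 _)).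
    apply: (le_trans (le_normr_Rintegral measurableT i2)).
    rewrite le_eqVlt; apply/orP; left; apply/eqP; apply: eq_Rintegral => z _.
    by rewrite (normrM (g z * rho z)) (ger0_norm (heat0 x z t0)).
  rewrite -(Rintegral_EFin i3); apply: ge0_le_integral_real.
  - by apply/measurable_EFinP; exact: integrableR_measurable i3.
  - apply/measurable_EFinP; apply: measurable_funD.
      exact: (measurableT_comp mT (pair1_measurable x)).
    exact: (measurableT_comp mT' (pair1_measurable x)).
  - move=> z; rewrite lee_fin; apply: (mulr_ge0 (ler0n R 2)); apply: (mulr_ge0 (normr_ge0 _)).
    exact: mulr_ge0 (normr_ge0 _) (heat0 x z t0).
  - by move=> z; rewrite lee_fin; exact: AM.
apply: lee_double low.
by apply: integral_ge0 => x _; apply: integral_ge0 => z _; rewrite lee_fin.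
Qed.

(** Schur's test with weight 1, where the heat kernel has mass 1. *)
Lemma gauss_spectrum_le t : 0 < t ->
  \int[lam]_y (p t y * power_spectrum y) <= \int[lam]_x (g x ^+ 2 * rho x).
Proof.
move=> t0; have := @gauss_spectrum_schur t (fun=> 1) t0 (measurable_cst _) (fun=> ltr01).
rewrite -lee_fin => /le_trans; apply; rewrite -Rintegral_EFin; last exact: integrable_sqr.
rewrite le_eqVlt; apply/orP; left; apply/eqP; apply: eq_integral => x _.
rewrite divr1; under eq_integral do rewrite mul1r mulrC.
have [im m1] := heat_mass data c0 x t0.
by rewrite Rintegral_EFin// m1 mule1.
Qed.

Lemma spectrum_integrable_le : integrableR lam (fun y => power_spectrum y * rho y) /\
  \int[lam]_y (power_spectrum y * rho y) <= \int[lam]_x (g x ^+ 2 * rho x).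
Proof.
apply: (Rintegral_fatou (F := fun n y => p n.+1%:R^-1 y * power_spectrum y)).
- by move=> n; apply: integrable_gauss_spectrum; rewrite invr_gt0.
- by move=> n y; rewrite mulr_ge0 ?gauss_density_ge0 ?power_spectrum_ge0.
- move=> y; rewrite /gauss_density.
  suff H : expR (- (n.+1%:R^-1 * dot y y)) * (power_spectrum y * rho y) @[n --> \oo] --> expR (- (0 * dot y y)) * (power_spectrum y * rho y).
    rewrite mul0r oppr0 expR0 mul1r in H; move: H; under eq_fun do rewrite [_ * rho y]mulrC mulrA.
    exact.
  apply: cvgM; last exact: cvg_cst.
  apply: (@continuous_cvg _ _ _ _ _ _ expR); first exact: continuous_expR.
  by apply: cvgN; apply: cvgM; [exact: cvg_harmonic|exact: cvg_cst].
- by move=> n; apply: gauss_spectrum_le; rewrite invr_gt0.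
Qed.

Variable L : R.
Hypothesis gL : forall x z, `|g x - g z| <= L * enorm (x - z).

(** The smoothed energy differs from the integral of g^2 by the error of the heat operator. For a
    Lipschitz g this error is uniformly small because the variance of the heat kernel is, and
    integrability of g makes the total error small. *)
Lemma spectrum_ge : \int[lam]_x (g x ^+ 2 * rho x) <= \int[lam]_y (power_spectrum y * rho y).
Proof.
have [iP _] := spectrum_integrable_le.
have hd0 : 0 <= hdim by exact: hdim_ge0.
have I0 : 0 <= I by apply: Rintegral_ge0.
have L0 : 0 <= `|L| by [].
have step e : 0 < e -> \int[lam]_x (g x ^+ 2 * rho x) - I * (`|L| * (e * (1 + hdim))) <=
    \int[lam]_y (power_spectrum y * rho y).
  move=> e0; pose t := e ^+ 2; have t0 : 0 < t by rewrite exprn_gt0.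
  apply: (@le_trans _ _ (\int[lam]_y (p t y * power_spectrum y))); last first.
    apply: le_Rintegral => //; first exact: integrable_gauss_spectrum.
    move=> y _; rewrite /gauss_density -mulrA [rho y * _]mulrC ler_piMl//.
      exact: mulr_ge0 (power_spectrum_ge0 y) (rho0 y).
    by rewrite -[X in _ <= X](@expR0 R) ler_expR oppr_le0 mulr_ge0 ?dot_ge0 ?(ltW t0).
  have [i1 ->] := gauss_spectrum_heat t0.
  have isq := integrable_sqr.
  have err x : `|heat_op t x - g x| <= `|L| * (e * (1 + hdim)).
    have [im m1] := heat_mass data c0 x t0; have [iv mv] := heat_variance data c0 x t0.
    have [i2 _] := heat_swap data ig x t0.
    have i3 := integrableRZ (g x) im.
    have -> : heat_op t x - g x = \int[lam]_z (g z * rho z * heat t x z - g x * (heat t x z * rho z)).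
      by rewrite (RintegralB measurableT i2 i3) (RintegralZl _ measurableT im) m1 mulr1.
    apply: (le_trans (le_normr_Rintegral measurableT (integrableRB i2 i3))).
    (* From |x - z| <= e + |x - z|^2/(4e). With t = e^2 the variance bound 4 t [hdim] contributes e
       [hdim], so both parts are of order e. *)
    pose u z := e * (heat t x z * rho z) + (4 * e)^-1 * (heat t x z * rho z * dot (x - z) (x - z)).
    have iu : integrableR lam u by apply: integrableRD; exact: integrableRZ.
    apply: (@le_trans _ _ (\int[lam]_z (`|L| * u z))).
      apply: le_Rintegral => //; [exact: integrableR_norm (integrableRB i2 i3)|exact: integrableRZ|].
      move=> z _; have A0 : 0 <= heat t x z * rho z by exact: mulr_ge0 (heat0 x z t0) (rho0 z).
      have -> : g z * rho z * heat t x z - g x * (heat t x z * rho z) = (heat t x z * rho z) * (g z - g x) by ring.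
      rewrite normrM (ger0_norm A0).
      have h1 : `|g z - g x| <= `|L| * enorm (x - z).
        rewrite distrC (le_trans (gL x z))// ler_wpM2r ?enorm_ge0//; exact: ler_norm.
      have h2 : enorm (x - z) <= e + (4 * e)^-1 * dot (x - z) (x - z).
        rewrite -sqr_enorm -subr_ge0.
        have -> : e + (4 * e)^-1 * enorm (x - z) ^+ 2 - enorm (x - z) = (4 * e)^-1 * (enorm (x - z) - 2 * e) ^+ 2.
          by field; rewrite (gt_eqF e0).
        by rewrite mulr_ge0 ?sqr_ge0// invr_ge0 mulr_ge0 ?(ltW e0).
      have h3 := le_trans h1 (ler_wpM2l L0 h2).
      have -> : `|L| * u z = (heat t x z * rho z) * (`|L| * (e + (4 * e)^-1 * dot (x - z) (x - z))).
        by rewrite /u; ring.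
      exact: ler_wpM2l.
    rewrite (RintegralZl _ measurableT iu) ler_wpM2l//.
    rewrite (RintegralD measurableT (integrableRZ e im) (integrableRZ (4 * e)^-1 iv)).
    rewrite (RintegralZl _ measurableT im) (RintegralZl _ measurableT iv) m1.
    have e4 : 0 <= (4 * e)^-1 by rewrite invr_ge0 mulr_ge0 ?(ltW e0).
    have := ler_wpM2l e4 mv; have -> : (4 * e)^-1 * (4 * t * hdim) = e * hdim.
      by rewrite /t; field; rewrite (gt_eqF e0).
    by lra.
  rewrite lerBlDr -lerBlDl -(RintegralB measurableT isq i1).
  apply: (le_trans (ler_norm _)).
  apply: (le_trans (le_normr_Rintegral measurableT (integrableRB isq i1))).
  rewrite -(RintegralZr _ measurableT (integrableR_norm ig)).
  apply: le_Rintegral => //; first exact: integrableR_norm (integrableRB isq i1).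
    have := integrableRZ (`|L| * (e * (1 + hdim))) (integrableR_norm ig).
    by congr (integrableR _ _); apply/funext => x; rewrite mulrC.
  move=> x _; have -> : g x ^+ 2 * rho x - g x * rho x * heat_op t x = - (g x * rho x * (heat_op t x - g x)) by ring.
  by rewrite normrN normrM ler_wpM2l.
apply/ler_addgt0Pr => e e0.
pose K := I * (`|L| * (1 + hdim)).
have K0 : 0 <= K by rewrite mulr_ge0// mulr_ge0// addr_ge0.
have := step (e / (K + 1)).
rewrite divr_gt0 ?ltr_wpDl// => /(_ isT).
have -> : I * (`|L| * (e / (K + 1) * (1 + hdim))) = e * (K / (K + 1)) by rewrite /K; ring.
have : e * (K / (K + 1)) <= e.
  by rewrite ler_piMr ?(ltW e0)// ler_pdivrMr ?ltr_wpDl// mul1r lerDl.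
by lra.
Qed.

Lemma plancherel : integrableR lam (fun y => power_spectrum y * rho y) /\
  \int[lam]_y (power_spectrum y * rho y) = \int[lam]_x (g x ^+ 2 * rho x).
Proof.
have [i1 h1] := spectrum_integrable_le; split=> //.
by apply/eqP; rewrite eq_le h1 spectrum_ge.
Qed.

End plancherel.

(** * Pitt's inequality for real functions *)

Section pitt.
Context {R : realType} {d : nat} {Rp : {fset 'rV[R]_d}} {k : 'rV[R]_d -> R}.
Variable data : dunkl_data Rp k.
Hypothesis c0 : dunkl_const Rp k != 0.
Hypothesis d_ge1 : (1 <= d)%N.
Implicit Types (x y z : 'rV[R]_d) (t s : R).
Notation lam := (@lebesgue_rV R d).
Notation leb := (@lebesgue_measure R).
Notation rho := (dunkl_density Rp k).
Notation p := (@gauss_density R d Rp k).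
Notation heat := (@heat R d Rp k).
Notation hdim := (@hdim R d Rp k).

Definition pitt_index : R := hdim / 2.
Notation m := pitt_index.

Lemma pitt_index_gt0 : 0 < m.
Proof.
rewrite divr_gt0// /hdim ltr_wpDr ?(abs_mult_ge0 data)// divr_gt0// ltr0n.
exact: d_ge1.
Qed.

Let m0 := pitt_index_gt0.

(* |z|^(-2m), with the value 1 instead of the junk value 0 at the origin *)
Definition pitt_weight z : R := (dot z z) `^ (- m) + (1 - dot z z * (dot z z) `^ (-1)).

Lemma pitt_weightE z : pitt_weight z = if z == 0 then 1 else (dot z z) `^ (- m).
Proof.
rewrite /pitt_weight; case: eqP => [->|/eqP z0].
  by rewrite dot0l mul0r subr0 powR0 ?add0r// oppr_eq0 gt_eqF.
by rewrite powR_inv1 ?dot_ge0// mulfV ?dot_eq0// subrr addr0.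
Qed.

Lemma dot_gt0 z : z != 0 -> 0 < dot z z.
Proof. by move=> z0; rewrite lt_neqAle eq_sym dot_eq0 z0 dot_ge0. Qed.

Lemma pitt_weight_gt0 z : 0 < pitt_weight z.
Proof.
rewrite pitt_weightE; case: eqP => // /eqP z0.
by rewrite powR_gt0// dot_gt0.
Qed.

Let mdot : measurable_fun setT (fun z : 'rV[R]_d => dot z z) := @measurable_dotxx R d.

Lemma measurable_pitt_weight : measurable_fun setT pitt_weight.
Proof.
apply: measurable_funD; first exact: measurable_fun_powRl.
apply: measurable_funB; first exact: measurable_cst.
by apply: measurable_funM; [exact: mdot|exact: measurable_fun_powRl].
Qed.

(** Gamma integral for |z|^(-2m), an equality off the origin. At z = 0 the weight is 1 and
    comparison of the pure power with its product by exp(-s) yields the inequality. *)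
Lemma pitt_weight_gamma z :
  ((Gamma m * pitt_weight z)%:E <= \int[leb]_s (gamma_kernel m 0 s * expR (- (s * dot z z)))%:E)%E.
Proof.
have E c : (\int[leb]_s (gamma_kernel m 0 s * expR (- (s * c)))%:E = \int[leb]_s (gamma_kernel m c s)%:E)%E.
  apply: eq_integral => s _; congr EFin; rewrite /gamma_kernel; case: ifP => _; last by rewrite mul0r.
  by rewrite mul0r oppr0 expR0 mulr1 (mulrC c).
rewrite E pitt_weightE; case: eqP => [->|/eqP z0].
  rewrite dot0l mulr1; have h := integral_gamma_kernel m0 (ltr01 : 0 < 1 :> R); rewrite powR1 mulr1 in h.
  rewrite -h; apply: ge0_le_integral_real.
  - by apply/measurable_EFinP; exact: measurable_gamma_kernel.
  - by apply/measurable_EFinP; exact: measurable_gamma_kernel.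
  - by move=> s; rewrite lee_fin gamma_kernel_ge0.
  move=> s; rewrite lee_fin /gamma_kernel; case: ifPn => // s0.
  by rewrite ler_wpM2l ?powR_ge0// ler_expR mul0r mul1r lerN2 ltW.
by rewrite (integral_gamma_kernel m0 (dot_gt0 z0)).
Qed.

Let mleb (f : R -> R) : measurable_fun setT f ->
  measurable_fun setT (fun q : R * 'rV[R]_d => f q.1).
Proof. by move=> mf; exact: (measurableT_comp mf measurable_fst). Qed.

Let mlam (f : 'rV[R]_d -> R) : measurable_fun setT f ->
  measurable_fun setT (fun q : R * 'rV[R]_d => f q.2).
Proof. by move=> mf; exact: (measurableT_comp mf measurable_snd). Qed.

Let mexp : measurable_fun setT (fun q : R * 'rV[R]_d => expR (- (q.1 * dot q.2 q.2))).
Proof.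
apply: measurableT_comp => //; apply: measurableT_comp => //.
by apply: measurable_funM; [exact: measurable_fst|exact: (mlam mdot)].
Qed.

Definition pitt_kernel t u s : R := gamma_kernel m 0 s *
  ((1 + 4 * s * t) `^ (- (2 * m)) * expR (- (s * u / (1 + 4 * s * t)))).

Lemma pitt_kernel_ge0 t u s : 0 <= pitt_kernel t u s.
Proof.
apply: mulr_ge0; first exact: gamma_kernel_ge0.
by apply: mulr_ge0; [exact: powR_ge0|exact: expR_ge0].
Qed.

(** Each Gaussian in the superposition is mapped by the heat kernel to a Gaussian, see
    [Rintegral_heat_gauss]; the exponent 2m appears because [hdim] = 2m. *)
Lemma pitt_weight_heat t x : 0 < t ->
  ((Gamma m)%:E * \int[lam]_z (pitt_weight z * rho z * heat t x z)%:E <=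
   \int[leb]_s (pitt_kernel t (dot x x) s)%:E)%E.
Proof.
move=> t0.
have hr0 z : 0 <= rho z * heat t x z by exact: mulr_ge0 (density_ge0 _) (heat_ge0 data c0 x z t0).
have mhr : measurable_fun setT (fun z => rho z * heat t x z).
  by apply: measurable_funM; [exact: measurable_density|exact: measurable_heat].
pose f s z : R := gamma_kernel m 0 s * expR (- (s * dot z z)) * (rho z * heat t x z).
have f0 s z : 0 <= f s z by exact: mulr_ge0 (mulr_ge0 (gamma_kernel_ge0 _ _ _) (expR_ge0 _)) (hr0 z).
have mf : measurable_fun setT (fun q : R * 'rV[R]_d => f q.1 q.2).
  apply: measurable_funM; last exact: mlam mhr.
  apply: measurable_funM; last exact: mexp.
  by apply: mleb; exact: measurable_gamma_kernel.
have mf' : measurable_fun setT (fun q : 'rV[R]_d * R => f q.2 q.1).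
  exact: (measurableT_comp mf (measurable_swap (T1 := 'rV[R]_d) (T2 := R))).
have mph : measurable_fun setT (fun z => pitt_weight z * rho z * heat t x z).
  under eq_fun do rewrite -mulrA; apply: measurable_funM; [exact: measurable_pitt_weight|exact: mhr].
have ph0 z : 0 <= pitt_weight z * rho z * heat t x z.
  by rewrite -mulrA; exact: mulr_ge0 (ltW (pitt_weight_gt0 z)) (hr0 z).
rewrite -(ge0_integralZl_real lam (ltW (Gamma_gt0 m0)) mph ph0).
apply: (@le_trans _ _ (\int[lam]_z \int[leb]_s (f s z)%:E)%E).
  apply: ge0_le_integral_real.
  - by apply/measurable_EFinP; apply: measurable_funM; [exact: measurable_cst|exact: mph].
  - exact: (measurable_ge0_integral leb mf' (fun z s => f0 s z)).
  - by move=> z; rewrite lee_fin; exact: mulr_ge0 (ltW (Gamma_gt0 m0)) (ph0 z).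
  move=> z; have mg : measurable_fun setT (fun s : R => gamma_kernel m 0 s * expR (- (s * dot z z))).
    apply: measurable_funM; first exact: measurable_gamma_kernel.
    apply: measurableT_comp => //; apply: measurableT_comp => //.
    by apply: measurable_funM; [exact: measurable_id|exact: measurable_cst].
  have -> : (\int[leb]_s (f s z)%:E = (rho z * heat t x z)%:E * \int[leb]_s (gamma_kernel m 0 s * expR (- (s * dot z z)))%:E)%E.
    rewrite -(ge0_integralZl_real leb (hr0 z) mg (fun s => mulr_ge0 (gamma_kernel_ge0 _ _ _) (expR_ge0 _))).
    by apply: eq_integral => s _; rewrite /f mulrC.
  have -> : (Gamma m * (pitt_weight z * rho z * heat t x z) = (rho z * heat t x z) * (Gamma m * pitt_weight z))%R by ring.
  rewrite EFinM; apply: lee_wpmul2l; first by rewrite lee_fin.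
  exact: pitt_weight_gamma.
rewrite -(tonelli_real leb lam mf f0) le_eqVlt; apply/orP; left; apply/eqP.
apply: eq_integral => s _; have [s0|s0] := ltP 0 s; last first.
  rewrite /pitt_kernel (gamma_kernel_le0 m 0 s0) mul0r integral0_eq// => z _.
  by rewrite /f (gamma_kernel_le0 m 0 s0) !mul0r.
have [ih eh] := Rintegral_heat_gauss data c0 x s0 t0.
have -> : (\int[lam]_z (f s z)%:E = (gamma_kernel m 0 s)%:E * \int[lam]_z (p s z * heat t x z)%:E)%E.
  rewrite -(ge0_integralZl_real lam (gamma_kernel_ge0 m 0 s) (integrableR_measurable ih)
    (fun z => mulr_ge0 (gauss_density_ge0 _ _) (heat_ge0 data c0 x z t0))).
  by apply: eq_integral => z _; rewrite /f /gauss_density; congr EFin; ring.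
rewrite (Rintegral_EFin ih) eh -EFinM; congr EFin; rewrite /pitt_kernel; congr (_ * (_ `^ _ * _)).
by rewrite /pitt_index; field.
Qed.

Lemma measurable_pitt_kernel :
  measurable_fun setT (fun q : (R * 'rV[R]_d) * R => pitt_kernel q.1.1 (dot q.1.2 q.1.2) q.2).
Proof.
have m3 : measurable_fun setT (fun q : (R * 'rV[R]_d) * R => q.2) by exact: measurable_snd.
have m1 : measurable_fun setT (fun q : (R * 'rV[R]_d) * R => q.1.1).
  exact: (measurableT_comp measurable_fst measurable_fst).
have m2 : measurable_fun setT (fun q : (R * 'rV[R]_d) * R => dot q.1.2 q.1.2).
  exact: (measurableT_comp mdot (measurableT_comp measurable_snd measurable_fst)).
have mq : measurable_fun setT (fun q : (R * 'rV[R]_d) * R => 1 + 4 * q.2 * q.1.1).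
  apply: measurable_funD; first exact: measurable_cst.
  by apply: measurable_funM; last exact: m1; apply: measurable_funM; [exact: measurable_cst|exact: m3].
apply: measurable_funM; first exact: (measurableT_comp (measurable_gamma_kernel m 0) m3).
apply: measurable_funM; first exact: measurable_fun_powRl.
apply: measurableT_comp => //; apply: measurableT_comp => //.
by apply: measurable_funM; [exact: (measurable_funM m3 m2)|exact: measurable_fun_invr].
Qed.

Section inequality.
Variable g : 'rV[R]_d -> R.
Hypothesis mg : measurable_fun setT g.
Hypothesis ig : integrableR lam (fun z => g z * rho z).
Variable B : R.
Hypothesis gB : forall x, `|g x| <= B.
Variable b : R.
Hypotheses (b0 : 0 < b) (bm : b < m).

Notation P := (@power_spectrum R d Rp k g).

Let mP : measurable_fun setT P. Proof. exact: measurable_power_spectrum. Qed.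
Let P0 y : 0 <= P y. Proof. exact: power_spectrum_ge0. Qed.

(** Writes |y|^(-2b) as a superposition of Gaussians in t. At u = 0 the power takes the default
    value 0, so an inequality is claimed. *)
Let powR_gamma (u : R) : 0 <= u ->
  ((Gamma b * u `^ (- b))%:E <= \int[leb]_t (gamma_kernel b 0 t * expR (- (t * u)))%:E)%E.
Proof.
move=> u0; have [->|un0] := eqVneq u 0.
  rewrite powR0 ?oppr_eq0 ?(gt_eqF b0)// mulr0; apply: integral_ge0 => t _.
  by rewrite lee_fin; exact: mulr_ge0 (gamma_kernel_ge0 _ _ _) (expR_ge0 _).
have u1 : 0 < u by rewrite lt_neqAle eq_sym un0.
rewrite -(integral_gamma_kernel b0 u1) le_eqVlt; apply/orP; left; apply/eqP.
apply: eq_integral => t _; congr EFin; rewrite /gamma_kernel; case: ifP => _; last by rewrite mul0r.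
by rewrite mul0r oppr0 expR0 mulr1 (mulrC u).
Qed.

Let a x : R := g x ^+ 2 * rho x / pitt_weight x.

Let a0 x : 0 <= a x.
Proof.
apply: divr_ge0 (ltW (pitt_weight_gt0 x)); exact: mulr_ge0 (sqr_ge0 _) (density_ge0 _).
Qed.

Let ma : measurable_fun setT a.
Proof.
apply: measurable_funM; last by apply: measurable_fun_invr; exact: measurable_pitt_weight.
by apply: measurable_funM; [exact: (measurable_funM mg mg)|exact: measurable_density].
Qed.

Let V t x : \bar R := (\int[leb]_s (pitt_kernel t (dot x x) s)%:E)%E.

Let V0 t x : (0 <= V t x)%E.
Proof. by apply: integral_ge0 => s _; rewrite lee_fin; exact: pitt_kernel_ge0. Qed.

Let mV : measurable_fun setT (fun q : R * 'rV[R]_d => V q.1 q.2).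
Proof.
apply: (measurable_ge0_integral leb (f := fun (q : R * 'rV[R]_d) s => pitt_kernel q.1 (dot q.2 q.2) s)).
  exact: measurable_pitt_kernel.
by move=> q s; exact: pitt_kernel_ge0.
Qed.

Let spectrum_V t : 0 < t ->
  ((Gamma m)%:E * (\int[lam]_y (p t y * P y))%:E <= \int[lam]_x ((a x)%:E * V t x))%E.
Proof.
move=> t0; have mVt : measurable_fun setT (V t) by exact: (measurableT_comp mV (pair1_measurable t)).
have mW : measurable_fun setT (fun x => \int[lam]_z (pitt_weight z * rho z * heat t x z)%:E)%E.
  apply: (measurable_ge0_integral lam (f := fun x z => pitt_weight z * rho z * heat t x z)).
    apply: measurable_funM; last exact: measurable_heat2.
    exact: (measurable_fun_snd (measurable_funM measurable_pitt_weight (measurable_density (Rp := Rp) (k := k)))).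
  move=> x z; apply: mulr_ge0 (heat_ge0 data c0 x z t0).
  exact: mulr_ge0 (ltW (pitt_weight_gt0 z)) (density_ge0 _).
have W0 x : (0 <= \int[lam]_z (pitt_weight z * rho z * heat t x z)%:E)%E.
  apply: integral_ge0 => z _; rewrite lee_fin; apply: mulr_ge0 (heat_ge0 data c0 x z t0).
  exact: mulr_ge0 (ltW (pitt_weight_gt0 z)) (density_ge0 _).
have G0 : (0 <= (Gamma m)%:E)%E by rewrite lee_fin; exact: ltW (Gamma_gt0 m0).
have mea : measurable_fun setT (EFin \o a) by exact/measurable_EFinP.
have h := lee_wpmul2l G0 (gauss_spectrum_schur data c0 mg ig t0 measurable_pitt_weight pitt_weight_gt0).
apply: (le_trans h); rewrite -ge0_integralZl//; last 2 first.
- by apply: emeasurable_funM; [exact: mea|exact: mW].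
- by move=> x _; apply: mule_ge0 (W0 x); rewrite lee_fin; exact: a0.
apply: ge0_le_integral_real.
- by apply: emeasurable_funM; [exact: measurable_cst|apply: emeasurable_funM; [exact: mea|exact: mW]].
- by apply: emeasurable_funM; [exact: mea|exact: mVt].
- by move=> x; apply: (mule_ge0 G0); apply: mule_ge0 (W0 x); rewrite lee_fin; exact: a0.
move=> x; rewrite muleCA; apply: lee_wpmul2l; first by rewrite lee_fin; exact: a0.
exact: pitt_weight_heat.
Qed.

Let weight_algebra (A v q q1 q2 f u : R) : v != 0 ->
  A / v * (f * q * (q1 * q2) * (u * v)) = q2 * q1 * (f * q * (u * A)).
Proof. by move=> v0; field. Qed.

Definition pitt_const : R := 4 `^ (- b) * (Gamma (m - b) / Gamma (m + b)).

(** Three moves: |y|^(-2b) becomes an integral over t of Gaussians, Schur's test with [pitt_weight]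
    is applied for each t, and the resulting double integral over s and t is [pitt_integral]. The
    factors Gamma(m) Gamma(b) are carried along and cancelled last. *)
Lemma pitt : (\int[lam]_y ((dot y y) `^ (- b) * (P y * rho y))%:E <=
  \int[lam]_x (pitt_const * ((dot x x) `^ b * (g x ^+ 2 * rho x)))%:E)%E.
Proof.
pose G := Gamma m * Gamma b; have G0 : 0 < G by exact: mulr_gt0 (Gamma_gt0 m0) (Gamma_gt0 b0).
have Gb0 := Gamma_gt0 b0; have Gm0 := Gamma_gt0 m0.
have Pr0 y : 0 <= P y * rho y by exact: mulr_ge0 (P0 y) (density_ge0 _).
have mPr : measurable_fun setT (fun y => P y * rho y).
  by apply: measurable_funM; [exact: mP|exact: measurable_density].
pose F t y : R := gamma_kernel b 0 t * expR (- (t * dot y y)) * (P y * rho y).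
have F0 t y : 0 <= F t y by exact: mulr_ge0 (mulr_ge0 (gamma_kernel_ge0 _ _ _) (expR_ge0 _)) (Pr0 y).
have mF : measurable_fun setT (fun q : R * 'rV[R]_d => F q.1 q.2).
  apply: measurable_funM; last exact: mlam mPr.
  apply: measurable_funM; last exact: mexp.
  by apply: mleb; exact: measurable_gamma_kernel.
have mF' : measurable_fun setT (fun q : 'rV[R]_d * R => F q.2 q.1).
  exact: (measurableT_comp mF (measurable_swap (T1 := 'rV[R]_d) (T2 := R))).
have step1 : ((Gamma b)%:E * \int[lam]_y ((dot y y) `^ (- b) * (P y * rho y))%:E <=
    \int[leb]_t \int[lam]_y (F t y)%:E)%E.
  rewrite (tonelli_real leb lam mF F0).
  have mf : measurable_fun setT (fun y => (dot y y) `^ (- b) * (P y * rho y)).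
    by apply: measurable_funM; [exact: measurable_fun_powRl|exact: mPr].
  rewrite -(ge0_integralZl_real lam (ltW Gb0) mf (fun y => mulr_ge0 (powR_ge0 _ _) (Pr0 y))).
  apply: ge0_le_integral_real.
  - by apply/measurable_EFinP; apply: measurable_funM; [exact: measurable_cst|exact: mf].
  - exact: (measurable_ge0_integral leb mF' (fun y t => F0 t y)).
  - by move=> y; rewrite lee_fin; exact: mulr_ge0 (ltW Gb0) (mulr_ge0 (powR_ge0 _ _) (Pr0 y)).
  move=> y; have mgk : measurable_fun setT (fun t : R => gamma_kernel b 0 t * expR (- (t * dot y y))).
    apply: measurable_funM; first exact: measurable_gamma_kernel.
    apply: measurableT_comp => //; apply: measurableT_comp => //.
    by apply: measurable_funM; [exact: measurable_id|exact: measurable_cst].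
  have -> : (\int[leb]_t (F t y)%:E = (P y * rho y)%:E * \int[leb]_t (gamma_kernel b 0 t * expR (- (t * dot y y)))%:E)%E.
    rewrite -(ge0_integralZl_real leb (Pr0 y) mgk (fun s => mulr_ge0 (gamma_kernel_ge0 _ _ _) (expR_ge0 _))).
    by apply: eq_integral => t _; rewrite /F mulrC.
  have -> : Gamma b * ((dot y y) `^ (- b) * (P y * rho y)) = (P y * rho y) * (Gamma b * (dot y y) `^ (- b)) by ring.
  rewrite EFinM; apply: lee_wpmul2l; first by rewrite lee_fin.
  by apply: powR_gamma; exact: dot_ge0.
have pc0 : 0 <= pitt_const.
  apply: mulr_ge0 (powR_ge0 _ _) _; apply: divr_ge0; apply: ltW; apply: Gamma_gt0.
    by rewrite subr_gt0.
  exact: addr_gt0 m0 b0.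
have R0 x : 0 <= (dot x x) `^ b * (g x ^+ 2 * rho x).
  exact: mulr_ge0 (powR_ge0 _ _) (mulr_ge0 (sqr_ge0 _) (density_ge0 _)).
have mR : measurable_fun setT (fun x => (dot x x) `^ b * (g x ^+ 2 * rho x)).
  apply: measurable_funM; first exact: measurable_fun_powRl.
  by apply: measurable_funM; [exact: (measurable_funM mg mg)|exact: measurable_density].
pose H t x : \bar R := ((gamma_kernel b 0 t * a x)%:E * V t x)%E.
have H0 t x : (0 <= H t x)%E.
  by apply: mule_ge0 (V0 t x); rewrite lee_fin; exact: mulr_ge0 (gamma_kernel_ge0 _ _ _) (a0 x).
have mH : measurable_fun setT (fun q : R * 'rV[R]_d => H q.1 q.2).
  apply: emeasurable_funM; last exact: mV.
  apply/measurable_EFinP; apply: measurable_funM; last exact: mlam ma.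
  by apply: mleb; exact: measurable_gamma_kernel.
have step2 : ((Gamma m)%:E * (\int[leb]_t \int[lam]_y (F t y)%:E) <= \int[leb]_t \int[lam]_x H t x)%E.
  have mFi : measurable_fun setT (fun t => \int[lam]_y (F t y)%:E)%E by exact: measurable_ge0_integral mF F0.
  have Fi0 t : (0 <= \int[lam]_y (F t y)%:E)%E by apply: integral_ge0 => y _; rewrite lee_fin.
  have Gme : (0 <= (Gamma m)%:E)%E by rewrite lee_fin; exact: ltW.
  rewrite -(ge0_integralZl leb measurableT mFi (fun t _ => Fi0 t) Gme).
  apply: ge0_le_integral_real.
  - by apply: emeasurable_funM; [exact: measurable_cst|exact: mFi].
  - exact: (measurable_fun_fubini_tonelli_F (m2 := lam) (fun q : R * 'rV[R]_d => H q.1 q.2) mH (fun q => H0 q.1 q.2)).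
  - by move=> t; apply: mule_ge0 (Fi0 t); rewrite lee_fin; exact: ltW.
  move=> t; have [t0|t0] := ltP 0 t; last first.
    rewrite integral0_eq; last by move=> y _; rewrite /F (gamma_kernel_le0 b 0 t0) !mul0r.
    by rewrite mule0; apply: integral_ge0 => x _; exact: H0.
  have ips := integrable_gauss_spectrum data ig t0.
  have -> : (\int[lam]_y (F t y)%:E = (gamma_kernel b 0 t)%:E * (\int[lam]_y (p t y * P y))%:E)%E.
    rewrite -(Rintegral_EFin ips) -(ge0_integralZl_real lam (gamma_kernel_ge0 b 0 t) (integrableR_measurable ips)
      (fun y => mulr_ge0 (gauss_density_ge0 _ _) (P0 y))).
    by apply: eq_integral => y _; rewrite /F /gauss_density; congr EFin; ring.
  have -> : (\int[lam]_x H t x = (gamma_kernel b 0 t)%:E * \int[lam]_x ((a x)%:E * V t x))%E.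
    rewrite -ge0_integralZl//; last 3 first.
    - apply: emeasurable_funM; first exact/measurable_EFinP.
      exact: (measurableT_comp mV (pair1_measurable t)).
    - by move=> x _; apply: mule_ge0 (V0 t x); rewrite lee_fin; exact: a0.
    - by rewrite lee_fin; exact: gamma_kernel_ge0.
    by apply: eq_integral => x _; rewrite /H EFinM muleA.
  rewrite muleCA; apply: lee_wpmul2l; first by rewrite lee_fin; exact: gamma_kernel_ge0.
  exact: spectrum_V.
have step3 : (\int[leb]_t \int[lam]_x H t x = \int[lam]_x (G * (pitt_const * ((dot x x) `^ b * (g x ^+ 2 * rho x))))%:E)%E.
  rewrite (@fubini_tonelli _ _ _ _ _ leb lam (fun q : R * 'rV[R]_d => H q.1 q.2) mH (fun q => H0 q.1 q.2))/=.
  (* [pitt_integral] needs |x| > 0, and at the origin the conventional value of [pitt_weight] would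
     be visible. *)
  apply: (ge0_integral_off_origin d_ge1).
  - exact: (measurable_fun_fubini_tonelli_G (m1 := leb) (fun q : R * 'rV[R]_d => H q.1 q.2) mH (fun q => H0 q.1 q.2)).
  - apply/measurable_EFinP; apply: measurable_funM; first exact: measurable_cst.
    by apply: measurable_funM; [exact: measurable_cst|exact: mR].
  - by move=> x; apply: integral_ge0 => t _; exact: H0.
  - by move=> x; rewrite lee_fin; exact: mulr_ge0 (ltW G0) (mulr_ge0 pc0 (R0 x)).
  move=> x x0; have u0 := dot_gt0 x0.
  have mVx : measurable_fun setT (V ^~ x) by exact: (measurableT_comp mV (pair2_measurable x)).
  have mgV : measurable_fun setT (fun t => (gamma_kernel b 0 t)%:E * V t x)%E.
    by apply: emeasurable_funM; [apply/measurable_EFinP; exact: measurable_gamma_kernel|exact: mVx].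
  have gV0 t : (0 <= (gamma_kernel b 0 t)%:E * V t x)%E.
    by apply: mule_ge0 (V0 t x); rewrite lee_fin; exact: gamma_kernel_ge0.
  transitivity ((a x)%:E * \int[leb]_t ((gamma_kernel b 0 t)%:E * V t x))%E.
    rewrite -ge0_integralZl//; last by rewrite lee_fin; exact: a0.
    by apply: eq_integral => t _; rewrite /H EFinM -muleA muleCA.
  have -> : (\int[leb]_t ((gamma_kernel b 0 t)%:E * V t x) = \int[leb]_t \int[leb]_s
      (gamma_kernel b 0 t * pitt_kernel t (dot x x) s)%:E)%E.
    apply: eq_integral => t _; rewrite (ge0_integralZl_real leb (gamma_kernel_ge0 b 0 t) _ (pitt_kernel_ge0 t (dot x x)))//.
    exact: (measurableT_comp measurable_pitt_kernel (pair1_measurable (t, x))).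
  rewrite (pitt_integral b0 bm u0) -EFinM; congr EFin.
  rewrite /a pitt_weightE (negbTE x0) /G /pitt_const.
  have -> : (dot x x) `^ (b - m) = (dot x x) `^ b * (dot x x) `^ (- m).
    by rewrite -powRD// (gt_eqF u0) implybT.
  have w0 : (dot x x) `^ (- m) != 0 by rewrite gt_eqF// powR_gt0.
  exact: weight_algebra.
have h : ((Gamma m)%:E * ((Gamma b)%:E * \int[lam]_y ((dot y y) `^ (- b) * (P y * rho y))%:E) <=
    G%:E * \int[lam]_x (pitt_const * ((dot x x) `^ b * (g x ^+ 2 * rho x)))%:E)%E.
  apply: le_trans (lee_wpmul2l _ step1) _; first by rewrite lee_fin ltW.
  apply: (le_trans step2); rewrite step3 (ge0_integralZl_real lam (ltW G0) _ (fun x => mulr_ge0 pc0 (R0 x)))//.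
  by apply: measurable_funM; [exact: measurable_cst|exact: mR].
by move: h; rewrite muleA -EFinM -/G lee_pmul2l// lte_fin.
Qed.

End inequality.

End pitt.

(** * Schwartz functions *)

Section schwartz_functions.
Context {R : realType} {d : nat}.
Variable g : 'rV[R]_d -> R.
Hypothesis gs : schwartz_real g.
Implicit Types x z v : 'rV[R]_d.

Lemma schwartz_continuous : continuous g.
Proof. by move=> x; apply: differentiable_continuous; exact: (gs.1 [::] x). Qed.

(** From (1 + u)^n <= 2^n (1 + u^n) with u = |x|^2; the seminorm of order 2n therefore suffices. *)
Lemma schwartz_decay n : exists M, forall x, `|g x| <= M / (1 + dot x x) ^+ n.
Proof.
have [M0 h0] := gs.2 0%N [::]; have [M1 h1] := gs.2 n.*2 [::].
exists (2 ^+ n * (M0 + M1)) => x.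
have u0 : 0 <= dot x x := dot_ge0 x.
have p0 : 0 < (1 + dot x x) ^+ n by rewrite exprn_gt0// ltr_wpDr.
rewrite ler_pdivlMr//.
have bound : (1 + dot x x) ^+ n <= 2 ^+ n * (1 + dot x x ^+ n).
  have [u1|u1] := leP (dot x x) 1.
    apply: (@le_trans _ _ (2 ^+ n)); first by rewrite lerXn2r ?nnegrE ?addr_ge0//; lra.
    by rewrite ler_peMr ?exprn_ge0// lerDl exprn_ge0.
  apply: (@le_trans _ _ ((2 * dot x x) ^+ n)).
    by rewrite lerXn2r ?nnegrE ?addr_ge0 ?mulr_ge0//; lra.
  by rewrite exprMn ler_wpM2l ?exprn_ge0// lerDr.
rewrite (le_trans (ler_wpM2l (normr_ge0 _) bound))// mulrCA ler_wpM2l ?exprn_ge0//.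
rewrite mulrDr mulr1; apply: lerD.
  by have := h0 x; rewrite expr0 mul1r.
have := h1 x; rewrite /iter_partial/= -mul2n exprM sqr_enorm mulrC; exact.
Qed.

Lemma schwartz_bounded : exists B, forall x, `|g x| <= B.
Proof. by have [M H] := schwartz_decay 0; exists M => x; have := H x; rewrite expr0 divr1. Qed.

(** Mean value theorem on the segment; the gradient is bounded by the seminorms of the first
    derivatives. *)
Lemma schwartz_lipschitz : exists L, forall x z, `|g x - g z| <= L * enorm (x - z).
Proof.
have [M HM] := choice (fun j : 'I_d => gs.2 0%N [:: j]).
exists (\sum_j `|M j|) => x z.
have diff y : differentiable g y := gs.1 [::] y.
have Dv v y : `|'D_v g y| <= (\sum_j `|M j|) * enorm v.
  have -> : 'D_v g y = \sum_j v ord0 j * 'D_(unit_vec R j) g y.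
    rewrite deriveE// {1}(row_sum_delta v) linear_sum; apply: eq_bigr => j _.
    by rewrite linearZ/= deriveE.
  rewrite (le_trans (ler_norm_sum _ _ _))// mulr_suml; apply: ler_sum => j _.
  rewrite normrM mulrC; apply: ler_pM => //; last exact: coord_le_enorm.
  by have := HM j y; rewrite expr0 mul1r => h; apply: (le_trans h); exact: ler_norm.
have D s : is_derive s (1 : R) (fun s : R => g (z + s *: (x - z))) ('D_(x - z) g (z + s *: (x - z))).
  by apply: is_derive_along; apply: DeriveDef => //; exact: diff_derivable.
have [|c _] := @MVT_segment R (fun s : R => g (z + s *: (x - z))) _ 0 1 ler01 (fun s _ => D s).
  apply: continuous_subspaceT => s; apply: differentiable_continuous.
  by apply/derivable1_diffP; have [] := D s.
have -> : z + 1 *: (x - z) = x by rewrite scale1r addrC subrK.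
by rewrite scale0r addr0 subr0 mulr1 => ->; exact: Dv.
Qed.

End schwartz_functions.

(** * Integrability of powers against the Dunkl measure *)

Section density_integrals.
Context {R : realType} {d : nat} {Rp : {fset 'rV[R]_d}} {k : 'rV[R]_d -> R}.
Variable data : dunkl_data Rp k.
Hypothesis c0 : dunkl_const Rp k != 0.
Hypothesis d_ge1 : (1 <= d)%N.
Implicit Types (x y z : 'rV[R]_d) (t s : R).
Notation lam := (@lebesgue_rV R d).
Notation leb := (@lebesgue_measure R).
Notation rho := (dunkl_density Rp k).
Notation hdim := (@hdim R d Rp k).
Notation m := (@pitt_index R d Rp k).

(** A function dominated by a superposition of Gaussians is integrated by Tonelli and the Gaussian
    formula, which replaces polar coordinates. The rate [phi] allows for 1 + s, where an additional
    Gaussian factor is present. *)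
Lemma integral_laplace_density (phi q : R -> R) (f : 'rV[R]_d -> R) :
  measurable_fun setT phi -> measurable_fun setT q ->
  measurable_fun setT f -> (forall x, 0 <= f x) ->
  (forall s, 0 <= q s) -> (forall s, phi s <= 0 -> q s = 0) ->
  (forall x, ((f x)%:E <= \int[leb]_s (q s * expR (- (phi s * dot x x)))%:E)%E) ->
  (\int[lam]_x (f x * rho x)%:E <= \int[leb]_s (q s * (2 * phi s) `^ (- hdim))%:E)%E.
Proof.
move=> mphi mq mf f0 q0 qneg fq.
pose F s x := q s * expR (- (phi s * dot x x)) * rho x.
have F0 s x : 0 <= F s x by exact: mulr_ge0 (mulr_ge0 (q0 s) (expR_ge0 _)) (density_ge0 x).
have mF : measurable_fun setT (fun p : R * 'rV[R]_d => F p.1 p.2).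
  apply: measurable_funM; last exact: (measurableT_comp (measurable_density (Rp := Rp) (k := k)) measurable_snd).
  apply: measurable_funM; first exact: (measurableT_comp mq measurable_fst).
  apply: measurableT_comp => //; apply: measurableT_comp => //; apply: measurable_funM; first exact: (measurableT_comp mphi measurable_fst).
  exact: (measurableT_comp (@measurable_dotxx R d) measurable_snd).
have mF' : measurable_fun setT (fun p : 'rV[R]_d * R => F p.2 p.1).
  exact: (measurableT_comp mF (measurable_swap (T1 := 'rV[R]_d) (T2 := R))).
apply: (@le_trans _ _ (\int[lam]_x \int[leb]_s (F s x)%:E)%E).
  apply: ge0_le_integral_real.
  - by apply/measurable_EFinP; apply: measurable_funM; [exact: mf|exact: measurable_density].
  - exact: (measurable_ge0_integral leb mF' (fun x s => F0 s x)).
  - by move=> x; rewrite lee_fin; exact: mulr_ge0 (f0 x) (density_ge0 x).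
  move=> x; have mqx : measurable_fun setT (fun s : R => q s * expR (- (phi s * dot x x))).
    apply: measurable_funM; first exact: mq.
    apply: measurableT_comp => //; apply: measurableT_comp => //.
    by apply: measurable_funM; [exact: mphi|exact: measurable_cst].
  have -> : (\int[leb]_s (F s x)%:E = (rho x)%:E * \int[leb]_s (q s * expR (- (phi s * dot x x)))%:E)%E.
    rewrite -(ge0_integralZl_real leb (density_ge0 x) mqx (fun s => mulr_ge0 (q0 s) (expR_ge0 _))).
    by apply: eq_integral => s _; rewrite /F mulrC.
  by rewrite mulrC EFinM; apply: lee_wpmul2l (fq x); rewrite lee_fin; exact: density_ge0.
rewrite -(tonelli_real leb lam mF F0) le_eqVlt; apply/orP; left; apply/eqP.
apply: eq_integral => s _; have [s0|s0] := ltP 0 (phi s); last first.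
  by rewrite (qneg s s0) mul0r integral0_eq// => x _; rewrite /F (qneg s s0) !mul0r.
have [mg _] := gauss_decay_density data s0.
have ig := gauss_decay_integrable (gauss_decay_density data s0).
rewrite -(Rintegral_gauss_density data c0 s0) EFinM -(Rintegral_EFin ig).
rewrite -(ge0_integralZl_real lam (q0 s) mg (fun x => gauss_density_ge0 (phi s) x)).
by apply: eq_integral => x _; rewrite /F /gauss_density mulrA.
Qed.

(** (1 + |x|^2)^(-n) is a Gamma average of exp(-s(1 + |x|^2)); integrating out x leaves a Gamma
    integral with exponent n - [hdim]. *)
Lemma integrable_decay n : hdim < n%:R -> integrableR lam (fun x => (1 + dot x x) ^- n * rho x).
Proof.
move=> hn; have n0 : 0 < n%:R :> R by exact: le_lt_trans (hdim_ge0 data) hn.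
have G0 := Gamma_gt0 n0.
have u0 x : 0 < 1 + dot x x by rewrite ltr_wpDr ?dot_ge0.
have mu : measurable_fun setT (fun x : 'rV[R]_d => 1 + dot x x).
  by apply: measurable_funD; [exact: measurable_cst|exact: measurable_dotxx].
have mf : measurable_fun setT (fun x : 'rV[R]_d => (1 + dot x x) ^- n).
  by apply: measurable_fun_invr; exact: measurable_funX.
have f0 x : 0 <= (1 + dot x x) ^- n by rewrite invr_ge0 exprn_ge0// ltW.
have qneg s : s <= 0 -> gamma_kernel n%:R 1 s = 0 by exact: gamma_kernel_le0.
have H := @integral_laplace_density idfun (gamma_kernel n%:R 1) (fun x => Gamma n%:R * (1 + dot x x) ^- n)
  (@measurable_id _ _ setT) (measurable_gamma_kernel _ _) (measurable_funM (measurable_cst _) mf) (fun x => mulr_ge0 (ltW G0) (f0 x))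
  (gamma_kernel_ge0 _ _) qneg.
have iG : integrableR lam (fun x => Gamma n%:R * (1 + dot x x) ^- n * rho x).
  apply: integrableR_ge0.
  - by apply: measurable_funM; [exact: (measurable_funM (measurable_cst _) mf)|exact: measurable_density].
  - by move=> x; exact: mulr_ge0 (mulr_ge0 (ltW G0) (f0 x)) (density_ge0 x).
  apply: (le_lt_trans (H _)).
    move=> x; have h := integral_gamma_kernel n0 (u0 x).
    rewrite -(powR_mulrn n (ltW (u0 x))) -powRN -h le_eqVlt; apply/orP; left; apply/eqP.
    apply: eq_integral => s _; congr EFin; rewrite /gamma_kernel; case: ifP => _; last by rewrite mul0r.
    by rewrite -mulrA -expRD; congr (_ * expR _); rewrite /=; ring.
  have nh : 0 < n%:R - hdim by rewrite subr_gt0.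
  have -> : (\int[leb]_s (gamma_kernel n%:R 1 s * (2 * s) `^ (- hdim))%:E =
     (2 `^ (- hdim))%:E * \int[leb]_s (gamma_kernel (n%:R - hdim) 1 s)%:E)%E.
    rewrite -(ge0_integralZl_real leb (powR_ge0 _ _) (measurable_gamma_kernel _ _) (gamma_kernel_ge0 _ _)).
    apply: eq_integral => s _; congr EFin; rewrite /gamma_kernel; case: ifPn => s0; last by rewrite mul0r mulr0.
    rewrite powRM ?(ltW s0)//.
    have -> : s `^ (n%:R - hdim - 1) = s `^ (n%:R - 1) * s `^ (- hdim).
      rewrite -powRD; last by rewrite (gt_eqF s0) implybT.
      by congr (_ `^ _); ring.
    by ring.
  by rewrite (integral_gamma_kernel nh (ltr01 : 0 < 1 :> R)) -EFinM ltry.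
have := integrableRZ (Gamma n%:R)^-1 iG; congr (integrableR _ _); apply/funext => x.
by rewrite -mulrA mulKf// gt_eqF.
Qed.

(** As a superposition of Gaussians of rate 1 + s this reduces to the Beta integral with both
    parameters m, since [hdim] = m + m. *)
Lemma integrable_singular : integrableR lam (fun x => (dot x x) `^ (- m) * expR (- dot x x) * rho x).
Proof.
have m0 := pitt_index_gt0 data d_ge1; have G0 := Gamma_gt0 m0.
pose f x : R := Gamma m * ((dot x x) `^ (- m) * expR (- dot x x)).
have mf : measurable_fun setT f.
  apply: measurable_funM; first exact: measurable_cst.
  apply: measurable_funM; first exact: (measurable_fun_powRl _ (@measurable_dotxx R d)).
  by apply: measurableT_comp => //; apply: measurableT_comp => //; exact: (@measurable_dotxx R d).
have f0 x : 0 <= f x by exact: mulr_ge0 (ltW G0) (mulr_ge0 (powR_ge0 _ _) (expR_ge0 _)).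
have mphi : measurable_fun setT (fun s : R => 1 + s) by apply: measurable_funD.
have iG : integrableR lam (fun x => f x * rho x).
  apply: integrableR_ge0.
  - by apply: measurable_funM; [exact: mf|exact: measurable_density].
  - by move=> x; exact: mulr_ge0 (f0 x) (density_ge0 x).
  have qneg s : 1 + s <= 0 -> gamma_kernel m 0 s = 0.
    by move=> h; apply: gamma_kernel_le0; lra.
  apply: (le_lt_trans (integral_laplace_density mphi (measurable_gamma_kernel m 0) mf f0
    (gamma_kernel_ge0 m 0) qneg _)).
    move=> x; have [->|x0] := eqVneq x 0.
      rewrite /f dot0l powR0 ?oppr_eq0 ?(gt_eqF m0)// mul0r mulr0; apply: integral_ge0 => s _.
      by rewrite lee_fin; exact: mulr_ge0 (gamma_kernel_ge0 _ _ _) (expR_ge0 _).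
    rewrite /f mulrA (mulrC _ (expR _)) EFinM -(integral_gamma_kernel m0 (dot_gt0 x0)).
    rewrite -(ge0_integralZl_real leb (expR_ge0 _) (measurable_gamma_kernel _ _) (gamma_kernel_ge0 _ _)).
    rewrite le_eqVlt; apply/orP; left; apply/eqP.
    apply: eq_integral => s _; congr EFin; rewrite /gamma_kernel; case: ifP => _; last by rewrite mul0r mulr0.
    rewrite mul0r oppr0 expR0 mulr1 mulrCA -expRD; congr (_ * expR _); ring.
  have -> : (\int[leb]_s (gamma_kernel m 0 s * (2 * (1 + s)) `^ (- hdim))%:E =
     (2 `^ (- hdim))%:E * \int[leb]_s (gamma_kernel m 0 s * (1 + s) `^ (- (m + m)))%:E)%E.
    rewrite -(ge0_integralZl_real leb (powR_ge0 _ _) _ (fun s => mulr_ge0 (gamma_kernel_ge0 _ _ _) (powR_ge0 _ _))).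
      apply: eq_integral => s _; congr EFin; have [s0|s0] := ltP 0 s; last first.
        by rewrite (gamma_kernel_le0 m 0 s0) !mul0r mulr0.
      rewrite powRM//; last by rewrite addr_ge0// ltW.
      by rewrite mulrCA; congr (_ * (_ * _ `^ _)); rewrite /pitt_index; field.
    by apply: measurable_funM; [exact: measurable_gamma_kernel|exact: measurable_fun_powRl].
  by rewrite (beta_prime m0 m0) -EFinM ltry.
have := integrableRZ (Gamma m)^-1 iG; congr (integrableR _ _); apply/funext => x.
by rewrite /f -mulrA mulKf// gt_eqF.
Qed.

End density_integrals.

(** F may have an infinite integral. Its negative part is dominated by that of l, hence integrable,
    so the integral of F is well defined and, if the positive part diverges, equal to plus
    infinity. *)
Lemma Rintegral_le_integral {dT} {T : measurableType dT} {R : realType} (mu : {measure set T -> \bar R})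
    (l F : T -> R) : measurable_fun setT F -> integrableR mu l -> (forall x, l x <= F x) ->
  ((\int[mu]_x l x)%:E <= \int[mu]_x (F x)%:E)%E.
Proof.
move=> mF il lF; have ml := integrableR_measurable il.
have meF : measurable_fun setT (EFin \o F) by exact/measurable_EFinP.
have mel : measurable_fun setT (EFin \o l) by exact/measurable_EFinP.
rewrite -(Rintegral_EFin il).
have neg : (\int[mu]_x (EFin \o F)^\- x <= \int[mu]_x (EFin \o l)^\- x)%E.
  apply: ge0_le_integral_real.
  - exact: measurable_funeneg.
  - exact: measurable_funeneg.
  - by move=> x; exact: funeneg_ge0.
  by move=> x; rewrite !funenegE/= ge_max !le_max lexx orbT lee_fin lerN2 lF.
have negfin := integral_funeneg_lt_pinfty measurableT il.
have [posfin|] := ltP (\int[mu]_x (EFin \o F)^\+ x)%E +oo%E.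
  apply: le_integral => //; last by move=> x _; rewrite lee_fin.
  apply/integrableP; split=> //; rewrite (_ : (fun x => _) = abse \o (EFin \o F))// fune_abse ge0_integralD//=.
  - by rewrite lte_add_pinfty// (le_lt_trans neg).
  - exact: measurable_funepos.
  - exact: measurable_funeneg.
rewrite leye_eq => /eqP posinf; rewrite (integralE _ _ (EFin \o F)) posinf addye ?leey//.
by rewrite eqe_oppLR/= lt_eqF// (le_lt_trans neg).
Qed.

(** * The limit b -> 0 *)

Section log_approximation.
Context {R : realType}.
Implicit Types (u b m : R).

(** The difference quotient (u^b - 1)/b, with u u^(-1) in place of 1: this product is 1 for u > 0
    and 0 at u = 0, so the approximation agrees at the origin with the default value ln 0 = 0. *)
Definition log_approx b u : R := (u `^ b - u * u `^ (-1)) / b.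

Lemma mulr_powRN1 u : 0 < u -> u * u `^ (-1) = 1.
Proof. by move=> u0; rewrite powR_inv1 ?(ltW u0)// mulfV// gt_eqF. Qed.

Lemma log_approx_gt0 b u : 0 < u -> log_approx b u = (expR (b * ln u) - 1) / b.
Proof. by move=> u0; rewrite /log_approx mulr_powRN1// /powR gt_eqF. Qed.

Lemma log_approx_at0 b : b != 0 -> log_approx b 0 = 0.
Proof. by move=> b0; rewrite /log_approx powR0// mul0r subr0 mul0r. Qed.

(** Uniform in b <= de. The quotient is at most |ln u| exp(b |ln u|), hence at most exp(2 de |ln
    u|)/de, which is controlled by u for large u and by u^(-m) for small u. *)
Lemma log_approx_bound m de b u : 0 < de -> de + de <= 1 -> de + de <= m -> 0 < b -> b <= de -> 0 <= u ->
  `|log_approx b u| <= de^-1 * (u + u `^ (- m)).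
Proof.
move=> de0 de1 dem b0 bde u0.
have R0 : 0 <= de^-1 * (u + u `^ (- m)) by rewrite mulr_ge0 ?invr_ge0 ?(ltW de0)// addr_ge0// powR_ge0.
have [->|un0] := eqVneq u 0; first by rewrite log_approx_at0 ?gt_eqF// normr0 mulr_ge0 ?invr_ge0 ?(ltW de0)// addr_ge0// powR_ge0.
have {un0}u1 : 0 < u by rewrite lt_neqAle eq_sym un0.
rewrite log_approx_gt0// normrM normfV (gtr0_norm b0) ler_pdivrMr//.
apply: (le_trans (norm_expR_sub1 _)); rewrite normrM (gtr0_norm b0).
set L := ln u; rewrite [X in _ <= X]mulrC -mulrA ler_wpM2l ?(ltW b0)//.
have h1 : `|L| <= de^-1 * expR (de * `|L|).
  rewrite -ler_pdivrMl ?invr_gt0// invrK.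
  by have := expR_ge1Dx (de * `|L|); move: (expR _) => E; lra.
have h2 : expR (b * `|L|) <= expR (de * `|L|) by rewrite ler_expR ler_wpM2r.
apply: (@le_trans _ _ (de^-1 * (expR (de * `|L|) * expR (de * `|L|)))).
  by rewrite mulrA ler_pM ?expR_ge0.
rewrite ler_wpM2l ?invr_ge0 ?(ltW de0)// -expRD -mulrDl.
have uE : u = expR L by rewrite lnK.
have vE : u `^ (- m) = expR (- m * L) by rewrite /powR gt_eqF.
have [L0|L0] := leP 0 L.
  rewrite (ger0_norm L0); apply: (@le_trans _ _ u); last by rewrite lerDl powR_ge0.
  by rewrite uE ler_expR -[X in _ <= X]mul1r ler_wpM2r.
rewrite (ltr0_norm L0); apply: (@le_trans _ _ (u `^ (- m))); last by rewrite lerDr.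
by rewrite vE ler_expR mulrN mulNr lerN2 ler_wnM2r// ltW.
Qed.

Lemma is_derive_log_approx u : is_derive (0 : R) 1 (fun b => expR (b * ln u)) (ln u).
Proof.
have D : is_derive (0 : R) (1 : R) (fun b : R => b * ln u) (ln u).
  have := is_deriveM (is_derive_id (0 : R) (1 : R)) (is_derive_cst (ln u) (0 : R) (1 : R)).
  by rewrite /GRing.scale/= mulr0 add0r mulr1.
have E : is_derive ((fun b : R => b * ln u) 0) 1 (@expR R) 1.
  by rewrite mul0r; have := is_derive_expR (0 : R); rewrite expR0.
by have := @is_derive1_comp R (@expR R) (fun b : R => b * ln u) 0 _ _ E D; rewrite mul1r.
Qed.

Lemma cvg_slope (f : R -> R) (l : R) (b : nat -> R) : is_derive (0 : R) (1 : R) f l -> (forall n, b n != 0) ->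
  b n @[n --> \oo] --> 0 -> (f (b n) - f 0) / b n @[n --> \oo] --> l.
Proof.
move=> D bn0 b0; have [df fl] := D.
have df' : (fun h => h^-1 *: (f (h *: 1 + 0) - f 0)) @ 0^' --> l by rewrite -fl; exact: df.
have b0' : b n @[n --> \oo] --> (0 : R)^'.
  move=> A /b0; rewrite nbhs_filterE/= => h; apply: filterS h => n /= h; exact: h (bn0 n).
have := cvg_comp _ _ b0' df'; apply: cvg_trans; apply: near_eq_cvg.
by apply: nearW => n /=; rewrite addr0 /GRing.scale/= mulr1 mulrC.
Qed.

Lemma log_approx_cvg u (b : nat -> R) : 0 <= u -> (forall n, b n != 0) -> b n @[n --> \oo] --> 0 ->
  log_approx (b n) u @[n --> \oo] --> ln u.
Proof.
move=> u0 bn0 b0; have [->|un0] := eqVneq u 0.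
  rewrite ln0//; rewrite (_ : (fun n => _) = fun=> 0); first exact: cvg_cst.
  by apply/funext => n; rewrite log_approx_at0.
have {un0}u1 : 0 < u by rewrite lt_neqAle eq_sym un0.
have := cvg_slope (is_derive_log_approx u) bn0 b0.
rewrite (_ : (fun n => log_approx (b n) u) = (fun n => (expR (b n * ln u) - expR (0 * ln u)) / b n))//.
by apply/funext => n; rewrite log_approx_gt0// mul0r expR0.
Qed.

Lemma log_approx_le b u : 0 < b -> 0 <= u -> (u * u `^ (-1) - u `^ (- b)) / b <= ln u.
Proof.
move=> b0 u0; have [->|un0] := eqVneq u 0.
  by rewrite ln0// mul0r powR0 ?oppr_eq0 ?gt_eqF// subr0 mul0r.
have {un0}u1 : 0 < u by rewrite lt_neqAle eq_sym un0.
rewrite mulr_powRN1// /powR gt_eqF// ler_pdivrMr// mulNr.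
by have := expR_ge1Dx (- (b * ln u)); move: (expR _) => E; rewrite (mulrC (ln u)); lra.
Qed.

End log_approximation.

Section pitt_constant.
Context {R : realType} {d : nat} {Rp : {fset 'rV[R]_d}} {k : 'rV[R]_d -> R}.
Variable data : dunkl_data Rp k.
Hypothesis d_ge1 : (1 <= d)%N.
Notation m := (@pitt_index R d Rp k).
Notation pitt_const := (@pitt_const R d Rp k).

Let m0 := pitt_index_gt0 data d_ge1.

(** Exponential of the logarithm of Pitt's constant, in a form that can be differentiated at b =
    0. *)
Let E (b : R) : R := expR (- (b * ln 4) + (ln (Gamma (m - b)) - ln (Gamma (m + b)))).

Let pitt_constE b : 0 < b -> b < m -> pitt_const b = E b.
Proof.
move=> b0 bm; have g1 : 0 < Gamma (m - b) by apply: Gamma_gt0; rewrite subr_gt0.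
have g2 : 0 < Gamma (m + b) by apply: Gamma_gt0; exact: addr_gt0.
rewrite /pitt_const /E (_ : 4 `^ (- b) = expR (- (b * ln 4))); last by rewrite /powR pnatr_eq0/= mulNr.
move: g1 g2; move: (Gamma (m - b)) (Gamma (m + b)) => p q p0 q0.
by rewrite expRD expRB (lnK p0) (lnK q0).
Qed.

Let E0 : E 0 = 1.
Proof. by rewrite /E mul0r oppr0 !addr0 addrN addr0 expR0. Qed.

(** The factor 4^(-b) contributes ln 4 = 2 ln 2, and each of the two Gamma factors contributes one
    digamma value. *)
Let dE : is_derive (0 : R) 1 E (- (2 * ln 2 + 2 * digamma m)).
Proof.
have D1 : is_derive (0 : R) (1 : R) (fun b : R => - (b * ln 4)) (- ln 4).
  have := is_deriveM (is_derive_id (0 : R) (1 : R)) (is_derive_cst (ln 4 : R) (0 : R) (1 : R)).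
  by rewrite /GRing.scale/= mulr0 add0r mulr1 => /is_deriveN.
have D2 : is_derive (0 : R) (1 : R) (fun b : R => ln (Gamma (m - b))) (- digamma m).
  have G := is_derive_ln_Gamma m0.
  have S : is_derive (0 : R) (1 : R) (fun b : R => m - b) (-1).
    have := is_deriveB (is_derive_cst m (0 : R) (1 : R)) (is_derive_id (0 : R) (1 : R)).
    by rewrite sub0r.
  have G' : is_derive ((fun b : R => m - b) 0) 1 (fun s => ln (Gamma s)) (digamma m) by rewrite subr0.
  by have := @is_derive1_comp R (fun s => ln (Gamma s)) (fun b : R => m - b) 0 _ _ G' S; rewrite mulrN1.
have D3 : is_derive (0 : R) (1 : R) (fun b : R => ln (Gamma (m + b))) (digamma m).
  have G := is_derive_ln_Gamma m0.
  have S : is_derive (0 : R) (1 : R) (fun b : R => m + b) 1.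
    have := is_deriveD (is_derive_cst m (0 : R) (1 : R)) (is_derive_id (0 : R) (1 : R)).
    by rewrite add0r.
  have G' : is_derive ((fun b : R => m + b) 0) 1 (fun s => ln (Gamma s)) (digamma m) by rewrite addr0.
  by have := @is_derive1_comp R (fun s => ln (Gamma s)) (fun b : R => m + b) 0 _ _ G' S; rewrite mulr1.
have D := is_deriveD D1 (is_deriveB D2 D3).
have H : is_derive ((fun b : R => - (b * ln 4) + (ln (Gamma (m - b)) - ln (Gamma (m + b)))) 0) 1 (@expR R) 1.
  rewrite mul0r oppr0 !addr0 addrN addr0.
  by have := is_derive_expR (0 : R); rewrite expR0.
have := @is_derive1_comp R (@expR R) (fun b : R => - (b * ln 4) + (ln (Gamma (m - b)) - ln (Gamma (m + b)))) 0 _ _ H D; rewrite mul1r.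
have l4 : ln 4 = 2 * ln 2 :> R by rewrite (_ : 4 = 2 * 2)// ?lnM ?posrE//; [ring|rewrite -natrM].
by congr (is_derive _ _ _ _); rewrite l4; ring.
Qed.

Lemma pitt_const_slope_cvg (b : nat -> R) : (forall n, 0 < b n) -> (forall n, b n < m) ->
  b n @[n --> \oo] --> 0 ->
  (1 - pitt_const (b n)) / b n @[n --> \oo] --> 2 * digamma m + 2 * ln 2.
Proof.
move=> b0 bm bcvg.
have H : (- ((E (b n) - E 0) / b n)) @[n --> \oo] --> - - (2 * ln 2 + 2 * digamma m).
  by apply: cvgN; exact: cvg_slope dE (fun n => lt0r_neq0 (b0 n)) bcvg.
rewrite opprK addrC in H; move: H.
rewrite (_ : (fun n => (1 - pitt_const (b n)) / b n) = (fun n => - ((E (b n) - E 0) / b n)))//.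
by apply/funext => n; rewrite E0 pitt_constE// -mulNr opprB.
Qed.

Lemma pitt_const_cvg (b : nat -> R) : (forall n, 0 < b n) -> (forall n, b n < m) ->
  b n @[n --> \oo] --> 0 -> pitt_const (b n) @[n --> \oo] --> (1 : R).
Proof.
move=> b0 bm bcvg; have H := pitt_const_slope_cvg b0 bm bcvg.
have K : 1 - b n * ((1 - pitt_const (b n)) / b n) @[n --> \oo] --> 1 - 0 * (2 * digamma m + 2 * ln 2).
  by apply: cvgB; [exact: cvg_cst|exact: cvgM bcvg H].
rewrite mul0r subr0 in K; move: K.
rewrite (_ : (fun n => pitt_const (b n)) = (fun n => 1 - b n * ((1 - pitt_const (b n)) / b n)))//.
by apply/funext => n; rewrite mulrCA mulfV ?gt_eqF// mulr1 opprB addrC subrK.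
Qed.

End pitt_constant.

Section schwartz_integrals.
Context {R : realType} {d : nat} {Rp : {fset 'rV[R]_d}} {k : 'rV[R]_d -> R}.
Variable data : dunkl_data Rp k.
Hypothesis c0 : dunkl_const Rp k != 0.
Hypothesis d_ge1 : (1 <= d)%N.
Notation lam := (@lebesgue_rV R d).
Notation rho := (dunkl_density Rp k).
Notation m := (@pitt_index R d Rp k).
Variable g : 'rV[R]_d -> R.
Hypothesis gs : schwartz_real g.

Lemma schwartz_measurable : measurable_fun setT g.
Proof. by apply: continuous_measurable_rV; exact: schwartz_continuous. Qed.

Let mg := schwartz_measurable.
Let mrho : measurable_fun setT rho := measurable_density (Rp := Rp) (k := k).
Let rho0 x : 0 <= rho x := density_ge0 (Rp := Rp) (k := k) x.

Let N := (Num.trunc (@hdim R d Rp k)).+1.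

Let iN : integrableR lam (fun x => (1 + dot x x) ^- N * rho x).
Proof. by apply: (integrable_decay data c0); rewrite /N truncnS_gt. Qed.

Let u1 (x : 'rV[R]_d) : 0 < 1 + dot x x :> R. Proof. by rewrite ltr_wpDr ?dot_ge0. Qed.

Lemma integrable_schwartz : integrableR lam (fun x => g x * rho x).
Proof.
have [M hM] := schwartz_decay gs N.
apply: (integrableR_dom _ (integrableRZ M iN)); first exact: measurable_funM.
move=> x; rewrite (normrM (g x)) (ger0_norm (rho0 x)); move: (rho x) (rho0 x) => r r0.
by rewrite mulrA; exact: ler_wpM2r r0 _ _ (hM x).
Qed.

Lemma integrable_schwartz_sqr : integrableR lam (fun x => (1 + dot x x) * (g x ^+ 2 * rho x)).
Proof.
have [M hM] := schwartz_decay gs N; have [M1 hM1] := schwartz_decay gs 1.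
have mu : measurable_fun setT (fun x : 'rV[R]_d => 1 + dot x x).
  by apply: measurable_funD; [exact: measurable_cst|exact: measurable_dotxx].
apply: (integrableR_dom _ (integrableRZ (M1 * M) iN)).
  by apply: measurable_funM; [exact: mu|exact: measurable_funM (measurable_funM mg mg) mrho].
move=> x; move: (rho x) (rho0 x) => r r0; rewrite (mulrA (1 + _)) (normrM (_ * _) r) (ger0_norm r0) [X in _ <= X]mulrA.
apply: ler_wpM2r => //; rewrite normrM (gtr0_norm (u1 x)) normrX expr2 mulrA.
have h := hM1 x; rewrite expr1 ler_pdivlMr// mulrC in h.
by rewrite -(mulrA M1) ler_pM// mulr_ge0// ltW.
Qed.

(** Where |x| >= 1 the singular power is at most 1 and Schwartz decay suffices; inside, g is bounded
    and 1 <= exp(1 - |x|^2) reduces to [integrable_singular]. *)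
Lemma integrable_schwartz_singular : integrableR lam (fun x => dot x x `^ (- m) * (g x ^+ 2 * rho x)).
Proof.
have [B hB] := schwartz_bounded gs; have m0 := pitt_index_gt0 data d_ge1.
have ising := integrable_singular data c0 d_ge1.
apply: (integrableR_dom _ (integrableRD integrable_schwartz_sqr (integrableRZ (B ^+ 2 * expR 1) ising))).
  apply: measurable_funM; last exact: measurable_funM (measurable_funM mg mg) mrho.
  by apply: measurable_fun_powRl; exact: measurable_dotxx.
move=> x; rewrite ger0_norm; last by rewrite mulr_ge0 ?powR_ge0// mulr_ge0 ?sqr_ge0.
move: (rho x) (rho0 x) => r r0; rewrite (mulrA (dot x x `^ _)) (mulrA (1 + _)) (mulrA (B ^+ 2 * _)) -mulrDl; apply: ler_wpM2r => //.
have g0 := sqr_ge0 (g x); have v0 := powR_ge0 (dot x x) (- m); have := dot_ge0 x.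
have gB : g x ^+ 2 <= B ^+ 2 by rewrite -(real_normK (num_real (g x))) lerXn2r ?nnegrE// (le_trans _ (hB x)).
move: (dot x x) v0 => u v0 u0; have e0 := expR_ge0 (- u); have e1 := expR_ge0 (1 : R).
have [u1'|u1'] := leP 1 u.
  apply: (@le_trans _ _ ((1 + u) * g x ^+ 2)).
    rewrite ler_wpM2r//; apply: (@le_trans _ _ (u `^ 0)); last by rewrite powRr0 lerDl.
    by rewrite ler_powR// oppr_le0 ltW.
  by rewrite lerDl (mulr_ge0 (mulr_ge0 (le_trans g0 gB) e1))// mulr_ge0.
have h : 1 <= expR 1 * expR (- u) by rewrite -expRD -[X in X <= _](@expR0 R) ler_expR subr_ge0 ltW.
rewrite (mulrA (B ^+ 2 * _)); apply: (@le_trans _ _ (B ^+ 2 * expR 1 * u `^ (- m) * expR (- u))); last first.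
  by rewrite lerDr mulr_ge0// addr_ge0.
have -> : B ^+ 2 * expR 1 * u `^ (- m) * expR (- u) = u `^ (- m) * (B ^+ 2 * (expR 1 * expR (- u))) by ring.
by rewrite ler_wpM2l// -[X in X <= _]mulr1 ler_pM// ler01.
Qed.

End schwartz_integrals.

Section log_limit.
Context {R : realType} {d : nat}.
Hypothesis d_ge1 : (1 <= d)%N.
Notation lam := (@lebesgue_rV R d).
Variables (m : R) (w : 'rV[R]_d -> R).
Hypotheses (m0 : 0 < m) (w0 : forall x, 0 <= w x).
Hypothesis iw : integrableR lam (fun x => (1 + dot x x) * w x).
Hypothesis isw : integrableR lam (fun x => dot x x `^ (- m) * w x).
Hypothesis mw : measurable_fun setT w.

Let mu : measurable_fun setT (fun x : 'rV[R]_d => dot x x) := @measurable_dotxx R d.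

Lemma integrable_weight : integrableR lam w.
Proof.
apply: (integrableR_dom mw iw) => x; rewrite ger0_norm// ler_peMl// lerDl; exact: dot_ge0.
Qed.

Lemma integrable_powR_weight b : 0 < b -> b <= 1 -> integrableR lam (fun x => dot x x `^ b * w x).
Proof.
move=> b0 b1; apply: (integrableR_dom _ iw).
  by apply: measurable_funM => //; exact: measurable_fun_powRl.
move=> x; rewrite ger0_norm ?mulr_ge0 ?powR_ge0// ler_wpM2r//.
have := dot_ge0 x; move: (dot x x) => u u0; have [u1|u1] := leP 1 u.
  by apply: (@le_trans _ _ (u `^ 1)); rewrite ?ler_powR// powRr1// lerDr.
apply: (@le_trans _ _ (1 `^ b)); last by rewrite powR1 lerDl.
by rewrite ge0_ler_powR ?nnegrE ?(ltW b0) ?(ltW u1)// ler01.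
Qed.

(** The factor is the indicator function of the complement of the origin, a null set. *)
Lemma Rintegral_off_origin (v : 'rV[R]_d -> R) : integrableR lam v -> (forall x, 0 <= v x) ->
  integrableR lam (fun x => dot x x * dot x x `^ (-1) * v x) /\
  \int[lam]_x (dot x x * dot x x `^ (-1) * v x) = \int[lam]_x v x.
Proof.
move=> iv v0; have mv := integrableR_measurable iv.
have e0 (x : 'rV[R]_d) : 0 <= dot x x * dot x x `^ (-1) by rewrite mulr_ge0 ?dot_ge0 ?powR_ge0.
have me : measurable_fun setT (fun x : 'rV[R]_d => dot x x * dot x x `^ (-1) * v x).
  apply: measurable_funM; last exact: mv.
  by apply: measurable_funM; [exact: mu|exact: measurable_fun_powRl].
have E : (\int[lam]_x (dot x x * dot x x `^ (-1) * v x)%:E = \int[lam]_x (v x)%:E)%E.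
  apply: (ge0_integral_off_origin d_ge1).
  - exact/measurable_EFinP.
  - exact/measurable_EFinP.
  - by move=> x; rewrite lee_fin mulr_ge0.
  - by move=> x; rewrite lee_fin.
  by move=> x x0; rewrite mulr_powRN1 ?mul1r// dot_gt0.
split; last by rewrite /Rintegral E.
apply: integrableR_ge0 => //; first by move=> x; rewrite mulr_ge0.
by rewrite E (Rintegral_EFin iv) ltry.
Qed.

Lemma integrable_log_approx b : 0 < b -> b <= 1 -> integrableR lam (fun x => log_approx b (dot x x) * w x) /\
  \int[lam]_x (log_approx b (dot x x) * w x) = b^-1 * (\int[lam]_x (dot x x `^ b * w x) - \int[lam]_x w x).
Proof.
move=> b0 b1; have [i1 e1] := Rintegral_off_origin integrable_weight w0.
have i2 := integrable_powR_weight b0 b1.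
have -> : (fun x => log_approx b (dot x x) * w x) =
    (fun x => b^-1 * (dot x x `^ b * w x - dot x x * dot x x `^ (-1) * w x)).
  by apply/funext => x; rewrite /log_approx; ring.
have i3 := integrableRB i2 i1; split; first exact: integrableRZ.
by rewrite RintegralZl// RintegralB// e1.
Qed.

(** Half of the minimum, since [log_approx_bound] asks for 2 de <= 1 and 2 de <= m. *)
Let de := Num.min m 1 / 2.
Definition pitt_exponent n : R := de / n.+1%:R.
Notation b := pitt_exponent.

Let de0 : 0 < de. Proof. by rewrite divr_gt0// lt_min m0 ltr01. Qed.
Let de2 : de + de = Num.min m 1. Proof. by rewrite /de; lra. Qed.

Lemma pitt_exponent_gt0 n : 0 < b n. Proof. by rewrite divr_gt0. Qed.

Let b_le n : b n <= de.
Proof. by rewrite ler_pdivrMr// ler_peMr ?(ltW de0)// ler1n. Qed.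

Lemma pitt_exponent_lt n : b n < m.
Proof.
apply: (le_lt_trans (b_le n)); apply: (@lt_le_trans _ _ (de + de)); first by rewrite ltrDl.
by rewrite de2 ge_min lexx.
Qed.

Lemma pitt_exponent_le1 n : b n <= 1.
Proof.
apply: (le_trans (b_le n)); apply: (@le_trans _ _ (de + de)); first by rewrite lerDl ltW.
by rewrite de2 ge_min lexx orbT.
Qed.

Lemma pitt_exponent_cvg : b n @[n --> \oo] --> (0 : R).
Proof.
rewrite -(mulr0 de); apply: cvgM; first exact: cvg_cst.
exact: cvg_harmonic.
Qed.

Lemma log_limit : integrableR lam (fun x => ln (dot x x) * w x) /\
  \int[lam]_x (log_approx (b n) (dot x x) * w x) @[n --> \oo] --> \int[lam]_x (ln (dot x x) * w x).
Proof.
apply: (@Rintegral_dominated_cvg _ _ _ lam (fun n x => log_approx (b n) (dot x x) * w x) _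
  (fun x => de^-1 * ((1 + dot x x) * w x + dot x x `^ (- m) * w x))).
- by move=> n; apply: integrableR_measurable; exact: (integrable_log_approx (pitt_exponent_gt0 n) (pitt_exponent_le1 n)).1.
- exact: integrableRZ (integrableRD iw isw).
- move=> x; apply: cvgM; last exact: cvg_cst.
  apply: log_approx_cvg; [exact: dot_ge0|by move=> n; rewrite gt_eqF// pitt_exponent_gt0|exact: pitt_exponent_cvg].
move=> n x; rewrite normrM (ger0_norm (w0 x)) -mulrDl mulrA ler_wpM2r//.
apply: (le_trans (@log_approx_bound R m de (b n) (dot x x) de0 _ _ (pitt_exponent_gt0 n) (b_le n) (dot_ge0 x))).
- by rewrite de2 ge_min lexx orbT.
- by rewrite de2 ge_min lexx.
by rewrite ler_wpM2l ?invr_ge0 ?(ltW de0)// lerD2r lerDr.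
Qed.

End log_limit.

Lemma ln_enorm {R : realType} {d : nat} (x : 'rV[R]_d) : ln (enorm x) = 2^-1 * ln (dot x x).
Proof.
have [->|x0] := eqVneq x 0; first by rewrite enorm0 dot0l ln0// mulr0.
have e0 : 0 < enorm x by rewrite lt_neqAle eq_sym enorm_eq0 x0 enorm_ge0.
by rewrite -sqr_enorm lnXn// -[ln _ *+ 2]mulr_natl mulrA mulVf// mul1r.
Qed.

(** * From Pitt's inequality to the logarithmic inequality *)

Section logarithmic_inequality.
Context {R : realType} {d : nat} {Rp : {fset 'rV[R]_d}} {k : 'rV[R]_d -> R}.
Variable data : dunkl_data Rp k.
Hypothesis d_ge1 : (1 <= d)%N.
Notation lam := (@lebesgue_rV R d).
Notation m := (@pitt_index R d Rp k).
Notation pitt_const := (@pitt_const R d Rp k).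
Variables w N : 'rV[R]_d -> R.
Hypotheses (mw : measurable_fun setT w) (w0 : forall x, 0 <= w x) (N0 : forall x, 0 <= N x).
Hypothesis iw : integrableR lam (fun x => (1 + dot x x) * w x).
Hypothesis isw : integrableR lam (fun x => dot x x `^ (- m) * w x).
Hypothesis iN : integrableR lam N.
Hypothesis eN : \int[lam]_x N x = \int[lam]_x w x.
Hypothesis pittN : forall b, 0 < b -> b < m -> b <= 1 ->
  (\int[lam]_y (dot y y `^ (- b) * N y)%:E <= (pitt_const b * \int[lam]_x (dot x x `^ b * w x))%:E)%E.

Let m0 := pitt_index_gt0 data d_ge1.
Let A := \int[lam]_x w x.

(** Integrating (1 - |y|^(-2b))/(2b) <= ln |y| against N, the first term is evaluated by Plancherel
    and the second estimated by Pitt. Splitting off 1 - C(b) leaves the difference quotient of the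
    constant and [log_approx], both of which have limits. *)
Lemma pitt_log_lower_bound b : 0 < b -> b < m -> b <= 1 ->
  ((2^-1 * ((1 - pitt_const b) / b * A - pitt_const b * \int[lam]_x (log_approx b (dot x x) * w x)))%:E
   <= \int[lam]_y (ln (enorm y) * N y)%:E)%E.
Proof.
move=> b0 bm b1; have mN := integrableR_measurable iN.
have [ia ea] := integrable_log_approx d_ge1 w0 iw mw b0 b1.
have mNb : measurable_fun setT (fun y => dot y y `^ (- b) * N y).
  by apply: measurable_funM; [apply: measurable_fun_powRl; exact: measurable_dotxx|exact: mN].
have p := pittN b0 bm b1.
have iNb : integrableR lam (fun y => dot y y `^ (- b) * N y).
  apply: (integrableR_ge0 mNb); first by move=> y; exact: mulr_ge0 (powR_ge0 _ _) (N0 y).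
  exact: le_lt_trans p (ltry _).
rewrite (Rintegral_EFin iNb) lee_fin in p.
have [iNo eNo] := Rintegral_off_origin d_ge1 iN N0.
have id := integrableRB iNo iNb.
(* Integrable minorant of the integrand; here too 1 is replaced by u u^(-1), in accordance with ln 0
   = 0. *)
pose l y := (2^-1 * b^-1) * (dot y y * dot y y `^ (-1) * N y - dot y y `^ (- b) * N y).
have il : integrableR lam l by exact: integrableRZ.
have lF y : l y <= ln (enorm y) * N y.
  have -> : l y = 2^-1 * ((dot y y * dot y y `^ (-1) - dot y y `^ (- b)) / b) * N y by rewrite /l; ring.
  rewrite ln_enorm; apply: ler_wpM2r (N0 y) _ _ _; apply: ler_wpM2l; first by rewrite invr_ge0.
  exact: log_approx_le b0 (dot_ge0 y).
have mF : measurable_fun setT (fun y : 'rV[R]_d => ln (enorm y) * N y).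
  apply: measurable_funM; last exact: mN.
  by apply: measurableT_comp => //; exact: measurable_enorm.
apply: le_trans (Rintegral_le_integral mF il lF); rewrite lee_fin.
rewrite /l RintegralZl// RintegralB// eNo eN -/A ea -/A.
move: p; set I := \int[lam]_x (dot x x `^ b * w x); set J := Rintegral _ _ _ => p.
have -> : (1 - pitt_const b) / b * A - pitt_const b * (b^-1 * (I - A)) = b^-1 * (A - pitt_const b * I) by ring.
rewrite -(mulrA 2^-1 b^-1); apply: ler_wpM2l; first by rewrite invr_ge0.
by apply: ler_wpM2l; [rewrite invr_ge0 ltW|rewrite lerD2l lerN2].
Qed.

Lemma log_uncertainty : integrableR lam (fun x => ln (enorm x) * w x) /\
  (((digamma m + ln 2) * A - \int[lam]_x (ln (enorm x) * w x))%:E <= \int[lam]_y (ln (enorm y) * N y)%:E)%E.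
Proof.
have [il cl] := log_limit d_ge1 m0 w0 iw isw mw.
have E : (fun x : 'rV[R]_d => ln (enorm x) * w x) = (fun x => 2^-1 * (ln (dot x x) * w x)).
  by apply/funext => x; rewrite ln_enorm mulrA.
rewrite E; split; first exact: integrableRZ.
rewrite RintegralZl//.
pose b := pitt_exponent m; pose I n := \int[lam]_x (log_approx (b n) (dot x x) * w x).
have b0 n : 0 < b n := pitt_exponent_gt0 m0 n; have bm n : b n < m := pitt_exponent_lt m0 n.
have bcvg : b n @[n --> \oo] --> (0 : R) := pitt_exponent_cvg m.
pose r n := 2^-1 * ((1 - pitt_const (b n)) / b n * A - pitt_const (b n) * I n).
have rK n : ((r n)%:E <= \int[lam]_y (ln (enorm y) * N y)%:E)%E.
  exact: pitt_log_lower_bound (b0 n) (bm n) (pitt_exponent_le1 m0 n).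
have rcvg : r n @[n --> \oo] --> 2^-1 * ((2 * digamma m + 2 * ln 2) * A - 1 * \int[lam]_x (ln (dot x x) * w x)).
  apply: cvgM; first exact: cvg_cst.
  apply: cvgB; first by apply: cvgM; [exact: (pitt_const_slope_cvg data d_ge1 b0 bm bcvg)|exact: cvg_cst].
  by apply: cvgM; [exact: (pitt_const_cvg data d_ge1 b0 bm bcvg)|exact: cl].
(* The value plus infinity satisfies the claim at once, and minus infinity is excluded by the first
   of the lower bounds. *)
move: rK; case: (\int[lam]_y _)%E => [K| |] rK; last 2 first.
- exact: leey.
- by have := rK 0%N; rewrite leeNy_eq.
rewrite lee_fin; set J := Rintegral _ _ _ in rcvg *.
have -> : (digamma m + ln 2) * A - 2^-1 * J = 2^-1 * ((2 * digamma m + 2 * ln 2) * A - 1 * J) by field.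
rewrite -(cvg_lim (@Rhausdorff R) rcvg); apply: limr_le; first by apply/cvg_ex; eexists; exact: rcvg.
by apply: nearW => n; have := rK n; rewrite lee_fin.
Qed.

End logarithmic_inequality.

(** * Complex-valued Schwartz functions *)

Section complex_schwartz.
Context {R : realType} {d : nat} {Rp : {fset 'rV[R]_d}} {k : 'rV[R]_d -> R}.
Variable data : dunkl_data Rp k.
Hypothesis c0 : dunkl_const Rp k != 0.
Hypothesis d_ge1 : (1 <= d)%N.
Notation lam := (@lebesgue_rV R d).
Notation rho := (dunkl_density Rp k).
Notation m := (@pitt_index R d Rp k).
Notation pitt_const := (@pitt_const R d Rp k).
Notation P := (@power_spectrum R d Rp k).
Notation cos_t := (@cos_transform R d Rp k).
Notation sin_t := (@sin_transform R d Rp k).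
Variable f : 'rV[R]_d -> R[i].
Hypothesis fs : schwartz f.

Let f1 x := complex.Re (f x).
Let f2 x := complex.Im (f x).
Let rho0 x : 0 <= rho x := density_ge0 (Rp := Rp) (k := k) x.
Let i1 := integrable_schwartz data c0 fs.1.
Let i2 := integrable_schwartz data c0 fs.2.
Let mrho : measurable_fun setT rho := measurable_density (Rp := Rp) (k := k).

Lemma sqr_normc (z : R[i]) : Normc.normc z ^+ 2 = complex.Re z ^+ 2 + complex.Im z ^+ 2.
Proof. by case: z => a b; rewrite /= sqr_sqrtr// addr_ge0 ?sqr_ge0. Qed.

Lemma dunkl_transformE y : dunkl_transform Rp k f y =
  Complex (cos_t f1 y + sin_t f2 y) (cos_t f2 y - sin_t f1 y).
Proof.
have i1c := integrable_cos_kernel data i1 y; have i1s := integrable_sin_kernel data i1 y.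
have i2c := integrable_cos_kernel data i2 y; have i2s := integrable_sin_kernel data i2 y.
rewrite /dunkl_transform /cintegral /cos_transform /sin_transform; congr Complex.
  rewrite -RintegralD//; congr (Rintegral _ _ _); apply/funext => x.
  rewrite (dunkl_kernelE data) /f1 /f2; case: (f x) => a b /=.
  by ring.
rewrite -RintegralB//; congr (Rintegral _ _ _); apply/funext => x.
rewrite (dunkl_kernelE data) /f1 /f2; case: (f x) => a b /=.
by ring.
Qed.

Let w x := Normc.normc (f x) ^+ 2 * rho x.
Let N y := Normc.normc (dunkl_transform Rp k f y) ^+ 2 * rho y.
Let PP y := P f1 y * rho y + P f2 y * rho y.
(** Interference of the transforms of the real and the imaginary part: cosine transforms are even
    and sine transforms odd in y. *)
Let odd y := 2 * (cos_t f1 y * sin_t f2 y - cos_t f2 y * sin_t f1 y) * rho y.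

Let wE x : w x = f1 x ^+ 2 * rho x + f2 x ^+ 2 * rho x.
Proof. by rewrite /w sqr_normc mulrDl. Qed.

Let NE y : N y = PP y + odd y.
Proof.
rewrite /N sqr_normc dunkl_transformE /= /PP /odd /power_spectrum.
move: (rho y) => r; ring.
Qed.

Let cos_tN g y : cos_t g (- y) = cos_t g y.
Proof. by congr (Rintegral _ _ _); apply/funext => x; rewrite kcosNr. Qed.

Let sin_tN g y : integrableR lam (fun z => g z * rho z) -> sin_t g (- y) = - sin_t g y.
Proof.
move=> ig; rewrite -mulN1r -RintegralZl//; last exact: integrable_sin_kernel.
by congr (Rintegral _ _ _); apply/funext => x; rewrite (ksinNr data) mulrN mulN1r.
Qed.

Let oddN y : odd (- y) = - odd y.
Proof.
rewrite /odd !cos_tN (sin_tN y i1) (sin_tN y i2).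
rewrite densityN -/f1 -/f2; by move: (rho y) => r; ring.
Qed.

(** The interference inherits integrability from the sum of the two power spectra. *)
Let odd_le y : `|odd y| <= PP y.
Proof.
rewrite /odd /PP -mulrDl; move: (rho y) (rho0 y) => r r0; rewrite normrM (ger0_norm r0).
apply: ler_wpM2r => //; rewrite /power_spectrum.
move: (cos_t f1 y) (sin_t f1 y) (cos_t f2 y) (sin_t f2 y) => a b c e.
have h1 := sqr_ge0 (a - e); have h2 := sqr_ge0 (c + b); have h3 := sqr_ge0 (a + e); have h4 := sqr_ge0 (c - b).
by rewrite ler_norml; apply/andP; split; nra.
Qed.

Let modd : measurable_fun setT odd.
Proof.
have mc1 := measurable_cos_transform data i1; have ms1 := measurable_sin_transform data i1.
have mc2 := measurable_cos_transform data i2; have ms2 := measurable_sin_transform data i2.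
apply: measurable_funM; last exact: mrho.
apply: measurable_funM; first exact: measurable_cst.
apply: measurable_funB; first exact: measurable_funM mc1 ms2.
exact: measurable_funM mc2 ms1.
Qed.

(* the interference term of |F f|^2 is odd, so it disappears against even weights *)
Let spectrum_even (phi : 'rV[R]_d -> R) : measurable_fun setT phi -> (forall y, 0 <= phi y) -> (forall y, phi (- y) = phi y) ->
  integrableR lam (fun y => phi y * PP y) ->
  integrableR lam (fun y => phi y * N y) /\ \int[lam]_y (phi y * N y) = \int[lam]_y (phi y * PP y).
Proof.
move=> mphi phi0 phiN iP.
have io : integrableR lam (fun y => phi y * odd y).
  apply: (integrableR_dom _ iP); first exact: measurable_funM mphi modd.
  by move=> y; rewrite normrM (ger0_norm (phi0 y)); exact: ler_wpM2l (phi0 y) _ _ (odd_le y).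
have -> : (fun y => phi y * N y) = (fun y => phi y * PP y + phi y * odd y).
  by apply/funext => y; rewrite NE mulrDr.
split; first exact: integrableRD.
rewrite RintegralD// (Rintegral_odd io) ?addr0// => y.
by rewrite phiN oddN mulrN.
Qed.

Let plancherel_schwartz g : schwartz_real g -> integrableR lam (fun y => P g y * rho y) /\
  \int[lam]_y (P g y * rho y) = \int[lam]_x (g x ^+ 2 * rho x).
Proof.
move=> gs; have [B hB] := schwartz_bounded gs; have [L hL] := schwartz_lipschitz gs.
exact: (plancherel data c0 (schwartz_measurable gs) (integrable_schwartz data c0 gs) hB hL).
Qed.

Let msq g : schwartz_real g -> measurable_fun setT (fun x => g x ^+ 2 * rho x).
Proof.
move=> gs; have mg := schwartz_measurable gs.
by apply: measurable_funM; [exact: (measurable_funM mg mg)|exact: mrho].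
Qed.

Let sq0 g x : 0 <= g x ^+ 2 * rho x.
Proof. exact: mulr_ge0 (sqr_ge0 _) (rho0 x). Qed.

Let pitt_schwartz g b : schwartz_real g -> 0 < b -> b < m -> b <= 1 ->
  [/\ integrableR lam (fun x => dot x x `^ b * (g x ^+ 2 * rho x)),
    integrableR lam (fun y => dot y y `^ (- b) * (P g y * rho y)) &
    \int[lam]_y (dot y y `^ (- b) * (P g y * rho y)) <=
    pitt_const b * \int[lam]_x (dot x x `^ b * (g x ^+ 2 * rho x))].
Proof.
move=> gs b0 bm b1.
have ig := integrable_powR_weight (sq0 g) (integrable_schwartz_sqr data c0 gs) (msq gs) b0 b1.
have p := pitt data c0 d_ge1 (schwartz_measurable gs) (integrable_schwartz data c0 gs) b0 bm.
rewrite (Rintegral_EFin (integrableRZ _ ig)) RintegralZl// in p.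
have ip : integrableR lam (fun y => dot y y `^ (- b) * (P g y * rho y)).
  apply: integrableR_ge0; last exact: le_lt_trans p (ltry _).
    apply: measurable_funM; first by apply: measurable_fun_powRl; exact: measurable_dotxx.
    apply: measurable_funM; last exact: mrho.
    exact: (measurable_power_spectrum data (integrable_schwartz data c0 gs)).
  by move=> y; exact: mulr_ge0 (powR_ge0 _ _) (mulr_ge0 (power_spectrum_ge0 _ _) (rho0 y)).
by split=> //; rewrite (Rintegral_EFin ip) lee_fin in p.
Qed.

Let integrable_sqr_weight : integrableR lam (fun x => (1 + dot x x) * w x).
Proof.
have -> : (fun x => (1 + dot x x) * w x) =
    (fun x => (1 + dot x x) * (f1 x ^+ 2 * rho x) + (1 + dot x x) * (f2 x ^+ 2 * rho x)).
  by apply/funext => x; rewrite wE mulrDr.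
apply: integrableRD; first exact: (integrable_schwartz_sqr data c0 fs.1).
exact: (integrable_schwartz_sqr data c0 fs.2).
Qed.

Let integrable_singular_weight : integrableR lam (fun x => dot x x `^ (- m) * w x).
Proof.
have -> : (fun x => dot x x `^ (- m) * w x) =
    (fun x => dot x x `^ (- m) * (f1 x ^+ 2 * rho x) + dot x x `^ (- m) * (f2 x ^+ 2 * rho x)).
  by apply/funext => x; rewrite wE mulrDr.
apply: integrableRD; first exact: (integrable_schwartz_singular data c0 d_ge1 fs.1).
exact: (integrable_schwartz_singular data c0 d_ge1 fs.2).
Qed.

Let mw : measurable_fun setT w.
Proof.
rewrite (_ : w = fun x => f1 x ^+ 2 * rho x + f2 x ^+ 2 * rho x); last by apply/funext => x; rewrite wE.
apply: measurable_funD; first exact: (msq fs.1).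
exact: (msq fs.2).
Qed.

Let w0 x : 0 <= w x. Proof. by rewrite wE; apply: addr_ge0; exact: sq0. Qed.

Let N0 x : 0 <= N x. Proof. exact: mulr_ge0 (sqr_ge0 _) (rho0 x). Qed.

Let plancherel_complex : integrableR lam N /\ \int[lam]_x N x = \int[lam]_x w x.
Proof.
have [j1 e1] := plancherel_schwartz fs.1; have [j2 e2] := plancherel_schwartz fs.2.
have iPP : integrableR lam PP by exact: integrableRD.
have one (v : 'rV[R]_d -> R) : (fun y => 1 * v y) = v by apply/funext => y; rewrite mul1r.
have ione : integrableR lam (fun y => 1 * PP y) by rewrite one.
have [iN eN] := @spectrum_even (fun=> 1) (measurable_cst _) (fun=> ler01) (fun=> erefl) ione.
rewrite !one in iN eN; split=> //; rewrite eN RintegralD// e1 e2.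
have iw g : schwartz_real g -> integrableR lam (fun x => g x ^+ 2 * rho x).
  by move=> gs; exact: (integrable_weight (sq0 g) (integrable_schwartz_sqr data c0 gs) (msq gs)).
rewrite -RintegralD//; last 2 first.
- exact: iw fs.1.
- exact: iw fs.2.
by congr (Rintegral _ _ _); apply/funext => x; rewrite wE.
Qed.

Let pitt_complex b : 0 < b -> b < m -> b <= 1 ->
  (\int[lam]_y (dot y y `^ (- b) * N y)%:E <= (pitt_const b * \int[lam]_x (dot x x `^ b * w x))%:E)%E.
Proof.
move=> b0 bm b1; have [j1 k1 e1] := pitt_schwartz fs.1 b0 bm b1; have [j2 k2 e2] := pitt_schwartz fs.2 b0 bm b1.
have PPE : (fun y => dot y y `^ (- b) * PP y) =
    (fun y => dot y y `^ (- b) * (P f1 y * rho y) + dot y y `^ (- b) * (P f2 y * rho y)).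
  by apply/funext => y; rewrite /PP mulrDr.
have wE' : (fun x => dot x x `^ b * w x) =
    (fun x => dot x x `^ b * (f1 x ^+ 2 * rho x) + dot x x `^ b * (f2 x ^+ 2 * rho x)).
  by apply/funext => x; rewrite wE mulrDr.
have [||||iN eN] := @spectrum_even (fun y => dot y y `^ (- b)).
- by apply: measurable_fun_powRl; exact: measurable_dotxx.
- by move=> y; exact: powR_ge0.
- by move=> y; rewrite dotNl dotNr opprK.
- by rewrite PPE; exact: integrableRD.
rewrite (Rintegral_EFin iN) lee_fin eN PPE wE' !RintegralD// mulrDr.
exact: lerD e1 e2.
Qed.

Lemma schwartz_log_uncertainty : integrableR lam (fun x => ln (enorm x) * w x) /\
  integrableR lam w /\
  (((digamma m + ln 2) * \int[lam]_x w x - \int[lam]_x (ln (enorm x) * w x))%:E <=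
   \int[lam]_y (ln (enorm y) * N y)%:E)%E.
Proof.
have [iN eN] := plancherel_complex.
have [il h] := log_uncertainty data d_ge1 mw w0 N0 integrable_sqr_weight integrable_singular_weight iN eN pitt_complex.
by split=> //; split=> //; exact: integrable_weight w0 integrable_sqr_weight mw.
Qed.

End complex_schwartz.

Lemma pitt_indexE (R : realType) (d : nat) (Rp : {fset 'rV[R]_d}) (k : 'rV[R]_d -> R) :
  (dunkl_lambda Rp k + 1) / 2 = @pitt_index R d Rp k.
Proof. by rewrite /dunkl_lambda /pitt_index /hdim; congr (_ / _); ring. Qed.

Import ComplexField.Normc.
Local Open Scope ereal_scope.

Theorem theorem4p1 (R : realType) (d : nat) (Phi Rp : {fset 'rV[R]_d})
    (k : 'rV[R]_d -> R) (f : 'rV[R]_d -> R[i])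
    (d_ge1 : (1 <= d)%N)
    (Phi_root : root_system Phi)
    (Rp_pos : positive_subsystem Phi Rp)
    (k_mult : multiplicity_function Phi k)
    (f_schwartz : schwartz f) :
  (digamma ((dunkl_lambda Rp k + 1) / 2)%R + ln 2)%:E *
    \int[lebesgue_rV R d]_x (normc (f x) ^+ 2 * dunkl_density Rp k x)%:E
  <=
  \int[lebesgue_rV R d]_x
    (ln (enorm x) * normc (f x) ^+ 2 * dunkl_density Rp k x)%:E +
  \int[lebesgue_rV R d]_y
    (ln (enorm y) * normc (dunkl_transform Rp k f y) ^+ 2 *
      dunkl_density Rp k y)%:E.
Proof.
have data := positive_subsystem_dunkl_data Phi_root Rp_pos k_mult.
(* The inverse in the normalising constant would be 0 for a vanishing integral. In that case the
   density is zero and so are all integrals; otherwise the integral times the constant is 1. *)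
have [c0|c0] := eqVneq (dunkl_const Rp k) 0%R.
  have rho0 x : dunkl_density Rp k x = 0%R by rewrite /dunkl_density c0 mul0r.
  rewrite !integral0_eq ?mule0 ?adde0// => x _; by rewrite rho0 mulr0.
have [il [iw h]] := schwartz_log_uncertainty data c0 d_ge1 f_schwartz.
rewrite pitt_indexE (Rintegral_EFin iw) -EFinM.
have E (v : 'rV[R]_d -> R) : (fun x => (ln (enorm x) * v x ^+ 2 * dunkl_density Rp k x)%:E) =
    (fun x => (ln (enorm x) * (v x ^+ 2 * dunkl_density Rp k x))%:E).
  by apply/funext => x; rewrite (mulrA (ln _)).
rewrite !E (Rintegral_EFin il) -leeBlDl//.
Qed.
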